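(* (1) For every $\theta_1\in(0,1]$ and every $\theta_2\in(0,1)$ one-parameter weighted estimates may fail: there exist a bounded linear operator $T\in\mathcal L(L^2(\mathbb R^2))$ with a $CZX$ kernel with parameters $\theta_1,\theta_2$, an exponent $p\in(1,\infty)$ and a weight $w\in A_p(\mathbb R^2)$ such that $T$ does not extend boundedly to $L^p(w)$. (2) Let $T\in\mathcal L(L^2(\mathbb R^2))$ be an operator with a $CZX$ kernel with parameters $\theta_1\in(0,1]$ and $\theta_2=1$, or, more generally, an operator with a kernel satisfying the $CZX$ estimates with parameters $\theta_1\in(0,1]$, $\theta_2=1$ in which $D_1(x,y)$ is replaced everywhere by the larger quantity $$D_1^{\log}(x,y):=\Big(\frac{|x^1-y^1|}{|x^2-y^2|}+\frac{|x^2-y^2|}{|x^1-y^1|}\Big)^{-1}\log\Big(\frac{|x^1-y^1|}{|x^2-y^2|}+\frac{|x^2-y^2|}{|x^1-y^1|}\Big).$$ Then for every $p\in(1,\infty)$ and every $w\in A_p(\mathbb R^2)$ the operator $T$ extends boundedly to $L^p(w)$.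
   Context: Write points of $\mathbb R^2$ as $x=(x^1,x^2)$. For $\theta_2\in(0,1]$ and $x^1\ne y^1$, $x^2\ne y^2$ put $$D_{\theta_2}(x,y):=\Big(\frac{|x^1-y^1|}{|x^2-y^2|}+\frac{|x^2-y^2|}{|x^1-y^1|}\Big)^{-\theta_2}.$$ Let $\theta_1,\theta_2\in(0,1]$. A function $K:\{(x,y)\in\mathbb R^2\times\mathbb R^2: x^1\neq y^1 \text{ and } x^2\ne y^2\}\to\mathbb C$ is a $CZX$ kernel with parameters $\theta_1,\theta_2$ if there is a constant $C_K$ such that (a) size: $|K(x,y)|\le C_K\frac{1}{|x^1-y^1|}\frac1{|x^2-y^2|}D_{\theta_2}(x,y)$; (b) mixed Hölder and size: $|K(x,y)-K((w^1,x^2),y)|\le C_K\frac{|x^1-w^1|^{\theta_1}}{|x^1-y^1|^{1+\theta_1}}\frac1{|x^2-y^2|}D_{\theta_2}(x,y)$ whenever $|x^1-w^1|\le|x^1-y^1|/2$, and $|K(x,y)-K((x^1,w^2),y)|\le C_K\frac{1}{|x^1-y^1|}\frac{|x^2-w^2|^{\theta_1}}{|x^2-y^2|^{1+\theta_1}}D_{\theta_2}(x,y)$ whenever $|x^2-w^2|\le|x^2-y^2|/2$; (c) the two estimates in (b) also hold for the kernel $(x,y)\mapsto K(y,x)$. $T\in\mathcal L(L^2(\mathbb R^2))$ has kernel $K$ if $\langle Tf,g\rangle=\iint K(x,y)f(y)g(x)\,dx\,dy$ whenever $f,g$ are finite linear combinations of indicators of cubes with $\{f\ne0\}\cap\{g\neq0\}=\varnothing$,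 where $\langle f,g\rangle=\int fg$. Cubes in $\mathbb R^2$ are axes-parallel half-open squares. A weight is an a.e. positive locally integrable function $w$; $w\in A_p(\mathbb R^2)$ means $[w]_{A_p}:=\sup_J\langle w\rangle_J\langle w^{-1/(p-1)}\rangle_J^{p-1}<\infty$, the supremum over all cubes $J\subset\mathbb R^2$, with $\langle f\rangle_J=\frac1{|J|}\int_Jf$. $\|f\|_{L^p(w)}=(\int|f|^pw)^{1/p}$. $T$ extends boundedly to $L^p(w)$ if there is $C<\infty$ with $\|Tf\|_{L^p(w)}\le C\|f\|_{L^p(w)}$ for all $f\in L^2(\mathbb R^2)\cap L^p(w)$. *)

(* Defs.v *)
From HB Require Import structures.
From mathcomp Require Import all_boot all_order all_algebra.
From mathcomp Require Import all_classical all_reals all_analysis.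
From mathcomp Require Import complex.

Set Implicit Arguments.
Unset Strict Implicit.
Unset Printing Implicit Defensive.
Import Order.TTheory GRing.Theory Num.Theory.
Import numFieldNormedType.Exports.
Local Open Scope classical_set_scope.
Local Open Scope ring_scope.

(* The factors are [measurableTypeR R] rather than [R] because this is the
   measurable type that carries [lebesgue_measure]. *)
Notation plane R := (measurableTypeR R * measurableTypeR R)%type.

Notation cmod := ComplexField.Normc.normc.

Section lebesgue2.
Variable R : realType.

Definition lebesgue2 : set (plane R) -> \bar R :=
  (@lebesgue_measure R \x @lebesgue_measure R)%E.

HB.instance Definition _ := Measure.on lebesgue2.

Let lebesgue2_sigma_finite : sigma_finite [set: plane R] lebesgue2.
Proof.
have /sigma_finiteP[F [TF ndF Foo]] := sigma_finiteT (@lebesgue_measure R).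
exists (fun n => F n `*` F n).
  rewrite -setXTT TF predeqE => -[x y]; split.
    move=> [/= [n _ Fnx] [k _ Gky]]; exists (maxn n k) => //; split.
    - by move: x Fnx; exact/subsetPset/ndF/leq_maxl.
    - by move: y Gky; exact/subsetPset/ndF/leq_maxr.
  by move=> [n _ []/= ? ?]; split; exists n.
move=> k; have [? ?] := Foo k; split; first exact: measurableX.
by rewrite /lebesgue2 product_measure1E// lte_mul_pinfty// ge0_fin_numE.
Qed.

HB.instance Definition _ := Measure_isSigmaFinite.Build _ _ _ lebesgue2
  lebesgue2_sigma_finite.

End lebesgue2.
Arguments lebesgue2 {R}.

Section definitions.
Variable R : realType.
Implicit Types (x y v : plane R) (f g : plane R -> R[i]) (w : plane R -> R).
Implicit Types (T : (plane R -> R[i]) -> (plane R -> R[i])).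
Implicit Types (K : plane R -> plane R -> R[i]) (D : plane R -> plane R -> R).

(* Meaningful when the real and imaginary parts of [h] are integrable on [A];
   [Rintegral] has a default value otherwise. *)
Definition integralC d (U : measurableType d) (mu : {measure set U -> \bar R})
    (A : set U) (h : U -> R[i]) : R[i] :=
  Complex (\int[mu]_(u in A) complex.Re (h u))
          (\int[mu]_(u in A) complex.Im (h u)).

Definition measurable_funC f : Prop :=
  measurable_fun [set: plane R] (fun x => complex.Re (f x)) /\
  measurable_fun [set: plane R] (fun x => complex.Im (f x)).

Definition L2norm f : \bar R :=
  Lnorm (@lebesgue2 R) 2%:E (fun x => (cmod (f x))%:E).

Definition in_L2 f : Prop := measurable_funC f /\ (L2norm f < +oo)%E.

(* Bounded linear operators on L^2 act on representatives: linearity is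
   required almost everywhere, so that linearity and boundedness together
   make [T] compatible with almost everywhere equality. *)
Definition bounded_operator_L2 T : Prop :=
  [/\ forall f, in_L2 f -> in_L2 (T f),
      forall (a : R[i]) f g, in_L2 f -> in_L2 g ->
        {ae @lebesgue2 R, forall x,
          T (fun u => a * f u + g u) x = a * T f x + T g x} &
      exists C : R, forall f, in_L2 f -> (L2norm (T f) <= C%:E * L2norm f)%E].

Definition square (a : plane R) (l : R) : set (plane R) :=
  `[a.1, a.1 + l[%classic `*` `[a.2, a.2 + l[%classic.

Definition is_cube (J : set (plane R)) : Prop :=
  exists a l, 0 < l /\ J = square a l.

Definition cube_simple f : Prop :=
  exists n (c : 'I_n -> R[i]) (Q : 'I_n -> set (plane R)),
    (forall i, is_cube (Q i)) /\
    (forall x, f x = \sum_(i < n) c i * \1_(Q i) x).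

Definition off_diag x y : Prop := x.1 != y.1 /\ x.2 != y.2.

(* [K] is a total function of which only the values on [off_diag] are used. *)
Definition has_kernel T K : Prop :=
  forall f g, cube_simple f -> cube_simple g ->
    [set x | f x != 0] `&` [set x | g x != 0] = set0 ->
    integralC (@lebesgue2 R) setT (fun x => T f x * g x) =
    integralC (@lebesgue2 R \x @lebesgue2 R)%E
      [set z | off_diag z.1 z.2] (fun z => K z.1 z.2 * f z.2 * g z.1).

Definition eccentricity x y : R :=
  `|x.1 - y.1| / `|x.2 - y.2| + `|x.2 - y.2| / `|x.1 - y.1|.

Definition Dtheta (theta2 : R) x y : R := eccentricity x y `^ (- theta2).

Definition D1log x y : R := (eccentricity x y)^-1 * ln (eccentricity x y).

Definition size_estimate D (C : R) K : Prop :=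
  forall x y, off_diag x y ->
    cmod (K x y) <= C * `|x.1 - y.1|^-1 * `|x.2 - y.2|^-1 * D x y.

Definition mixed_holder_estimate D (theta1 C : R) K : Prop :=
  (forall x y (w1 : R), off_diag x y -> `|x.1 - w1| <= `|x.1 - y.1| / 2 ->
    cmod (K x y - K (w1, x.2) y) <=
      C * (`|x.1 - w1| `^ theta1 / `|x.1 - y.1| `^ (1 + theta1))
        * `|x.2 - y.2|^-1 * D x y) /\
  (forall x y (w2 : R), off_diag x y -> `|x.2 - w2| <= `|x.2 - y.2| / 2 ->
    cmod (K x y - K (x.1, w2) y) <=
      C * `|x.1 - y.1|^-1
        * (`|x.2 - w2| `^ theta1 / `|x.2 - y.2| `^ (1 + theta1)) * D x y).

Definition CZX_estimates D (theta1 : R) K : Prop :=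
  exists C : R, [/\ size_estimate D C K,
    mixed_holder_estimate D theta1 C K &
    mixed_holder_estimate D theta1 C (fun x y => K y x)].

Definition CZX_kernel (theta1 theta2 : R) K : Prop :=
  CZX_estimates (Dtheta theta2) theta1 K.

Definition CZX_log_kernel (theta1 : R) K : Prop :=
  CZX_estimates D1log theta1 K.

(* [locally_integrable] of the library is restricted to functions on [R]. *)
Definition is_weight w : Prop :=
  [/\ measurable_fun [set: plane R] w,
      {ae @lebesgue2 R, forall x, 0 < w x} &
      forall A : set (R * R), compact A ->
        (\int[@lebesgue2 R]_(x in A) `|w x|%:E < +oo)%E].

(* Extended real, since [w `^ (- (p - 1)^-1)] need not be locally integrable. *)
Definition average (J : set (plane R)) w : \bar R :=
  (((fine (lebesgue2 J))^-1)%:E * \int[@lebesgue2 R]_(x in J) (w x)%:E)%E.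

Definition Ap_characteristic (p : R) w : \bar R :=
  ereal_sup [set (average J w *
      average J (fun x => (w x `^ (- (p - 1)^-1))%R) `^ (p - 1)%R)%E
    | J in is_cube].

Definition Ap_weight (p : R) w : Prop :=
  is_weight w /\ (Ap_characteristic p w < +oo)%E.

Definition Lpw_norm (p : R) w f : \bar R :=
  ((\int[@lebesgue2 R]_x (cmod (f x) `^ p * w x)%R%:E) `^ (p^-1)%R)%E.

Definition in_Lpw (p : R) w f : Prop :=
  measurable_funC f /\ (Lpw_norm p w f < +oo)%E.

Definition extends_boundedly_Lpw T (p : R) w : Prop :=
  exists C : R, forall f, in_L2 f -> in_Lpw p w f ->
    (Lpw_norm p w (T f) <= C%:E * Lpw_norm p w f)%E.

End definitions.

(* Main.v *)
Require Import Defs.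
From mathcomp Require Import all_boot all_order all_algebra.
From mathcomp Require Import all_classical all_reals all_analysis.
From mathcomp Require Import complex.
From mathcomp Require Import measurable_realfun.
From mathcomp Require Import ring lra zify.
Set Implicit Arguments.
Unset Strict Implicit.
Unset Printing Implicit Defensive.
Import Order.TTheory GRing.Theory Num.Theory.
Import numFieldNormedType.Exports.
Local Open Scope classical_set_scope.
Local Open Scope ring_scope.

(* Let r <= R be the two coordinate distances between x and y. For every e > 0
   one has D_1^log <= C_e D_{1-e}, so in part (2) the kernel is bounded by
   C r^{-e} R^{e-2}: along the coordinate lines it is less singular than any
   power. On a fine dyadic grid the operator thus becomes a matrix whose rows
   indexed by a cube Q differ, off the neighbours of Q, from a common row by
   averages of |f|^s over larger cubes, with s > 1 as close to 1 as desired.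
   Hence the dyadic sharp function of Tf is controlled by (M |f|^s)^{1/s}, and
   the openness of A_p, sharp-function duality and the weighted maximal theorem
   give weighted bounds that are uniform in the mesh. Fatou's lemma concludes.

   For part (1), write b = theta_2 < 1. The kernel
   (|x1 - y1|^{b-1} - 1)_+ psi(x2 - y2), with psi a tent around +-3/2, is
   integrable in each variable, so Schur's test applies. It sends the indicator
   of [2d, 3d] x [-1/8, 1/8], which has measure d/4, to a function of size at
   least c d^b on a rectangle of area d^2/2 within distance d of the
   singularity of the weight |x - (0, 3/2)|^{-a}. As a > p b + 1 is compatible
   with a < 2 for p close to 1, letting d -> 0 contradicts boundedness. *)

(** The obstacle is the singularity along whole coordinate lines: near such a line the kernel is not
    controlled by averages of |f|, but only, through Hoelder's inequality with exponent s', by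
    averages of |f|^s; here e is taken so small that 2 e s' < 1. Passing to |f|^s costs a little of
    A_p, since w now has to lie in A_{p/s}, and the openness of A_p pays for this. The part of f
    near a cube then requires an L^s bound with s < 2, which is not given. It is obtained by running
    the same argument without weights on the transposed matrix, from L^2 up to L^{s'} with s' > 2,
    and dualising. Discretising makes every norm a finite sum, so a small multiple of the left-hand
    side can be absorbed without an a priori bound, and stopping-time arguments become inductions on
    the level of a cube. Matrix entries are averages over cells, and the powers of the mesh cancel
    in their estimates. In part (1) one compares powers of d: the p-th power of the norm of the
    image is at least a multiple of d^(bp-a+2), that of the test function at most one of d. *)

Section RealPowers.
Context {R : realType}.
Implicit Types x y z p q : R.

Lemma powRS x q : 0 <= x -> q != 0 -> x `^ q = x * x `^ (q - 1).
Proof.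
move=> x0 q0; transitivity (x `^ (1 + (q - 1))); first by rewrite subrKC.
by rewrite [LHS]powRD; [rewrite powRr1|rewrite subrKC (negPf q0)].
Qed.

Lemma powR1D x q : 0 < x -> x `^ (1 + q) = x * x `^ q.
Proof.
by move=> x0; rewrite [LHS]powRD ?powRr1 ?(ltW x0) // (gt_eqF x0) implybT.
Qed.

Lemma powRVn x q : 0 < x -> x `^ (- q) * x `^ q = 1.
Proof. by move=> x0; rewrite powRN mulVf // gt_eqF // powR_gt0. Qed.

Lemma ler_powR2 x y q : 0 <= q -> 0 <= x -> x <= y -> x `^ q <= y `^ q.
Proof. by move=> q0 x0 xy; apply: ge0_ler_powR; rewrite ?nnegrE // (le_trans x0 xy). Qed.

Lemma powRK x q : 0 <= x -> q != 0 -> (x `^ q) `^ q^-1 = x.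
Proof. by move=> x0 q0; rewrite -powRrM divff // powRr1. Qed.

Lemma powRVK x q : 0 <= x -> q != 0 -> (x `^ q^-1) `^ q = x.
Proof. by move=> x0 q0; rewrite -powRrM mulVf // powRr1. Qed.

Lemma ler_powR2_root x y q : 0 < q -> 0 <= x -> 0 <= y -> x `^ q <= y -> x <= y `^ q^-1.
Proof.
move=> q0 x0 y0 xy; rewrite -[leLHS](@powRK _ q) // ?gt_eqF //.
by apply: ler_powR2; rewrite ?invr_ge0 ?powR_ge0 // ltW.
Qed.

Lemma ler_powR2_inv x y q : 0 < q -> 0 <= x -> 0 <= y -> x `^ q <= y `^ q -> x <= y.
Proof.
by move=> q0 x0 y0 /ler_powR2_root -/(_ q0 x0 (powR_ge0 _ _)); rewrite powRK // gt_eqF.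
Qed.

(** Convexity of the power, from Young's inequality for z and l^(q-1). With a well-chosen [l] it
    serves below in place of Hoelder's inequality and of the mean value theorem. *)
Lemma powR_tangent z l q : 1 < q -> 0 <= z -> 0 <= l ->
  l `^ q + q * l `^ (q - 1) * (z - l) <= z `^ q.
Proof.
move=> q1 z0 l0; have q0 : 0 < q by lra.
have := @conjugate_powR _ z (l `^ (q - 1)) q (q / (q - 1)) z0 (powR_ge0 _ _) q0.
rewrite -powRrM; have -> : (q - 1) * (q / (q - 1)) = q by field; lra.
case/(_ _ _)/Wrap.
- by rewrite divr_gt0 // subr_gt0.
- by field; lra.
have -> : l `^ q = l * l `^ (q - 1) by apply: powRS => //; lra.
set a := l `^ _; set b := z `^ q => -[H].
have /= := ler_pM2l q0 (z * a) (b / q + l * a / (q / (q - 1))).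
rewrite H; have -> : q * (b / q + l * a / (q / (q - 1))) = b + l * a * (q - 1).
  by field; lra.
by move=> /idP; lra.
Qed.

(** Young's inequality for x / l and l y, where [l] solves l^(p/(p-1)) = d. The arbitrarily small
    factor [d] is what the later absorptions use. *)
Lemma young_eps p d : 1 < p -> 0 < d -> exists2 K, 0 <= K &
  forall x y, 0 <= x -> 0 <= y -> x * y <= K * x `^ p + d * y `^ (p / (p - 1)).
Proof.
move=> p1 d0; have p0 : 0 < p by lra.
have pp : 0 < p / (p - 1) by rewrite divr_gt0 // subr_gt0.
pose l := d `^ (p / (p - 1))^-1.
have l0 : 0 < l by apply: powR_gt0.
have lE : l `^ (p / (p - 1)) = d by rewrite powRVK ?(ltW d0) // gt_eqF.
exists (l^-1 `^ p); first exact: powR_ge0.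
move=> x y x0 y0.
have -> : x * y = (l^-1 * x) * (l * y) by field; lra.
apply: le_trans (conjugate_powR _ _ p0 pp _) _.
- by rewrite mulr_ge0 // invr_ge0 ltW.
- by rewrite mulr_ge0 // ltW.
- by field; lra.
rewrite !powRM ?invr_ge0 ?(ltW l0) // lE.
apply: lerD.
  rewrite ler_pdivrMr // ler_peMr ?(ltW p1) // mulr_ge0 ?powR_ge0 //.
rewrite ler_pdivrMr // ler_peMr ?mulr_ge0 ?powR_ge0 ?(ltW d0) //.
by rewrite ler_pdivlMr ?subr_gt0 //; lra.
Qed.

(** Hoelder's inequality for a weight [W] and its dual [V], the form in which A_p is applied. The
    tangent inequality for u / V is summed against [V]. *)
Lemma holder_weight (X : finType) (P : pred X) (u V W : X -> R) (c q : R) :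
  1 < q -> 0 <= c -> (forall i, 0 <= u i) -> (forall i, 0 < V i) ->
  (forall i, W i * V i `^ (q - 1) = 1) ->
  (c * \sum_(x | P x) u x) `^ q <=
  (c * \sum_(x | P x) (u x `^ q * W x)) * (c * \sum_(x | P x) V x) `^ (q - 1).
Proof.
move=> q1 c0 u0 V0 WV; have q0 : 0 < q by lra.
set U := \sum_(x | P x) u x; set S := \sum_(x | P x) V x.
have U0 : 0 <= U by apply: sumr_ge0.
have S0 : 0 <= S by apply: sumr_ge0 => i _; exact: ltW.
have W0 i : 0 < W i.
  have := WV i; have : 0 < V i `^ (q - 1) by apply: powR_gt0.
  by move=> h e; rewrite -(pmulr_lgt0 _ h) e.
have T0 : 0 <= \sum_(x | P x) u x `^ q * W x.
  by apply: sumr_ge0 => i _; rewrite mulr_ge0 ?powR_ge0 // ltW.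
rewrite !powRM // (powRS c0) ?gt_eqF // mulrACA ler_wpM2l ?mulr_ge0 ?powR_ge0 //.
have [SE|Sn] := eqVneq S 0.
  have -> : U = 0.
    apply: big1 => x Px; have := psumr_neq0P (F := V).
    have : S > 0; last by rewrite SE ltxx.
    rewrite /S (bigD1 x) //= ltr_pwDl // sumr_ge0 // => i _; exact: ltW.
  by rewrite powR0 ?gt_eqF // mulr_ge0 ?powR_ge0.
have Sp : 0 < S by rewrite lt_neqAle eq_sym Sn.
(* With the tangent point at the [V]-mean of u / V, the linear terms cancel in the sum. *)
pose l := U / S.
have l0 : 0 <= l by rewrite divr_ge0.
have H : l `^ q * S <= \sum_(x | P x) u x `^ q * W x.
  have -> : l `^ q * S = \sum_(x | P x) (l `^ q * V x + q * l `^ (q - 1) * (u x - l * V x)).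
    rewrite big_split /= -mulr_sumr -/S -mulr_sumr sumrB -mulr_sumr -/U -/S.
    by rewrite /l divfK // subrr mulr0 addr0.
  apply: ler_sum => x Px.
  have Vx := V0 x.
  have -> : u x `^ q * W x = V x * (u x / V x) `^ q.
    have -> : W x = V x * (V x)^-1 `^ q.
      rewrite -powR_inv1 ?(ltW Vx) // -powRrM.
      apply: (mulIf (x := V x `^ (q - 1))); first by rewrite gt_eqF // powR_gt0.
      rewrite WV -mulrA -powRD ?(gt_eqF Vx) ?implybT //.
      have -> : -1 * q + (q - 1) = -1 by ring.
      by rewrite powR_inv1 ?(ltW Vx) // divff // gt_eqF.
    by rewrite powRM ?invr_ge0 ?(ltW Vx) // mulrCA.
  have := powR_tangent q1 (divr_ge0 (u0 x) (ltW Vx)) l0.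
  move=> /(ler_wpM2l (ltW Vx)); apply: le_trans.
  rewrite le_eqVlt; apply/orP; left; apply/eqP.
  by field; rewrite gt_eqF.
have -> : U = l * S by rewrite /l divfK.
rewrite powRM // (powRS S0) ?gt_eqF //.
by rewrite mulrA ler_wpM2r // powR_ge0.
Qed.

End RealPowers.

(** * Averages over dyadic cubes and sharp-function duality *)

(* [dy k] and [nb k] relate two cells that lie in the same dyadic cube of level
   [k], respectively in two equal or adjacent cubes of level [k]. *)
Record dyadic (X : finType) (N : nat) (dy nb : nat -> rel X) : Prop := Dyadic {
  dy_refl : forall k, reflexive (dy k);
  dy_sym : forall k, symmetric (dy k);
  dy_trans : forall k, transitive (dy k);
  dyS : forall k x y, dy k x y -> dy k.+1 x y;
  dy0 : forall x y, dy 0 x y = (x == y);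
  dyN : forall x y, dy N x y;
  card_dy : forall k x, (k <= N)%N -> #|dy k x| = (4 ^ k)%N;
  nb_sym : forall k, symmetric (nb k);
  nb_dy : forall k x y z, dy k x y -> nb k x z = nb k y z;
  dy_nb : forall k x y, dy k x y -> nb k x y;
  nbS : forall k x y, nb k x y -> nb k.+1 x y;
  card_nb : forall k x, (#|nb k x| <= 9 * 4 ^ k)%N }.

Section Averages.
Context {R : realType} {X : finType} {N : nat} {dy nb : nat -> rel X}.
Hypothesis G : dyadic N dy nb.
Implicit Types (u v c : X -> R) (k : nat) (x y z : X).

(** Both averages carry the factor 4^-k, the inverse size of one cube. For [avn], which runs over up
    to nine cubes, this leaves the factor 9 of [avn_const]. *)
Definition avd k u x : R := (4 ^- k) * \sum_(y | dy k x y) u y.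
Definition avn k u x : R := (4 ^- k) * \sum_(y | nb k x y) u y.

Lemma dyE k x y : dy k x y -> dy k x =1 dy k y.
Proof.
move=> xy z; apply/idP/idP; apply: (dy_trans G) => //.
by rewrite (dy_sym G).
Qed.

Lemma nbE k x y : dy k x y -> nb k x =1 nb k y.
Proof. by move=> xy z; exact: (nb_dy G). Qed.

Lemma nb_dyr k x y z : dy k y z -> nb k x y = nb k x z.
Proof. by move=> yz; rewrite !(nb_sym G _ x) (nb_dy G x yz). Qed.

Lemma avd_dy k u x y : dy k x y -> avd k u x = avd k u y.
Proof. by move=> xy; congr (_ * _); apply: eq_bigl => z; exact: dyE. Qed.

Lemma avn_dy k u x y : dy k x y -> avn k u x = avn k u y.
Proof. by move=> xy; congr (_ * _); apply: eq_bigl => z; exact: nbE. Qed.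

Lemma inv4_gt0 k : 0 < 4 ^- k :> R.
Proof. by rewrite invr_gt0 exprn_gt0. Qed.
Let i4 := inv4_gt0.
Let i4' k : 0 <= 4 ^- k :> R. Proof. exact: ltW. Qed.

Lemma avd_ge0 k u x : (forall z, 0 <= u z) -> 0 <= avd k u x.
Proof. by move=> u0; rewrite mulr_ge0 // sumr_ge0. Qed.

Lemma avn_ge0 k u x : (forall z, 0 <= u z) -> 0 <= avn k u x.
Proof. by move=> u0; rewrite mulr_ge0 // sumr_ge0. Qed.

Lemma avd_gt0 k u x : (forall z, 0 < u z) -> 0 < avd k u x.
Proof.
move=> u0; rewrite mulr_gt0 // (bigD1 x) ?(dy_refl G) //= ltr_pwDl // sumr_ge0 // => i _.
exact: ltW.
Qed.

Lemma le_avd k u v x : (forall z, dy k x z -> u z <= v z) -> avd k u x <= avd k v x.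
Proof. by move=> uv; rewrite ler_wpM2l // ler_sum. Qed.

Lemma le_avn k u v x : (forall z, nb k x z -> u z <= v z) -> avn k u x <= avn k v x.
Proof. by move=> uv; rewrite ler_wpM2l // ler_sum. Qed.

Lemma eq_avd k u v x : (forall z, dy k x z -> u z = v z) -> avd k u x = avd k v x.
Proof. by move=> uv; congr (_ * _); exact: eq_bigr. Qed.

Lemma eq_avn k u v x : (forall z, nb k x z -> u z = v z) -> avn k u x = avn k v x.
Proof. by move=> uv; congr (_ * _); exact: eq_bigr. Qed.

Lemma avdD k u v x : avd k (fun z => u z + v z) x = avd k u x + avd k v x.
Proof. by rewrite /avd big_split mulrDr. Qed.

Lemma avdZ k (a : R) u x : avd k (fun z => a * u z) x = a * avd k u x.
Proof. by rewrite /avd -mulr_sumr mulrCA. Qed.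

Lemma avnZ k (a : R) u x : avn k (fun z => a * u z) x = a * avn k u x.
Proof. by rewrite /avn -mulr_sumr mulrCA. Qed.

Lemma avd0 u x : avd 0 u x = u x.
Proof.
rewrite /avd expr0 invr1 mul1r (eq_bigl (pred1 x)) ?big_pred1_eq // => y.
by rewrite (dy0 G) eq_sym.
Qed.

Lemma avd_const k (a : R) x : (k <= N)%N -> avd k (fun=> a) x = a.
Proof.
move=> kN; rewrite /avd sumr_const.
rewrite (card_dy G) // -[a *+ _]mulr_natr mulrCA natrX mulVf ?mulr1 // expf_neq0.
Qed.

Lemma avd_le_avn k u x : (forall z, 0 <= u z) -> avd k u x <= avn k u x.
Proof.
move=> u0; rewrite ler_wpM2l // [leRHS](bigID (dy k x)) /=.
rewrite -[leLHS]addr0 lerD ?sumr_ge0 //.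
rewrite le_eqVlt; apply/orP; left; apply/eqP; apply: eq_bigl => y.
by apply/idP/andP => [xy|[]//]; split => //; exact: (dy_nb G).
Qed.

Lemma avn_const k (a : R) x : 0 <= a -> avn k (fun=> a) x <= 9 * a.
Proof.
move=> a0; rewrite /avn sumr_const.
rewrite -[a *+ _]mulr_natr mulrCA [leRHS]mulrC ler_wpM2l //.
rewrite mulrC ler_pdivrMr ?exprn_gt0 //.
by rewrite -(natrX _ 4 k) -natrM ler_nat (card_nb G).
Qed.

(** Averaging over cubes is self-adjoint and fixes every function that is constant on them. *)
Lemma sum_avd k (c u : X -> R) : (k <= N)%N -> (forall x y, dy k x y -> c x = c y) ->
  \sum_x c x * avd k u x = \sum_x c x * u x.
Proof.
move=> kN cE; under eq_bigr do rewrite /avd mulrCA mulr_sumr mulr_sumr.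
under eq_bigr do rewrite big_mkcond.
rewrite exchange_big /=; apply: eq_bigr => y _.
rewrite -[RHS](avd_const _ y kN) /avd mulr_sumr [RHS]big_mkcond; apply: eq_bigr => x _.
rewrite (dy_sym G k x y); case: ifP => // yx.
by rewrite (cE _ _ yx).
Qed.

Lemma sum_avn k u v : \sum_x u x * avn k v x = \sum_x avn k u x * v x.
Proof.
under eq_bigr do rewrite /avn mulrCA !mulr_sumr big_mkcond.
rewrite exchange_big /=; apply: eq_bigr => y _.
rewrite /avn -mulrA mulr_suml mulr_sumr [RHS]big_mkcond; apply: eq_bigr => x _.
by rewrite (nb_sym G).
Qed.

Lemma sum_avd_pred k (P : pred X) u : (k <= N)%N -> (forall x y, dy k x y -> P x = P y) ->
  \sum_(y | P y) avd k u y = \sum_(y | P y) u y.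
Proof.
move=> kN PE; have E (F : X -> R) : \sum_(y | P y) F y = \sum_y (P y)%:R * F y.
  by rewrite big_mkcond; apply: eq_bigr => y _; case: (P y); rewrite ?mul1r ?mul0r.
by rewrite !E; apply: sum_avd => // x y xy; rewrite (PE _ _ xy).
Qed.

Lemma avd_tower k u x : (k < N)%N -> avd k.+1 (avd k u) x = avd k.+1 u x.
Proof.
move=> kN; congr (_ * _); apply: sum_avd_pred (ltnW kN) _ => y z /(dyS G) yz.
by rewrite !(dy_sym G _ x); exact: dyE.
Qed.

Lemma avn_avd k u x : (k <= N)%N -> avn k (avd k u) x = avn k u x.
Proof.
by move=> kN; congr (_ * _); apply: sum_avd_pred kN _ => y z yz; exact: nb_dyr.
Qed.

Lemma avd_le_avdS k u x y : (k < N)%N -> dy k.+1 x y -> (forall z, 0 <= u z) ->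
  avd k u y <= 4 * avd k.+1 u x.
Proof.
move=> kN xy u0; rewrite (avd_dy u xy) /avd mulrA exprS invfM mulrA mulfV // mul1r.
rewrite ler_wpM2l // [leRHS](bigID (dy k y)) /=.
rewrite -[leLHS]addr0 lerD ?sumr_ge0 //.
rewrite le_eqVlt; apply/orP; left; apply/eqP; apply: eq_bigl => z.
by apply/idP/andP => [h|[]//]; split => //; exact: (dyS G).
Qed.

Lemma sum_avdN u x : \sum_y u y = 4 ^+ N * avd N u x.
Proof.
rewrite /avd mulrA divff ?mul1r ?expf_neq0 //.
by apply: eq_bigl => y; rewrite (dyN G).
Qed.

(* The tangent point [t] plays the role of a stopping threshold: it is reset to
   the average of [g] as soon as that average exceeds [2 * t], and the potential
   [S * (M - t)_+] pays for the reset. *)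
Lemma sharp_function_step (h g S M : X -> R) :
  (forall x, 0 <= g x) -> (forall x, 0 <= S x) ->
  (forall k x, (k <= N)%N -> avd k g x <= M x) ->
  (forall k x, (k <= N)%N -> exists a : R, forall y, dy k x y ->
     avd k (fun z => `|h z - a|) y <= S y) ->
  forall k, (k <= N)%N -> forall x (t a : R), 0 <= t -> avd k g x <= 2 * t ->
    avd k (fun z => `|h z - a| * g z) x <=
      8 * t * avd k (fun z => `|h z - a|) x + 24 * avd k (fun z => S z * Num.max (M z - t) 0) x.
Proof.
move=> g0 S0 gM hS; elim=> [|k IH] kN x t a t0 gt.
  rewrite !avd0 in gt *; apply: ler_wpDr.
    by rewrite mulr_ge0 // mulr_ge0 // le_max lexx orbT.
  rewrite mulrC ler_wpM2r //; apply: le_trans gt _.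
  by rewrite ler_wpM2r //; lra.
have kN' := ltnW kN.
rewrite -(avd_tower _ _ kN) -[X in _ <= 8 * t * X + _](avd_tower _ _ kN).
rewrite -[X in _ <= _ + 24 * X](avd_tower _ _ kN) -!avdZ -avdD.
apply: le_avd => y xy.
have [le|gt2] := leP (avd k g y) (2 * t); first exact: IH.
have [g' gE] : exists g', avd k g y = g' by eexists.
(* A cube has four children, so an average that is at most 2 t one level up is at most 8 t here. *)
rewrite gE in gt2; have g'8 : g' <= 8 * t.
  by rewrite -gE; apply: le_trans (avd_le_avdS kN xy g0) _; lra.
have g'0 : 0 <= g' by rewrite -gE; apply: avd_ge0.
have [b hb] := hS k y kN'.
have [I IE] : exists I, avd k (fun z => `|h z - a|) y = I by eexists.
have [J JE] : exists J, avd k (fun z => `|h z - b|) y = J by eexists.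
rewrite IE.
have step : avd k (fun z => `|h z - a| * g z) y <=
    avd k (fun z => `|h z - b| * g z) y + `|a - b| * g'.
  rewrite -gE -avdZ -avdD; apply: le_avd => z _.
  rewrite -mulrDl ler_wpM2r // [`|a - b|]distrC.
  by rewrite -(subrKA b (h z)); exact: ler_normD.
have ab : `|a - b| <= I + J.
  rewrite -[leLHS](avd_const _ y kN') -IE -JE -avdD; apply: le_avd => z _.
  rewrite [`|h z - a|]distrC.
  by rewrite -(subrKA (h z) a); exact: ler_normD.
have J0 : 0 <= J by rewrite -JE; apply: avd_ge0.
have I0 : 0 <= I by rewrite -IE; apply: avd_ge0.
have IHb := IH kN' y g' b g'0 _.
have {IHb}IHb := IHb (ltac:(rewrite gE; lra)).
rewrite JE in IHb.
(* As t < g' / 2, raising the threshold from [t] to [g'] releases 24 S (g' - t), which is at least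
   12 g' J. Of this, 8 g' J pays for the induction hypothesis, and 4 g' J for the term 8 t J caused
   by replacing the constant [a] by [b]. *)
have pay : 12 * g' * J + 24 * avd k (fun z => S z * Num.max (M z - g') 0) y <=
    24 * avd k (fun z => S z * Num.max (M z - t) 0) y.
  have -> : 12 * g' * J = avd k (fun=> 12 * g' * J) y by rewrite avd_const.
  rewrite -!avdZ -avdD; apply: le_avd => z yz.
  have Jz : J <= S z by rewrite -JE (avd_dy _ yz); exact: hb.
  have Mz : g' <= M z by rewrite -gE (avd_dy _ yz); exact: gM.
  have -> : Num.max (M z - g') 0 = M z - g' by apply/max_idPl; lra.
  have -> : Num.max (M z - t) 0 = M z - t by apply/max_idPl; lra.
  have : g' * J <= g' * S z by rewrite ler_wpM2l.
  have : S z * g' >= S z * (2 * t) by rewrite ler_wpM2l // ltW.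
  by nra.
have abg : `|a - b| * g' <= 8 * t * I + 8 * t * J.
  rewrite -mulrDr; apply: le_trans (_ : (I + J) * g' <= _); first by rewrite ler_wpM2r.
  by rewrite mulrC ler_wpM2r // addr_ge0.
have tJ : t * J <= g' / 2 * J by rewrite ler_wpM2r //; lra.
by lra.
Qed.

(** The stopping argument starts on the cube of level [N] with the constant 0 and with the mean of
    [g] as threshold. The last hypothesis bounds the mean of |h| on that cube, where one would use
    decay at infinity on the whole plane. *)
Lemma sharp_function_duality (h g S M : X -> R) :
  (forall x, 0 <= g x) -> (forall x, 0 <= S x) ->
  (forall k x, (k <= N)%N -> avd k g x <= M x) ->
  (forall k x, (k <= N)%N -> exists a : R, forall y, dy k x y ->
     avd k (fun z => `|h z - a|) y <= S y) ->
  (forall x, avd N (fun z => `|h z|) x <= S x) ->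
  \sum_x `|h x| * g x <= 32 * \sum_x S x * M x.
Proof.
move=> g0 S0 gM hS hN.
have [[x0 _]|no] := pselect (exists x : X, True); last first.
  by rewrite !big1 ?mulr0 // => x _; case: no; exists x.
set t := avd N g x0; have t0 : 0 <= t by apply: avd_ge0.
have := @sharp_function_step h g S M g0 S0 gM hS N (leqnn _) x0 t 0 t0 _.
case/(_ _)/Wrap; first by rewrite -/t; lra.
have E : (fun z => `|h z - 0|) = (fun z => `|h z|) by apply/funext => z; rewrite subr0.
rewrite E; under eq_avd do rewrite subr0; move=> [H].
rewrite !(sum_avdN _ x0) [leRHS]mulrCA ler_wpM2l ?exprn_ge0 //.
apply: le_trans H _.
rewrite (_ : 32 * _ = 8 * avd N (fun y => S y * M y) x0 + 24 * avd N (fun y => S y * M y) x0); last by ring.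
 apply: lerD; last first.
  rewrite ler_wpM2l //; apply: le_avd => z _; rewrite ler_wpM2l //.
  have tM : t <= M z by rewrite /t (avd_dy g (dyN G x0 z)); exact: gM.
  by rewrite ge_max; lra.
rewrite -mulrA ler_wpM2l //.
rewrite -[leLHS](avd_const _ x0 (leqnn N)); apply: le_avd => z _.
rewrite mulrC; apply: ler_pM => //; first exact: avd_ge0.
  by rewrite (avd_dy _ (dyN G x0 z)).
by rewrite /t (avd_dy g (dyN G x0 z)); exact: gM.
Qed.

End Averages.

Arguments avd {R X} dy k u x.
Arguments avn {R X} nb k u x.

(** * Self-improvement of discrete Muckenhoupt weights *)

(** A_p over the [nb] neighbourhoods, that is, over tripled cubes. In this form it makes adjacent
    cubes comparable and contains the doubling property. *)
Definition Apair (R : realType) (X : finType) (N : nat) (nb : nat -> rel X) (p A : R) (W : X -> R) :=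
  (forall x, 0 < W x) /\
  forall k x, (k <= N)%N ->
    avn nb k W x * avn nb k (fun z => W z `^ (- (p - 1)^-1)) x `^ (p - 1) <= A.

Section Weights.
Context {R : realType}.

(** [V] is the weight dual to [W]. Induction on the level with a stopping threshold [t], as for the
    sharp function, except that each reset loses a factor up to 8^e. The term - b t of [claim]
    recovers this loss. Where V < b t / 2 on a single cell, that term is compensated by [W], which
    exceeds (b t / 2)^(1-p) there. *)
Lemma reverse_holder (p A : R) : 1 < p -> exists e : R, 0 < e <= 1 /\
  forall (X : finType) (N : nat) (dy nb : nat -> rel X) (V W : X -> R),
  dyadic N dy nb -> (forall x, 0 < V x) -> (forall x, W x * V x `^ (p - 1) = 1) ->
  (forall k x, (k <= N)%N -> avd dy k W x * avd dy k V x `^ (p - 1) <= A) ->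
  forall k x, (k <= N)%N -> avd dy k (fun z => V z `^ (1 + e)) x <= 5 * avd dy k V x `^ (1 + e).
Proof.
move=> p1; pose A' := Num.max A 1.
have A'1 : 1 <= A' by rewrite le_max lexx orbT.
have AA' : A <= A' by rewrite le_max lexx.
have p10 : p - 1 != 0 by rewrite subr_eq0 gt_eqF.
(* Chosen so that (b / 2)^(p-1) A' = 1/4: when the average of [V] is t, A_p bounds the [W] term of
   [claim] by b t / 4. *)
pose b := 2 * (4 * A')^-1 `^ (p - 1)^-1.
have b0 : 0 < b by rewrite mulr_gt0 ?powR_gt0 ?invr_gt0 //; lra.
have bE : (b / 2) `^ (p - 1) * A' = 4^-1.
  have -> : b / 2 = (4 * A')^-1 `^ (p - 1)^-1 by rewrite /b; field.
  by rewrite powRVK // ?invr_ge0; [field|]; lra.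
have b2 : b <= 2.
  have h1 : 1 `^ (p - 1)^-1 = 1 :> R by rewrite powR1.
  rewrite -[leRHS]mulr1 ler_wpM2l // -[leRHS]h1.
  apply: ler_powR2; rewrite ?invr_ge0 ?subr_ge0 ?(ltW p1) //; first by lra.
  by rewrite invf_le1; lra.
(* A reset multiplies the threshold by at most 8, whence the condition 8^e <= 1 + b / 64. *)
pose e := Num.min 1 (ln (1 + b / 64) / ln 8).
have l8 : 0 < ln (8 : R) by apply: ln_gt0; lra.
have e0 : 0 < e by rewrite lt_min ltr01 divr_gt0 // ln_gt0 //; lra.
have e1 : e <= 1 by rewrite ge_min lexx.
have e8 : 8 `^ e <= 1 + b / 64.
  rewrite -[leRHS]lnK ?posrE; last by lra.
  rewrite /powR pnatr_eq0 ler_expR -ler_pdivlMr //.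
  by rewrite ge_min lexx orbT.
exists e; split; first by rewrite e0.
move=> X N dy nb V W G V0 WV WA.
have W0 x : 0 < W x.
  have := WV x; have : 0 < V x `^ (p - 1) by apply: powR_gt0.
  by move=> h f; rewrite -(pmulr_lgt0 _ h) f.
have claim k : (k <= N)%N -> forall x (t : R), 0 < t -> avd dy k V x <= 2 * t ->
  avd dy k (fun z => V z `^ (1 + e)) x <=
    t `^ e * (4 * avd dy k V x - b * t + b * t * (b * t / 2) `^ (p - 1) * avd dy k W x).
  elim: k => [|k IH] kN x t t0 Vt.
    rewrite !(avd0 G) in Vt *.
    rewrite powR1D //.
    have Ve : V x `^ e <= 2 * t `^ e.
      apply: le_trans (_ : (2 * t) `^ e <= _); first by apply: ler_powR2; rewrite // ltW.
      rewrite powRM ?(ltW t0) // ler_wpM2r ?powR_ge0 //.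
      by rewrite -[leRHS](@powRr1 R 2) // ler_powR //; lra.
    apply: le_trans (_ : t `^ e * (2 * V x) <= _).
      by rewrite mulrC mulrCA mulrA ler_wpM2r // ltW.
    rewrite ler_wpM2l ?powR_ge0 //.
    have h0 : 0 <= b * t * (b * t / 2) `^ (p - 1) * W x.
      by rewrite !mulr_ge0 ?powR_ge0 // ltW.
    have [h|h] := leP (b * t / 2) (V x); first by lra.
    suff : b * t * 1 <= b * t * ((b * t / 2) `^ (p - 1) * W x).
      by rewrite mulr1 mulrA; have := V0 x; lra.
    rewrite ler_wpM2l //; first by rewrite mulr_ge0 ?(ltW b0) ?(ltW t0).
    rewrite -[leLHS](WV x) mulrC ler_wpM2r ?(ltW (W0 x)) //.
    by apply: ler_powR2; rewrite ?subr_ge0 ?(ltW p1) ?(ltW h) // ltW.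
  have kN' := ltnW kN.
  rewrite -(avd_tower G _ _ kN) -[avd dy k.+1 V x](avd_tower G _ _ kN).
  rewrite -[avd dy k.+1 W x](avd_tower G _ _ kN).
  set c := b * t * _.
  have -> : t `^ e * (4 * avd dy k.+1 (avd dy k V) x - b * t + c * avd dy k.+1 (avd dy k W) x)
      = avd dy k.+1 (fun y => t `^ e * (4 * avd dy k V y - b * t + c * avd dy k W y)) x.
    by rewrite avdZ !avdD !avdZ (avd_const G).
  apply: le_avd => y xy; rewrite /c {c}.
  have [le|gt2] := leP (avd dy k V y) (2 * t); first exact: IH.
  have [g gE] : exists g, avd dy k V y = g by eexists.
  have g8 : g <= 8 * t.
    rewrite -gE; apply: le_trans (avd_le_avdS G kN xy _) _; last by lra.
    by move=> z; exact: ltW.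
  have := WA k y kN'; have := IH kN' y g.
  rewrite gE in gt2 *; have g0 : 0 < g by lra.
  have Wy0 : 0 <= avd dy k W y by apply: avd_ge0 => z; exact: ltW.
  move=> /(_ g0 _)/Wrap[|{}IH WAg]; first by lra.
  apply: le_trans IH _.
  move: (avd dy k W y) WAg Wy0 => w WAg Wy0.
  have -> : (b * g / 2) `^ (p - 1) = (b / 2) `^ (p - 1) * g `^ (p - 1).
    by rewrite -powRM ?divr_ge0 ?(ltW b0) ?(ltW g0) //; congr (_ `^ _); field.
  have small : b * g * ((b / 2) `^ (p - 1) * g `^ (p - 1)) * w <= b * g / 4.
    rewrite -mulrA ler_wpM2l //; first by rewrite mulr_ge0 // ltW.
    rewrite -bE -mulrA ler_wpM2l ?powR_ge0 // mulrC.
    exact: le_trans AA'.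
  have ge : g `^ e <= 8 `^ e * t `^ e.
    by rewrite -powRM ?(ltW t0) //; apply: ler_powR2; rewrite ?(ltW e0) ?(ltW g0).
  apply: le_trans (_ : t `^ e * (4 * g - b * t) <= _); last first.
    rewrite ler_wpM2l ?powR_ge0 // lerDl !mulr_ge0 ?powR_ge0 ?(ltW b0) ?(ltW t0) //.
  apply: le_trans (_ : (8 `^ e * t `^ e) * (4 * g - b * g + b * g / 4) <= _).
    apply: ler_pM => //; [exact: powR_ge0| |by lra].
    have h0 : 0 <= b * g * ((b / 2) `^ (p - 1) * g `^ (p - 1)) * w.
      by rewrite !mulr_ge0 ?powR_ge0 ?(ltW b0) ?(ltW g0) //.
    by nra.
  rewrite mulrC mulrA mulrC ler_wpM2l ?powR_ge0 //.
  have h : 4 * g - b * g + b * g / 4 = g * (4 - 3 * b / 4) by field.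
  rewrite h; apply: le_trans (_ : g * (4 - 3 * b / 4) * (1 + b / 64) <= _).
    by rewrite ler_wpM2l // mulr_ge0 ?(ltW g0) //; lra.
  have bt : b * t <= b * (g / 2) by rewrite ler_wpM2l //; lra.
  have : 0 <= g * b * b by apply: mulr_ge0; [apply: mulr_ge0|]; exact: ltW.
  have : 0 < g * b by rewrite mulr_gt0.
  by nra.
move=> k x kN.
have t0 : 0 < avd dy k V x by apply: (avd_gt0 G).
have := claim k kN x _ t0 _; case/(_ _)/Wrap; first by lra.
move=> [H]; apply: le_trans H _.
have := WA k x kN.
have [t tE] : exists t, avd dy k V x = t by eexists.
rewrite tE in t0 *; have [w wE] : exists w, avd dy k W x = w by eexists.
rewrite wE => WAg.
rewrite powR1D // [leRHS]mulrA [leRHS]mulrC ler_wpM2l ?powR_ge0 //.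
have -> : (b * t / 2) `^ (p - 1) = (b / 2) `^ (p - 1) * t `^ (p - 1).
  by rewrite -powRM ?divr_ge0 ?(ltW b0) ?(ltW t0) //; congr (_ `^ _); field.
have small : b * t * ((b / 2) `^ (p - 1) * t `^ (p - 1)) * w <= b * t / 4.
  rewrite -mulrA ler_wpM2l //; first by rewrite mulr_ge0 // ltW.
  rewrite -bE -mulrA ler_wpM2l ?powR_ge0 // mulrC.
  exact: le_trans AA'.
have : 0 <= b * t by rewrite mulr_ge0 // ltW.
by lra.
Qed.

(** With q - 1 = (p - 1) / (1 + e) the A_q dual of [W] is V^(1+e), and reverse Hoelder bounds its
    average by that of [V]. The factor 45 is 5 from [reverse_holder] times 9 for the cubes of a
    neighbourhood. *)
Lemma Apair_open (p A : R) : 1 < p -> exists q A' : R, 1 < q < p /\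
  forall (X : finType) (N : nat) (dy nb : nat -> rel X) (W : X -> R),
  dyadic N dy nb -> Apair N nb p A W -> Apair N nb q A' W.
Proof.
move=> p1; have [e [/andP[e0 e1] H]] := reverse_holder A p1.
have p10 : 0 < p - 1 by lra.
exists (1 + (p - 1) / (1 + e)), ((45 `^ ((p - 1) / (1 + e))) * A); split.
  rewrite ltrDl divr_gt0 //=; last by lra.
  by rewrite -ltrBrDl ltr_pdivrMr ?ltr_pMr //; lra.
move=> X N dy nb W G [W0 WA]; split => // k x kN.
set V := fun z => W z `^ (- (p - 1)^-1) in WA.
have V0 z : 0 < V z by apply: powR_gt0.
have WV z : W z * V z `^ (p - 1) = 1.
  rewrite /V -powRrM mulNr mulVf ?gt_eqF // powR_inv1 ?(ltW (W0 z)) //.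
  by rewrite mulfV // gt_eqF.
have Vn0 : 0 <= avn nb k V x by apply: avn_ge0 => z; exact: ltW.
have {H}RH : avn nb k (fun z => V z `^ (1 + e)) x <= 45 * avn nb k V x `^ (1 + e).
  rewrite -(avn_avd G _ _ kN).
  apply: le_trans (_ : avn nb k (fun=> 5 * avn nb k V x `^ (1 + e)) x <= _); last first.
    rewrite (le_trans (avn_const G _ _ _)) ?mulr_ge0 ?powR_ge0 // mulrA.
    by rewrite ler_wpM2r ?powR_ge0 //; lra.
  apply: le_avn => y xy; apply: le_trans (H _ _ _ _ V W G V0 WV _ _ _ kN) _.
    move=> j z jN; apply: le_trans (WA j z jN).
    rewrite ler_pM ?powR_ge0 //.
    - by apply: avd_ge0 => ?; exact: ltW.
    - by apply: (avd_le_avn G) => ?; exact: ltW.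
    - apply: ler_powR2; [exact: ltW|by apply: avd_ge0 => ?; exact: ltW|].
      by apply: (avd_le_avn G) => ?; exact: ltW.
  rewrite ler_wpM2l //; apply: ler_powR2; first by lra.
    by apply: avd_ge0 => z; exact: ltW.
  rewrite ler_wpM2l ?invr_ge0 ?exprn_ge0 // [leRHS](bigID (dy k y)) /=.
  rewrite -[leLHS]addr0 lerD ?sumr_ge0 //; last by move=> *; exact: ltW.
  rewrite le_eqVlt; apply/orP; left; apply/eqP; apply: eq_bigl => z.
  apply/idP/andP => [h|[]//]; split => //.
  by rewrite -(nb_dyr G x h).
have -> : 1 + (p - 1) / (1 + e) - 1 = (p - 1) / (1 + e) by ring.
have EV : (fun z => W z `^ (- ((p - 1) / (1 + e))^-1)) = (fun z => V z `^ (1 + e)).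
  by apply/funext => z; rewrite /V -powRrM; congr (_ `^ _); field; lra.
rewrite EV; set q := (p - 1) / (1 + e).
have q0 : 0 < q by rewrite divr_gt0 //; lra.
apply: le_trans (_ : avn nb k W x * (45 * avn nb k V x `^ (1 + e)) `^ q <= _).
  rewrite ler_wpM2l ?avn_ge0 //; first by move=> *; exact: ltW.
  apply: ler_powR2 => //; first exact: ltW.
  by apply: avn_ge0 => *; exact: powR_ge0.
rewrite powRM ?powR_ge0 // -powRrM mulrCA ler_wpM2l ?powR_ge0 //.
have -> : (1 + e) * q = p - 1 by rewrite /q; field; lra.
exact: WA.
Qed.

Lemma Apair_dual (p A : R) (X : finType) (N : nat) (nb : nat -> rel X) (W : X -> R) :
  1 < p -> Apair N nb p A W ->
  Apair N nb (p / (p - 1)) (A `^ (p - 1)^-1) (fun z => W z `^ (- (p - 1)^-1)).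
Proof.
move=> p1 [W0 WA]; split=> [x|k x kN]; first exact: powR_gt0.
have p10 : 0 < p - 1 by lra.
have e1 : p / (p - 1) - 1 = (p - 1)^-1 by field; lra.
rewrite e1 invrK.
have -> : (fun z => (W z `^ (- (p - 1)^-1)) `^ (- (p - 1))) = W.
  apply/funext => z; rewrite -powRrM mulrNN mulVf ?gt_eqF // powRr1 //.
  exact: ltW.
have a0 : 0 <= avn nb k W x by apply: avn_ge0 => z; exact: ltW.
have := WA k x kN; set a := avn nb k W x in a0 *; set v := avn nb k _ x.
have v0 : 0 <= v by apply: avn_ge0 => z; exact: powR_ge0.
move=> H.
have := ler_powR2 (_ : 0 <= (p - 1)^-1) _ H => /(_ _ _)/Wrap[||h].
- by rewrite invr_ge0 ltW.
- by rewrite mulr_ge0 // powR_ge0.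
apply: le_trans h; rewrite powRM ?powR_ge0 // powRK ?gt_eqF //.
by rewrite mulrC.
Qed.

(** Through the constant weight the weighted theorem also yields unweighted bounds. *)
Lemma Apair1 (q : R) (X : finType) (N : nat) (dy nb : nat -> rel X) :
  1 < q -> dyadic N dy nb -> Apair N nb q (9 * 9 `^ (q - 1)) (fun=> 1 : R).
Proof.
move=> q1 G; split=> // k x kN.
have h : avn nb k (fun=> 1 : R) x <= 9.
  by rewrite (le_trans (avn_const G _ _ _)) ?mulr1.
have h0 : 0 <= avn nb k (fun=> 1 : R) x by apply: avn_ge0.
under [X in _ * X `^ _]eq_avn do rewrite powR1.
by rewrite ler_pM ?powR_ge0 //; apply: ler_powR2; rewrite ?subr_ge0 ?(ltW q1).
Qed.

(** Hoelder's inequality for the constant 1 bounds the A_p product of one cube from below by 1,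
    while A_p bounds that of the neighbourhood from above by [A]. *)
Lemma Apair_doubling (p A : R) (X : finType) (N : nat) (dy nb : nat -> rel X) (W : X -> R) :
  1 < p -> dyadic N dy nb -> Apair N nb p A W ->
  forall k x, (k <= N)%N -> avn nb k W x <= A * avd dy k W x.
Proof.
move=> p1 G [W0 WA] k x kN.
set V := fun z => W z `^ (- (p - 1)^-1) in WA.
have V0 z : 0 < V z by apply: powR_gt0.
have p10 : p - 1 != 0 by rewrite subr_eq0 gt_eqF.
have WV z : W z * V z `^ (p - 1) = 1.
  rewrite /V -powRrM mulNr mulVf // powR_inv1 ?(ltW (W0 z)) //.
  by rewrite mulfV // gt_eqF.
have := @holder_weight R X (dy k x) (fun=> 1) V W (4 ^- k) p p1 (ltW (inv4_gt0 _)).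
move=> /(_ (fun=> ler01) V0 WV).
rewrite (_ : 4 ^- k * _ = avd dy k (fun=> 1) x) // (avd_const G) // powR1.
under eq_bigr do rewrite mul1r.
rewrite -/(avd dy k W x).
rewrite -/(avd dy k V x) => H.
have d0 : 0 < avd dy k V x by apply: (avd_gt0 G).
have Vp : 0 < avd dy k V x `^ (p - 1) by apply: powR_gt0.
have Wd : 0 <= avd dy k W x by apply/ltW/(avd_gt0 G).
have Wn : 0 <= avn nb k W x by apply: avn_ge0 => z; exact: ltW.
have A0 : 0 <= A by apply: le_trans (WA k x kN); rewrite mulr_ge0 ?powR_ge0.
rewrite -(ler_pM2r Vp); apply: le_trans (_ : A * 1 <= _).
  rewrite mulr1; apply: le_trans (WA k x kN); rewrite ler_wpM2l //.
  apply: ler_powR2; [by lra|exact: ltW|].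
  by apply: (avd_le_avn G) => z; exact: ltW.
by rewrite -mulrA ler_wpM2l.
Qed.

End Weights.

(** * Maximal functions *)

Section MaximalFunctions.
Context {R : realType}.

Section Star.
Variables (X : finType) (N : nat) (m : nat -> X -> R).
Implicit Types (k : nat) (x : X).

(** The maximum over the levels from k to [N], empty for k = N + 1. If each [m i] is constant on
    cubes of level i, then [star k] is constant on cubes of level k ([star_dy]), which the arguments
    level by level rely on. *)
Definition star k x : R := \big[Num.max/0]_(k <= i < N.+1) m i x.

Lemma starN x : star N.+1 x = 0. Proof. by rewrite /star big_geq. Qed.

Lemma starS k x : (k <= N)%N -> star k x = Num.max (m k x) (star k.+1 x).
Proof. by move=> kN; rewrite /star big_ltn. Qed.

Lemma star_ge0 k x : (forall i, 0 <= m i x) -> 0 <= star k x.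
Proof. by move=> m0; rewrite /star; elim/big_ind: _ => // a b a0 b0; rewrite le_max a0. Qed.

Lemma starS_le k x : (k <= N)%N -> star k.+1 x <= star k x.
Proof. by move=> kN; rewrite [leRHS]starS // le_max lexx orbT. Qed.

Lemma le_star k i x : (k <= i <= N)%N -> m i x <= star k x.
Proof.
move=> /andP[ki iN]; rewrite -(subKn ki).
elim: {k ki}(i - k)%N (leq_subr k i) => [_|n IH ni].
  by rewrite subn0 starS // le_max lexx.
apply: le_trans (IH (ltnW ni)) _; rewrite -(subnSK ni) starS_le //.
by rewrite (leq_trans (leq_subr _ _)).
Qed.

Lemma star_le k x (a : R) : 0 <= a -> (forall i, (k <= i <= N)%N -> m i x <= a) -> star k x <= a.
Proof.
move=> a0 ma; rewrite /star big_seq; elim/big_ind: _ => //.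
  by move=> u v ua va; rewrite ge_max ua.
by move=> i; rewrite mem_index_iota ltnS; exact: ma.
Qed.

(** Takes the place of the layer-cake formula: for the maximal functions below, the increment at
    level k is constant on cubes of level k and can be averaged there. *)
Lemma telescope_star (w : X -> R) (q : R) : 0 < q ->
  \sum_x star 0 x `^ q * w x =
  \sum_(0 <= k < N.+1) \sum_x (star k x `^ q - star k.+1 x `^ q) * w x.
Proof.
move=> q0; rewrite exchange_big /=; apply: eq_bigr => x _.
rewrite -mulr_suml; congr (_ * _).
rewrite -[RHS]opprK -sumrN; under [in RHS]eq_bigr do rewrite opprB.
by rewrite telescope_sumr // starN powR0 ?gt_eqF // sub0r opprK.
Qed.

End Star.

Variables (X : finType) (N : nat) (dy nb : nat -> rel X).
Hypothesis G : dyadic N dy nb.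
Implicit Types (W u : X -> R) (k : nat) (x : X).

Definition avw W u k x : R := avd dy k (fun z => u z * W z) x / avd dy k W x.

Lemma dy_leq k i x y : (k <= i)%N -> dy k x y -> dy i x y.
Proof.
move=> /subnKC <-; elim: (i - k)%N => [|j IH]; rewrite ?addn0 // => /IH/(dyS G).
by rewrite addnS.
Qed.

Lemma nb_leq k i x y : (k <= i)%N -> nb k x y -> nb i x y.
Proof.
move=> /subnKC <-; elim: (i - k)%N => [|j IH]; rewrite ?addn0 // => /IH/(nbS G).
by rewrite addnS.
Qed.

Lemma star_dy (m : nat -> X -> R) k x y : dy k x y ->
  (forall i z w, dy i z w -> m i z = m i w) -> star N m k x = star N m k y.
Proof.
move=> xy mE; rewrite /star; apply: eq_big_nat => i /andP[ki _]; apply: mE.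
exact: dy_leq xy.
Qed.

Lemma avw_ge0 W u k x : (forall z, 0 < W z) -> (forall z, 0 <= u z) -> 0 <= avw W u k x.
Proof.
move=> W0 u0; rewrite divr_ge0 //; last by apply/ltW/(avd_gt0 G).
by apply: avd_ge0 => z; rewrite mulr_ge0 // ltW.
Qed.

Lemma avw_dy W u k x y : dy k x y -> avw W u k x = avw W u k y.
Proof. by move=> xy; rewrite /avw !(avd_dy G _ xy). Qed.

End MaximalFunctions.

Section MaximalTheorem.
Context {R : realType}.

(** Doob's maximal inequality for the measure with density [W]. An increment at level k occurs only
    where m k exceeds the maximum over the higher levels, and there star k = m k. Convexity compares
    the increment of the q-th power with m k times that of the power q - 1; Young's inequality then
    absorbs the maximal function. *)
Lemma doob (q : R) : 1 < q -> exists2 C, 0 <= C &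
  forall (X : finType) N (dy nb : nat -> rel X), dyadic N dy nb ->
  forall W u : X -> R, (forall x, 0 < W x) -> (forall x, 0 <= u x) ->
  \sum_x star N (avw dy W u) 0 x `^ q * W x <= C * \sum_x u x `^ q * W x.
Proof.
move=> q1; have q0 : 0 < q by lra.
have q10 : 0 < q - 1 by lra.
(* Half the inverse of the factor q / (q - 1) in [key], so that the term to be absorbed is S / 2. *)
have d0 : 0 < (q - 1) / q / 2 by rewrite !divr_gt0.
have [K K0 HK] := young_eps q1 d0.
exists (2 * (q / (q - 1)) * K); first by rewrite mulr_ge0 // mulr_ge0 // divr_ge0 // ltW.
move=> X N dy nb G W u W0 u0.
set m := avw dy W u.
have m0 i z : 0 <= m i z by apply: (avw_ge0 G).
have s0 k x : 0 <= star N m k x by apply: star_ge0.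
have mE i z w : dy i z w -> m i z = m i w by apply: (avw_dy G).
have key : \sum_x star N m 0 x `^ q * W x <=
    q / (q - 1) * \sum_x u x * W x * star N m 0 x `^ (q - 1).
  rewrite telescope_star //.
  have -> : \sum_x u x * W x * star N m 0 x `^ (q - 1) =
      \sum_x star N m 0 x `^ (q - 1) * (u x * W x).
    by apply: eq_bigr => x _; rewrite mulrC.
  rewrite telescope_star // mulr_sumr big_nat [leRHS]big_nat; apply: ler_sum => k.
  rewrite ltnS /= => kN.
  set D := fun x => star N m k x `^ (q - 1) - star N m k.+1 x `^ (q - 1).
  have DE x y : dy k x y -> D x = D y.
    move=> xy; rewrite /D (star_dy G xy mE).
    by rewrite (star_dy G (dyS G xy) mE).
  rewrite -(sum_avd G (c := D) _ kN DE).
  have -> : \sum_x D x * avd dy k (fun z => u z * W z) x =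
      \sum_x D x * m k x * avd dy k W x.
    apply: eq_bigr => x _; rewrite -mulrA; congr (_ * _).
    by rewrite /m /avw divfK // gt_eqF // (avd_gt0 G).
  rewrite (sum_avd G (c := fun x => D x * m k x) _ kN); last first.
    by move=> x y xy; rewrite (DE _ _ xy) (mE _ _ _ xy).
  rewrite mulr_sumr; apply: ler_sum => x _.
  rewrite mulrA ler_wpM2r ?(ltW (W0 x)) // /D starS //.
  have [h|h] := leP (m k x) (star N m k.+1 x).
    by rewrite !subrr mul0r mulr0.
  move: (m0 k x) (s0 k.+1 x) h; move: (m k x) (star N m k.+1 x) => a b a0 b0 h.
  have qn : q != 0 by rewrite gt_eqF.
  have := powR_tangent q1 a0 b0; rewrite (powRS a0 qn) (powRS b0 qn).
  set A := a `^ (q - 1); set B := b `^ (q - 1) => H.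
  rewrite -(ler_pM2l q10).
  have -> : (q - 1) * (q / (q - 1) * ((A - B) * a)) = q * (A - B) * a by field; lra.
  by nra.
set S := \sum_x star N m 0 x `^ q * W x in key *.
set U := \sum_x u x `^ q * W x.
have key2 : \sum_x u x * W x * star N m 0 x `^ (q - 1) <= K * U + (q - 1) / q / 2 * S.
  rewrite !mulr_sumr -big_split /=; apply: ler_sum => x _.
  have := HK _ _ (u0 x) (powR_ge0 (star N m 0 x) (q - 1)).
  rewrite -powRrM mulrCA divff ?mulr1 ?gt_eqF // => H.
  by have := ler_wpM2r (ltW (W0 x)) H; lra.
have qq : 0 < q / (q - 1) by rewrite divr_gt0.
have := le_trans key (ler_wpM2l (ltW qq) key2).
have -> : q / (q - 1) * (K * U + (q - 1) / q / 2 * S) = q / (q - 1) * K * U + S / 2.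
  by field; lra.
rewrite -!mulrA; lra.
Qed.

(** By Hoelder's inequality and A_q, the q-th power of an average of u is at most [A] times the
    largest [W]-average of u^q over the neighbouring cubes, so Doob's inequality with exponent r is
    applied to u^q. The room between q and q r takes the place of interpolation. *)
Lemma weighted_maximal (q r A : R) : 1 < q -> 1 < r -> exists2 C, 0 <= C &
  forall (X : finType) N (dy nb : nat -> rel X) (W : X -> R),
  dyadic N dy nb -> Apair N nb q A W ->
  forall u : X -> R, (forall x, 0 <= u x) -> exists M : X -> R,
  [/\ forall x, 0 <= M x, forall k x, (k <= N)%N -> avn nb k u x <= M x &
      \sum_x M x `^ (q * r) * W x <= C * \sum_x u x `^ (q * r) * W x].
Proof.
move=> q1 r1; have [C C0 HC] := doob r1.
pose A' := Num.max A 0.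
have A'0 : 0 <= A' by rewrite le_max lexx orbT.
exists (A' `^ r * (A' * C)); first by rewrite !mulr_ge0 ?powR_ge0.
move=> X N dy nb W G HA u u0; have [W0 WA] := HA.
have q0 : 0 < q by lra. have r0 : 0 < r by lra.
pose U x := u x `^ q.
have U0 x : 0 <= U x by apply: powR_ge0.
pose m := avw dy W U.
have m0 i z : 0 <= m i z by apply: (avw_ge0 G).
have mE i z w : dy i z w -> m i z = m i w by apply: (avw_dy G).
(* A neighbourhood is not a dyadic cube, so its [W]-average is replaced by the largest one among the
   cubes composing it. *)
pose n k x := \big[Num.max/0]_(y | nb k x y) m k y.
have n_ge k x y : nb k x y -> m k y <= n k x by move=> xy; exact: le_bigmax_cond.
have n_arg k x : exists2 y, nb k x y & n k x = m k y.
  have := @bigmax_eq_arg _ R X 0 x (nb k x) (m k).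
  rewrite (dy_nb G) ?(dy_refl G) // => /(_ isT) h.
  eexists; last by apply: h => i _.
  case: arg_maxP => //; exact: (dy_nb G (dy_refl G k x)).
have n0 i z : 0 <= n i z.
  by have [y _ ->] := n_arg i z.
pose M x := (A' * star N n 0 x) `^ q^-1.
exists M; split=> [x|k x kN|]; first exact: powR_ge0.
  rewrite /M; apply: ler_powR2_root => //; first exact: avn_ge0.
    by rewrite mulr_ge0 // star_ge0.
  set V := fun z => W z `^ (- (q - 1)^-1) in WA.
  have V0 z : 0 < V z by apply: powR_gt0.
  have q10 : q - 1 != 0 by rewrite subr_eq0 gt_eqF.
  have WV z : W z * V z `^ (q - 1) = 1.
    rewrite /V -powRrM mulNr mulVf // powR_inv1 ?(ltW (W0 z)) //.
    by rewrite mulfV // gt_eqF.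
  have := @holder_weight R X (nb k x) u V W (4 ^- k) q q1 (ltW (inv4_gt0 _)) u0 V0 WV.
  rewrite -/(avn nb k u x) -/(avn nb k V x) -/(avn nb k (fun z => u z `^ q * W z) x).
  move=> H; apply: le_trans H _.
  have h : avn nb k (fun z => u z `^ q * W z) x <= star N n 0 x * avn nb k W x.
    rewrite -(avn_avd G _ _ kN) -(avn_avd G W _ kN) -avnZ; apply: le_avn => y xy.
    have Wd : 0 < avd dy k W y by apply: (avd_gt0 G).
    rewrite -ler_pdivrMr //; apply: le_trans (n_ge k x y xy) _.
    by apply: le_star.
  apply: le_trans (ler_wpM2r (powR_ge0 _ _) h) _.
  rewrite -mulrA [leRHS]mulrC ler_wpM2l ?star_ge0 //.
  by rewrite (le_trans (WA k x kN)) // le_max lexx.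
have ME x : M x `^ (q * r) = A' `^ r * star N n 0 x `^ r.
  rewrite /M -powRrM mulrA mulVf ?mul1r ?gt_eqF // powRM //.
  exact: star_ge0.
under eq_bigr do rewrite ME -mulrA.
have -> : \sum_x u x `^ (q * r) * W x = \sum_x U x `^ r * W x.
  by apply: eq_bigr => x _; rewrite powRrM.
rewrite -mulr_sumr -!mulrA ler_wpM2l ?powR_ge0 //.
apply: le_trans (ler_wpM2l A'0 (HC X N dy nb G W U W0 U0)).
rewrite -/m !telescope_star // mulr_sumr big_nat [leRHS]big_nat; apply: ler_sum => k.
rewrite ltnS /= => kN.
set D := fun x => star N m k x `^ r - star N m k.+1 x `^ r.
have sm0 j x : 0 <= star N m j x by apply: star_ge0.
have sn0 j x : 0 <= star N n j x by apply: star_ge0.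
have DE x y : dy k x y -> D x = D y.
  move=> xy; rewrite /D (star_dy G xy mE).
  by rewrite (star_dy G (dyS G xy) mE).
have D0 x : 0 <= D x.
  by rewrite subr_ge0; apply: ler_powR2 => //; [exact: ltW|exact: starS_le].
apply: le_trans (_ : \sum_x avn nb k D x * W x <= _).
  apply: ler_sum => x _; rewrite ler_wpM2r ?(ltW (W0 x)) // starS //.
  have [h|h] := leP (n k x) (star N n k.+1 x).
    by rewrite subrr; exact: avn_ge0.
  have [y xy yE] := n_arg k x.
  (* A jump of [star N n] at x comes from the cube of a neighbour y. There [star N m] jumps at least
     as much, because y remains a neighbour of x at all higher levels. *)
  apply: le_trans (_ : D y <= _); last first.
    have -> : D y = avd dy k D y.
      by rewrite -(avd_const G (D y) y kN); apply: eq_avd => z yz; exact: DE.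
    rewrite ler_wpM2l ?invr_ge0 ?exprn_ge0 // [leRHS](bigID (dy k y)) /=.
    rewrite -[leLHS]addr0 lerD ?sumr_ge0 //.
    rewrite le_eqVlt; apply/orP; left; apply/eqP; apply: eq_bigl => z.
    apply/idP/andP => [yz|[]//]; split => //.
    by rewrite -(nb_dyr G x yz).
  apply: lerB; apply: ler_powR2; rewrite ?(ltW r0) ?n0 ?sm0 //.
    by rewrite yE; apply: le_star; rewrite leqnn.
  apply: star_le => // i /andP[ki iN]; apply: le_trans (n_ge i x y _) _.
    exact: (nb_leq G (ltnW ki) xy).
  by apply: le_star; rewrite ki.
(* The neighbourhood average moves onto [W], where doubling turns it into an average over one
   cube. *)
rewrite -(sum_avn G).
apply: le_trans (_ : \sum_x D x * (A * avd dy k W x) <= _).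
  by apply: ler_sum => x _; rewrite ler_wpM2l //; exact: (Apair_doubling q1 G HA).
have -> : \sum_x D x * (A * avd dy k W x) = A * \sum_x D x * W x.
  under eq_bigr do rewrite mulrCA.
  by rewrite -mulr_sumr (sum_avd G (c := D) _ kN DE).
rewrite ler_wpM2r ?le_max ?lexx //; apply: sumr_ge0 => x _.
by rewrite mulr_ge0 ?(ltW (W0 x)) //; exact: D0.
Qed.

End MaximalTheorem.

(** * Weighted bounds for matrices on a dyadic structure *)

Section Operators.
Context {R : realType}.

Definition matrix_op (X : finType) (a : X -> X -> R) (f : X -> R) (x : X) : R :=
  \sum_l a x l * f l.

Definition bounded_mx (X : finType) (q B : R) (a : X -> X -> R) :=
  forall f : X -> R, \sum_x `|matrix_op a f x| `^ q <= B * \sum_x `|f x| `^ q.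

(* Off the neighbours of a cube, the rows of [a] indexed by that cube differ from
   a common row by an amount controlled by the averages of [`|f| `^ s] over
   larger cubes. *)
Definition regular_mx (X : finType) (N : nat) (dy nb : nat -> rel X) (s H : R) (a : X -> X -> R) :=
  forall k x, (k <= N)%N -> exists b : X -> R, forall (f : X -> R) (m : R), 0 <= m ->
    (forall j, (k <= j <= N)%N -> avn nb j (fun l => `|f l| `^ s) x <= m `^ s) ->
    forall y, dy k x y -> \sum_(l | ~~ nb k x l) `|a y l - b l| * `|f l| <= H * m.

(** Pair h = a f with sg(h) |h|^(p'-1), the function that realises its norm, and absorb the sum of
    |h|^p' by Young's inequality. *)
Lemma bounded_mx_dual (p B : R) : 1 < p -> 0 <= B -> exists2 B', 0 <= B' &
  forall (X : finType) (a : X -> X -> R),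
  bounded_mx p B (fun x y => a y x) -> bounded_mx (p / (p - 1)) B' a.
Proof.
move=> p1 B0; have p10 : 0 < p - 1 by lra.
have p'1 : 1 < p / (p - 1) by rewrite ltr_pdivlMr // mul1r; lra.
have d0 : 0 < (2 * (B + 1))^-1 by rewrite invr_gt0; lra.
have [K K0 HK] := young_eps p'1 d0.
exists (2 * K); first by rewrite mulr_ge0.
move=> X a Ha f.
set p' := p / (p - 1) in p'1 HK *.
have pE : p' / (p' - 1) = p by rewrite /p'; field; lra.
have p'p : (p' - 1) * p = p' by rewrite /p'; field; lra.
have p'0 : p' != 0 by rewrite gt_eqF // (lt_trans ltr01).
rewrite pE in HK.
pose h := matrix_op a f; pose g x := Num.sg (h x) * `|h x| `^ (p' - 1).
have gE x : `|g x| `^ p <= `|h x| `^ p'.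
  rewrite /g normrM normr_sg (ger0_norm (powR_ge0 _ _)).
  have [->|hx] := eqVneq (h x) 0; first by rewrite mul0r powR0 ?powR_ge0 // gt_eqF //; lra.
  by rewrite mul1r -powRrM p'p.
have hE : \sum_x `|h x| `^ p' = \sum_l f l * matrix_op (fun x y => a y x) g l.
  transitivity (\sum_x h x * g x).
    apply: eq_bigr => x _; rewrite /g mulrA [h x * _]mulrC -normrEsg.
    exact: powRS.
  under eq_bigr do rewrite /h /matrix_op mulr_suml.
  rewrite exchange_big /=; apply: eq_bigr => l _; rewrite mulr_sumr.
  by apply: eq_bigr => x _; rewrite -mulrA mulrCA.
set S := \sum_x `|h x| `^ p' in hE *; set U := \sum_x `|f x| `^ p'.
have gS : \sum_x `|g x| `^ p <= S by apply: ler_sum => x _; exact: gE.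
have key : S <= K * U + (2 * (B + 1))^-1 * (B * S).
  rewrite hE.
  apply: le_trans (_ : \sum_l `|f l| * `|matrix_op (fun x y => a y x) g l| <= _).
    by apply: ler_sum => l _; rewrite -normrM ler_norm.
  rewrite -hE; apply: le_trans (_ : K * U + (2 * (B + 1))^-1 *
      \sum_l `|matrix_op (fun x y => a y x) g l| `^ p <= _).
    by rewrite !mulr_sumr -big_split /=; apply: ler_sum => l _; exact: HK.
  rewrite lerD2l ler_wpM2l ?(ltW d0) //; apply: le_trans (Ha g) _.
  by rewrite ler_wpM2l.
have S0 : 0 <= S by apply: sumr_ge0 => *; exact: powR_ge0.
have : (2 * (B + 1))^-1 * (B * S) <= S / 2.
  rewrite mulrA [leRHS]mulrC ler_wpM2r // invfM -mulrA ler_piMr ?invr_ge0 //.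
  by rewrite mulrC ler_pdivrMr; lra.
by rewrite -mulrA; lra.
Qed.

Section SharpBound.
Context {X : finType} {N : nat} {dy nb : nat -> rel X}.
Hypothesis G : dyadic N dy nb.
Variables (s B H : R) (a : X -> X -> R).
Hypotheses (s1 : 1 < s) (B0 : 0 <= B) (H0 : 0 <= H).
Hypotheses (Ba : bounded_mx s B a) (Ra : regular_mx N dy nb s H a).
Variables (f M : X -> R).
Hypothesis M0 : forall x, 0 <= M x.
Hypothesis fM : forall k x, (k <= N)%N -> avn nb k (fun l => `|f l| `^ s) x <= M x.

Let S x := (B `^ s^-1 + H) * M x `^ s^-1.

(** The constant subtracted on a cube is the common row applied to the far part of [f]. The near
    part is treated by Hoelder's inequality on the cube and the L^s bound, the remaining far part by
    regularity. *)
Lemma operator_oscillation k x : (k <= N)%N -> exists b : X -> R, forall y, dy k x y ->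
  avd dy k (fun z => `|matrix_op a f z - \sum_(l | ~~ nb k x l) b l * f l|) y <= S y.
Proof.
have s0 : 0 < s by exact: lt_trans s1. have sn : s != 0 by rewrite gt_eqF.
move=> kN; have [b Hb] := Ra x kN; exists b => y xy.
pose f1 l := if nb k x l then f l else 0.
have loc : avd dy k (fun z => `|matrix_op a f1 z|) y <= (B * M y) `^ s^-1.
  apply: ler_powR2_root => //; [by apply: avd_ge0|by rewrite mulr_ge0|].
  have := @holder_weight R X (dy k y) (fun z => `|matrix_op a f1 z|) (fun=> 1) (fun=> 1)
    (4 ^- k) s s1 (ltW (inv4_gt0 _)) (fun=> normr_ge0 _) (fun=> ltr01).
  case/(_ _)/Wrap; first by move=> i; rewrite powR1 mul1r.
  rewrite -/(avd dy k (fun z => `|matrix_op a f1 z|) y).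
  rewrite -/(avd dy k (fun=> 1) y) (avd_const G) // powR1 mulr1 => -[h].
  apply: le_trans h _; apply: le_trans (_ : 4 ^- k * (B * \sum_l `|f1 l| `^ s) <= _).
    rewrite ler_wpM2l ?invr_ge0 ?exprn_ge0 //; apply: le_trans (Ba f1).
    rewrite [leRHS](bigID (dy k y)) /= -[leLHS]addr0 lerD //.
      by apply: ler_sum => i _; rewrite mulr1.
    by apply: sumr_ge0 => *; exact: powR_ge0.
  rewrite mulrCA ler_wpM2l //.
  have -> : \sum_l `|f1 l| `^ s = \sum_(l | nb k x l) `|f l| `^ s.
    rewrite [RHS]big_mkcond; apply: eq_bigr => l _; rewrite /f1; case: ifP => // _.
    by rewrite normr0 powR0.
  by rewrite -/(avn nb k (fun l => `|f l| `^ s) x) (avn_dy G _ xy) fM.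
rewrite /S mulrDl -powRM //.
have nonloc : avd dy k (fun=> H * M y `^ s^-1) y <= H * M y `^ s^-1 by rewrite (avd_const G).
apply: le_trans (lerD loc nonloc); rewrite -avdD; apply: le_avd => z yz.
have xz : dy k x z by apply: (dy_trans G) yz.
apply: le_trans (_ : `|matrix_op a f1 z| +
    \sum_(l | ~~ nb k x l) `|a z l - b l| * `|f l| <= _); last first.
  rewrite lerD2l; apply: (Hb f (M y `^ s^-1)) => //; first exact: powR_ge0.
  move=> j /andP[kj jN]; rewrite powRVK //.
  by rewrite (avn_dy G _ (dy_leq G kj xy)) fM.
have -> : matrix_op a f z - \sum_(l | ~~ nb k x l) b l * f l =
    matrix_op a f1 z + \sum_(l | ~~ nb k x l) (a z l - b l) * f l.
  rewrite /matrix_op (bigID (nb k x)) /= -addrA; congr (_ + _); last first.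
    by rewrite -sumrB; apply: eq_bigr => l _; rewrite mulrBl.
  by rewrite big_mkcond; apply: eq_bigr => l _; rewrite /f1; case: ifP => // _; rewrite mulr0.
apply: le_trans (ler_normD _ _) _; rewrite lerD2l.
apply: le_trans (ler_norm_sum _ _ _) _; apply: ler_sum => l _.
by rewrite normrM.
Qed.

Lemma operator_duality (g Mg : X -> R) : (forall x, 0 <= g x) ->
  (forall k x, (k <= N)%N -> avd dy k g x <= Mg x) ->
  \sum_x `|matrix_op a f x| * g x <= 32 * \sum_x S x * Mg x.
Proof.
move=> g0 gM; apply: (sharp_function_duality G) => //.
- by move=> x; rewrite mulr_ge0 ?addr_ge0 ?powR_ge0.
- move=> k x kN; have [b Hb] := operator_oscillation x kN.
  by eexists; exact: Hb.
(* At level [N] every cell is a neighbour, so the far sum is empty and the subtracted constant is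
   0. *)
- move=> x; have [b Hb] := operator_oscillation x (leqnn N).
  apply: le_trans (Hb x (dy_refl G N x)); rewrite le_eqVlt; apply/orP; left; apply/eqP.
  apply: eq_avd => z _; rewrite big1 ?subr0 // => l.
  by rewrite (dy_nb G (dyN G x l)).
Qed.

End SharpBound.

(** [W] in A_q bounds the maximal function of |f|^s in L^(p/s)(W), as p / s > q. The dual weight in
    A_q' does the same in L^p' for g = |Tf|^(p-1) W. The p'-th power of the norm of g is the very
    sum to be estimated, and is absorbed. *)
Lemma weighted_operator (p s q q' A A' B H : R) : 1 < s -> 1 < q -> s * q < p ->
  1 < q' < p / (p - 1) -> 0 <= B -> 0 <= H -> exists2 C, 0 <= C &
  forall (X : finType) N (dy nb : nat -> rel X) (W : X -> R) (a : X -> X -> R),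
  dyadic N dy nb -> Apair N nb q A W ->
  Apair N nb q' A' (fun x => W x `^ (- (p - 1)^-1)) ->
  bounded_mx s B a -> regular_mx N dy nb s H a ->
  forall f : X -> R,
  \sum_x `|matrix_op a f x| `^ p * W x <= C * \sum_x `|f x| `^ p * W x.
Proof.
move=> s1 q1 sqp /andP[q'1 q'p] B0 H0.
have s0 : 0 < s by lra. have sn : s != 0 by rewrite gt_eqF.
have q0 : 0 < q by lra. have q'0 : 0 < q' by lra.
have sq0 : 0 < s * q by rewrite mulr_gt0.
have ssq : s < s * q by rewrite ltr_pMr.
have p1 : 1 < p by lra. have p0 : 0 < p by lra. have p10 : 0 < p - 1 by lra.
have r1 : 1 < p / (s * q) by rewrite ltr_pdivlMr ?mul1r.
have r'1 : 1 < p / (p - 1) / q' by rewrite ltr_pdivlMr ?mul1r.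
have [C1 C10 HC1] := weighted_maximal A q1 r1.
have [C2 C20 HC2] := weighted_maximal A' q'1 r'1.
have d0 : 0 < (64 * (C2 + 1))^-1 by rewrite invr_gt0; lra.
have [K K0 HK] := young_eps p1 d0.
set c := B `^ s^-1 + H; have c0 : 0 <= c by rewrite addr_ge0 ?powR_ge0.
exists (64 * (K * (c `^ p * C1))); first by rewrite !mulr_ge0 ?powR_ge0.
move=> X N dy nb W a G HW HV Ba Ra f; have [W0 _] := HW; have [V0 _] := HV.
set V := fun x => W x `^ (- (p - 1)^-1) in HV V0.
have [M [M0 fM HM]] := HC1 X N dy nb W G HW (fun x => `|f x| `^ s) (fun=> powR_ge0 _ _).
pose g x := `|matrix_op a f x| `^ (p - 1) * W x.
have g0 x : 0 <= g x by rewrite mulr_ge0 ?powR_ge0 // ltW.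
have [Mg [Mg0 gM HMg]] := HC2 X N dy nb V G HV g g0.
have gMd k x : (k <= N)%N -> avd dy k g x <= Mg x.
  by move=> kN; apply: le_trans (gM k x kN); exact: (avd_le_avn G).
have := operator_duality G s1 B0 H0 Ba Ra M0 fM g0 gMd; rewrite -/c.
have -> : \sum_x `|matrix_op a f x| * g x = \sum_x `|matrix_op a f x| `^ p * W x.
  by apply: eq_bigr => x _; rewrite /g mulrA -powRS // gt_eqF.
set T := \sum_x `|matrix_op a f x| `^ p * W x; set F := \sum_x `|f x| `^ p * W x => HT.
have E1 : q * (p / (s * q)) = p / s by field; lra.
have E2 : q' * (p / (p - 1) / q') = p / (p - 1) by field; lra.
rewrite E1 in HM; rewrite E2 in HMg.
have EF : \sum_x (`|f x| `^ s) `^ (p / s) * W x = F.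
  by apply: eq_bigr => x _; rewrite -powRrM mulrCA divff ?mulr1.
have ET : \sum_x g x `^ (p / (p - 1)) * V x = T.
  apply: eq_bigr => x _; rewrite /g powRM ?powR_ge0 ?(ltW (W0 x)) // -powRrM.
  rewrite mulrCA divff ?gt_eqF // mulr1 -mulrA /V -powRD ?(gt_eqF (W0 x)) ?implybT //.
  have -> : p / (p - 1) + - (p - 1)^-1 = 1 by field; lra.
  by rewrite powRr1 // ltW.
rewrite EF in HM; rewrite ET in HMg.
have young x : c * M x `^ s^-1 * Mg x <= K * c `^ p * (M x `^ (p / s) * W x) +
    (64 * (C2 + 1))^-1 * (Mg x `^ (p / (p - 1)) * V x).
  have Wp : 0 < W x `^ p^-1 by apply: powR_gt0.
  have := HK (c * M x `^ s^-1 * W x `^ p^-1) (Mg x * W x `^ (- p^-1)).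
  case/(_ _ _)/Wrap; first by rewrite !mulr_ge0 ?powR_ge0.
    by rewrite mulr_ge0 ?powR_ge0.
  have -> : c * M x `^ s^-1 * W x `^ p^-1 * (Mg x * W x `^ (- p^-1)) = c * M x `^ s^-1 * Mg x.
    rewrite mulrACA -[RHS]mulr1; congr (_ * _).
    by rewrite powRN divff // gt_eqF.
  rewrite !powRM ?mulr_ge0 ?powR_ge0 // -!powRrM.
  have -> : p^-1 * p = 1 by rewrite mulVf // gt_eqF.
  rewrite powRr1 ?(ltW (W0 x)) //.
  have -> : - p^-1 * (p / (p - 1)) = - (p - 1)^-1 by field; lra.
  have -> : s^-1 * p = p / s by rewrite mulrC.
  by move=> [h]; rewrite -/V in h; rewrite -[K * _ * _]mulrA !mulrA in h *.
have HT2 : T <= 32 * (K * c `^ p * (C1 * F) + (64 * (C2 + 1))^-1 * (C2 * T)).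
  apply: le_trans HT _; rewrite ler_wpM2l //.
  apply: le_trans (ler_sum _ (fun x _ => young x)) _.
  rewrite big_split /= -!mulr_sumr lerD //.
    by rewrite ler_wpM2l // mulr_ge0 ?powR_ge0.
  by rewrite ler_wpM2l // ltW.
have T0 : 0 <= T by apply: sumr_ge0 => x _; rewrite mulr_ge0 ?powR_ge0 // ltW.
have : (64 * (C2 + 1))^-1 * (C2 * T) <= T / 64.
  rewrite mulrA [leRHS]mulrC ler_wpM2r // invfM -mulrA ler_piMr ?invr_ge0 //.
  by rewrite mulrC ler_pdivrMr; lra.
have -> : 64 * (K * (c `^ p * C1)) * F = 64 * (K * c `^ p * (C1 * F)) by ring.
by lra.
Qed.

(** The case s = 2 with constant weight. The auxiliary exponents are the midpoints of 1 and r / 2,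
    and of 1 and r'. *)
Lemma bounded_mx_power (r B H : R) : 2 < r -> 0 <= B -> 0 <= H -> exists2 C, 0 <= C &
  forall (X : finType) N (dy nb : nat -> rel X) (a : X -> X -> R),
  dyadic N dy nb -> bounded_mx 2 B a -> regular_mx N dy nb 2 H a -> bounded_mx r C a.
Proof.
move=> r2 B0 H0.
have q1 : 1 < (1 + r / 2) / 2 by lra.
have r'1 : 1 < r / (r - 1) by rewrite ltr_pdivlMr; lra.
have q'1 : 1 < (1 + r / (r - 1)) / 2 < r / (r - 1) by apply/andP; split; lra.
have q2 : 2 * ((1 + r / 2) / 2) < r by lra.
have h2 : 1 < 2 :> R by lra.
have [C C0 HC] := weighted_operator (9 * 9 `^ ((1 + r / 2) / 2 - 1))
  (9 * 9 `^ ((1 + r / (r - 1)) / 2 - 1)) h2 q1 q2 q'1 B0 H0.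
exists C => // X N dy nb a G Ba Ra f.
have := HC X N dy nb (fun=> 1) a G (Apair1 q1 G) _ Ba Ra f.
have E (u : X -> R) : \sum_x u x * 1 = \sum_x u x.
  by apply: eq_bigr => x _; rewrite mulr1.
rewrite (E (fun x => `|matrix_op a f x| `^ r)) (E (fun x => `|f x| `^ r)); apply.
have -> : (fun=> 1 `^ (- (r - 1)^-1)) = (fun=> 1) :> (X -> R).
  by apply/funext => x; rewrite powR1.
by apply: (Apair1 _ G); case/andP: q'1.
Qed.

(** Openness of A_p, for the weight and for its dual, yields q < p and q' < p'. Then s > 1 is fixed
    with s q < p and s < 2. *)
Theorem discrete_weighted_bound (p A : R) : 1 < p -> exists s : R, 1 < s < 2 /\
  forall B H, 0 <= B -> 0 <= H -> exists2 C, 0 <= C &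
  forall (X : finType) N (dy nb : nat -> rel X) (W : X -> R) (a : X -> X -> R),
  dyadic N dy nb -> bounded_mx 2 B a -> regular_mx N dy nb 2 H (fun x y => a y x) ->
  regular_mx N dy nb s H a -> Apair N nb p A W -> forall f : X -> R,
  \sum_x `|matrix_op a f x| `^ p * W x <= C * \sum_x `|f x| `^ p * W x.
Proof.
move=> p1; have p'1 : 1 < p / (p - 1) by rewrite ltr_pdivlMr; lra.
have [q [A1 [/andP[q1 qp] Hq]]] := Apair_open A p1.
have [q' [A2 [/andP[q'1 q'p] Hq']]] := Apair_open (A `^ (p - 1)^-1) p'1.
have q0 : 0 < q by lra.
have pq1 : 1 < p / q by rewrite ltr_pdivlMr ?mul1r.
pose m := Num.min 2 (p / q).
have m1 : 1 < m by rewrite lt_min pq1 andbT; lra.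
have m2 : m <= 2 by rewrite ge_min lexx.
have mq : m <= p / q by rewrite ge_min lexx orbT.
pose s := (1 + m) / 2.
have s1 : 1 < s by rewrite /s; lra.
have s2 : s < 2 by rewrite /s; lra.
have sq : s * q < p by rewrite -ltr_pdivlMr // /s; lra.
exists s; split; first by rewrite s1.
move=> B H B0 H0.
have h2 : 1 < 2 :> R by lra.
(* The L^s bound for the near parts: transpose on L^2, raise the exponent to s' > 2 by the
   regularity of the transpose, and transpose back. *)
have [B1 B10 HB1] := bounded_mx_dual h2 B0.
have r2 : 2 < s / (s - 1) by rewrite ltr_pdivlMr; lra.
have [B2 B20 HB2] := bounded_mx_power r2 B10 H0.
have r1 : 1 < s / (s - 1) by lra.
have [B3 B30 HB3] := bounded_mx_dual r1 B20.
have q'1p : 1 < q' < p / (p - 1) by rewrite q'1.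
have [C C0 HC] := weighted_operator A1 A2 s1 q1 sq q'1p B30 H0.
exists C => // X N dy nb W a G Ba Rat Ra WA.
apply: (HC X N dy nb) => //; first exact: (Hq X N dy nb).
  by apply: (Hq' X N dy nb) => //; exact: Apair_dual.
have -> : s = s / (s - 1) / (s / (s - 1) - 1) by field; lra.
apply: HB3; apply: (HB2 X N dy nb) => //.
have <- : 2 / (2 - 1) = 2 :> R by field; lra.
exact: HB1.
Qed.

End Operators.

(** * The dyadic grid *)

Section Grid.

Definition adjn (a b : nat) := ((a <= b.+1) && (b <= a.+1))%N.
(** Subtraction is truncated, so one of the summands vanishes and the sum is |a - b|. *)
Definition distn (a b : nat) : nat := (a - b) + (b - a).

Lemma near_dist a b d : (0 < d)%N -> adjn (a %/ d) (b %/ d) -> (distn a b < 2 * d)%N.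
Proof.
move=> d0 /andP[h1 h2]; rewrite /distn.
have u1 : (a %/ d * d <= b %/ d * d + d)%N by rewrite -mulSnr leq_mul2r h1 orbT.
have u2 : (b %/ d * d <= a %/ d * d + d)%N by rewrite -mulSnr leq_mul2r h2 orbT.
move: (divn_eq a d) (divn_eq b d) (ltn_pmod a d0) (ltn_pmod b d0) u1 u2.
by move: (a %/ d * d)%N (b %/ d * d)%N (a %% d)%N (b %% d)%N => u v r r'; lia.
Qed.

Lemma card_block n d q : (q.+1 * d.+1 <= n)%N ->
  #|[pred y : 'I_n | q == (y %/ d.+1)%N]| = d.+1.
Proof.
move=> qn; have lt (j : 'I_d.+1) : (q * d.+1 + j < n)%N.
  by apply: leq_trans qn; rewrite mulSn addnC ltn_add2r.
pose f j := Ordinal (lt j).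
have fi : injective f by move=> i j /(congr1 val)/= /addnI /val_inj.
rewrite -[RHS]card_ord -(card_imset _ fi) //; apply: eq_card => y; rewrite !finset.inE.
apply/eqP/imsetP => [qy|[j _ ->]]; last by rewrite /= divnMDl // divn_small ?addn0.
have yd : (y %% d.+1 < d.+1)%N by rewrite ltn_mod.
by exists (Ordinal yd) => //; apply: val_inj; rewrite /= qy -divn_eq.
Qed.

(** An element is determined by the offset of its block, one of three, and its remainder. *)
Lemma card_adj n d x : (#|[pred y : 'I_n | adjn x (y %/ d.+1)]| <= 3 * d.+1)%N.
Proof.
pose f (y : 'I_n) : 'I_3 * 'I_d.+1 := (inord (y %/ d.+1 + 1 - x), inord (y %% d.+1)).
have fi : {in [pred y : 'I_n | adjn x (y %/ d.+1)] &, injective f}.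
  move=> y z; rewrite !finset.inE /adjn => /andP[a1 a2] /andP[b1 b2] [/(congr1 val) e1 /(congr1 val) e2].
  rewrite /= !inordK in e1; [|lia|lia].
  rewrite /= !inordK ?ltn_mod // in e2.
  apply: val_inj; rewrite /= (divn_eq y d.+1) (divn_eq z d.+1) e2; congr (_ * _ + _)%N.
  lia.
by rewrite -(card_in_imset fi) (leq_trans (max_card _)) // card_prod !card_ord.
Qed.

Lemma card_pair (S T : finType) (P : pred S) (Q : pred T) :
  #|(fun y : S * T => P y.1 && Q y.2)| = (#|P| * #|Q|)%N.
Proof. by rewrite -cardX; apply: eq_card => -[u v]; rewrite !finset.inE. Qed.

Context {N : nat}.
Let X : finType := ('I_(2 ^ N) * 'I_(2 ^ N))%type.

Definition same_cube (k : nat) : rel X :=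
  fun x y => (x.1 %/ 2 ^ k == y.1 %/ 2 ^ k)%N && (x.2 %/ 2 ^ k == y.2 %/ 2 ^ k)%N.
Definition near_cube (k : nat) : rel X :=
  fun x y => adjn (x.1 %/ 2 ^ k) (y.1 %/ 2 ^ k) && adjn (x.2 %/ 2 ^ k) (y.2 %/ 2 ^ k).

Lemma grid_dyadic : dyadic N same_cube near_cube.
Proof.
have pos k : exists d, (2 ^ k = d.+1)%N.
  by exists (2 ^ k).-1; rewrite prednK // expn_gt0.
have half (a k : nat) : (a %/ 2 ^ k.+1 = (a %/ 2 ^ k) %/ 2)%N by rewrite -divnMA -expnSr.
split.
- by move=> k x; rewrite /same_cube !eqxx.
- by move=> k x y; rewrite /same_cube ![(_ == (x.1 %/ _)%N)]eq_sym ![(_ == (x.2 %/ _)%N)]eq_sym.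
- by move=> k y x z; rewrite /same_cube => /andP[/eqP -> /eqP ->].
- by move=> k x y; rewrite /same_cube !half => /andP[/eqP -> /eqP ->]; rewrite !eqxx.
- by move=> [x1 x2] [y1 y2]; rewrite /same_cube /= expn0 !divn1.
- by move=> x y; rewrite /same_cube !divn_small ?eqxx.
- move=> k [x1 x2] kN.
  transitivity (#|(fun y : 'I_(2 ^ N) => x1 %/ 2 ^ k == y %/ 2 ^ k)%N| *
    #|(fun y : 'I_(2 ^ N) => x2 %/ 2 ^ k == y %/ 2 ^ k)%N|)%N; first exact: card_pair.
  have [d dE] := pos k.
  have bd (x : 'I_(2 ^ N)) : #|fun y : 'I_(2 ^ N) => (x %/ 2 ^ k == y %/ 2 ^ k)%N| = (2 ^ k)%N.
    have e : (2 ^ N = 2 ^ (N - k) * 2 ^ k)%N by rewrite -expnD subnK.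
    rewrite dE; apply: card_block; rewrite -dE [X in (_ <= X)%N]e leq_mul2r.
    by rewrite ltn_divLR ?expn_gt0 // -e ltn_ord orbT.
  by rewrite !bd -expnMn.
- by move=> k x y; rewrite /near_cube /adjn; congr (_ && _); rewrite andbC.
- by move=> k x y z; rewrite /same_cube /near_cube => /andP[/eqP -> /eqP ->].
- by move=> k x y; rewrite /same_cube /near_cube /adjn => /andP[/eqP -> /eqP ->]; rewrite !leqnSn.
- by move=> k x y; rewrite /near_cube /adjn !half; lia.
- move=> k [x1 x2]; have [d dE] := pos k.
  have -> : #|near_cube k (x1, x2)| = (#|(fun y : 'I_(2 ^ N) => adjn (x1 %/ 2 ^ k) (y %/ 2 ^ k))| *
    #|(fun y : 'I_(2 ^ N) => adjn (x2 %/ 2 ^ k) (y %/ 2 ^ k))|)%N by exact: card_pair.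
  have h (x : 'I_(2 ^ N)) : (#|fun y : 'I_(2 ^ N) => adjn (x %/ 2 ^ k) (y %/ 2 ^ k)| <= 3 * 2 ^ k)%N.
    by rewrite dE; exact: card_adj.
  apply: leq_trans (leq_mul (h _) (h _)) _.
  by rewrite mulnACA -expnMn.
Qed.

End Grid.

(** * Summation of pointwise kernel bounds over dyadic annuli *)

Section GridRegularity.
Context {R : realType}.

Lemma powR_Xn (x y : R) n : 0 <= x -> (x ^+ n) `^ y = (x `^ y) ^+ n.
Proof.
move=> x0; elim: n => [|n IH]; first by rewrite !expr0 powR1.
by rewrite !exprS powRM ?exprn_ge0 // IH.
Qed.

(** Comparison with the integral of t^-a; each step of the induction is the tangent inequality for
    the power 1 / (1 - a). *)
Lemma sum_power (a : R) n : 0 <= a < 1 ->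
  \sum_(i < n) (1 + i%:R) `^ (- a) <= (1 - a)^-1 * n%:R `^ (1 - a).
Proof.
move=> /andP[a0 a1]; have b0 : 0 < 1 - a by lra.
elim: n => [|n IH]; first by rewrite big_ord0 mulr_ge0 ?invr_ge0 ?powR_ge0 // ltW.
rewrite big_ord_recr /=.
have [az|/negPf an] := eqVneq a 0.
  by move: IH; rewrite az oppr0 addr0 invr1 !mul1r !powRr0 !powRr1 // [n.+1%:R]mulrSr; lra.
set b := 1 - a in b0 IH *.
have n0 : 0 < 1 + n%:R :> R by rewrite ltr_pwDl.
have c1 : 1 < b^-1 by rewrite invf_gt1 // /b; lra.
have := powR_tangent c1 (powR_ge0 n%:R b) (powR_ge0 (1 + n%:R) b).
rewrite !powRK ?gt_eqF ?(ltW n0) // -powRrM.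
have -> : b * (b^-1 - 1) = a by rewrite /b; field; lra.
have -> : n.+1%:R = 1 + n%:R :> R by rewrite mulrS.
move=> h; apply: le_trans (lerD IH (lexx _)) _.
have ap : 0 < (1 + n%:R : R) `^ (- a) by apply: powR_gt0.
have aE : (1 + n%:R : R) `^ (- a) * (1 + n%:R) `^ a = 1 by apply: powRVn.
move: h ap aE; move: ((1 + n%:R) `^ _) ((1 + n%:R) `^ a) ((1 + n%:R) `^ b) (n%:R `^ b).
move=> u v y x h u0 uv.
have := ler_wpM2l (ltW u0) h.
have -> : u * (1 + n%:R + b^-1 * v * (x - y)) = u * (1 + n%:R) + b^-1 * (x - y) * (u * v) by ring.
rewrite uv mulr1; lra.
Qed.

Lemma sum_ord_eq n c : (\sum_(l < n) (l == c :> nat) <= 1)%N.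
Proof.
have [cn|cn] := ltnP c n.
  rewrite (bigD1 (Ordinal cn)) //= eqxx big1 // => l; rewrite -val_eqE /= => /negPf -> //.
rewrite big1 // => l _; apply/eqP; rewrite eqb0.
by apply/eqP => h; move: cn; rewrite -h leqNgt ltn_ord.
Qed.

(** Each distance from [y] is attained at most twice. *)
Lemma sum_dist n m (y : nat) (g : nat -> R) : (forall i, 0 <= g i) ->
  \sum_(l < n | (distn y l < m)%N) g (distn y l) <= 2 * \sum_(i < m) g i.
Proof.
move=> g0.
have -> : \sum_(l < n | (distn y l < m)%N) g (distn y l) =
    \sum_(i < m) \sum_(l < n) (distn y l == i)%:R * g i.
  rewrite exchange_big /= big_mkcond; apply: eq_bigr => l _; case: ifP => h; last first.
    rewrite big1 // => i _; case: eqP => [e|]; last by rewrite mul0r.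
    by move: h; rewrite e ltn_ord.
  rewrite (bigD1 (Ordinal h)) //= eqxx mul1r big1 ?addr0 // => i.
  rewrite -val_eqE /= eq_sym => /negPf ->; by rewrite mul0r.
rewrite mulr_sumr; apply: ler_sum => i _; rewrite -mulr_suml ler_wpM2r //.
rewrite -natr_sum ler_nat.
apply: leq_trans (_ : \sum_(l < n) ((l == (y + i)%N :> nat) + (l == (y - i)%N :> nat)) <= _)%N.
  by apply: leq_sum => l _; rewrite /distn; lia.
by rewrite big_split /= (leq_add (sum_ord_eq _ _) (sum_ord_eq _ _)).
Qed.

(** On the annulus of level j, Hoelder's inequality with s' is applied to each singular factor. As 2
    e s' < 1, its s'-th power sums along a coordinate like a convergent integral. The result is a
    multiple of (2^j)^(2-2e) m, so with the pointwise bound the annulus contributes a multiple of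
    2^(-e(j-k)) m, a geometric series in j. *)
Lemma regular_of_pointwise (e s C : R) : 0 < e -> 1 < s -> 2 * e * (s / (s - 1)) < 1 -> 0 <= C ->
  exists2 H, 0 <= H & forall N (a : 'I_(2 ^ N) * 'I_(2 ^ N) -> 'I_(2 ^ N) * 'I_(2 ^ N) -> R),
  (forall k x, (k <= N)%N -> exists b, exists2 z, same_cube k x z &
    forall y l j, same_cube k x y -> (k <= j)%N -> ~~ near_cube j x l ->
    `|a y l - b l| <= C * (2 ^+ k) `^ e * (2 ^+ j) `^ (e - 2) *
      ((1 + (distn y.1 l.1)%:R) `^ (- (2 * e)) + (1 + (distn y.2 l.2)%:R) `^ (- (2 * e)) +
      ((1 + (distn z.1 l.1)%:R) `^ (- (2 * e)) + (1 + (distn z.2 l.2)%:R) `^ (- (2 * e))))) ->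
  regular_mx N same_cube near_cube s H a.
Proof.
move=> e0 s1 es C0.
have s0 : 0 < s by lra. have s10 : 0 < s - 1 by lra. have sn : s != 0 by rewrite gt_eqF.
(* The exponent of a singular factor raised to the power s'. *)
pose a0 := 2 * e * (s / (s - 1)).
have a00 : 0 < a0 by rewrite !mulr_gt0 ?invr_gt0.
pose D := 3 * (2 * ((1 - a0)^-1 * 2 `^ (1 - a0))).
have D0 : 0 <= D.
  rewrite mulr_ge0 // mulr_ge0 // mulr_ge0 ?powR_ge0 // invr_ge0.
  by rewrite subr_ge0 ltW.
pose E := D `^ ((s - 1) / s) * 2 `^ (2 - 2 * e).
have E0 : 0 <= E by rewrite mulr_ge0 ?powR_ge0.
have DE : 3 * (2 * ((1 - a0)^-1 * 2 `^ (1 - a0))) = D by [].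
have EE : E = D `^ ((s - 1) / s) * 2 `^ (2 - 2 * e) by [].
clearbody D E.
pose r := (2 `^ e)^-1 : R.
have r0 : 0 < r by rewrite invr_gt0 powR_gt0.
have r1 : r < 1.
  rewrite invf_lt1 ?powR_gt0 // /powR pnatr_eq0 /= expR_gt1.
  by rewrite mulr_gt0 // ln_gt0 // ltr1n.
exists (C * 4 * E * (1 - r)^-1).
  by rewrite mulr_ge0 ?invr_ge0 ?subr_ge0 ?(ltW r1) // mulr_ge0 // mulr_ge0.
move=> N a Ha k x kN; have [b [z xz Hb]] := Ha k x kN; exists b => f m m0 fm y xy.
have G := @grid_dyadic N.
(* Hoelder on one annulus, for one of the four singular factors *)
have holder (j : nat) (pr : 'I_(2 ^ N) * 'I_(2 ^ N) -> 'I_(2 ^ N))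
    (qr : 'I_(2 ^ N) * 'I_(2 ^ N) -> 'I_(2 ^ N)) w :
    (k <= j <= N)%N -> same_cube k x w ->
    (pr = fst /\ qr = snd \/ pr = snd /\ qr = fst) ->
    \sum_(l | near_cube j x l) `|f l| * (1 + (distn (pr w) (pr l))%:R) `^ (- (2 * e)) <=
    D `^ ((s - 1) / s) * (2 ^+ j) `^ (2 - 2 * e) * m.
  move=> kjN xw pq; have /andP[kj jN] := kjN.
  pose V (l : 'I_(2 ^ N) * 'I_(2 ^ N)) : R := (1 + (distn (pr w) (pr l))%:R) `^ (- a0).
  pose W (l : 'I_(2 ^ N) * 'I_(2 ^ N)) : R := (1 + (distn (pr w) (pr l))%:R) `^ (2 * e * s).
  have d0 l : 0 < 1 + (distn (pr w) (pr l))%:R :> R by rewrite ltr_pwDl.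
  have V0 l : 0 < V l by apply: powR_gt0.
  have WV l : W l * V l `^ (s - 1) = 1.
    rewrite /W /V -powRrM -powRD ?(gt_eqF (d0 _)) ?implybT //.
    have -> : 2 * e * s + - a0 * (s - 1) = 0 by rewrite /a0; field; lra.
    by rewrite powRr0.
  have := @holder_weight R _ (near_cube j x)
    (fun l => `|f l| * (1 + (distn (pr w) (pr l))%:R) `^ (- (2 * e))) V W 1 s s1 ler01.
  move=> /(_ _ V0 WV)/Wrap[l|]; first by rewrite mulr_ge0 ?powR_ge0.
  rewrite !mul1r => -[h].
  set L := \sum_(l | _) _ in h *.
  have L0 : 0 <= L by apply: sumr_ge0 => l _; rewrite mulr_ge0 ?powR_ge0.
  have P0 : 0 < 2 ^+ j :> R by rewrite exprn_gt0.
  have fE : \sum_(l | near_cube j x l)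
      (`|f l| * (1 + (distn (pr w) (pr l))%:R) `^ (- (2 * e))) `^ s * W l <= (2 ^+ j) `^ 2 * m `^ s.
    have -> : (2 ^+ j) `^ 2 = 4 ^+ j :> R.
      by rewrite powR_mulrn ?ltW // -exprM mulnC exprM; congr (_ ^+ _); rewrite expr2; ring.
    rewrite -ler_pdivrMl ?exprn_gt0 //; apply: le_trans (fm j kjN).
    rewrite /avn le_eqVlt; apply/orP; left; apply/eqP; congr (_ * _).
    apply: eq_bigr => l _; rewrite powRM ?powR_ge0 // -mulrA -powRrM /W.
    rewrite -powRD ?(gt_eqF (d0 _)) ?implybT //.
    have -> : - (2 * e) * s + 2 * e * s = 0 by ring.
    by rewrite powRr0 mulr1.
  have VE : \sum_(l | near_cube j x l) V l <= D * (2 ^+ j) `^ (2 - a0).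
    pose g i : R := (1 + i%:R) `^ (- a0).
    have g0 i : 0 <= g i by apply: powR_ge0.
    have near_pr l : near_cube j x l ->
        (distn (pr w) (pr l) < 2 * 2 ^ j)%N && adjn (qr x %/ 2 ^ j) (qr l %/ 2 ^ j).
      move=> xl; have xw' : same_cube j x w by apply: (dy_leq G kj).
      move: xl xw'; rewrite /near_cube /same_cube /adjn /distn => /andP[h1 h2] /andP[/eqP e1 /eqP e2].
      have [[-> ->]|[-> ->]] := pq; rewrite ?h1 ?h2 andbT; apply: near_dist; rewrite ?expn_gt0 //.
        by rewrite /adjn -e1.
      by rewrite /adjn -e2.
    apply: le_trans (_ : \sum_(l : 'I_(2 ^ N) * 'I_(2 ^ N) |
        (distn (pr w) (pr l) < 2 * 2 ^ j)%N && adjn (qr x %/ 2 ^ j) (qr l %/ 2 ^ j))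
        g (distn (pr w) (pr l)) <= _).
      rewrite [leLHS]big_mkcond [leRHS]big_mkcond; apply: ler_sum => l _.
      case: ifP => [/near_pr -> //|_]; case: ifP => _ //; exact: g0.
    have -> : \sum_(l : 'I_(2 ^ N) * 'I_(2 ^ N) |
        (distn (pr w) (pr l) < 2 * 2 ^ j)%N && adjn (qr x %/ 2 ^ j) (qr l %/ 2 ^ j))
        g (distn (pr w) (pr l)) =
      \sum_(u < 2 ^ N | (distn (pr w) u < 2 * 2 ^ j)%N)
        \sum_(v < 2 ^ N | adjn (qr x %/ 2 ^ j) (v %/ 2 ^ j)) g (distn (pr w) u).
      have [[-> ->]|[-> ->]] := pq.
        by rewrite pair_big.
      by rewrite exchange_big pair_big /=; apply: eq_bigl => l; rewrite andbC.
    under eq_bigr do rewrite sumr_const -mulr_natr.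
    rewrite -mulr_suml mulrC.
    set c := #|_|; have cE : (c <= 3 * 2 ^ j)%N.
      have [d dE] : exists d, (2 ^ j = d.+1)%N.
        by exists (2 ^ j).-1; rewrite prednK // expn_gt0.
      by rewrite /c dE; exact: card_adj.
    have a01 : 0 <= a0 < 1 by rewrite (ltW a00).
    apply: le_trans (_ : (3 * 2 ^+ j) * (2 * ((1 - a0)^-1 * (2 * 2 ^+ j) `^ (1 - a0))) <= _).
      apply: ler_pM => //; first by apply: sumr_ge0.
        by rewrite -(natrX _ 2) -natrM ler_nat.
      apply: le_trans (sum_dist _ _ _ g0) _; rewrite ler_wpM2l //.
      by apply: le_trans (sum_power _ a01) _; rewrite natrM natrX.
    rewrite powRM ?(ltW P0) //.
    have -> : 2 - a0 = 1 + (1 - a0) by ring.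
    rewrite (@powR1D _ (2 ^+ j) (1 - a0)) // -DE.
    by rewrite le_eqVlt; apply/orP; left; apply/eqP; ring.
  apply: ler_powR2_inv s0 L0 _ _.
    by rewrite !mulr_ge0 ?powR_ge0.
  apply: le_trans h _; apply: le_trans (_ : ((2 ^+ j) `^ 2 * m `^ s) *
      (D * (2 ^+ j) `^ (2 - a0)) `^ (s - 1) <= _).
    apply: ler_pM => //; [|exact: powR_ge0|].
      by apply: sumr_ge0 => l _; rewrite mulr_ge0 ?powR_ge0.
    by apply: ler_powR2 => //; [exact: ltW|apply: sumr_ge0 => l _; exact: ltW].
  rewrite !powRM ?mulr_ge0 ?powR_ge0 // -!powRrM.
  have -> : (s - 1) / s * s = s - 1 by field.
  have -> : (2 ^+ j) `^ ((2 - 2 * e) * s) = (2 ^+ j) `^ 2 * (2 ^+ j) `^ ((2 - a0) * (s - 1)) :> R.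
    rewrite -powRD ?(gt_eqF P0) ?implybT //; congr (_ `^ _); rewrite /a0; field; lra.
  by rewrite le_eqVlt; apply/orP; left; apply/eqP; ring.
pose F l := `|a y l - b l| * `|f l|.
have F0 l : 0 <= F l by rewrite mulr_ge0.
have annulus j : (k <= j < N)%N ->
    \sum_(l | near_cube j.+1 x l && ~~ near_cube j x l) F l <= C * 4 * E * r ^+ (j - k) * m.
  move=> /andP[kj jN].
  have kjN : (k <= j.+1 <= N)%N by rewrite (leqW kj).
  pose t (pr : 'I_(2 ^ N) * 'I_(2 ^ N) -> 'I_(2 ^ N)) w (l : 'I_(2 ^ N) * 'I_(2 ^ N)) : R :=
    (1 + (distn (pr w) (pr l))%:R) `^ (- (2 * e)).
  apply: le_trans (_ : C * (2 ^+ k) `^ e * (2 ^+ j) `^ (e - 2) *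
     \sum_(l | near_cube j.+1 x l) (`|f l| * t fst y l + `|f l| * t snd y l +
        (`|f l| * t fst z l + `|f l| * t snd z l)) <= _).
    rewrite mulr_sumr big_mkcond [leRHS]big_mkcond; apply: ler_sum => l _.
    case: (near_cube j.+1 x l) => //=; case: ifP => [jl|_]; last first.
      by rewrite !mulr_ge0 ?powR_ge0 // !addr_ge0 // mulr_ge0 ?powR_ge0.
    rewrite /F; apply: le_trans (ler_wpM2r (normr_ge0 (f l)) (Hb y l j xy kj jl)) _.
    by rewrite /t le_eqVlt; apply/orP; left; apply/eqP; ring.
  rewrite !big_split /=.
  have h1 := holder j.+1 fst snd y kjN xy (or_introl (conj erefl erefl)).
  have h2 := holder j.+1 snd fst y kjN xy (or_intror (conj erefl erefl)).
  have h3 := holder j.+1 fst snd z kjN xz (or_introl (conj erefl erefl)).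
  have h4 := holder j.+1 snd fst z kjN xz (or_intror (conj erefl erefl)).
  set Q := D `^ _ * _ * m in h1 h2 h3 h4.
  apply: le_trans (_ : C * (2 ^+ k) `^ e * (2 ^+ j) `^ (e - 2) * (Q + Q + (Q + Q)) <= _).
    by rewrite ler_wpM2l ?mulr_ge0 ?powR_ge0 // lerD ?lerD.
  rewrite /Q exprS powRM ?exprn_ge0 //.
  have P0 : 0 < 2 ^+ j :> R by rewrite exprn_gt0.
  have -> : r ^+ (j - k) = (2 ^+ k) `^ e * ((2 ^+ j) `^ (e - 2) * (2 ^+ j) `^ (2 - 2 * e)).
    rewrite -powRD ?(gt_eqF P0) ?implybT //.
    have -> : e - 2 + (2 - 2 * e) = - e by ring.
    have e1 : (2 `^ e) ^+ j = (2 `^ e) ^+ k * (2 `^ e) ^+ (j - k) :> R by rewrite -exprD subnKC.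
    by rewrite powRN !powR_Xn // e1 /r exprVn invfM mulVKf // expf_neq0 // gt_eqF // powR_gt0.
  rewrite EE; move: ((2 ^+ k) `^ e) ((2 ^+ j) `^ (e - 2)) ((2 ^+ j) `^ (2 - 2 * e)).
  move: (D `^ _) (2 `^ _) => u1 u2 u3 u4 u5.
  by rewrite le_eqVlt; apply/orP; left; apply/eqP; ring.
(* The far cells are split into annuli downward from level [N], where every cell is near. *)
have tail n : (k + n <= N)%N -> \sum_(l | ~~ near_cube (N - n) x l) F l <=
    \sum_(N - n <= j < N) \sum_(l | near_cube j.+1 x l && ~~ near_cube j x l) F l.
  elim: n => [|n IH] kn.
    by rewrite subn0 big_geq // big1 // => l; rewrite (dy_nb G (dyN G x l)).
  have nN : (N - n.+1 < N)%N by clear -kn; lia.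
  rewrite big_ltn // (bigID (near_cube (N - n.+1).+1 x)) /=; apply: lerD.
    by rewrite le_eqVlt; apply/orP; left; apply/eqP; apply: eq_bigl => l; rewrite andbC.
  have E' : ((N - n.+1).+1 = N - n)%N by clear -kn; lia.
  rewrite E'; apply: le_trans (IH _); last by clear -kn; lia.
  rewrite le_eqVlt; apply/orP; left; apply/eqP; apply: eq_bigl => l.
  by apply/andP/idP => [[]//|h]; split => //; apply: contra h => h; rewrite -E'; exact: (nbS G).
have := tail (N - k)%N; rewrite subKn // subnKC // leqnn => /(_ isT) h.
apply: le_trans h _.
apply: le_trans (_ : \sum_(k <= j < N) C * 4 * E * r ^+ (j - k) * m <= _).
  by rewrite big_nat [leRHS]big_nat; apply: ler_sum => j; exact: annulus.
under eq_bigr do rewrite mulrAC.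
rewrite -mulr_sumr mulrAC -!mulrA.
rewrite ler_wpM2l // ler_wpM2l // ler_wpM2l // ler_wpM2r //.
have -> : \sum_(k <= j < N) r ^+ (j - k) = \sum_(i < N - k) r ^+ i.
  rewrite -{1}(add0n k) big_addn big_mkord; apply: eq_bigr => i _; by rewrite addnK.
have r10 : 0 < 1 - r by lra.
rewrite -(ler_pM2l r10) divff ?gt_eqF //.
have := subrX1 r (N - k); have : 0 <= r ^+ (N - k) by rewrite exprn_ge0 // ltW.
set q := \sum_(i < _) _; lra.
Qed.

End GridRegularity.

(** The square of side 2^(M+1) centred at the origin is cut into cells of side 2^-M, which makes
    2^(2M+1) cells in each coordinate. *)
Notation cells M := ('I_(2 ^ M.*2.+1) * 'I_(2 ^ M.*2.+1))%type.

(** * Cells of the plane and density of step functions *)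

Section Plane.
Context {R : realType}.
Local Notation mu := (@lebesgue2 R).
Implicit Types (u v w : plane R -> R) (z : plane R).

Lemma measurable_square (a : plane R) (l : R) : measurable (square a l).
Proof. by apply: measurableX; exact: measurable_itv. Qed.

Lemma lebesgue2_rect (a b c d : R) (ba bb bc bd : bool) : a <= b -> c <= d ->
  mu ([set` Interval (BSide ba a) (BSide bb b)] `*` [set` Interval (BSide bc c) (BSide bd d)]) =
  ((b - a) * (d - c))%:E.
Proof.
move=> ab cd; rewrite /lebesgue2 product_measure1E; [|exact: measurable_itv..].
have E (bs bt : bool) (s t : R) : s <= t ->
    @lebesgue_measure R [set` Interval (BSide bs s) (BSide bt t)] = (t - s)%:E.
  move=> st; rewrite lebesgue_measure_itv /= lte_fin; case: ltP => // ts.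
  by rewrite (le_anti (introT andP (conj st ts))) subrr.
transitivity (@lebesgue_measure R [set` Interval (BSide ba a) (BSide bb b)] *
  @lebesgue_measure R [set` Interval (BSide bc c) (BSide bd d)])%E; first by [].
by rewrite (E ba bb) // (E bc bd) // EFinM.
Qed.

Lemma lebesgue2_square (a : plane R) (l : R) : 0 <= l -> mu (square a l) = (l ^+ 2)%:E.
Proof.
by move=> l0; rewrite /square lebesgue2_rect ?lerDl // expr2 !(addrC _ l) !addrK.
Qed.

Lemma integral_indicM d (T : measurableType d) (nu : {measure set T -> \bar R}) (A : set T) (w : T -> R) :
  (\int[nu]_z (\1_A z * w z)%:E = \int[nu]_(z in A) (w z)%:E)%E.
Proof.
rewrite [RHS]integral_mkcond; apply: eq_integral => z _.
by rewrite patchE indicE; case: (z \in A); rewrite ?mul1r ?mul0r.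
Qed.

Definition mesh (M : nat) : R := 2 ^- M.
Definition corner M (x : cells M) : plane R :=
  (x.1%:R * mesh M - 2 ^+ M, x.2%:R * mesh M - 2 ^+ M).
Definition cell M (x : cells M) : set (plane R) := square (corner x) (mesh M).

Lemma mesh_gt0 M : 0 < mesh M. Proof. by rewrite invr_gt0 exprn_gt0. Qed.
Lemma mesh_le1 M : mesh M <= 1.
Proof. by rewrite invf_le1 ?exprn_gt0 // exprn_ege1 // ler1n. Qed.

Lemma mesh_small (e : R) : 0 < e -> exists M0, forall M, (M0 <= M)%N -> mesh M <= e.
Proof.
move=> e0; exists (Num.truncn e^-1).+1 => M hM.
rewrite /mesh invf_ple ?posrE ?exprn_gt0 //.
have := truncnS_gt e^-1; move/ltW => h; apply: le_trans h _.
by rewrite -natrX ler_nat (leq_trans hM) // ltnW // ltn_expl.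
Qed.

Lemma pow_large (r : R) : exists M0, forall M, (M0 <= M)%N -> r <= 2 ^+ M.
Proof.
exists (Num.truncn r).+1 => M hM; have := truncnS_gt r; move/ltW => h; apply: le_trans h _.
by rewrite -natrX ler_nat (leq_trans hM) // ltnW // ltn_expl.
Qed.

Lemma measurable_cell M (x : cells M) : measurable (cell x).
Proof. exact: measurable_square. Qed.

Lemma lebesgue2_cell M (x : cells M) : mu (cell x) = (mesh M ^+ 2)%:E.
Proof. by rewrite lebesgue2_square // ltW // mesh_gt0. Qed.

Lemma in_coord (M i : nat) (t : R) :
  (t \in `[i%:R * mesh M - 2 ^+ M, i%:R * mesh M - 2 ^+ M + mesh M[) =
  (i%:R <= (t + 2 ^+ M) * 2 ^+ M < i%:R + 1).
Proof.
have h0 := mesh_gt0 M; have P0 : 0 < 2 ^+ M :> R by rewrite exprn_gt0.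
rewrite in_itv /= lerBlDr; congr (_ && _).
  by rewrite -[mesh M]/(2 ^+ M)^-1 ler_pdivrMr.
rewrite addrAC ltrBrDr -{2}[mesh M]mul1r -mulrDl.
by rewrite -[mesh M]/(2 ^+ M)^-1 ltr_pdivlMr.
Qed.

Lemma cellE M (x : cells M) z : cell x z <->
  (x.1%:R <= (z.1 + 2 ^+ M) * 2 ^+ M < x.1%:R + 1) /\
  (x.2%:R <= (z.2 + 2 ^+ M) * 2 ^+ M < x.2%:R + 1).
Proof.
rewrite /cell /square /=; split => [[]|[]].
  by rewrite !in_coord.
by move=> h1 h2; split; rewrite /= in_coord.
Qed.

Lemma cell_inj M (x y : cells M) z : cell x z -> cell y z -> x = y.
Proof.
have key0 (i j : nat) (s : R) : i%:R <= s -> s < j%:R + 1 -> (i <= j)%N.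
  by move=> a b; rewrite -ltnS -(ltr_nat R) -natr1 (le_lt_trans a b).
have key (i j : nat) (s : R) : i%:R <= s < i%:R + 1 -> j%:R <= s < j%:R + 1 -> i = j.
  move=> /andP[a b] /andP[c d]; apply/eqP; rewrite eqn_leq.
  by rewrite (key0 _ _ _ a d) (key0 _ _ _ c b).
move=> /cellE[a b] /cellE[c d]; rewrite [x]surjective_pairing [y]surjective_pairing.
by congr pair; apply: val_inj; [exact: key a c|exact: key b d].
Qed.

Lemma cell_exists M z : - 2 ^+ M <= z.1 < 2 ^+ M -> - 2 ^+ M <= z.2 < 2 ^+ M ->
  exists x : cells M, cell x z.
Proof.
have key (t : R) : - 2 ^+ M <= t < 2 ^+ M ->
    exists i : 'I_(2 ^ M.*2.+1), i%:R <= (t + 2 ^+ M) * 2 ^+ M < i%:R + 1.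
  move=> /andP[a b]; set s := (t + _) * _.
  have P0 : 0 < 2 ^+ M :> R by rewrite exprn_gt0.
  have s0 : 0 <= s by rewrite mulr_ge0 ?(ltW P0) // -lerBlDr sub0r.
  have sl : s < (2 ^ M.*2.+1)%:R.
    rewrite natrX exprS -addnn exprD mulrA ltr_pM2r //; lra.
  have ti := truncn_itv s0.
  have lt : (Num.truncn s < 2 ^ M.*2.+1)%N.
    by rewrite -(ltr_nat R); case/andP: ti => h _; exact: le_lt_trans sl.
  by exists (Ordinal lt); move: ti; rewrite /= natr1.
move=> /key[i hi] /key[j hj]; exists (i, j); exact/cellE.
Qed.

Lemma cell_close M (x : cells M) z z' : cell x z -> cell x z' ->
  `|z.1 - z'.1| <= mesh M /\ `|z.2 - z'.2| <= mesh M.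
Proof.
rewrite /cell /square /= !in_itv /= => -[/andP[a b] /andP[c d]] [/andP[a' b'] /andP[c' d']].
by rewrite !ler_norml; lra.
Qed.

Definition step M (c : cells M -> R) z : R := \sum_x c x * \1_(cell x) z.

Lemma step_in M (c : cells M -> R) x z : cell x z -> step c z = c x.
Proof.
move=> xz; rewrite /step (bigD1 x) //= indicE mem_set // mulr1 big1 ?addr0 // => y yx.
rewrite indicE memNset ?mulr0 // => yz.
by move/eqP: yx; apply; exact: cell_inj xz.
Qed.

Lemma step_out M (c : cells M -> R) z : (forall x : cells M, ~ cell x z) -> step c z = 0.
Proof. by move=> xz; rewrite /step big1 // => y _; rewrite indicE memNset ?mulr0. Qed.

Lemma stepP M (c : cells M -> R) z :
  (exists2 x, cell x z & step c z = c x) \/ ((forall x : cells M, ~ cell x z) /\ step c z = 0).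
Proof.
have [[x xz]|h] := pselect (exists x : cells M, cell x z).
  by left; exists x => //; exact: step_in.
have h' (x : cells M) : ~ cell x z by move=> xz; apply: h; exists x.
by right; split => //; exact: step_out.
Qed.

Lemma measurable_step M (c : cells M -> R) : measurable_fun [set: plane R] (step c).
Proof.
apply: measurable_sum => x; apply: measurable_funM => //.
by apply: measurable_indic; exact: measurable_cell.
Qed.

(** The condition phi 0 = 0 discards the region outside the grid, where a step function is 0. *)
Lemma integral_step M (c : cells M -> R) (phi : R -> R) w : phi 0 = 0 -> (forall t, 0 <= phi t) ->
  measurable_fun [set: plane R] w -> (forall z, 0 <= w z) ->
  (\int[mu]_z (phi (step c z) * w z)%:E =
   \sum_x (phi (c x))%:E * \int[mu]_(z in cell x) (w z)%:E)%E.
Proof.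
move=> phi0 phiP mw w0.
have mi (x : cells M) : measurable_fun [set: plane R] (fun z => (\1_(cell x) z * w z)%:E).
  apply/measurable_EFinP; apply: measurable_funM => //.
  by apply: measurable_indic; exact: measurable_cell.
transitivity (\int[mu]_z (\sum_x (phi (c x))%:E * (\1_(cell x) z * w z)%:E))%E.
  apply: eq_integral => z _; have [[x xz ->]|[xz ->]] := stepP c z.
    rewrite (bigD1 x) //= indicE mem_set // mul1r big1 ?adde0 // => y yx.
    rewrite indicE memNset ?mul0r ?mule0 // => yz.
    by move/eqP: yx; apply; exact: cell_inj xz.
  by rewrite phi0 mul0r big1 // => y _; rewrite indicE memNset ?mul0r ?mule0.
rewrite ge0_integral_sum //; last 2 first.
- by move=> x; apply: measurable_funeM.
- by move=> x z _; rewrite mule_ge0 ?lee_fin // mulr_ge0.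
apply: eq_bigr => x _; rewrite ge0_integralZl ?lee_fin //; last first.
  by move=> z _; rewrite lee_fin mulr_ge0.
by rewrite integral_indicM.
Qed.

Definition sqi u : \bar R := (\int[mu]_z (u z ^+ 2)%:E)%E.
Definition L2 u : Prop := measurable_fun [set: plane R] u /\ (sqi u < +oo)%E.

Lemma measurable_sqr u : measurable_fun [set: plane R] u ->
  measurable_fun [set: plane R] (fun z => (u z ^+ 2)%:E).
Proof. by move=> mf; apply/measurable_EFinP; exact: measurable_funX. Qed.

Lemma sqi_ge0 u : (0 <= sqi u)%E.
Proof. by apply: integral_ge0 => z _; rewrite lee_fin sqr_ge0. Qed.

Lemma le_sqi u v : measurable_fun [set: plane R] u -> measurable_fun [set: plane R] v ->
  (forall z, `|u z| <= `|v z|) -> (sqi u <= sqi v)%E.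
Proof.
move=> mf mv uv; apply: ge0_le_integral => //; rewrite ?measurableT //.
- by move=> z _; rewrite lee_fin sqr_ge0.
- exact: measurable_sqr.
- exact: measurable_sqr.
- move=> z _; rewrite lee_fin -[u z ^+ 2]real_normK ?num_real //.
  by rewrite -[v z ^+ 2]real_normK ?num_real // lerXn2r ?nnegrE.
Qed.

Lemma sqiZ (a : R) u : measurable_fun [set: plane R] u ->
  sqi (fun z => a * u z) = ((a ^+ 2)%:E * sqi u)%E.
Proof.
move=> mf; rewrite /sqi -ge0_integralZl ?lee_fin ?sqr_ge0 //.
- by apply: eq_integral => z _; rewrite exprMn EFinM.
- exact: measurable_sqr.
- by move=> z _; rewrite lee_fin sqr_ge0.
Qed.

Lemma sqiD u v : measurable_fun [set: plane R] u -> measurable_fun [set: plane R] v ->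
  (sqi (fun z => u z + v z)%R <= 2%:E * sqi u + 2%:E * sqi v)%E.
Proof.
move=> mf mv; have Z f : measurable_fun [set: plane R] f ->
    (2%:E * sqi f = \int[mu]_z (2%:E * (f z ^+ 2)%:E))%E.
  move=> mh; rewrite ge0_integralZl ?lee_fin //; first exact: measurable_sqr.
  by move=> z _; rewrite lee_fin sqr_ge0.
rewrite !Z // /sqi.
rewrite -ge0_integralD //; last 4 first.
- by move=> z _; rewrite mule_ge0 ?lee_fin ?sqr_ge0.
- by apply: measurable_funeM; exact: measurable_sqr.
- by move=> z _; rewrite mule_ge0 ?lee_fin ?sqr_ge0.
- by apply: measurable_funeM; exact: measurable_sqr.
apply: ge0_le_integral => //.
- by move=> z _; rewrite lee_fin sqr_ge0.
- by apply: measurable_sqr; exact: measurable_funD.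
- apply: emeasurable_funD; apply: measurable_funeM; exact: measurable_sqr.
- move=> z _; rewrite -!EFinM -EFinD lee_fin.
  by have := sqr_ge0 (u z - v z); rewrite !expr2; lra.
Qed.

Lemma L2D u v : L2 u -> L2 v -> L2 (fun z => u z + v z).
Proof.
move=> [mf fu] [mv fv]; split; first exact: measurable_funD.
by apply: le_lt_trans (sqiD mf mv) _; rewrite lte_add_pinfty // lte_mul_pinfty ?lee_fin.
Qed.

Lemma L2Z (a : R) u : L2 u -> L2 (fun z => a * u z).
Proof.
move=> [mf fu]; split; first exact: measurable_funM.
by rewrite sqiZ // lte_mul_pinfty ?lee_fin ?sqr_ge0.
Qed.

Lemma L2B u v : L2 u -> L2 v -> L2 (fun z => u z - v z).
Proof.
move=> Lu Lv; have := L2D Lu (L2Z (-1) Lv).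
by under eq_fun do rewrite mulN1r.
Qed.

Lemma L2_integrable u A : L2 u -> measurable A -> (mu A < +oo)%E -> mu.-integrable A (EFin \o u).
Proof.
move=> [mf fu] mA Aoo; apply/integrableP; split.
  by apply/measurable_EFinP; exact: measurable_funTS.
apply: le_lt_trans (_ : \int[mu]_(z in A) (1 + (u z ^+ 2)%:E) < +oo)%E.
  apply: ge0_le_integral => //.
  - by apply/measurable_EFinP/measurableT_comp => //; exact: measurable_funTS.
  - apply: emeasurable_funD => //; apply: measurable_funTS; exact: measurable_sqr.
  - move=> z _; rewrite /= -EFinD lee_fin.
    have := sqr_ge0 (`|u z| - 1); rewrite -[u z ^+ 2]real_normK ?num_real // !expr2.
    by have := normr_ge0 (u z); nra.
rewrite ge0_integralD //; last 2 first.
- by move=> z _; rewrite lee_fin sqr_ge0.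
- by apply: measurable_funTS; exact: measurable_sqr.
rewrite integral_cst // mul1e lte_add_pinfty //.
apply: le_lt_trans fu; apply: ge0_subset_integral => //; first exact: measurable_sqr.
by move=> z _; rewrite lee_fin sqr_ge0.
Qed.

Definition rav M u (x : cells M) : R := mesh M ^- 2 * (\int[mu]_(z in cell x) u z)%R.
(** Conditional expectation on the cells, extended by 0 outside the grid. *)
Definition EM M u : plane R -> R := step (rav (M := M) u).

Lemma L2_integrable_cell M u (x : cells M) : L2 u -> mu.-integrable (cell x) (EFin \o u).
Proof.
by move=> Lu; apply: L2_integrable => //; [exact: measurable_cell|rewrite lebesgue2_cell ltry].
Qed.

Lemma Rintegral_cell_rav M u (x : cells M) :
  (\int[mu]_(z in cell x) u z)%R = mesh M ^+ 2 * rav u x.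
Proof. by rewrite /rav mulrA divff ?mul1r // expf_neq0 // gt_eqF // mesh_gt0. Qed.

Lemma ravD M u v (x : cells M) : L2 u -> L2 v ->
  rav (fun z => u z + v z) x = rav u x + rav v x.
Proof.
move=> Lu Lv; rewrite /rav RintegralD ?mulrDr //; [exact: measurable_cell|..];
exact: L2_integrable_cell.
Qed.

Lemma ravZ M (a : R) u (x : cells M) : L2 u -> rav (fun z => a * u z) x = a * rav u x.
Proof.
move=> Lu; rewrite /rav RintegralZl; [by rewrite mulrCA|exact: measurable_cell|].
exact: L2_integrable_cell.
Qed.

Lemma integral_cst_cell M (x : cells M) (a : \bar R) :
  (\int[mu]_(z in cell x) cst a z = a * (mesh M ^+ 2)%:E)%E.
Proof.
rewrite integral_cst; last exact: measurable_cell.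
exact: (congr1 (fun m => a * m)%E (lebesgue2_cell x)).
Qed.

Lemma Rintegral_cst_cell M (x : cells M) (a : R) :
  (\int[mu]_(z in cell x) cst a z)%R = a * mesh M ^+ 2.
Proof.
rewrite Rintegral_cst; last exact: measurable_cell.
exact: (congr1 (fun m => a * fine m) (lebesgue2_cell x)).
Qed.

Lemma rav_const M (a : R) u (x : cells M) : (forall z, cell x z -> u z = a) -> rav u x = a.
Proof.
move=> ua; rewrite /rav (_ : (\int[mu]_(z in cell x) u z)%R = (\int[mu]_(z in cell x) (cst a z))%R).
  by rewrite Rintegral_cst_cell mulrCA mulVf ?mulr1 // expf_neq0 // gt_eqF // mesh_gt0.
by apply: eq_Rintegral => z; rewrite inE => /ua.
Qed.

Lemma le_rav M u v (x : cells M) : mu.-integrable (cell x) (EFin \o u) ->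
  mu.-integrable (cell x) (EFin \o v) -> (forall z, cell x z -> u z <= v z) -> rav u x <= rav v x.
Proof.
move=> iu iv uv; rewrite ler_wpM2l ?invr_ge0 ?sqr_ge0 //.
by apply: le_Rintegral => //; exact: measurable_cell.
Qed.

Lemma integrable_cst_cell M (x : cells M) (a : R) : mu.-integrable (cell x) (EFin \o cst a).
Proof.
have mc : measurable (cell x) by exact: measurable_cell.
apply/integrableP; split; first by apply/measurable_EFinP.
by rewrite (_ : \int[_]_(_ in _) _ = \int[mu]_(z in cell x) cst `|a|%:E z)%E // integral_cst_cell -EFinM ltry.
Qed.

Lemma integrable_sqr_cell M (x : cells M) u : L2 u ->
  mu.-integrable (cell x) (EFin \o (fun z => u z ^+ 2)).
Proof.
move=> [mf fu]; apply: (integrableS measurableT); [exact: measurable_cell|by []|].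
apply/integrableP; split; first exact: measurable_sqr.
by under eq_integral do rewrite gee0_abs ?lee_fin ?sqr_ge0 //.
Qed.

(** Jensen's inequality, by averaging 2 r u - r^2 <= u^2. *)
Lemma rav_sqr M u (x : cells M) : L2 u -> rav u x ^+ 2 <= rav (fun z => u z ^+ 2) x.
Proof.
move=> Lu; set r := rav u x; have mc := measurable_cell x.
have iu := L2_integrable_cell x Lu.
have -> : r ^+ 2 = rav (fun z => 2 * r * u z + cst (- r ^+ 2) z) x.
  have i2 : mu.-integrable (cell x) (EFin \o (fun z => 2 * r * u z)).
    by apply: (integrableZl mc (2 * r) iu).
  rewrite /rav RintegralD //; last exact: integrable_cst_cell.
  rewrite RintegralZl // Rintegral_cell_rav -/r Rintegral_cst_cell.
  field; exact/lt0r_neq0/mesh_gt0.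
apply: le_rav; [| exact: integrable_sqr_cell|].
  have := integrableD mc (integrableZl mc (2 * r) iu) (integrable_cst_cell x (- r ^+ 2)).
  by apply: eq_integrable.
by move=> z _; have := sqr_ge0 (u z - r); rewrite /cst !expr2; lra.
Qed.

Lemma sqi_step M (c : cells M -> R) : sqi (step c) = (mesh M ^+ 2 * \sum_x c x ^+ 2)%:E.
Proof.
have p0 : (0 : R) ^+ 2 = 0 by rewrite expr0n.
have E := @integral_step M c (fun t : R => t ^+ 2) (cst 1) p0 (@sqr_ge0 R)
  (measurable_cst (1 : R)) (fun=> ler01).
rewrite /sqi; transitivity (\int[mu]_z (step c z ^+ 2 * cst 1 z)%:E)%E.
  by apply: eq_integral => z _; rewrite /cst mulr1.
rewrite E mulr_sumr -sumEFin; apply: eq_bigr => x _.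
rewrite (_ : \int[mu]_(z in cell x) _ = \int[mu]_(z in cell x) cst 1%:E z)%E //.
by rewrite integral_cst_cell mul1e -EFinM mulrC.
Qed.

Lemma step_L2 M (c : cells M -> R) : L2 (step c).
Proof. by split; [exact: measurable_step|rewrite sqi_step ltry]. Qed.

Lemma sum_integral_cell M w : measurable_fun [set: plane R] w -> (forall z, 0 <= w z) ->
  (\sum_(x : cells M) \int[mu]_(z in cell x) (w z)%:E <= \int[mu]_z (w z)%:E)%E.
Proof.
move=> mw w0; have := @integral_step M (fun=> 1) (fun t => t ^+ 2) w _ (@sqr_ge0 _) mw w0.
move=> /(_ _)/Wrap[|[E]]; first by rewrite expr0n.
have -> : (\sum_(x : cells M) \int[mu]_(z in cell x) (w z)%:E =
    \int[mu]_z (step (fun _ : cells M => 1) z ^+ 2 * w z)%:E)%E.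
  by rewrite E; apply: eq_bigr => x _; rewrite expr1n mul1e.
apply: ge0_le_integral => //.
- by move=> z _; rewrite lee_fin mulr_ge0 ?sqr_ge0.
- apply/measurable_EFinP; apply: measurable_funM => //.
  by apply: measurable_funX; exact: measurable_step.
- exact/measurable_EFinP.
- move=> z _; rewrite lee_fin ler_piMl //.
  by have [[x _ ->]|[_ ->]] := stepP (fun _ : cells M => 1) z; rewrite ?expr1n ?expr0n.
Qed.

Lemma sqi_EM M u : L2 u -> (sqi (EM M u) <= sqi u)%E.
Proof.
move=> Lu; have [mf _] := Lu; rewrite sqi_step.
apply: le_trans (sum_integral_cell M (measurable_funX 2 mf) (fun z => sqr_ge0 (u z))).
rewrite mulr_sumr -sumEFin; apply: lee_sum => x _.
have fi : (\int[mu]_(z in cell x) (u z ^+ 2)%:E)%E \is a fin_num.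
  by apply: integrable_fin_num; [exact: measurable_cell|exact: integrable_sqr_cell].
rewrite -(fineK fi) lee_fin -[leRHS]/(\int[mu]_(z in cell x) (u z ^+ 2))%R.
by rewrite Rintegral_cell_rav ler_wpM2l ?sqr_ge0 // rav_sqr.
Qed.

End Plane.

Section Density.
Import HBNNSimple.
Context {R : realType}.
Local Notation mu := (@lebesgue2 R).
Implicit Types (u v w : plane R -> R) (z : plane R).

(** Convergence of the conditional expectations themselves. As [EM] is linear and contracts L^2,
    these functions form a closed subspace, which reduces density to indicators. *)
Definition approximable u : Prop := L2 u /\
  forall e : R, 0 < e -> exists M0, forall M, (M0 <= M)%N -> (sqi (fun z => u z - EM M u z)%R <= e%:E)%E.

Lemma EM_L2 M u : L2 (EM M u). Proof. exact: step_L2. Qed.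

Lemma EMD M u v z : L2 u -> L2 v -> EM M (fun z => u z + v z) z = EM M u z + EM M v z.
Proof.
move=> Lu Lv; rewrite /EM /step -big_split; apply: eq_bigr => x _.
by rewrite ravD // mulrDl.
Qed.

Lemma EMZ M (a : R) u z : L2 u -> EM M (fun z => a * u z) z = a * EM M u z.
Proof. by move=> Lu; rewrite /EM /step mulr_sumr; apply: eq_bigr => x _; rewrite ravZ // mulrA. Qed.

Lemma approximableD u v : approximable u -> approximable v -> approximable (fun z => u z + v z).
Proof.
move=> [Lu Au] [Lv Av]; split; first exact: L2D.
move=> e e0; have e4 : 0 < e / 4 by rewrite divr_gt0.
have [M1 h1] := Au _ e4; have [M2 h2] := Av _ e4.
exists (maxn M1 M2) => M; rewrite geq_max => /andP[m1 m2].
have E z : u z + v z - EM M (fun z => u z + v z) z = (u z - EM M u z) + (v z - EM M v z).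
  by rewrite EMD //; ring.
under [X in sqi X]eq_fun do rewrite E.
have [mf1 _] := L2B Lu (EM_L2 M u); have [mf2 _] := L2B Lv (EM_L2 M v).
apply: le_trans (sqiD mf1 mf2) _.
apply: le_trans (leeD (lee_wpmul2l _ (h1 _ m1)) (lee_wpmul2l _ (h2 _ m2))) _.
- by rewrite lee_fin.
- by rewrite lee_fin.
- by rewrite -!EFinM -EFinD lee_fin; lra.
Qed.

Lemma approximableZ (a : R) u : approximable u -> approximable (fun z => a * u z).
Proof.
move=> [Lu Au]; split; first exact: L2Z.
move=> e e0; have a0 : 0 < a ^+ 2 + 1 by rewrite ltr_pwDr // sqr_ge0.
have [M1 h1] := Au _ (divr_gt0 e0 a0); exists M1 => M /h1 h.
have E z : a * u z - EM M (fun z => a * u z) z = a * (u z - EM M u z).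
  by rewrite EMZ // mulrBr.
under [X in sqi X]eq_fun do rewrite E.
have [mf1 _] := L2B Lu (EM_L2 M u); rewrite sqiZ //.
apply: le_trans (lee_wpmul2l _ h) _; first by rewrite lee_fin sqr_ge0.
rewrite -EFinM lee_fin mulrCA ler_piMr ?(ltW e0) // ler_pdivrMr // mul1r; lra.
Qed.

Lemma approximable_ext u v : u =1 v -> approximable u -> approximable v.
Proof. by move=> /funext ->. Qed.

Lemma approximable_sum (I : Type) (s : seq I) (u : I -> plane R -> R) :
  (forall i, approximable (u i)) -> approximable (fun z => \sum_(i <- s) u i z).
Proof.
move=> Au; elim: s => [|i s IH].
  apply: approximable_ext (_ : approximable (fun z => 0 * step (fun _ : cells 0 => 0) z)).
    by move=> z; rewrite big_nil mul0r.
  split; first exact/L2Z/step_L2.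
  move=> e e0; exists 0%N => M _.
  have E z : 0 * step (fun _ : cells 0 => 0) z - EM M (fun z => 0 * step (fun _ : cells 0 => 0) z) z = 0 * step (fun _ : cells 0 => 0) z.
    by rewrite EMZ ?mul0r ?subrr //; exact: step_L2.
  under [X in sqi X]eq_fun do rewrite E.
  by rewrite sqiZ ?expr0n /= ?mul0e ?lee_fin ?(ltW e0) //; exact: measurable_step.
by apply: approximable_ext (approximableD (Au i) IH) => z; rewrite big_cons.
Qed.

Lemma approximable_lim u : L2 u ->
  (forall e : R, 0 < e -> exists2 v, approximable v & (sqi (fun z => u z - v z)%R <= e%:E)%E) ->
  approximable u.
Proof.
move=> Lu H; split => // e e0; have e8 : 0 < e / 16 by rewrite divr_gt0.
have [v [Lv Av] uv] := H _ e8; have [M0 h] := Av _ e8; exists M0 => M /h {}h.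
have Luv := L2B Lu Lv; have [m1 _] := Luv; have [m2 _] := L2B Lv (EM_L2 M v).
have [m3 _] := EM_L2 M (fun z => u z - v z).
have E z : u z - EM M u z = (u z - v z) + ((v z - EM M v z) + -1 * EM M (fun z => u z - v z) z).
  have -> : EM M (fun z => u z - v z) z = EM M u z - EM M v z.
    have := EMD M z Lu (L2Z (-1) Lv); rewrite EMZ // mulN1r => <-.
    by congr (EM M _ z); apply/funext => t; rewrite mulN1r.
  ring.
under [X in sqi X]eq_fun do rewrite E.
have m4 : measurable_fun [set: plane R] (fun z => -1 * EM M (fun z => u z - v z) z) by exact: measurable_funM.
apply: le_trans (sqiD m1 (measurable_funD m2 m4)) _.
have h2 := sqiD m2 m4; rewrite sqiZ // sqrrN expr1n mul1e in h2.
have h3 := sqi_EM M Luv.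
apply: le_trans (leeD (lee_wpmul2l _ uv) (lee_wpmul2l _ h2)) _; rewrite ?lee_fin //.
apply: le_trans (leeD (lexx _) (lee_wpmul2l _ (leeD (lee_wpmul2l _ h) (lee_wpmul2l _ (le_trans h3 uv))))) _; rewrite ?lee_fin //.
by lra.
Qed.

Lemma sqi_indic (A : set (plane R)) : measurable A -> sqi (\1_A) = mu A.
Proof.
move=> mA; transitivity (\int[mu]_z (\1_A z)%:E)%E; last by rewrite integral_indic // setIT.
by apply: eq_integral => z _; rewrite indicE; case: (z \in A); rewrite ?expr1n ?expr0n.
Qed.

Lemma L2_indic (A : set (plane R)) : measurable A -> (mu A < +oo)%E -> L2 (\1_A).
Proof. by move=> mA Aoo; split; [exact: measurable_indic|rewrite sqi_indic]. Qed.

Definition box (r : R) : set (plane R) := square (- r, - r) (r + r).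

Lemma boxE r z : box r z <-> (- r <= z.1 < r) /\ (- r <= z.2 < r).
Proof. by rewrite /box /square /= !in_itv /= addKr. Qed.

Lemma measurable_box r : measurable (box r). Proof. exact: measurable_square. Qed.

Lemma box_lty r : 0 <= r -> (mu (box r) < +oo)%E.
Proof. by move=> r0; rewrite [mu _]lebesgue2_square ?addr_ge0 // ltry. Qed.

(* A corner-shaped region is cut only by cells in a thin neighbourhood of six lines. *)
Lemma approximable_corner (a b r : R) : 0 < r ->
  approximable (\1_([set z : plane R | a <= z.1 /\ b <= z.2] `&` box r)).
Proof.
move=> r0; set A := _ `&` _.
have mA : measurable A.
  apply: measurableI; last exact: measurable_box.
  rewrite (_ : [set z | _] = `[a, +oo[%classic `*` `[b, +oo[%classic).
    by apply: measurableX; exact: measurable_itv.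
  by apply/seteqP; split => z /=; rewrite !in_itv /= !andbT.
have LA : L2 (\1_A).
  apply: L2_indic => //; apply: le_lt_trans (box_lty (ltW r0)).
  by apply: le_measure; rewrite ?inE; [exact: mA|exact: measurable_box|exact: subIsetr].
split => // e e0.
pose S1 (h f : R) : set (plane R) := `[f - h, f + h]%classic `*` `[- (r + 1), r + 1]%classic.
pose S2 (h f : R) : set (plane R) := `[- (r + 1), r + 1]%classic `*` `[f - h, f + h]%classic.
(* Six strips of area 4 h (r + 1) each. *)
have e1 : 0 < e / (24 * (r + 1)) by rewrite divr_gt0 // mulr_gt0 // addr_gt0.
have [M1 hM1] := mesh_small e1; have [M2 hM2] := pow_large r.
exists (maxn M1 M2) => M; rewrite geq_max => /andP[/hM1 {hM1}m1 /hM2 {hM2}m2].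
have h0 := @mesh_gt0 R M; have h1 := @mesh_le1 R M; set h := mesh M in m1 h0 h1.
pose F1 := [:: a; - r; r]; pose F2 := [:: b; - r; r].
pose D z : R := \sum_(f <- F1) \1_(S1 h f) z + \sum_(f <- F2) \1_(S2 h f) z.
have mS1 f : measurable (S1 h f) by apply: measurableX; exact: measurable_itv.
have mS2 f : measurable (S2 h f) by apply: measurableX; exact: measurable_itv.
have i01 (B : set (plane R)) z : 0 <= (\1_B z : R) <= 1.
  by rewrite indicE; case: (_ \in _); rewrite !(lexx, ler01).
have EM01 z : 0 <= EM M (\1_A) z <= 1.
  rewrite /EM; have [[x _ ->]|[_ ->]] := @stepP R M (rav (M := M) (\1_A)) z; last by rewrite lexx ler01.
  apply/andP; split.
    rewrite mulr_ge0 ?invr_ge0 ?sqr_ge0 // Rintegral_ge0 // => t _; by case/andP: (i01 A t).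
  rewrite -(@rav_const R M 1 (cst 1) x) //; apply: le_rav.
  - exact: L2_integrable_cell.
  - exact: integrable_cst_cell.
  - by move=> t _; case/andP: (i01 A t).
have sum0 (s : seq R) (S : R -> set (plane R)) z : 0 <= \sum_(f <- s) \1_(S f) z :> R.
  by apply: sumr_ge0 => f _; case/andP: (i01 (S f) z).
have D0 z : 0 <= D z by rewrite addr_ge0 ?sum0.
(* [D] counts the strips that contain z. If there is none, z is farther than h from each line, so
   its cell lies entirely inside or outside [A] and the average equals the indicator. *)
have bd z : (\1_A z - EM M (\1_A) z) ^+ 2 <= D z.
  have le1 : (\1_A z - EM M (\1_A) z) ^+ 2 <= 1.
    rewrite -real_normK ?num_real // exprn_ile1 // ler_norml.
    by have := i01 A z; have := EM01 z; lra.
  have [nz|] := leP 1 (D z); first exact: le_trans le1 nz.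
  move=> Dlt; suff -> : EM M (\1_A) z = \1_A z by rewrite subrr expr0n.
  have notS1 f : f \in F1 -> ~ S1 h f z.
    move=> fF Sz; move: Dlt; apply/negP; rewrite -leNgt /D (big_rem f) // indicE mem_set //.
    by rewrite -addrA lerDl addr_ge0 ?sum0.
  have notS2 f : f \in F2 -> ~ S2 h f z.
    move=> fF Sz; move: Dlt; apply/negP; rewrite -leNgt /D addrC (big_rem f) // indicE mem_set //.
    by rewrite -addrA lerDl addr_ge0 ?sum0.
  have same z' : `|z.1 - z'.1| <= h -> `|z.2 - z'.2| <= h -> (A z <-> A z').
    move=> d1 d2; have [Az|nAz] := pselect (A z \/ A z'); last first.
      by split => ?; exfalso; apply: nAz; [left|right].
    have [B1 B2] : - (r + 1) <= z.1 <= r + 1 /\ - (r + 1) <= z.2 <= r + 1.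
      move: d1 d2; rewrite !ler_norml => d1 d2.
      by case: Az => -[_ /boxE[c1 c2]]; split; lra.
    have n1 f : f \in F1 -> ~~ (f - h <= z.1 <= f + h).
      move=> /notS1 n; apply/negP => c; apply: n; split => /=; rewrite in_itv /=; lra.
    have n2 f : f \in F2 -> ~~ (f - h <= z.2 <= f + h).
      move=> /notS2 n; apply/negP => c; apply: n; split => /=; rewrite in_itv /=; lra.
    have := n1 a (mem_head _ _); have := n1 (- r); have := n1 r.
    have := n2 b (mem_head _ _); have := n2 (- r); have := n2 r.
    rewrite !inE !eqxx !orbT => /(_ isT) p1 /(_ isT) p2 p3 /(_ isT) p4 /(_ isT) p5 p6.
    move: d1 d2; rewrite !ler_norml => /andP[d1 d1'] /andP[d2 d2'].
    rewrite /A /setI /= !boxE.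
    clear -p1 p2 p3 p4 p5 p6 d1 d1' d2 d2' h0.
    by split => -[[c1 c2] [/andP[c3 c4] /andP[c5 c6]]]; repeat split; lra.
  have [[x xz E]|[nz E]] := @stepP R M (rav (M := M) (\1_A)) z.
    rewrite /EM E; apply: rav_const => z' xz'.
    have [d1 d2] := cell_close xz xz'.
    rewrite !indicE; congr (nat_of_bool _)%:R; apply/idP/idP; rewrite !inE => ?.
      exact/(same z' d1 d2).
    exact/(same z' d1 d2).
  rewrite /EM E indicE memNset // => -[_ /boxE[c1 c2]].
  have [||x xz] := @cell_exists R M z; last exact: (nz x).
    by apply/andP; lra.
  by apply/andP; lra.
apply: le_trans (_ : \int[mu]_z (D z)%:E <= _)%E.
  apply: ge0_le_integral => //.
  - by move=> z _; rewrite lee_fin sqr_ge0.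
  - apply: measurable_sqr; apply: measurable_funB; first exact: measurable_indic.
    exact: measurable_step.
  - apply/measurable_EFinP; apply: measurable_funD; apply: measurable_sum => f; exact: measurable_indic.
  - by move=> z _; rewrite lee_fin bd.
have I1 (s : seq R) (S : R -> set (plane R)) : (forall f, measurable (S f)) ->
    (forall f, mu (S f) = (h * 4 * (r + 1))%:E) ->
    (\int[mu]_z (\sum_(f <- s) \1_(S f) z)%:E = ((size s)%:R * (h * 4 * (r + 1)))%:E)%E.
  move=> mS ES; under eq_integral do rewrite -sumEFin.
  rewrite ge0_integral_sum //; last by move=> f; apply/measurable_EFinP; exact: measurable_indic.
  transitivity (\sum_(f <- s) (h * 4 * (r + 1))%:E)%E.
    by apply: eq_bigr => f _; rewrite integral_indic // setIT; exact: ES.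
  by rewrite sumEFin big_const_seq count_predT iter_addr addr0 mulr_natl.
have r1 : 0 <= r + 1 by rewrite addr_ge0 // ltW.
under eq_integral do rewrite EFinD.
rewrite ge0_integralD //; last 4 first.
- by move=> z _; rewrite lee_fin sumr_ge0 // => f _; case/andP: (i01 (S1 h f) z).
- by apply/measurable_EFinP; apply: measurable_sum => f; exact: measurable_indic.
- by move=> z _; rewrite lee_fin sumr_ge0 // => f _; case/andP: (i01 (S2 h f) z).
- by apply/measurable_EFinP; apply: measurable_sum => f; exact: measurable_indic.
rewrite !I1 //; last 2 first.
- move=> f; rewrite [mu _]lebesgue2_rect; [congr (_%:E); ring|lra|lra].
- move=> f; rewrite [mu _]lebesgue2_rect; [congr (_%:E); ring|lra|lra].
rewrite -EFinD lee_fin /=; have r10 : 0 < r + 1 by lra.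
have : h * (24 * (r + 1)) <= e by rewrite -ler_pdivlMr // mulr_gt0.
lra.
Qed.

(** The pi-lambda argument for preimages under [p] inside a set [Z] of finite measure. It is applied
    to each coordinate and to the identity of the plane. *)
Lemma approximable_dynkin d (T : measurableType d) (G : set (set T)) (p : plane R -> T) (Z : set (plane R)) :
  d.-measurable = <<s G >> -> setI_closed G -> measurable_fun [set: plane R] p ->
  measurable Z -> (mu Z < +oo)%E -> approximable (\1_Z) ->
  (forall S, G S -> approximable (\1_(p @^-1` S `&` Z))) ->
  forall S, measurable S -> approximable (\1_(p @^-1` S `&` Z)).
Proof.
move=> EG IG mp mZ Zoo AZ AG S mS.
have mpre B : measurable B -> measurable (p @^-1` B).
  by move=> mB; rewrite -[_ @^-1` _]setTI; exact: mp.
have fin B : measurable B -> (mu (p @^-1` B `&` Z) < +oo)%E.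
  move=> mB; apply: le_lt_trans Zoo; apply: le_measure; rewrite ?inE //.
  by apply: measurableI => //; exact: mpre.
rewrite EG in mS; move: S mS.
apply: (@dynkin_induction _ T G (fun S => approximable (\1_(p @^-1` S `&` Z))) EG IG).
- by rewrite preimage_setT setTI.
- exact: AG.
- move=> B mB AB.
  apply: approximable_ext (approximableD AZ (approximableZ (-1) AB)) => z.
  rewrite !indicE !in_setI preimage_setC in_setC.
  by case: (z \in Z); case: (z \in p @^-1` B); rewrite ?andbT ?andbF ?mulr0 ?addr0 ?mulr1 ?subrr.
- move=> F mF tF AF.
  pose Fi i := p @^-1` F i `&` Z.
  have mFi i : measurable (Fi i) by apply: measurableI => //; exact: mpre.
  have UE : p @^-1` (\bigcup_k F k) `&` Z = \bigcup_k Fi k.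
    by rewrite preimage_bigcup setI_bigcupl.
  have tFi : trivIset setT Fi.
    move/trivIsetP: tF => tF; apply/trivIsetP => i j _ _ ij.
    by rewrite /Fi setIACA -preimage_setI tF // preimage_set0 set0I.
  have mU : measurable (\bigcup_k F k) by exact: bigcup_measurable.
  have mUi : measurable (\bigcup_k Fi k) by exact: bigcup_measurable.
  apply: approximable_lim.
    by apply: L2_indic; [apply: measurableI => //; exact: mpre|exact: fin].
  move=> e e0; rewrite UE.
  have cvg := @measure_semi_sigma_additive _ _ _ mu Fi mFi tFi mUi.
  have finU : mu (\bigcup_k Fi k) \is a fin_num.
    by rewrite ge0_fin_numE // -UE fin.
  have [n hn] : exists n, (mu (\bigcup_k Fi k) - e%:E <= \sum_(0 <= i < n) mu (Fi i))%E.
    apply: contrapT => no.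
    have h n : (\sum_(0 <= i < n) mu (Fi i) <= mu (\bigcup_k Fi k) - e%:E)%E.
      by rewrite leNgt; apply/negP => /ltW hn; apply: no; exists n.
    have : (mu (\bigcup_k Fi k) <= mu (\bigcup_k Fi k) - e%:E)%E by apply: (cvge_to_le cvg); exact: nearW.
    by rewrite leNgt lteBlDr // lteDl // lte_fin e0.
  exists (fun z => \sum_(i <- index_iota 0 n) \1_(Fi i) z); first exact: approximable_sum.
  have E z : \sum_(i <- index_iota 0 n) \1_(Fi i) z = \1_(\big[setU/set0]_(0 <= i < n) Fi i) z :> R.
    rewrite big_mkord -bigcup_mkord indicE; case: (pselect (exists2 i, (i < n)%N & Fi i z)) => [[i ni iz]|no].
      rewrite mem_set; last by exists i.
      rewrite (bigD1_seq i) ?mem_index_iota ?iota_uniq //= indicE mem_set // big1 ?addr0 // => k ki.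
      rewrite indicE memNset // => kz; rewrite eq_sym in ki.
      by move/trivIsetP: tFi => /(_ i k Logic.I Logic.I ki)/seteqP[/(_ z) h _]; exact: h.
    rewrite memNset; last by move=> [i /= ni iz]; apply: no; exists i.
    rewrite big_nat big1 // => k /andP[_ kn]; rewrite indicE memNset // => kz.
    by apply: no; exists k.
  set V := \big[setU/set0]_(0 <= i < n) Fi i in E.
  have mV : measurable V by apply: bigsetU_measurable.
  have VU : V `<=` \bigcup_k Fi k.
    by rewrite /V big_mkord -bigcup_mkord => z [i _ iz]; exists i.
  have Vfin : mu V \is a fin_num.
    rewrite ge0_fin_numE //; apply: le_lt_trans (_ : mu (\bigcup_k Fi k) < +oo)%E.
      by apply: le_measure; rewrite ?inE.
    by rewrite -ge0_fin_numE.
  have E2 : (fun z => \1_(\bigcup_k Fi k) z - \sum_(i <- index_iota 0 n) \1_(Fi i) z) =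
      \1_(\bigcup_k Fi k `\` V) :> (plane R -> R).
    apply/funext => z; rewrite E !indicE in_setD.
    have [zV|zV] := boolP (z \in V); last by rewrite subr0 andbT.
    by rewrite (_ : z \in \bigcup_k Fi k) ?subrr // inE; apply: VU; rewrite inE in zV.
  rewrite E2 sqi_indic; last exact: measurableD.
  have -> : mu (\bigcup_k Fi k `\` V) = (mu (\bigcup_k Fi k) - mu V)%E.
    by rewrite [LHS]measureD // ?(setIidr VU) // -ge0_fin_numE.
  rewrite leeBlDr // addeC -leeBlDr //.
  have -> : mu V = (\sum_(0 <= i < n) mu (Fi i))%E by rewrite /V !big_mkord; apply: measure_bigsetU.
  exact: hn.
Qed.

(** Three passes of the pi-lambda argument: from corner regions to a measurable set times a ray,
    then to products of measurable sets, which generate the rest. *)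
Lemma approximable_measurable (A : set (plane R)) (m : nat) : measurable A ->
  approximable (\1_(A `&` box (2 ^+ m))).
Proof.
move=> mA; have r0 : 0 < 2 ^+ m :> R by rewrite exprn_gt0.
set r : R := 2 ^+ m in r0 *.
have mray (a : R) : measurable (`[a, +oo[%classic : set (measurableTypeR R)) by exact: measurable_itv.
have mB := measurable_box r; have Boo := box_lty (ltW r0).
have fin (B : set (plane R)) : measurable B -> (mu (B `&` box r) < +oo)%E.
  move=> mB'; apply: le_lt_trans Boo; apply: le_measure; rewrite ?inE //.
  exact: measurableI.
pose G : set (set (measurableTypeR R)) := @RGenCInfty.G R.
have EG : measurable = <<s G >> by exact: RGenCInfty.measurableE.
have IG : setI_closed G.
  move=> A1 A2 [a ->] [b ->]; exists (Num.max a b).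
  by apply/seteqP; split => t /=; rewrite !in_itv /= !andbT ge_max => /andP.
have box_corner : box r = [set z : plane R | - r <= z.1 /\ - r <= z.2] `&` box r.
  by apply/seteqP; split => [z /[dup] /boxE[/andP[? ?] /andP[? ?]]|z []].
have Abox : approximable (\1_(box r)) by rewrite box_corner; exact: approximable_corner.
have mS (p : plane R -> measurableTypeR R) S : measurable_fun [set: plane R] p -> measurable S ->
    measurable (p @^-1` S).
  by move=> mp mS; rewrite -[_ @^-1` _]setTI; exact: mp.
have mf1 : measurable_fun [set: plane R] (fst : plane R -> measurableTypeR R) by exact: measurable_fst.
have mf2 : measurable_fun [set: plane R] (snd : plane R -> measurableTypeR R) by exact: measurable_snd.
have step0 (b : R) S : measurable S ->
    approximable (\1_(fst @^-1` S `&` (snd @^-1` `[b, +oo[%classic `&` box r))).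
  apply: (approximable_dynkin EG IG mf1).
  - by apply: measurableI => //; exact: mS.
  - by apply: fin; exact: mS.
  - rewrite (_ : _ `&` _ = [set z : plane R | - r <= z.1 /\ b <= z.2] `&` box r).
      exact: approximable_corner.
    apply/seteqP; split => [z [/=]|z [[h1 h2] h3]].
      by rewrite in_itv /= andbT => h /[dup] /boxE[/andP[? ?] _].
    by split => //=; rewrite in_itv /= h2.
  - move=> _ [a ->].
    rewrite (_ : _ `&` _ = [set z : plane R | a <= z.1 /\ b <= z.2] `&` box r).
      exact: approximable_corner.
    by apply/seteqP; split => [z [/= h1 [/= h2 h3]]|z [[h1 h2] h3]];
      rewrite ?in_itv /= ?andbT in h1 h2 *; split => //; rewrite /= ?in_itv /= ?h1 ?h2.
have step1 S S' : measurable S -> measurable S' ->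
    approximable (\1_(snd @^-1` S' `&` (fst @^-1` S `&` box r))).
  move=> mS1; apply: (approximable_dynkin EG IG mf2).
  - by apply: measurableI => //; exact: mS.
  - by apply: fin; exact: mS.
  - have := step0 (- r) S mS1; rewrite (_ : snd @^-1` _ `&` box r = box r) //.
    apply/seteqP; split => [z []//|z /[dup] /boxE[_ /andP[h _]] hb].
    by split => //=; rewrite in_itv /= h.
  - by move=> _ [b ->]; rewrite setICA; exact: step0.
have mid : measurable_fun [set: plane R] (id : plane R -> plane R) by exact: measurable_id.
pose G2 : set (set (plane R)) := [set B1 `*` B2 | B1 in measurable & B2 in measurable].
have EG2 : measurable = <<s G2 >> by exact: measurable_prod_measurableType.
have IG2 : setI_closed G2.
  move=> _ _ [A1 mA1 [A2 mA2 <-]] [B1 mB1 [B2 mB2 <-]].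
  exists (A1 `&` B1); first exact: measurableI.
  by exists (A2 `&` B2); [exact: measurableI|rewrite setXI].
apply: (@approximable_dynkin _ _ G2 id (box r) EG2 IG2 mid mB Boo Abox _ A mA).
move=> _ [B1 mB1 [B2 mB2 <-]].
rewrite (_ : _ `&` _ = snd @^-1` B2 `&` (fst @^-1` B1 `&` box r)); first exact: step1.
by apply/seteqP; split => [z [[h1 h2] h3]|z [h1 [h2 h3]]]; split.
Qed.

Lemma approximable_sfun (g : {nnsfun plane R >-> R}) (m : nat) :
  approximable (fun z => g z * \1_(box (2 ^+ m)) z).
Proof.
under eq_fun do rewrite fimfunEord mulr_suml.
apply: approximable_sum => i; move: (nth _ _ _) => c.
apply: approximable_ext (approximableZ c (approximable_measurable m (measurable_sfunP g (measurable_set1 c)))) => z.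
by rewrite -mulrA; congr (_ * _); rewrite !indicE in_setI; do 2 case: (_ \in _); rewrite ?mulr1 ?mulr0.
Qed.

(** Increasing simple functions are cut to growing boxes and converge in L^2 by dominated
    convergence with bound u^2. *)
Lemma approximable_ge0 u : L2 u -> (forall z, 0 <= u z) -> approximable u.
Proof.
move=> [mf fu] u0; apply: approximable_lim => // e e0.
have mE : measurable_fun [set: plane R] (EFin \o u) by exact/measurable_EFinP.
have [g [gnd gcvg]] := approximation measurableT mE (fun z _ => u0 z : (0 <= (u z)%:E)%E).
pose v n z := g n z * \1_(box (2 ^+ n)) z.
have gu n z : g n z <= u z.
  have := gcvg z Logic.I => cv; rewrite -lee_fin.
  apply: (cvge_to_ge cv); exists n => // k /= nk; rewrite lee_fin.
  by have /lefP := gnd _ _ nk; apply.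
have v0 n z : 0 <= v n z <= u z.
  rewrite /v indicE; case: (_ \in _); rewrite ?mulr1 ?mulr0 ?lexx ?u0 //.
  by rewrite gu andbT.
have mv n : measurable_fun [set: plane R] (v n).
  by apply: measurable_funM => //; apply: measurable_indic; exact: measurable_box.
have vcvg z : (v n z @[n --> \oo] --> u z)%classic.
  have := gcvg z Logic.I => /fine_cvgP[_ /=]; apply: cvg_trans.
  apply: near_eq_cvg; have [N hN] := pow_large (`|z.1| + `|z.2| + 1).
  exists N => // n /= /hN h; rewrite /v indicE mem_set ?mulr1 //.
  apply/boxE; have := ler_norm z.1; have := ler_norm (- z.1).
  have := ler_norm z.2; have := ler_norm (- z.2); rewrite !normrN; clear -h.
  by have := normr_ge0 z.1; have := normr_ge0 z.2; split; apply/andP; split; lra.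
have dom : (\int[mu]_z ((u z - v n z) ^+ 2)%:E @[n --> \oo] --> 0)%E%classic.
  have H1 n : measurable_fun [set: plane R] (fun z => ((u z - v n z) ^+ 2)%:E).
    by apply: measurable_sqr; exact: measurable_funB.
  have H2 : {ae mu, forall z, [set: plane R] z -> (((u z - v n z) ^+ 2)%:E @[n --> \oo] --> 0%:E)%classic}.
    apply: aeW => z _; apply: cvg_EFin; first by near=> n.
    rewrite -[X in (_ --> X)%classic](_ : (u z - u z) ^+ 2 = 0); last by rewrite subrr expr0n.
    rewrite expr2 (_ : fine \o _ = (fun n => (u z - v n z) * (u z - v n z))).
      by apply: cvgM; apply: cvgB => //; exact: cvg_cst.
    by apply/funext => n; rewrite /= expr2.
  have H3 : mu.-integrable [set: plane R] (fun z => (u z ^+ 2)%:E).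
    apply/integrableP; split; first exact: measurable_sqr.
    by under eq_integral do rewrite gee0_abs ?lee_fin ?sqr_ge0 //.
  have H4 : {ae mu, forall z n, [set: plane R] z -> (`|((u z - v n z) ^+ 2)%:E| <= (u z ^+ 2)%:E)%E}.
    apply: aeW => z n _; rewrite gee0_abs ?lee_fin ?sqr_ge0 //.
    by rewrite lerXn2r ?nnegrE //; have := v0 n z; lra.
  have [_ _ +] := dominated_convergence measurableT H1 (measurable_cst _) H2 H3 H4.
  by rewrite integral0.
have [n hn] : exists n, (\int[mu]_z ((u z - v n z) ^+ 2)%:E <= e%:E)%E.
  apply: contrapT => no; have h n : (e%:E <= \int[mu]_z ((u z - v n z) ^+ 2)%:E)%E.
    by rewrite leNgt; apply/negP => /ltW ?; apply: no; exists n.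
  have : (e%:E <= 0)%E by apply: (cvge_to_ge dom); exact: nearW.
  by rewrite lee_fin leNgt e0.
by exists (v n) => //; exact: approximable_sfun.
Unshelve. all: by end_near. Qed.

Theorem approximable_L2 u : L2 u -> approximable u.
Proof.
move=> Lu; have [mf fu] := Lu.
have mp : measurable_fun [set: plane R] (fun z => Num.max (u z) 0) by exact: measurable_maxr.
have mn : measurable_fun [set: plane R] (fun z => Num.max (- u z) 0).
  by apply: measurable_maxr => //; exact: measurableT_comp.
have h (v : plane R -> R) : measurable_fun [set: plane R] v -> (forall z, 0 <= v z <= `|u z|) ->
    approximable v.
  move=> mv vu; apply: approximable_ge0; last by move=> z; case/andP: (vu z).
  split => //; apply: le_lt_trans fu; apply: le_sqi => // z.
  by case/andP: (vu z) => a b; rewrite ger0_norm.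
apply: approximable_ext (approximableD (h _ mp _) (approximableZ (-1) (h _ mn _))) => z.
- rewrite mulN1r; have [hz|/ltW hz] := leP 0 (u z).
    by rewrite (max_idPr _) ?subr0 // oppr_le0.
  by rewrite (max_idPl _) ?oppr_ge0 // opprK add0r.
- by rewrite ge_max le_max lexx orbT ler_norm normr_ge0.
- by rewrite ge_max le_max lexx orbT -normrN ler_norm normr_ge0.
Qed.

End Density.

(** * Weights on cells *)

Section SmallLevelSets.
Context {R : realType}.

Lemma powR_ratio_lt1 (a b : R) : a < b -> 0 < 2 `^ (a - b) < 1.
Proof.
move=> ab; rewrite powR_gt0 //= /powR pnatr_eq0 /= -[ltRHS]expR0 ltr_expR.
by rewrite pmulr_llt0 ?subr_lt0 // ln_gt0 // (ltr1n R 2).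
Qed.

(* Dyadic layer-cake bound: on [2^-(n+1) r < g <= 2^-n r] the integrand is at most
   [2^(a(n+1)) r^-a]. *)
Lemma integral_negative_power (a b : R) : 0 < a < b -> exists2 C, 0 <= C &
  forall d (T : measurableType d) (nu : {measure set T -> \bar R}) (D : set T) (g : T -> R) (A r : R),
  measurable D -> measurable_fun [set: T] g -> (forall z, D z -> 0 <= g z <= r) -> 0 < r -> 0 <= A ->
  (forall t : R, 0 < t -> (nu (D `&` [set z | (g z <= t)%R]) <= (A * t `^ b)%:E)%E) ->
  (\int[nu]_(z in D) (g z `^ (- a))%:E <= (C * A * r `^ (b - a))%:E)%E.
Proof.
move=> /andP[a0 ab]; have /andP[q0 q1] := powR_ratio_lt1 ab.
set q := 2 `^ (a - b) in q0 q1.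
exists (2 `^ a / (1 - q)); first by rewrite divr_ge0 ?powR_ge0 ?subr_ge0 ?ltW.
move=> d T nu D g A r mD mg gr r0 A0 H.
pose t n : R := 2 ^- n * r.
have t0 n : 0 < t n by rewrite mulr_gt0 ?invr_gt0 ?exprn_gt0.
pose E n := D `&` [set z | g z <= t n].
have mE n : measurable (E n).
  have -> : E n = D `&` g @^-1` `]-oo, t n].
    by apply/seteqP; split => z [? ?]; split => //=; rewrite in_itv /= in *.
  by apply: measurableI => //; rewrite -[_ @^-1` _]setTI; apply: mg => //; exact: measurable_itv.
pose c n : R := t n.+1 `^ (- a).
have c0 n : 0 <= c n by exact: powR_ge0.
pose F n z := ((c n)%:E * (\1_(E n) z)%:E)%E.
have F0 n z : (0 <= F n z)%E by rewrite mule_ge0 ?lee_fin.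
have mF n : measurable_fun D (F n).
  apply: measurable_funTS; apply: measurable_funeM; apply/measurable_EFinP.
  exact: measurable_indic.
apply: le_trans (_ : \int[nu]_(z in D) (\sum_(0 <= n <oo) F n z) <= _)%E.
  apply: ge0_le_integral => //.
  - by move=> z _; rewrite lee_fin powR_ge0.
  - apply/measurable_EFinP; apply: measurable_funTS.
    exact: (measurableT_comp (measurable_powR (- a)) mg).
  - by apply: ge0_emeasurable_sum => [n z Dz _|n _]; [exact: F0|exact: mF].
  move=> z Dz; have /andP[g0 gle] := gr z Dz.
  (* At a zero of [g] the negative power is 0 by convention. *)
  have [gz|gn] := eqVneq (g z) 0.
    rewrite gz powR0 ?oppr_eq0 ?gt_eqF //.
    by apply: nneseries_ge0 => n _ _; exact: F0.
  have gp : 0 < g z by rewrite lt_neqAle eq_sym gn.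
  have ex : exists n, t n.+1 < g z.
    have [M hM] := mesh_small (divr_gt0 gp (ltr_wpDl ler01 r0)).
    exists M; apply: lt_le_trans (_ : t M.+1 < mesh M * (1 + r)) _.
      apply: lt_le_trans (_ : _ < 2 ^- M * r) _.
        by rewrite ltr_pM2r // ltf_pV2 ?posrE ?exprn_gt0 // exprS ltr_pMl ?exprn_gt0 // ltr1n.
      by rewrite ler_wpM2l ?(ltW (mesh_gt0 _)) // lerDr.
    by rewrite -ler_pdivlMr ?ltr_wpDl // hM.
  case: (ex_minnP ex) => n hn nmin.
  have gn' : g z <= t n.
    case: n hn nmin => [|n] hn nmin; first by rewrite /t expr0 invr1 mul1r.
    rewrite leNgt; apply/negP => h; have := nmin n h; by rewrite ltnn.
  have Fn : (F n z <= \sum_(0 <= n <oo) F n z)%E.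
    apply: le_trans (@nneseries_lim_ge _ (F ^~ z) xpredT 0%N n.+1 _); last by move=> k _ _; exact: F0.
    by rewrite big_nat_recr //= leeDr // sume_ge0.
  apply: le_trans Fn; rewrite /F indicE mem_set; last by split.
  rewrite mule1 lee_fin /c !powRN lef_pV2 ?posrE ?powR_gt0 //.
  by apply: ler_powR2; rewrite ?(ltW a0) ?(ltW (t0 _)) // ltW.
rewrite integral_nneseries //.
apply: lime_le.
  by apply: is_cvg_nneseries => n _ _; apply: integral_ge0.
apply: nearW => N.
apply: le_trans (_ : \sum_(0 <= n < N) (2 `^ a * A * r `^ (b - a) * q ^+ n)%:E <= _)%E.
  apply: lee_sum => n _; rewrite /F ge0_integralZl //; last 2 first.
  - by apply: measurable_funTS; apply/measurable_EFinP; exact: measurable_indic.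
  - by rewrite lee_fin.
  rewrite integral_indic //.
  have -> : E n `&` D = E n by apply/setIidPl => z [].
  apply: le_trans (lee_wpmul2l _ (H (t n) (t0 n))) _; first by rewrite lee_fin.
  rewrite -EFinM lee_fin /c.
  have p2 : 0 < 2 ^- n :> R by rewrite invr_gt0 exprn_gt0.
  have p2' : 0 < 2 ^- n.+1 :> R by rewrite invr_gt0 exprn_gt0.
  have E1 : (2 ^- n.+1) `^ (- a) = 2 `^ a * (2 `^ a) ^+ n :> R.
    rewrite -exprS -powR_Xn // -powR_inv1 ?exprn_ge0 // -powRrM mulN1r opprK //.
  have E2 : (2 ^- n) `^ b = (2 `^ (- b)) ^+ n :> R.
    by rewrite -exprVn powR_Xn ?invr_ge0 // -powR_inv1 // -powRrM mulN1r.
  rewrite /t !powRM ?(ltW p2) ?(ltW p2') ?(ltW r0) // E1 E2.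
  have -> : q ^+ n = (2 `^ a) ^+ n * (2 `^ (- b)) ^+ n.
    by rewrite -exprMn -powRD // pnatr_eq0 implybT.
  have -> : r `^ (b - a) = r `^ b * r `^ (- a) by rewrite -powRD // (gt_eqF r0) implybT.
  by rewrite le_eqVlt; apply/orP; left; apply/eqP; ring.
rewrite sumEFin lee_fin -mulr_sumr.
have -> : 2 `^ a / (1 - q) * A * r `^ (b - a) = 2 `^ a * A * r `^ (b - a) * (1 - q)^-1 by ring.
rewrite ler_wpM2l ?mulr_ge0 ?powR_ge0 //.
have q1' : 0 < 1 - q by rewrite subr_gt0.
rewrite -[leRHS]mul1r ler_pdivlMr // mulrC big_mkord -[1 - q]opprB mulNr -subrX1 opprB.
by rewrite gerBl exprn_ge0 // ltW.
Qed.

Lemma Rintegral_gt0 d (T : measurableType d) (nu : {measure set T -> \bar R}) (A : set T) (f : T -> R) :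
  measurable A -> (0 < nu A)%E -> nu.-integrable A (EFin \o f) -> (forall t, A t -> 0 < f t) ->
  0 < \int[nu]_(t in A) f t.
Proof.
move=> mA A0 fi f0; have [mf _] := integrableP _ _ _ fi.
have h0 : 0 <= \int[nu]_(t in A) f t.
  by apply: Rintegral_ge0 => z Az; exact/ltW/f0.
rewrite lt_neqAle h0 andbT eq_sym; apply/eqP => E.
have : (\int[nu]_(t in A) `|(EFin \o f) t|)%E = 0%E.
  transitivity (\int[nu]_(t in A) (EFin \o f) t)%E.
    by apply: eq_integral => z; rewrite inE => Az; rewrite gee0_abs // lee_fin ltW // f0.
  by rewrite -[LHS]fineK ?integrable_fin_num // -/(Rintegral nu A f) E.
move=> /(ae_eq_integral_abs nu mA mf).1 [B [mB B0 sB]].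
have : (nu A <= nu B)%E.
  apply: le_measure; rewrite ?inE // => z Az; apply: sB => /= h.
  by have := f0 z Az; have [->] := h Az; rewrite ltxx.
by rewrite leNgt B0 A0.
Qed.

Lemma integrable_comb d (T : measurableType d) (nu : {measure set T -> \bar R}) (A : set T) (a b : R) (u v : T -> R) :
  measurable A -> nu.-integrable A (EFin \o u) -> nu.-integrable A (EFin \o v) ->
  nu.-integrable A (EFin \o (fun t => a * u t + b * v t)) /\
  \int[nu]_(t in A) (a * u t + b * v t) = a * \int[nu]_(t in A) u t + b * \int[nu]_(t in A) v t.
Proof.
move=> mA iu iv.
have iu' : nu.-integrable A (EFin \o (fun t => a * u t)) by exact: (integrableZl mA a iu).
have iv' : nu.-integrable A (EFin \o (fun t => b * v t)) by exact: (integrableZl mA b iv).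
split; first exact: (integrableD mA iu' iv').
by rewrite RintegralD // !RintegralZl.
Qed.

End SmallLevelSets.

Section CellWeights.
Context {R : realType}.
Local Notation mu := (@lebesgue2 R).
Implicit Types (u v w : plane R -> R) (z : plane R).

Lemma rav_gt0 M (x : cells M) u : mu.-integrable (cell x) (EFin \o u) ->
  (forall z, cell x z -> 0 < u z) -> 0 < rav u x.
Proof.
move=> iu u0; rewrite /rav mulr_gt0 ?invr_gt0 ?exprn_gt0 ?mesh_gt0 //.
apply: Rintegral_gt0 => //; first exact: measurable_cell.
have h : (0 < mu (cell x))%E by rewrite lebesgue2_cell lte_fin exprn_gt0 ?mesh_gt0.
exact: h.
Qed.

(** The integral form of [holder_weight], again with the tangent at l = U / S. *)
Lemma holder_cell M (x : cells M) (q : R) u w : 1 < q ->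
  (forall z, 0 <= u z) -> (forall z, 0 < w z) ->
  mu.-integrable (cell x) (EFin \o u) -> mu.-integrable (cell x) (EFin \o (fun z => u z `^ q * w z)) ->
  mu.-integrable (cell x) (EFin \o (fun z => w z `^ (- (q - 1)^-1))) ->
  rav u x `^ q <= rav (fun z => u z `^ q * w z) x * rav (fun z => w z `^ (- (q - 1)^-1)) x `^ (q - 1).
Proof.
move=> q1 u0 w0 iu iuw iv; have mc : measurable (@cell R M x) := measurable_cell x.
have q0 : 0 < q - 1 by lra. have h0 : 0 <= mesh M ^- 2 :> R by rewrite invr_ge0 sqr_ge0.
pose V z := w z `^ (- (q - 1)^-1); rewrite -/V in iv *.
have V0 z : 0 < V z by exact: powR_gt0.
have S0 : 0 < rav V x by exact: rav_gt0.
have U0 : 0 <= rav u x by rewrite mulr_ge0 // Rintegral_ge0.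
have T0 : 0 <= rav (fun z => u z `^ q * w z) x.
  by rewrite mulr_ge0 // Rintegral_ge0 // => z _; rewrite mulr_ge0 ?powR_ge0 // ltW.
set U := rav u x in U0 *; set S := rav V x in S0 *; pose l := U / S.
have l0 : 0 <= l by rewrite divr_ge0 // ltW.
have [ic Ec] := integrable_comb (q * l `^ (q - 1)) (l `^ q - q * l `^ (q - 1) * l) mc iu iv.
have H : l `^ q * S <= rav (fun z => u z `^ q * w z) x.
  have -> : l `^ q * S = rav (fun z => (q * l `^ (q - 1)) * u z + (l `^ q - q * l `^ (q - 1) * l) * V z) x.
    rewrite [RHS]/rav Ec mulrDr ![_ ^- 2 * (_ * _)]mulrCA -/(rav u x) -/(rav V x) -/U -/S.
    have -> : U = l * S by rewrite /l divfK // gt_eqF.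
    ring.
  apply: le_rav => // z _.
  have -> : u z `^ q * w z = V z * (u z / V z) `^ q.
    have -> : w z = V z * (V z)^-1 `^ q.
      rewrite -powR_inv1 ?(ltW (V0 z)) // -powRrM mulN1r -powR1D //.
      rewrite /V -powRrM (_ : _ * _ = 1) ?powRr1 ?(ltW (w0 z)) //; field; lra.
    by rewrite powRM ?invr_ge0 ?(ltW (V0 z)) // mulrCA.
  have := powR_tangent q1 (divr_ge0 (u0 z) (ltW (V0 z))) l0.
  move=> /(ler_wpM2l (ltW (V0 z))); apply: le_trans.
  rewrite le_eqVlt; apply/orP; left; apply/eqP.
  by field; rewrite gt_eqF.
have -> : U = l * S by rewrite /l divfK // gt_eqF.
rewrite powRM ?(ltW S0) // (powRS (ltW S0)) ?gt_eqF //; last by lra.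
by rewrite mulrA ler_wpM2r // powR_ge0.
Qed.

(** A_p multiplied out, with (l^2)^p = |J| |J|^(p-1). Integrability is included so that the
    integrals may be taken in the reals. *)
Definition Ap_bound (p A : R) w : Prop := forall (a : plane R) (l : R), 0 < l ->
  [/\ mu.-integrable (square a l) (EFin \o w),
      mu.-integrable (square a l) (EFin \o (fun z => w z `^ (- (p - 1)^-1))) &
      (\int[mu]_(z in square a l) w z) *
      (\int[mu]_(z in square a l) (w z `^ (- (p - 1)^-1))) `^ (p - 1) <= A * (l ^+ 2) `^ p].

(** Changing [w] on a null set makes it positive everywhere and leaves all integrals unchanged. *)
Lemma Ap_weight_bound (p : R) w : 1 < p -> Ap_weight p w -> exists w' : plane R -> R, exists A : R,
  [/\ measurable_fun [set: plane R] w', forall z, 0 < w' z, {ae mu, forall z, w z = w' z},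
      0 <= A & Ap_bound p A w'].
Proof.
move=> p1 [[mw w0 wloc] Aoo].
pose w' z := if 0 < w z then w z else 1.
have mw' : measurable_fun [set: plane R] w'.
  by apply: measurable_fun_ifT => //; exact: measurable_fun_ltr.
have w'0 z : 0 < w' z by rewrite /w'; case: ifP.
have ww' : {ae mu, forall z, w z = w' z}.
  by apply: filterS w0 => z; rewrite /w' => ->.
pose s := - (p - 1)^-1.
have ae1 J : ae_eq mu J (EFin \o w) (EFin \o w') by apply: filterS ww' => z h _ /=; rewrite h.
have ae2 J : ae_eq mu J (EFin \o (fun z => w z `^ s)) (EFin \o (fun z => w' z `^ s)).
  by apply: filterS ww' => z h _ /=; rewrite h.
have ms (v : plane R -> R) : measurable_fun [set: plane R] v -> measurable_fun [set: plane R] (fun z => v z `^ s).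
  by move=> mv; exact: (measurableT_comp (measurable_powR s) mv).
have p10 : 0 < p - 1 by lra.
have mJ (a : plane R) (l : R) : measurable (square a l) by exact: measurable_square.
have Eav a l (v v' : plane R -> R) : measurable_fun [set: plane R] v -> measurable_fun [set: plane R] v' ->
    ae_eq mu (square a l) (EFin \o v) (EFin \o v') -> 0 <= l ->
    average (square a l) v = (((l ^+ 2)^-1)%:E * \int[mu]_(z in square a l) (v' z)%:E)%E.
  move=> mv mv' vv' l0; rewrite /average lebesgue2_square //=; congr (_ * _)%E.
  apply: ae_eq_integral => //; apply/measurable_EFinP; exact: measurable_funTS.
have char_le a l : 0 < l -> (((l ^+ 2)^-1)%:E * \int[mu]_(z in square a l) (w' z)%:E *
    (((l ^+ 2)^-1)%:E * \int[mu]_(z in square a l) (w' z `^ s)%:E) `^ (p - 1) <= Ap_characteristic p w)%E.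
  move=> l0; rewrite -(Eav a l w w') ?(ltW l0) // -(Eav a l (fun z => w z `^ s)) ?(ltW l0) //; [|exact: ms..].
  apply: ereal_sup_ubound; exists (square a l) => //.
  by exists a, l.
have Afin : Ap_characteristic p w \is a fin_num.
  rewrite ge0_fin_numE //; apply: le_trans (char_le (0, 0) 1 ltr01).
  rewrite mule_ge0 ?poweR_ge0 // mule_ge0 ?lee_fin ?invr_ge0 ?sqr_ge0 //.
  by apply: integral_ge0 => z _; rewrite lee_fin ltW.
exists w', (fine (Ap_characteristic p w)); split => //.
  rewrite fine_ge0 //; apply: le_trans (char_le (0, 0) 1 ltr01).
  rewrite mule_ge0 ?poweR_ge0 // mule_ge0 ?lee_fin ?invr_ge0 ?sqr_ge0 //.
  by apply: integral_ge0 => z _; rewrite lee_fin ltW.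
move=> a l l0; have l20 : 0 < l ^+ 2 by rewrite exprn_gt0.
have iw : mu.-integrable (square a l) (EFin \o w').
  apply/integrableP; split; first by apply/measurable_EFinP; exact: measurable_funTS.
  apply: le_lt_trans (wloc (`[a.1, a.1 + l]%classic `*` `[a.2, a.2 + l]%classic) _); last first.
    by apply: compact_setX; exact: segment_compact.
  have mR : measurable (`[a.1, a.1 + l]%classic `*` `[a.2, a.2 + l]%classic : set (plane R)).
    by apply: measurableX; exact: measurable_itv.
  apply: le_trans (_ : (\int[mu]_(z in square a l) `|w z|%:E <= _)%E).
    rewrite le_eqVlt; apply/orP; left; apply/eqP; apply: ae_eq_integral => //.
    - by apply/measurable_EFinP/measurableT_comp => //; exact: measurable_funTS.
    - by apply/measurable_EFinP/measurableT_comp => //; exact: measurable_funTS.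
    - by apply: filterS ww' => z h _ /=; rewrite h.
  apply: ge0_subset_integral => //.
    by apply/measurable_EFinP/measurableT_comp => //; exact: measurable_funTS.
  by move=> z; rewrite /square /= !in_itv /= => -[/andP[-> /ltW ->] /andP[-> /ltW ->]].
have Iw0 : 0 < \int[mu]_(z in square a l) w' z.
  have h : (0 < mu (square a l))%E by rewrite lebesgue2_square ?(ltW l0) // lte_fin.
  by apply: Rintegral_gt0 => //; exact: h.
have EIw : (\int[mu]_(z in square a l) (w' z)%:E = (\int[mu]_(z in square a l) w' z)%:E)%E.
  by rewrite -[LHS]fineK // integrable_fin_num.
have := char_le a l l0; rewrite EIw.
have I20 : (0 <= \int[mu]_(z in square a l) (w' z `^ s)%:E)%E.
  by apply: integral_ge0 => z _; rewrite lee_fin powR_ge0.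
(* An infinite dual integral would make the A_p product infinite, because the integral of the weight
   over the square is positive. *)
case E2 : (\int[mu]_(z in square a l) (w' z `^ s)%:E)%E I20 => [I2| |] //= I20; last first.
  rewrite mulry gtr0_sg ?invr_gt0 // mul1e poweRyr ?gt_eqF // -EFinM mulry gtr0_sg ?mul1e; last first.
    by rewrite mulr_gt0 // invr_gt0.
  by rewrite leye_eq => /eqP h; rewrite h in Afin.
have E2' : \int[mu]_(z in square a l) (w' z `^ s) = I2 by rewrite /Rintegral E2.
rewrite lee_fin in I20; rewrite -!EFinM -{1}(fineK Afin) lee_fin => h.
split => //.
  apply/integrableP; split; first by apply/measurable_EFinP; apply: measurable_funTS; exact: ms.
  rewrite (_ : \int[mu]_(z in _) _ = I2%:E)%E ?ltry // -E2.
  by apply: eq_integral => z _; rewrite gee0_abs // lee_fin powR_ge0.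
rewrite E2'; move: h; rewrite powRM ?invr_ge0 ?(ltW l20) // => h.
have L0 : 0 < (l ^+ 2) `^ p by exact: powR_gt0.
rewrite -ler_pdivrMr //; apply: le_trans h; rewrite le_eqVlt; apply/orP; left; apply/eqP.
have -> : ((l ^+ 2) `^ p)^-1 = (l ^+ 2)^-1 * (l ^+ 2)^-1 `^ (p - 1).
  rewrite -powRS ?invr_ge0 ?(ltW l20) ?gt_eqF //; last by lra.
  by rewrite -(powR_inv1 (ltW l20)) -powRrM mulN1r powRN.
ring.
Qed.

Lemma Ap_bound_cell (p A : R) w M (x : cells M) : Ap_bound p A w ->
  mu.-integrable (cell x) (EFin \o w) /\
  mu.-integrable (cell x) (EFin \o (fun z => w z `^ (- (p - 1)^-1))).
Proof. by move=> H; have [] := H (corner x) (mesh M) (mesh_gt0 M). Qed.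

Lemma sum_rav_subset M (P : pred (cells M)) v (a : plane R) (l : R) :
  measurable_fun [set: plane R] v -> (forall z, 0 <= v z) -> mu.-integrable (square a l) (EFin \o v) ->
  (forall y : cells M, P y -> cell y `<=` @square R a l) ->
  mesh M ^+ 2 * \sum_(y | P y) rav v y <= \int[mu]_(z in square a l) v z.
Proof.
move=> mv v0 iv PJ; have mJ := @measurable_square R a l.
have mJv : measurable_fun [set: plane R] (fun z => \1_(square a l) z * v z).
  by apply: measurable_funM => //; exact: measurable_indic.
have Jv0 z : 0 <= \1_(square a l) z * v z by rewrite mulr_ge0.
have := sum_integral_cell M mJv Jv0; rewrite integral_indicM => H.
have fin : (\int[mu]_(z in square a l) (v z)%:E)%E \is a fin_num by exact: integrable_fin_num.
rewrite -lee_fin -[leRHS]/((fine _)%:E) [leRHS]fineK //; apply: le_trans H.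
rewrite mulr_sumr -sumEFin [leRHS](bigID P) /= -[leLHS]adde0 leeD //; last first.
  by apply: sume_ge0 => y _; apply: integral_ge0 => z _; rewrite lee_fin.
apply: lee_sum => y Py; rewrite -Rintegral_cell_rav.
have iy : mu.-integrable (cell y) (EFin \o v).
  by apply: integrableS iv => //; [exact: measurable_cell|exact: PJ].
rewrite -[leLHS]/((fine _)%:E) fineK ?integrable_fin_num //; last exact: measurable_cell.
rewrite le_eqVlt; apply/orP; left; apply/eqP; apply: eq_integral => z.
by rewrite inE => yz; rewrite indicE mem_set ?mul1r //; exact: (PJ y).
Qed.

Lemma near_cube_square M k (x y : cells M) : near_cube k x y -> cell y `<=`
  @square R (((x.1 %/ 2 ^ k)%N%:R - 1) * (2 ^+ k * mesh M) - 2 ^+ M,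
             ((x.2 %/ 2 ^ k)%N%:R - 1) * (2 ^+ k * mesh M) - 2 ^+ M) (3 * (2 ^+ k * mesh M)).
Proof.
move=> /andP[a b] z /cellE[yz1 yz2].
have key (i j : nat) (t : R) : adjn (i %/ 2 ^ k) (j %/ 2 ^ k) ->
    j%:R <= (t + 2 ^+ M) * 2 ^+ M < j%:R + 1 ->
    t \in `[((i %/ 2 ^ k)%N%:R - 1) * (2 ^+ k * mesh M) - 2 ^+ M,
            ((i %/ 2 ^ k)%N%:R - 1) * (2 ^+ k * mesh M) - 2 ^+ M + 3 * (2 ^+ k * mesh M)[.
  move=> /andP[h1 h2] /andP[h3 h4]; rewrite in_itv /=.
  set q := (i %/ 2 ^ k)%N in h1 h2 *; set r := (j %/ 2 ^ k)%N in h1 h2 *.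
  have K0 : 0 < 2 ^+ k :> R by rewrite exprn_gt0.
  have P0 : 0 < 2 ^+ M :> R by rewrite exprn_gt0.
  have d1 : r%:R * 2 ^+ k <= j%:R :> R by rewrite -natrX -natrM ler_nat leq_divM.
  have d2 : j%:R + 1 <= (r%:R + 1) * 2 ^+ k :> R.
    by rewrite -natrX natr1 natr1 -natrM ler_nat ltn_ceil // expn_gt0.
  have q1 : q%:R - 1 <= r%:R :> R by rewrite lerBlDr natr1 ler_nat.
  have q2 : r%:R <= q%:R + 1 :> R by rewrite natr1 ler_nat.
  set s := (t + 2 ^+ M) * 2 ^+ M in h3 h4.
  have -> : t = s * mesh M - 2 ^+ M by rewrite /s /mesh mulfK ?addrK // gt_eqF.
  rewrite lerD2r addrAC ltrD2r !mulrA -mulrDl ler_pM2r ?mesh_gt0 // ltr_pM2r ?mesh_gt0 //.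
  apply/andP; split.
    by apply: le_trans h3; apply: le_trans d1; rewrite ler_pM2r.
  apply: lt_le_trans h4 _; apply: le_trans d2 _; rewrite -mulrDl ler_pM2r //; lra.
by split; [exact: key a yz1|exact: key b yz2].
Qed.

(** By Jensen's inequality the dual power of an average is at most the average of the dual power, so
    A_p on the tripled square passes to cell averages. The factor 9^p comes from (3 l)^2 = 9 l^2. *)
Lemma Apair_rav (p A : R) w M : 1 < p -> 0 <= A -> measurable_fun [set: plane R] w -> (forall z, 0 < w z) ->
  Ap_bound p A w -> Apair M.*2.+1 near_cube p (9 `^ p * A) (fun x : cells M => rav w x).
Proof.
move=> p1 A0 mw w0 H; have p10 : 0 < p - 1 by lra.
have W0 (x : cells M) : 0 < rav w x.
  by apply: rav_gt0 => //; case: (Ap_bound_cell x H).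
split => // k x kN.
pose s := - (p - 1)^-1; rewrite -/s.
set l := 2 ^+ k * mesh M : R.
have l0 : 0 < l by rewrite mulr_gt0 ?mesh_gt0 ?exprn_gt0.
set c : plane R := ((((x.1 %/ 2 ^ k)%N%:R - 1) * l - 2 ^+ M,
             ((x.2 %/ 2 ^ k)%N%:R - 1) * l - 2 ^+ M)).
have l30 : 0 < 3 * l by rewrite mulr_gt0.
have [iw iv HA] := H c (3 * l) l30; rewrite -/s in iv HA.
have sub y : near_cube k x y -> cell y `<=` square c (3 * l) by exact: near_cube_square.
have mv : measurable_fun [set: plane R] (fun z => w z `^ s).
  exact: (measurableT_comp (measurable_powR s) mw).
have h20 : 0 < mesh M ^+ 2 :> R by rewrite exprn_gt0 ?mesh_gt0.
have Ek : 4 ^- k = mesh M ^+ 2 / l ^+ 2 :> R.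
  rewrite /l exprMn invfM mulrCA mulfV ?mulr1 ?gt_eqF //.
  by rewrite -exprM mulnC exprM expr2 -natrM.
have Jensen (y : cells M) : rav w y `^ s <= rav (fun z => w z `^ s) y.
  have [iwy ivy] := Ap_bound_cell y H; rewrite -/s in ivy.
  have i1 : mu.-integrable (cell y) (EFin \o cst 1) by exact: integrable_cst_cell.
  have E : (fun z => cst 1 z `^ p * w z) = w :> (plane R -> R).
    by apply/funext => z; rewrite powR1 mul1r.
  have := @holder_cell M y p (cst 1) w p1 (fun _ => ler01) w0 i1.
  rewrite E -/s => /(_ iwy ivy).
  rewrite (rav_const (a := 1)) // powR1 => h.
  have S0 : 0 <= rav (fun z => w z `^ s) y.
    by rewrite mulr_ge0 ?invr_ge0 ?sqr_ge0 // Rintegral_ge0 // => z _; exact: powR_ge0.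
  have h' : (rav w y)^-1 <= rav (fun z => w z `^ s) y `^ (p - 1).
    by rewrite -[leLHS]mul1r ler_pdivrMr // mulrC.
  rewrite /s powRN -powR_inv1 ?powR_ge0 // -powRrM mulrN1 -[X in _ `^ X]mulN1r powRrM powR_inv1 ?(ltW (W0 y)) //.
  apply: le_trans (ler_powR2 _ _ h') _; rewrite ?invr_ge0 ?(ltW p10) ?(ltW (W0 y)) //.
  by rewrite powRK // gt_eqF.
have nb_le v : measurable_fun [set: plane R] v -> (forall z, 0 <= v z) ->
    mu.-integrable (square c (3 * l)) (EFin \o v) ->
    avn near_cube k (fun y : cells M => rav v y) x <= (l ^+ 2)^-1 * \int[mu]_(z in square c (3 * l)) v z.
  move=> mv' v0 iv'; rewrite /avn Ek [mesh M ^+ 2 / _]mulrC -mulrA ler_wpM2l ?invr_ge0 ?sqr_ge0 //.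
  exact: sum_rav_subset.
set I1 := \int[mu]_(z in _) w z in HA; set I2 := \int[mu]_(z in _) _ in HA.
have I10 : 0 <= I1 by apply: Rintegral_ge0 => z _; exact: ltW.
have I20 : 0 <= I2 by apply: Rintegral_ge0 => z _; exact: powR_ge0.
have L0 : 0 < l ^+ 2 by rewrite exprn_gt0.
apply: le_trans (_ : (l ^+ 2)^-1 * I1 * ((l ^+ 2)^-1 * I2) `^ (p - 1) <= _).
  apply: ler_pM; rewrite ?powR_ge0 //.
  - by apply: avn_ge0 => y; exact: ltW.
  - by apply: nb_le => // z; exact: ltW.
  - apply: ler_powR2; first exact: ltW.
      by apply: avn_ge0 => y; exact: powR_ge0.
    apply: le_trans (nb_le _ mv _ iv); last by move=> z; exact: powR_ge0.
    by apply: le_avn => y _; exact: Jensen.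
rewrite powRM ?invr_ge0 ?(ltW L0) // mulrACA -powRS ?invr_ge0 ?(ltW L0) ?gt_eqF //; last by lra.
rewrite -(powR_inv1 (ltW L0)) -powRrM mulN1r powRN mulrC ler_pdivrMr ?powR_gt0 //.
apply: le_trans HA _; rewrite exprMn powRM ?(ltW L0) ?exprn_ge0 //.
by rewrite -natrX mulrA [A * _]mulrC.
Qed.

(** Averaging over cells is bounded on L^p(w): Hoelder's inequality against the dual weight, then
    A_p on the cell itself. *)
Lemma sum_rav_weight (p A : R) w M u : 1 < p -> 0 <= A ->
  measurable_fun [set: plane R] w -> (forall z, 0 < w z) -> Ap_bound p A w -> L2 u ->
  mu.-integrable setT (EFin \o (fun z => `|u z| `^ p * w z)) ->
  mesh M ^+ 2 * \sum_(x : cells M) `|rav u x| `^ p * rav w x <= A * \int[mu]_z (`|u z| `^ p * w z).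
Proof.
move=> p1 A0 mw w0 H Lu iup; have [mf _] := Lu.
have p10 : 0 < p - 1 by lra.
have p0 : 0 < p by lra.
have mup : measurable_fun [set: plane R] (fun z => `|u z| `^ p * w z).
  apply: measurable_funM => //; apply: (measurableT_comp (measurable_powR p)).
  exact: measurableT_comp.
have up0 z : 0 <= `|u z| `^ p * w z by rewrite mulr_ge0 ?powR_ge0 // ltW.
have h20 : 0 < mesh M ^+ 2 :> R by rewrite exprn_gt0 ?mesh_gt0.
apply: le_trans (_ : A * \sum_(x : cells M) \int[mu]_(z in cell x) (`|u z| `^ p * w z) <= _); last first.
  rewrite ler_wpM2l // -lee_fin -sumEFin.
  rewrite -[leRHS]/((fine _)%:E) [leRHS]fineK ?integrable_fin_num //.
  apply: le_trans (sum_integral_cell M mup up0); apply: lee_sum => x _.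
  rewrite -[leLHS]/((fine _)%:E) fineK // integrable_fin_num //; first exact: measurable_cell.
  by apply: integrableS iup => //; exact: measurable_cell.
rewrite !mulr_sumr; apply: ler_sum => x _; rewrite Rintegral_cell_rav [leRHS]mulrCA ler_wpM2l ?(ltW h20) //.
have [iwx ivx] := Ap_bound_cell x H.
have iux := L2_integrable_cell x Lu.
have iax : mu.-integrable (cell x) (EFin \o (fun z => `|u z|)).
  have := integrable_abse iux; by apply: eq_integrable => //; exact: measurable_cell.
have iupx : mu.-integrable (cell x) (EFin \o (fun z => `|u z| `^ p * w z)).
  by apply: integrableS iup => //; exact: measurable_cell.
have hol := holder_cell p1 (fun z => normr_ge0 (u z)) w0 iax iupx ivx.
have rw0 : 0 <= rav w x by rewrite mulr_ge0 ?invr_ge0 ?sqr_ge0 // Rintegral_ge0 // => z _; exact: ltW.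
apply: le_trans (_ : (rav (fun z => `|u z|) x) `^ p * rav w x <= _).
  rewrite ler_wpM2r //; apply: ler_powR2; [exact: ltW|exact: normr_ge0|].
  rewrite /rav normrM ger0_norm ?invr_ge0 ?sqr_ge0 // ler_wpM2l ?invr_ge0 ?sqr_ge0 //.
  by apply: le_normr_Rintegral => //; exact: measurable_cell.
apply: le_trans (ler_wpM2r rw0 hol) _; rewrite -mulrA [leRHS]mulrC ler_wpM2l //.
  by rewrite mulr_ge0 ?invr_ge0 ?sqr_ge0 // Rintegral_ge0.
have [_ _] := H (corner x) (mesh M) (mesh_gt0 M).
rewrite -/(cell x) !Rintegral_cell_rav powRM ?(ltW h20) //; last first.
  by rewrite mulr_ge0 ?invr_ge0 ?sqr_ge0 // Rintegral_ge0 // => z _; exact: powR_ge0.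
rewrite mulrACA -powRS ?(ltW h20) ?(gt_eqF p0) //.
by rewrite mulrC ler_pM2r ?powR_gt0 // mulrC.
Qed.

End CellWeights.

(** * Kernels on cells *)

Section KernelEstimates.
Context {R : realType}.
Implicit Types (x y w : plane R) (k : plane R -> plane R -> R).

Definition rmin x y : R := Num.min `|x.1 - y.1| `|x.2 - y.2|.
Definition rmax x y : R := Num.max `|x.1 - y.1| `|x.2 - y.2|.

Lemma off_diag_gt0 x y : off_diag x y -> 0 < `|x.1 - y.1| /\ 0 < `|x.2 - y.2|.
Proof. by move=> [h1 h2]; rewrite !normr_gt0 !subr_eq0. Qed.

Lemma rmin_gt0 x y : off_diag x y -> 0 < rmin x y.
Proof. by move=> /off_diag_gt0[h1 h2]; rewrite /rmin lt_min h1. Qed.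

Lemma rmin_le_rmax x y : rmin x y <= rmax x y.
Proof. by rewrite /rmin /rmax; case: (leP `|x.1 - y.1| `|x.2 - y.2|) => // /ltW. Qed.

Lemma rmax_gt0 x y : off_diag x y -> 0 < rmax x y.
Proof. by move=> /rmin_gt0/lt_le_trans; apply; exact: rmin_le_rmax. Qed.

Lemma rmin_rmax x y : rmin x y * rmax x y = `|x.1 - y.1| * `|x.2 - y.2|.
Proof. by rewrite /rmin /rmax; case: (leP `|x.1 - y.1| `|x.2 - y.2|) => //; rewrite mulrC. Qed.

Lemma eccentricity_ge x y : off_diag x y -> rmax x y / rmin x y <= eccentricity x y.
Proof.
move=> /off_diag_gt0[h1 h2]; rewrite /rmax /rmin /eccentricity.
by case: (leP `|x.1 - y.1| `|x.2 - y.2|) => _; rewrite (lerDl, lerDr) divr_ge0.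
Qed.

Lemma eccentricityC x y : eccentricity x y = eccentricity y x.
Proof. by rewrite /eccentricity !(distrC x.1) !(distrC x.2). Qed.

Lemma powRN_anti (a b e : R) : 0 <= e -> 0 < a -> a <= b -> b `^ (- e) <= a `^ (- e).
Proof.
move=> e0 a0 ab; rewrite !powRN lef_pV2 ?posrE ?powR_gt0 ?(lt_le_trans a0 ab) //.
by apply: ler_powR2 => //; exact: ltW.
Qed.

(** With r <= R the two distances, the size is r^-e R^(e-2), and an increment d of one coordinate
    gains d^e at the price of a further r^-e. Both kinds of kernel in part (2) satisfy this for
    every small e, which lets them be treated together. *)
Definition czx_real (e C : R) k : Prop :=
  (forall x y, off_diag x y -> `|k x y| <= C * (rmin x y `^ (- e) * rmax x y `^ (e - 2))) /\
  (forall x w y, off_diag x y -> x.1 = w.1 \/ x.2 = w.2 ->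
     `|x.1 - w.1| <= `|x.1 - y.1| / 2 -> `|x.2 - w.2| <= `|x.2 - y.2| / 2 ->
     `|k x y - k w y| <= C * (`|x.1 - w.1| `^ e + `|x.2 - w.2| `^ e) *
        (rmin x y `^ (- (2 * e)) * rmax x y `^ (e - 2))).

Lemma ln_le_powR (t e : R) : 0 < e -> 0 < t -> ln t <= e^-1 * t `^ e.
Proof.
move=> e0 t0; rewrite -(ler_pM2l e0) mulrA mulfV ?gt_eqF // mul1r -ln_powR.
have := @le_ln1Dx R (t `^ e - 1); rewrite subrKC => h.
by have := powR_gt0 e t0; move=> h'; have := h _; lra.
Qed.

(** The eccentricity is at least R / r, so its power e - 1 divided by r R is at most r^-e R^(e-2).
    As an increment is at most half the distance, the Hoelder exponent t may be lowered to e. *)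
Lemma czx_of_estimates (D : plane R -> plane R -> R) (t e : R) k (C : R) : 0 < e <= 1 -> e <= t ->
  (forall x y, off_diag x y -> 0 <= D x y <= e^-1 * eccentricity x y `^ (e - 1)) -> 0 <= C ->
  (forall x y, off_diag x y -> `|k x y| <= C * `|x.1 - y.1|^-1 * `|x.2 - y.2|^-1 * D x y) ->
  (forall x y (w1 : R), off_diag x y -> `|x.1 - w1| <= `|x.1 - y.1| / 2 ->
    `|k x y - k (w1, x.2) y| <=
      C * (`|x.1 - w1| `^ t / `|x.1 - y.1| `^ (1 + t)) * `|x.2 - y.2|^-1 * D x y) ->
  (forall x y (w2 : R), off_diag x y -> `|x.2 - w2| <= `|x.2 - y.2| / 2 ->
    `|k x y - k (x.1, w2) y| <=
      C * `|x.1 - y.1|^-1 * (`|x.2 - w2| `^ t / `|x.2 - y.2| `^ (1 + t)) * D x y) ->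
  czx_real e (C * e^-1) k.
Proof.
move=> /andP[e0 e1] et HD C0 Hs H1 H2; have ei : 0 <= e^-1 by rewrite invr_ge0 ltW.
have DE x y : off_diag x y -> `|x.1 - y.1|^-1 * `|x.2 - y.2|^-1 * D x y <=
    e^-1 * (rmin x y `^ (- e) * rmax x y `^ (e - 2)).
  move=> od; have [h1 h2] := off_diag_gt0 od.
  have m0 := rmin_gt0 od; have M0 := rmax_gt0 od.
  rewrite -invfM -rmin_rmax; set m := rmin x y in m0 *; set M := rmax x y in M0 *.
  apply: le_trans (_ : (m * M)^-1 * (e^-1 * (m / M) `^ (1 - e)) <= _).
    rewrite ler_wpM2l ?invr_ge0 ?mulr_ge0 ?(ltW m0) ?(ltW M0) //.
    apply: le_trans (proj2 (andP (HD x y od))) _; rewrite ler_wpM2l //.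
    have -> : m / M = (M / m)^-1 by rewrite invf_div.
    have -> : (e - 1) = - (1 - e) by ring.
    rewrite -powR_inv1 ?divr_ge0 ?(ltW m0) ?(ltW M0) // -powRrM mulN1r.
    apply: powRN_anti; rewrite ?subr_ge0 ?divr_gt0 //; exact: eccentricity_ge.
  rewrite mulrCA ler_wpM2l // le_eqVlt; apply/orP; left; apply/eqP.
  rewrite powRM ?invr_ge0 ?(ltW m0) ?(ltW M0) // invfM mulrACA.
  congr (_ * _).
    rewrite -(powR_inv1 (ltW m0)) -powRD ?(gt_eqF m0) ?implybT //; congr (_ `^ _); ring.
  rewrite -(powR_inv1 (ltW M0)) -powRrM -powRD ?(gt_eqF M0) ?implybT //; congr (_ `^ _); ring.
have ratio (d r m : R) : 0 <= d -> 0 < r -> d <= r / 2 -> 0 < m -> m <= r ->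
    d `^ t / r `^ (1 + t) <= r^-1 * (d `^ e * m `^ (- e)).
  move=> d0 r0 dr m0 mr; rewrite powR1D // invfM mulrCA ler_wpM2l ?invr_ge0 ?(ltW r0) //.
  have -> : d `^ t / r `^ t = (d / r) `^ t.
    by rewrite powRM ?invr_ge0 ?(ltW r0) // -(powR_inv1 (ltW r0)) -powRrM mulN1r powRN.
  set q := d / r; have q0 : 0 <= q by rewrite divr_ge0 // ltW.
  have q1 : q <= 1 by rewrite ler_pdivrMr // mul1r (le_trans dr) // ler_pdivrMr // ler_peMr ?(ltW r0) //; lra.
  rewrite (_ : d `^ e = q `^ e * r `^ e); last by rewrite -powRM ?(ltW r0) // /q divfK // gt_eqF.
  rewrite -mulrA.
  apply: le_trans (_ : q `^ e * 1 <= _).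
    rewrite mulr1; have [->|qn] := eqVneq q 0.
      by rewrite !powR0 ?gt_eqF // (lt_le_trans e0 et).
    have qp : 0 < q by rewrite lt_neqAle eq_sym qn.
    by apply: ger_powR => //; rewrite qp.
  rewrite ler_wpM2l ?powR_ge0 // powRN ler_pdivlMr ?powR_gt0 // mul1r.
  by apply: ler_powR2 => //; exact: ltW.
split=> [x y od|x w y od xw dx1 dx2].
  rewrite -mulrA; apply: le_trans (Hs x y od) _; rewrite -!mulrA ler_wpM2l //.
  by rewrite mulrA; exact: DE.
have [h1 h2] := off_diag_gt0 od.
have m0 := rmin_gt0 od; have M0 := rmax_gt0 od.
have main (d r r' : R) : 0 <= d -> 0 < r -> d <= r / 2 -> rmin x y <= r -> 0 < r' ->
   r^-1 * r'^-1 * D x y <= e^-1 * (rmin x y `^ (- e) * rmax x y `^ (e - 2)) ->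
   0 <= D x y ->
   C * (d `^ t / r `^ (1 + t)) * r'^-1 * D x y <=
   C * e^-1 * d `^ e * (rmin x y `^ (- (2 * e)) * rmax x y `^ (e - 2)).
  move=> d0 r0 dr mr r'0 HH D0; have := ratio d r (rmin x y) d0 r0 dr m0 mr.
  set X := _ / r `^ (1 + t); clearbody X => H.
  have pos' : 0 <= r'^-1 * D x y by rewrite mulr_ge0 ?invr_ge0 // ltW.
  rewrite -!mulrA ler_wpM2l //; apply: le_trans (ler_wpM2r pos' H) _.
  have -> : rmin x y `^ (- (2 * e)) = rmin x y `^ (- e) * rmin x y `^ (- e).
    by rewrite -powRD ?(gt_eqF m0) ?implybT //; congr (_ `^ _); ring.
  have pos : 0 <= d `^ e * rmin x y `^ (- e) by rewrite mulr_ge0 ?powR_ge0.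
  have := ler_wpM2l pos HH.
  move: (d `^ e) (rmin x y `^ (- e)) (rmax x y `^ (e - 2)) (e^-1) (r^-1) (r'^-1) (D x y).
  move=> a b c f g h i; rewrite !mulrA => hh.
  have -> : g * a * b * h * i = a * b * g * h * i by ring.
  by have -> : f * a * b * b * c = a * b * f * b * c by ring.
have /andP[D0 _] := HD x y od.
have DE' := DE x y od; have DE'' := DE'; rewrite [_^-1 * _^-1]mulrC in DE''.
have n1 : rmin x y <= `|x.1 - y.1| by rewrite /rmin ge_min lexx.
have n2 : rmin x y <= `|x.2 - y.2| by rewrite /rmin ge_min lexx orbT.
case: xw => [e1' | e2'].
  have -> : w = (x.1, w.2) by rewrite [LHS]surjective_pairing e1'.
  rewrite /= subrr normr0 powR0 ?gt_eqF // add0r.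
  apply: le_trans (H2 x y w.2 od dx2) _.
  rewrite [leLHS](_ : _ = C * (`|x.2 - w.2| `^ t / `|x.2 - y.2| `^ (1 + t)) / `|x.1 - y.1| * D x y); last first.
    by congr (_ * _); rewrite mulrAC.
  exact: main.
have -> : w = (w.1, x.2) by rewrite [LHS]surjective_pairing e2'.
rewrite /= subrr normr0 powR0 ?gt_eqF // addr0.
by apply: le_trans (H1 x y w.1 od dx1) _; exact: main.
Qed.

(** Removes the closeness condition: when it fails, both smaller distances are at most 3 rho and the
    size estimate alone gives the bound. *)
Lemma czx_increment (e C : R) k (rho : R) x w y : 0 < e <= 1 -> 0 <= C -> czx_real e C k ->
  off_diag x y -> off_diag w y -> x.1 = w.1 \/ x.2 = w.2 ->
  `|x.1 - w.1| <= rho -> `|x.2 - w.2| <= rho ->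
  `|k x y - k w y| <= 3 * C * rho `^ e *
     (rmin x y `^ (- (2 * e)) * rmax x y `^ (e - 2) + rmin w y `^ (- (2 * e)) * rmax w y `^ (e - 2)).
Proof.
move=> /andP[e0 e1] C0 [Hs Hh] odx odw xw d1 d2.
have rho0 : 0 <= rho by exact: le_trans d1.
set F := fun v => rmin v y `^ (- (2 * e)) * rmax v y `^ (e - 2).
have F0 v : 0 <= F v by rewrite mulr_ge0 ?powR_ge0.
rewrite -/(F x) -/(F w).
have [/andP[a1 a2]|far] := boolP ((`|x.1 - w.1| <= `|x.1 - y.1| / 2) && (`|x.2 - w.2| <= `|x.2 - y.2| / 2)).
  apply: le_trans (Hh x w y odx xw a1 a2) _; rewrite -/(F x).
  apply: le_trans (_ : 2 * C * rho `^ e * F x <= _).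
    rewrite ler_wpM2r // [2 * C]mulrC -mulrA ler_wpM2l // mulr_natl mulr2n.
    by rewrite lerD // ler_powR2 // ltW.
  have P0 : 0 <= C * rho `^ e by rewrite mulr_ge0 ?powR_ge0.
  have := mulr_ge0 P0 (F0 x); have := mulr_ge0 P0 (F0 w).
  by rewrite -!mulrA !mulrDr !mulrA; lra.
have close : rmin x y <= 3 * rho /\ rmin w y <= 3 * rho.
  have [h1 h2] := off_diag_gt0 odx.
  move: far; rewrite negb_and -!ltNge => /orP[] h.
    have hx : `|x.1 - y.1| <= 2 * rho by lra.
    have hw : `|w.1 - y.1| <= 3 * rho.
      have := ler_distD x.1 w.1 y.1; rewrite [`|w.1 - x.1|]distrC; lra.
    by split; rewrite /rmin ge_min ?hw //; apply/orP; left; lra.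
  have hx : `|x.2 - y.2| <= 2 * rho by lra.
  have hw : `|w.2 - y.2| <= 3 * rho.
    have := ler_distD x.2 w.2 y.2; rewrite [`|w.2 - x.2|]distrC; lra.
  by split; rewrite /rmin ge_min ?hw ?orbT //; apply/orP; right; lra.
have size v : off_diag v y -> rmin v y <= 3 * rho -> `|k v y| <= 3 * C * rho `^ e * F v.
  move=> od le; apply: le_trans (Hs v y od) _.
  have m0 := rmin_gt0 od.
  have -> : rmin v y `^ (- e) = rmin v y `^ e * rmin v y `^ (- (2 * e)).
    by rewrite -powRD ?(gt_eqF m0) ?implybT //; congr (_ `^ _); ring.
  rewrite -mulrA -/(F v) mulrA ler_wpM2r // [3 * C]mulrC -mulrA ler_wpM2l //.
  apply: le_trans (ler_powR2 (ltW e0) (ltW m0) le) _; rewrite powRM // ler_wpM2r ?powR_ge0 //.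
  by rewrite ler1_powR //; lra.
have [lx lw] := close.
rewrite mulrDr; apply: le_trans (ler_normB _ _) _; apply: lerD; exact: size.
Qed.

(** The coordinates are changed one at a time through [v]. One coordinate distance of [v] to y is
    that of w and the other that of x, so the intermediate terms have the same form. *)
Lemma czx_difference (e C : R) k (rho r : R) x w y : 0 < e <= 1 -> 0 <= C -> 0 < r -> czx_real e C k ->
  off_diag x y -> off_diag w y ->
  `|x.1 - w.1| <= rho -> `|x.2 - w.2| <= rho ->
  r <= rmax x y -> r <= rmax w y -> r <= rmax (w.1, x.2) y ->
  `|k x y - k w y| <= 9 * C * rho `^ e * r `^ (e - 2) *
     (`|x.1 - y.1| `^ (- (2 * e)) + `|x.2 - y.2| `^ (- (2 * e)) +
      (`|w.1 - y.1| `^ (- (2 * e)) + `|w.2 - y.2| `^ (- (2 * e)))).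
Proof.
move=> e01 C0 r0 H odx odw d1 d2 rx rw rv; have /andP[e0 e1] := e01.
have rho0 : 0 <= rho by exact: le_trans d1.
pose v : plane R := (w.1, x.2).
have odv : off_diag v y by case: odx; case: odw.
have v1 : `|v.1 - w.1| <= rho by rewrite /= subrr normr0.
have v2 : `|x.2 - v.2| <= rho by rewrite /= subrr normr0.
have I1 := czx_increment e01 C0 H odx odv (or_intror erefl) d1 v2.
have I2 := czx_increment e01 C0 H odv odw (or_introl erefl) v1 d2.
have B u : off_diag u y -> r <= rmax u y -> rmin u y `^ (- (2 * e)) * rmax u y `^ (e - 2) <=
    r `^ (e - 2) * (`|u.1 - y.1| `^ (- (2 * e)) + `|u.2 - y.2| `^ (- (2 * e))).
  move=> od ru; rewrite mulrC ler_pM ?powR_ge0 //.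
    have -> : e - 2 = - (2 - e) by ring.
    by apply: powRN_anti => //; lra.
  by rewrite /rmin; case: (leP `|u.1 - y.1| `|u.2 - y.2|) => _; rewrite (lerDl, lerDr) powR_ge0.
have Bx := B x odx rx; have Bw := B w odw rw; have Bv := B v odv rv; rewrite /= in Bv.
have Q0 : 0 <= 3 * C * rho `^ e by rewrite !mulr_ge0 ?powR_ge0.
apply: le_trans (_ : `|k x y - k v y| + `|k v y - k w y| <= _).
  by rewrite -(subrKA (k v y) (k x y)); exact: ler_normD.
apply: le_trans (lerD I1 I2) _; rewrite -mulrDr.
have -> : 9 * C * rho `^ e * r `^ (e - 2) *
     (`|x.1 - y.1| `^ (- (2 * e)) + `|x.2 - y.2| `^ (- (2 * e)) +
      (`|w.1 - y.1| `^ (- (2 * e)) + `|w.2 - y.2| `^ (- (2 * e)))) =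
   3 * C * rho `^ e * (3 * (r `^ (e - 2) *
     (`|x.1 - y.1| `^ (- (2 * e)) + `|x.2 - y.2| `^ (- (2 * e)) +
      (`|w.1 - y.1| `^ (- (2 * e)) + `|w.2 - y.2| `^ (- (2 * e)))))) by ring.
rewrite ler_wpM2l //; apply: le_trans (lerD (lerD Bx Bv) (lerD Bv Bw)) _.
rewrite -!mulrDr mulrCA ler_wpM2l ?powR_ge0 //.
have := powR_ge0 `|x.1 - y.1| (- (2 * e)); have := powR_ge0 `|x.2 - y.2| (- (2 * e)).
have := powR_ge0 `|w.1 - y.1| (- (2 * e)); have := powR_ge0 `|w.2 - y.2| (- (2 * e)).
lra.
Qed.

End KernelEstimates.

(** * Rows and entries of the matrix of a kernel *)

Section CellKernel.
Context {R : realType}.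
Local Notation mu := (@lebesgue2 R).
Implicit Types (x y w z : plane R) (k : plane R -> plane R -> R).

Definition in_slot (M i : nat) (t : R) : bool := i%:R <= (t + 2 ^+ M) * 2 ^+ M < i%:R + 1.

Lemma in_slot_far M i l d (t s : R) : in_slot M i t -> in_slot M l s -> (0 < d)%N ->
  ~~ adjn (i %/ d) (l %/ d) -> d%:R * mesh M <= `|t - s|.
Proof.
move=> /andP[a1 a2] /andP[b1 b2] d0; rewrite /adjn negb_and -!ltnNge => H.
have P0 : 0 < 2 ^+ M :> R by rewrite exprn_gt0.
have E : `|t - s| = `|(t + 2 ^+ M) * 2 ^+ M - (s + 2 ^+ M) * 2 ^+ M| * mesh M.
  rewrite -mulrBl normrM (gtr0_norm P0) -mulrA mulfV ?gt_eqF // mulr1; congr `|_|; ring.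
rewrite E ler_pM2r ?mesh_gt0 //; move: (_ * _) (_ * _) a1 a2 b1 b2 => u v a1 a2 b1 b2.
have far (i' l' : nat) (u' v' : R) : ((l' %/ d).+1 < i' %/ d)%N -> i'%:R <= u' -> v' < l'%:R + 1 -> d%:R <= u' - v'.
  move=> h h1 h2.
  have : (l' + 1 + d <= i')%N.
    have := ltn_ceil l' d0; have := leq_divM i' d; move: h.
    move: (i' %/ d)%N (l' %/ d)%N => q r h; have : (r.+2 * d <= q * d)%N by rewrite leq_mul2r h orbT.
    rewrite !mulSn; lia.
  by rewrite -(ler_nat R) !natrD; lra.
case/orP: H => H.
  by apply: le_trans (ler_norm _); exact: (far i l).
by rewrite distrC; apply: le_trans (ler_norm _); exact: (far l i).
Qed.

Lemma in_slot_near M i i' d (t t' : R) : in_slot M i t -> in_slot M i' t' -> (0 < d)%N ->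
  (i %/ d = i' %/ d)%N -> `|t - t'| <= d%:R * mesh M.
Proof.
move=> /andP[a1 a2] /andP[b1 b2] d0 ii.
have P0 : 0 < 2 ^+ M :> R by rewrite exprn_gt0.
have E : `|t - t'| = `|(t + 2 ^+ M) * 2 ^+ M - (t' + 2 ^+ M) * 2 ^+ M| * mesh M.
  rewrite -mulrBl normrM (gtr0_norm P0) -mulrA mulfV ?gt_eqF // mulr1; congr `|_|; ring.
rewrite E ler_pM2r ?mesh_gt0 //; move: (_ * _) (_ * _) a1 a2 b1 b2 => u v a1 a2 b1 b2.
have near (i1 i2 : nat) : (i1 %/ d = i2 %/ d)%N -> i1%:R + 1 <= i2%:R + d%:R :> R.
  move=> h; rewrite -natrD natr1 ler_nat.
  have := ltn_ceil i1 d0; have := leq_divM i2 d; rewrite h mulSn; lia.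
have := near _ _ ii; have := near _ _ (esym ii).
by rewrite ler_norml; lra.
Qed.

Lemma in_slot_dist M i l (t s : R) : in_slot M i t -> in_slot M l s ->
  ((distn i l)%:R - 1) * mesh M <= `|t - s| <= ((distn i l)%:R + 1) * mesh M.
Proof.
move=> /andP[a1 a2] /andP[b1 b2].
have P0 : 0 < 2 ^+ M :> R by rewrite exprn_gt0.
have E : `|t - s| = `|(t + 2 ^+ M) * 2 ^+ M - (s + 2 ^+ M) * 2 ^+ M| * mesh M.
  rewrite -mulrBl normrM (gtr0_norm P0) -mulrA mulfV ?gt_eqF // mulr1; congr `|_|; ring.
rewrite E !ler_pM2r ?mesh_gt0 //; move: (_ * _) (_ * _) a1 a2 b1 b2 => u v a1 a2 b1 b2.
rewrite /distn; case: (leqP i l) => h.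
  rewrite (eqP h) add0n natrB //.
  have hR : i%:R <= l%:R :> R by rewrite ler_nat.
  by have := ler_norm (u - v); rewrite [`|u - v|]distrC ler_norml; lra.
have h' := ltnW h; rewrite (eqP h') addn0 natrB //.
have hR : l%:R <= i%:R :> R by rewrite ler_nat.
by have := ler_norm (v - u); rewrite ler_norml; lra.
Qed.

(** For n <= 1 the layer-cake bound is applied. For n >= 2, [g] is at least a third of (1 + n) times
    the mesh, and the integrand is bounded pointwise. *)
Lemma integral_singular (a : R) : 0 < a < 1 -> exists2 C : R, 0 <= C &
  forall M (l : cells M) (g : plane R -> R) (n : nat), measurable_fun [set: plane R] g ->
  (forall z, cell l z -> (n%:R - 1) * mesh M <= g z <= (n%:R + 1) * mesh M /\ 0 <= g z) ->
  (forall t : R, 0 < t -> (mu (cell l `&` [set z | (g z <= t)%R]) <= (2 * mesh M * t)%:E)%E) ->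
  (\int[mu]_(z in cell l) (g z `^ (- a))%:E <= (C * (mesh M ^+ 2 * mesh M `^ (- a) * (1 + n%:R) `^ (- a)))%:E)%E.
Proof.
move=> a01; have /andP[a0 a1] := a01; have [C0 C00 HC] := integral_negative_power a01.
exists (C0 * 8 + 3 `^ a); first by rewrite addr_ge0 ?powR_ge0 ?mulr_ge0.
move=> M l g n mg gn glev; have h0 := mesh_gt0 (R := R) M.
have ml : measurable (@cell R M l) := measurable_cell l.
have mga : measurable_fun (@cell R M l) (fun z => (g z `^ (- a))%:E).
  by apply/measurable_EFinP/measurable_funTS; exact: (measurableT_comp (measurable_powR (- a)) mg).
set P := mesh M ^+ 2 * mesh M `^ (- a) * (1 + n%:R) `^ (- a).
have P0 : 0 <= P by rewrite !mulr_ge0 ?powR_ge0 ?(ltW h0).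
have [n1|n2] := leqP n 1.
  have h2 : 0 < 2 * mesh M :> R by rewrite mulr_gt0.
  apply: le_trans (HC _ _ mu (cell l) g (2 * mesh M) (2 * mesh M) ml mg _ h2 (ltW h2) _) _.
  - move=> z /gn[/andP[_ h] ->]; apply: le_trans h _; rewrite ler_wpM2r ?(ltW h0) //.
    have : n%:R <= 1 :> R by rewrite (ler_nat R n 1).
    by lra.
  - by move=> t t0; rewrite powRr1 ?(ltW t0) //; exact: glev.
  rewrite lee_fin; apply: le_trans (_ : C0 * 8 * P <= _); last by rewrite ler_wpM2r // lerDl powR_ge0.
  rewrite -!mulrA ler_wpM2l // !mulrA.
  have -> : (2 * mesh M) `^ (1 - a) = 2 * mesh M * (2 `^ (- a) * mesh M `^ (- a)).
    by rewrite powR1D // powRM ?(ltW h0).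
  have H1 : 2 `^ (- a) <= 2 * (1 + n%:R) `^ (- a).
    apply: le_trans (_ : (1 + n%:R) `^ (- a) <= _); last by have := powR_ge0 (1 + n%:R : R) (- a); lra.
    apply: powRN_anti; rewrite ?(ltW a0) ?ltr_wpDr //.
    have : n%:R <= 1 :> R by rewrite (ler_nat R n 1).
    by lra.
  rewrite /P; have -> : 2 * mesh M * (2 * mesh M * (2 `^ (- a) * mesh M `^ (- a))) =
     4 * (mesh M ^+ 2 * mesh M `^ (- a)) * 2 `^ (- a) by ring.
  have -> : 8 * mesh M * mesh M * mesh M `^ (- a) * (1 + n%:R) `^ (- a) =
     4 * (mesh M ^+ 2 * mesh M `^ (- a)) * (2 * (1 + n%:R) `^ (- a)) by ring.
  by rewrite ler_wpM2l // !mulr_ge0 ?powR_ge0 ?(ltW h0).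
apply: le_trans (_ : \int[mu]_(z in cell l) (cst (3 `^ a * (mesh M `^ (- a) * (1 + n%:R) `^ (- a)))%:E z) <= _)%E.
  apply: ge0_le_integral => //.
  - by move=> z _; rewrite lee_fin powR_ge0.
  move=> z /gn[/andP[lo _] _]; rewrite lee_fin.
  have n2' : 2 <= n%:R :> R by rewrite (ler_nat R 2 n).
  have p3 : 3^-1 * mesh M * (1 + n%:R) <= g z.
    apply: le_trans lo; rewrite mulrAC ler_wpM2r ?(ltW h0) //; lra.
  have pp : 0 < 3^-1 * mesh M * (1 + n%:R) :> R by rewrite !mulr_gt0 // ?invr_gt0 // ltr_wpDr.
  apply: le_trans (powRN_anti (ltW a0) pp p3) _.
  rewrite !powRM ?mulr_ge0 ?invr_ge0 ?(ltW h0) ?addr_ge0 // -mulrA.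
  by rewrite -(powR_inv1 (ler0n R 3)) -powRrM mulN1r opprK.
rewrite integral_cst_cell -EFinM lee_fin.
have -> : 3 `^ a * (mesh M `^ (- a) * (1 + n%:R) `^ (- a)) * mesh M ^+ 2 = 3 `^ a * P by rewrite /P; ring.
by rewrite ler_wpM2r // lerDr mulr_ge0.
Qed.

Lemma cell_singular (a : R) : 0 < a < 1 -> exists2 C : R, 0 <= C &
  forall M (l : cells M) (i : nat) (t : R), in_slot M i t ->
  (\int[mu]_(z in cell l) (`|t - z.1| `^ (- a))%:E <=
     (C * (mesh M ^+ 2 * mesh M `^ (- a) * (1 + (distn i l.1)%:R) `^ (- a)))%:E)%E /\
  (\int[mu]_(z in cell l) (`|t - z.2| `^ (- a))%:E <=
     (C * (mesh M ^+ 2 * mesh M `^ (- a) * (1 + (distn i l.2)%:R) `^ (- a)))%:E)%E.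
Proof.
move=> a01; have [C C0 HC] := integral_singular a01; exists C => // M l i t it.
have h0 := mesh_gt0 (R := R) M.
have mg1 : measurable_fun [set: plane R] (fun z => `|t - z.1|).
  by apply: measurableT_comp => //; apply: measurable_funB => //; exact: measurable_fst.
have mg2 : measurable_fun [set: plane R] (fun z => `|t - z.2|).
  by apply: measurableT_comp => //; apply: measurable_funB => //; exact: measurable_snd.
have mI (g : plane R -> R) (s : R) : measurable_fun [set: plane R] g ->
    measurable (@cell R M l `&` [set z | g z <= s]).
  move=> mg; have -> : [set z | g z <= s] = g @^-1` `]-oo, s].
    by apply/seteqP; split => z /=; rewrite in_itv.
  apply: measurableI; first exact: measurable_cell.
  by rewrite -[_ @^-1` _]setTI; apply: mg => //; exact: measurable_itv.
have rect (s : R) : 0 < s ->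
    mu (`[t - s, t + s]%classic `*` `[(corner l).2, (corner l).2 + mesh M]%classic) = (2 * mesh M * s)%:E /\
    mu (`[(corner l).1, (corner l).1 + mesh M]%classic `*` `[t - s, t + s]%classic) = (2 * mesh M * s)%:E.
  move=> s0; have ts : t - s <= t + s by lra.
  by rewrite !lebesgue2_rect ?lerDl ?(ltW h0) //; split; congr _%:E; ring.
have cellI z : cell l z -> ((corner l).1 <= z.1 <= (corner l).1 + mesh M) /\ ((corner l).2 <= z.2 <= (corner l).2 + mesh M).
  by rewrite /cell /square /= !in_itv /= => -[/andP[-> /ltW ->] /andP[-> /ltW ->]].
split; apply: HC => //.
- by move=> z /cellE[h1 h2]; split; rewrite ?in_slot_dist.
- move=> s s0; rewrite -(rect s s0).1; apply: le_measure; rewrite ?inE.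
  + exact: mI.
  + by apply: measurableX; exact: measurable_itv.
  + move=> z [/cellI[_ h]]; rewrite /= ler_norml => /andP[h1 h2].
    by split => //=; rewrite in_itv /= ?h //; lra.
- by move=> z /cellE[h1 h2]; split; rewrite ?in_slot_dist.
- move=> s s0; rewrite -(rect s s0).2; apply: le_measure; rewrite ?inE.
  + exact: mI.
  + by apply: measurableX; exact: measurable_itv.
  + move=> z [/cellI[h _]]; rewrite /= ler_norml => /andP[h1 h2].
    by split => //=; rewrite in_itv /= ?h //; lra.
Qed.

Definition off : set (plane R * plane R) := [set z | off_diag z.1 z.2].
Definition restr k (z : plane R * plane R) : R := \1_off z * k z.1 z.2.

Lemma measurable_off : measurable off.
Proof.
have m (f : plane R * plane R -> R) : measurable_fun setT f -> measurable [set z | f z != 0].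
  move=> mf; have -> : [set z | f z != 0] = f @^-1` (~` [set 0]).
    by apply/seteqP; split => z /= /eqP.
  by rewrite -[_ @^-1` _]setTI; apply: mf => //; apply: measurableC; exact: measurable_set1.
have -> : off = [set z : plane R * plane R | z.1.1 - z.2.1 != 0] `&` [set z | z.1.2 - z.2.2 != 0].
  by apply/seteqP; split => z /=; rewrite /off /off_diag /= !subr_eq0.
have m1 : measurable_fun [set: plane R * plane R] (fst : _ -> plane R) := measurable_fst.
have m2 : measurable_fun [set: plane R * plane R] (snd : _ -> plane R) := measurable_snd.
apply: measurableI; apply: m; apply: measurable_funB.
- exact: (measurableT_comp measurable_fst m1).
- exact: (measurableT_comp measurable_fst m2).
- exact: (measurableT_comp measurable_snd m1).
- exact: (measurableT_comp measurable_snd m2).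
Qed.

Lemma czx_close (e C m d : R) k x w y : 0 < e <= 1 -> 0 <= C -> 0 < m -> czx_real e C k ->
  m <= `|x.1 - y.1| -> m <= `|x.2 - y.2| -> m <= `|w.1 - y.1| -> m <= `|w.2 - y.2| ->
  `|x.1 - w.1| <= d -> `|x.2 - w.2| <= d ->
  `|k x y - k w y| <= 36 * C * m `^ (e - 2) * m `^ (- (2 * e)) * d `^ e.
Proof.
move=> e01 C0 m0 H a1 a2 b1 b2 d1 d2; have /andP[e0 e1] := e01.
have pos (t : R) : m <= `|t| -> t != 0 by rewrite -normr_gt0; exact: lt_le_trans.
have odx : off_diag x y by split; rewrite -subr_eq0 pos.
have odw : off_diag w y by split; rewrite -subr_eq0 pos.
have P (t : R) : m <= `|t| -> `|t| `^ (- (2 * e)) <= m `^ (- (2 * e)).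
  by move=> mt; apply: powRN_anti => //; rewrite mulr_ge0 // ltW.
have mx u : m <= `|u.1 - y.1| -> m <= rmax u y by rewrite /rmax le_max => ->.
apply: le_trans (czx_difference (rho := d) (r := m) e01 C0 m0 H odx odw d1 d2 (mx _ a1) (mx _ b1) (mx (w.1, x.2) b1)) _.
have -> : 36 * C * m `^ (e - 2) * m `^ (- (2 * e)) * d `^ e =
  9 * C * d `^ e * m `^ (e - 2) * (m `^ (- (2 * e)) + m `^ (- (2 * e)) + (m `^ (- (2 * e)) + m `^ (- (2 * e)))) by ring.
rewrite ler_wpM2l ?mulr_ge0 ?powR_ge0 //; apply: lerD; apply: lerD; exact: P.
Qed.

Lemma corner_cell M (x : cells M) : cell x (@corner R M x).
Proof.
by rewrite /cell /square /= !in_itv /= !lexx !ltrDl mesh_gt0.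
Qed.

Lemma cell_exists_norm M z : `|z.1| + `|z.2| + 1 <= 2 ^+ M -> exists x : cells M, cell x z.
Proof.
have key (s t : R) : `|s| + `|t| + 1 <= 2 ^+ M -> - 2 ^+ M <= s < 2 ^+ M.
  by have := ler_norm s; have := ler_norm (- s); rewrite normrN; have := normr_ge0 t; lra.
by move=> h; apply: cell_exists; [exact: key h|apply: key (z.1) _; rewrite [_ + `|z.1|]addrC].
Qed.

Lemma double_step M (c : cells M -> cells M -> R) i j x y : cell i x -> cell j y ->
  \sum_i' \sum_j' c i' j' * (\1_(cell i') x * \1_(cell j') y) = c i j.
Proof.
move=> xi yj; transitivity (step (fun i' => step (c i') y) x); last by rewrite (step_in _ xi) (step_in _ yj).
apply: eq_bigr => i' _; rewrite /step mulr_suml; apply: eq_bigr => j' _; ring.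
Qed.

(* Off the diagonal [k] is continuous, hence a pointwise limit of step functions
   on products of cells. *)
Lemma measurable_restr (e C : R) k : 0 < e <= 1 -> 0 <= C -> czx_real e C k ->
  czx_real e C (fun x y => k y x) -> measurable_fun [set: plane R * plane R] (restr k).
Proof.
move=> e01 C0 H H'; have /andP[e0 e1] := e01.
have m1 : measurable_fun [set: plane R * plane R] (fst : _ -> plane R) := measurable_fst.
have m2 : measurable_fun [set: plane R * plane R] (snd : _ -> plane R) := measurable_snd.
pose h M (z : plane R * plane R) : R := \1_off z * \sum_(i : cells M) \sum_(j : cells M)
  k (corner i) (corner j) * (\1_(cell i) z.1 * \1_(cell j) z.2).
apply: (@measurable_fun_cvg _ _ _ _ h).
  move=> M; apply: measurable_funM; first by apply: measurable_indic; exact: measurable_off.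
  apply: measurable_sum => i; apply: measurable_sum => j; apply: measurable_funM => //.
  apply: measurable_funM.
    by apply: (measurableT_comp _ m1); apply: measurable_indic; exact: measurable_cell.
  by apply: (measurableT_comp _ m2); apply: measurable_indic; exact: measurable_cell.
move=> z _; rewrite /h /restr.
have [zo|zo] := pselect (off z); last first.
  rewrite indicE memNset // mul0r.
  by apply: cvg_near_cst; apply: nearW => n; rewrite mul0r.
rewrite indicE mem_set // mul1r.
have m0 : 0 < rmin z.1 z.2 / 2 by rewrite divr_gt0 // rmin_gt0.
set m := rmin z.1 z.2 / 2 in m0.
have mm1 : m <= 2 * m by rewrite ler_peMl ?(ltW m0) // ler1n.
have mm2 : m <= m + m / 2 by rewrite lerDl divr_ge0 // ltW.
have mz : 2 * m <= `|z.1.1 - z.2.1| /\ 2 * m <= `|z.1.2 - z.2.2|.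
  by rewrite /m mulrC divfK // /rmin !ge_min !lexx orbT.
(* Each variable is moved to the corner of its cell at the cost of [czx_close], with constant 36;
   adding 1 makes [Q] positive. *)
pose Q : R := 72 * C * m `^ (e - 2) * m `^ (- (2 * e)) + 1.
have Q0 : 0 < Q by rewrite ltr_wpDl // !mulr_ge0 ?powR_ge0.
apply/cvgrPdist_le => eps eps0.
pose d := Num.min (m / 2) ((eps / Q) `^ e^-1).
have d0 : 0 < d by rewrite lt_min divr_gt0 //= powR_gt0 // divr_gt0.
have [M1 hM1] := mesh_small d0.
have [M2 hM2] := pow_large (`|z.1.1| + `|z.1.2| + `|z.2.1| + `|z.2.2| + 1).
exists (maxn M1 M2) => // M /=; rewrite geq_max => /andP[/hM1 {hM1}hd /hM2 {hM2}hr].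
have q1 := normr_ge0 z.1.1; have q2 := normr_ge0 z.1.2; have q3 := normr_ge0 z.2.1; have q4 := normr_ge0 z.2.2.
have hr1 : `|z.1.1| + `|z.1.2| + 1 <= 2 ^+ M by lra.
have hr2 : `|z.2.1| + `|z.2.2| + 1 <= 2 ^+ M by lra.
have [i zi] := cell_exists_norm hr1; have [j zj] := cell_exists_norm hr2.
rewrite mul1r (double_step _ zi zj).
have [ci1 ci2] := cell_close zi (corner_cell i); have [cj1 cj2] := cell_close zj (corner_cell j).
have hm : mesh M <= m / 2 by apply: le_trans hd _; rewrite /d ge_min lexx.
have tri (s t s' : R) : 2 * m <= `|s - t| -> `|s - s'| <= mesh M -> m + m / 2 <= `|s' - t|.
  move=> h1 h2; have := ler_distD s' s t; lra.
have tri2 (s t t' : R) : m + m / 2 <= `|s - t| -> `|t - t'| <= mesh M -> m <= `|s - t'|.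
  move=> h1 h2; have := ler_distD t' s t; rewrite [`|t' - t|]distrC; lra.
have [z1 z2] := mz.
have c1 := tri _ _ _ z1 ci1; have c2 := tri _ _ _ z2 ci2.
have d1 := tri2 _ _ _ c1 cj1; have d2 := tri2 _ _ _ c2 cj2.
have S1 : `|k z.1 z.2 - k (corner i) z.2| <= 36 * C * m `^ (e - 2) * m `^ (- (2 * e)) * mesh M `^ e.
  by apply: czx_close => //; [exact: le_trans mm1 z1|exact: le_trans mm1 z2|exact: le_trans mm2 c1|exact: le_trans mm2 c2].
have S2 : `|k (corner i) z.2 - k (corner i) (corner j)| <= 36 * C * m `^ (e - 2) * m `^ (- (2 * e)) * mesh M `^ e.
  apply: (czx_close (k := fun x y => k y x) (x := z.2) (w := corner j) (y := corner i)) => //.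
  - by rewrite distrC (le_trans mm2 c1).
  - by rewrite distrC (le_trans mm2 c2).
  - by rewrite distrC.
  - by rewrite distrC.
have S3 : mesh M `^ e <= eps / Q.
  apply: le_trans (ler_powR2 (ltW e0) (ltW (mesh_gt0 _)) (_ : _ <= (eps / Q) `^ e^-1)) _.
    by apply: le_trans hd _; rewrite /d ge_min lexx orbT.
  by rewrite powRVK ?gt_eqF // divr_ge0 // ltW.
apply: le_trans (_ : Q * (eps / Q) <= _); last by rewrite mulrC divfK // gt_eqF.
apply: le_trans (_ : Q * mesh M `^ e <= _); last by rewrite ler_wpM2l // ltW.
rewrite -(subrKA (k (corner i) z.2)); apply: le_trans (ler_normD _ _) _.
apply: le_trans (lerD S1 S2) _.
rewrite -mulrDl ler_wpM2r ?powR_ge0 //.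
by rewrite /Q -!mulrDl -natrD lerDl.
Qed.

Lemma ae_off x : {ae mu, forall y, off_diag x y}.
Proof.
have line (S : set R) (c : R) : S = [set c] -> @lebesgue_measure R S = 0%E.
  by move=> ->; rewrite lebesgue_measure_set1.
pose N1 : set (plane R) := [set x.1] `*` setT. pose N2 : set (plane R) := setT `*` [set x.2].
have mN1 : measurable N1 by apply: measurableX => //; exact: measurable_set1.
have mN2 : measurable N2 by apply: measurableX => //; exact: measurable_set1.
have N10 : mu N1 = 0%E.
  have := @product_measure1E _ _ _ _ R (@lebesgue_measure R) (@lebesgue_measure R) [set x.1] setT (measurable_set1 _) measurableT.
  by move=> E; apply: etrans E _; rewrite [X in (X * _)%E](line _ x.1) ?mul0e.
have N20 : mu N2 = 0%E.
  have := @product_measure1E _ _ _ _ R (@lebesgue_measure R) (@lebesgue_measure R) setT [set x.2] measurableT (measurable_set1 _).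
  by move=> E; apply: etrans E _; rewrite [X in (_ * X)%E](line _ x.2) ?mule0.
exists (N1 `|` N2); split; first exact: measurableU.
  by apply: null_set_setU.
move=> y /= h; apply: contrapT => no; apply: h; split; apply/eqP => e; apply: no; [left|right]; split => //=.
Qed.

Lemma measurable_row k x : measurable_fun [set: plane R * plane R] (restr k) ->
  measurable_fun [set: plane R] (fun y => restr k (x, y)).
Proof. by move=> mk; apply: (measurableT_comp mk); exact: pair1_measurable. Qed.

Lemma restr_norm k x y : `|restr k (x, y)| = \1_off (x, y) * `|k x y|.
Proof. by rewrite /restr normrM ger0_norm. Qed.

Lemma row_bound (e C r : R) k x y : 0 < e <= 1 -> 0 <= C -> 0 < r -> czx_real e C k -> r <= rmax x y ->
  `|restr k (x, y)| <= C * r `^ (e - 2) * (`|x.1 - y.1| `^ (- e) + `|x.2 - y.2| `^ (- e)).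
Proof.
move=> /andP[e0 e1] C0 r0 [Hs _] rM; rewrite restr_norm.
have [xy|xy] := pselect (off (x, y)); last first.
  by rewrite indicE memNset // mul0r mulr_ge0 ?addr_ge0 ?mulr_ge0 ?powR_ge0.
rewrite indicE mem_set // mul1r; apply: le_trans (Hs x y xy) _.
rewrite -mulrA ler_wpM2l // mulrC ler_pM ?powR_ge0 //.
  have -> : e - 2 = - (2 - e) by ring.
  by apply: powRN_anti => //; lra.
by rewrite /rmin; case: (leP `|x.1 - y.1| `|x.2 - y.2|) => _; rewrite (lerDl, lerDr) powR_ge0.
Qed.

Lemma measurable_dist_powR (a t : R) :
  measurable_fun [set: plane R] (fun z => `|t - z.1| `^ (- a)) /\
  measurable_fun [set: plane R] (fun z => `|t - z.2| `^ (- a)).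
Proof.
by split; apply: (measurableT_comp (measurable_powR (- a))); apply: measurableT_comp => //;
  apply: measurable_funB => //; (exact: measurable_fst || exact: measurable_snd).
Qed.

Definition far_cells M (j : nat) (x l : cells M) : Prop := ~~ near_cube j x l.

Lemma rmax_far M j (x y l : cells M) z w : far_cells j x l -> same_cube j x y ->
  in_slot M y.1 z.1 -> in_slot M y.2 z.2 -> cell l w -> 2 ^+ j * mesh M <= rmax z w.
Proof.
rewrite /far_cells /near_cube => far /andP[/eqP e1 /eqP e2] z1 z2 /cellE[w1 w2].
have p0 : (0 < 2 ^ j)%N by rewrite expn_gt0.
rewrite -natrX /rmax le_max; move: far; rewrite negb_and e1 e2.
by case/orP => h; apply/orP; [left|right]; apply: (in_slot_far _ _ p0 h).
Qed.

Lemma integral_le_sum2 (l : set (plane R)) (c : R) (f1 f2 : plane R -> R) (b1 b2 : R) :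
  measurable l -> 0 <= c -> measurable_fun [set: plane R] f1 -> measurable_fun [set: plane R] f2 ->
  (forall z, 0 <= f1 z) -> (forall z, 0 <= f2 z) ->
  (\int[mu]_(z in l) (f1 z)%:E <= b1%:E)%E -> (\int[mu]_(z in l) (f2 z)%:E <= b2%:E)%E ->
  (\int[mu]_(z in l) (c * (f1 z + f2 z))%:E <= (c * (b1 + b2))%:E)%E.
Proof.
move=> ml c0 m1 m2 f10 f20 h1 h2.
have mf1 : measurable_fun l (EFin \o f1) by apply/measurable_EFinP; exact: measurable_funTS.
have mf2 : measurable_fun l (EFin \o f2) by apply/measurable_EFinP; exact: measurable_funTS.
rewrite (eq_integral (fun z => c%:E * ((f1 z)%:E + (f2 z)%:E))%E); last by move=> z _; rewrite EFinM EFinD.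
rewrite ge0_integralZl ?lee_fin //; last 2 first.
- exact: emeasurable_funD.
- by move=> z _; rewrite adde_ge0 // lee_fin.
rewrite ge0_integralD //; try by move=> z _; rewrite lee_fin.
by rewrite EFinM EFinD lee_wpmul2l ?lee_fin // leeD.
Qed.

(** A qualitative bound, with [B] depending on [M]; it serves integrability and Fubini's theorem. *)
Lemma row_integral_bound (e C : R) : 0 < e < 1 -> 0 <= C -> forall M, exists2 B, 0 <= B &
  forall k, czx_real e C k -> measurable_fun [set: plane R * plane R] (restr k) ->
  forall (y l : cells M) x, cell y x -> far_cells 0 y l ->
  (\int[mu]_(z in cell l) `|restr k (x, z)|%:E <= B%:E)%E.
Proof.
move=> e01 C0 M; have /andP[e0 e1] := e01; have [C1 C10 HC] := cell_singular e01.
have h0 := mesh_gt0 (R := R) M.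
set q := mesh M ^+ 2 * mesh M `^ (- e).
have q0 : 0 <= q by rewrite mulr_ge0 ?powR_ge0 ?sqr_ge0.
exists (C * mesh M `^ (e - 2) * (C1 * q + C1 * q)).
  by rewrite !mulr_ge0 ?powR_ge0 ?addr_ge0 ?mulr_ge0 ?powR_ge0 ?(ltW h0).
move=> k H mk y l x yx far; have ml : measurable (@cell R M l) := measurable_cell l.
have [x1 x2] := (cellE _ _).1 yx.
have [m1 m2] := measurable_dist_powR e x.1; have [_ m2'] := measurable_dist_powR e x.2.
have [I1 _] := HC M l y.1 x.1 x1; have [_ I2] := HC M l y.2 x.2 x2.
have le1 n : C1 * (q * (1 + n%:R) `^ (- e)) <= C1 * q.
  rewrite ler_wpM2l // ler_piMr //.
  apply: le_trans (powRN_anti (ltW e0) ltr01 (_ : 1 <= 1 + n%:R)) _; first by rewrite lerDl.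
  by rewrite powR1.
apply: le_trans (_ : \int[mu]_(z in cell l) (C * mesh M `^ (e - 2) * (`|x.1 - z.1| `^ (- e) + `|x.2 - z.2| `^ (- e)))%:E <= _)%E.
  apply: ge0_le_integral => //.
  - by apply/measurable_EFinP/measurableT_comp => //; apply: measurable_funTS; exact: measurable_row.
  - by apply/measurable_EFinP/measurable_funTS; apply: measurable_funM => //; exact: measurable_funD.
  move=> z lz; rewrite lee_fin; apply: (row_bound _ C0 h0 H); first by rewrite e0 ltW.
  have := rmax_far far _ x1 x2 lz; rewrite expr0 mul1r; apply.
  by rewrite /same_cube !eqxx.
apply: integral_le_sum2 => //.
- by rewrite mulr_ge0 ?powR_ge0.
- by apply: le_trans I1 _; rewrite lee_fin le1.
- by apply: le_trans I2 _; rewrite lee_fin le1.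
Qed.

Definition row k M (l : cells M) x : R := \int[mu]_(z in cell l) restr k (x, z).

Lemma row_integrable (e C : R) k M (y l : cells M) x : 0 < e < 1 -> 0 <= C -> czx_real e C k ->
  measurable_fun [set: plane R * plane R] (restr k) -> cell y x -> far_cells 0 y l ->
  mu.-integrable (cell l) (fun z => (restr k (x, z))%:E).
Proof.
move=> e01 C0 H mk yx far; apply/integrableP; split.
  by apply/measurable_EFinP/measurable_funTS; exact: measurable_row.
have [B B0 HB] := row_integral_bound e01 C0 M.
by apply: le_lt_trans (HB k H mk y l x yx far) _; rewrite ltry.
Qed.

Lemma far_cells_mono M j (x y l : cells M) : far_cells j x l -> same_cube j x y -> far_cells 0 y l.
Proof.
rewrite /far_cells => far xy; apply: contra far => h.
have G := @grid_dyadic M.*2.+1.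
by rewrite (nb_dy G _ xy); exact: (nb_leq G (leq0n j)).
Qed.

(** [czx_difference] integrated over the cell [l], with rho the side of a cube of level i and r that
    of level j. Each singular factor integrates to its discrete counterpart by [cell_singular]. *)
Lemma row_difference (e C : R) : 0 < 2 * e < 1 -> 0 <= C -> exists2 B, 0 <= B &
  forall k, czx_real e C k -> measurable_fun [set: plane R * plane R] (restr k) ->
  forall M (x y l : cells M) i j u v, (i <= j)%N -> same_cube i x y -> far_cells j x l ->
  cell y u -> cell x v ->
  `|row k l u - row k l v| <= B * (2 ^+ i) `^ e * (2 ^+ j) `^ (e - 2) *
      ((1 + (distn y.1 l.1)%:R) `^ (- (2 * e)) + (1 + (distn y.2 l.2)%:R) `^ (- (2 * e)) +
      ((1 + (distn x.1 l.1)%:R) `^ (- (2 * e)) + (1 + (distn x.2 l.2)%:R) `^ (- (2 * e)))).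
Proof.
move=> e01 C0; have /andP[e20 e21] := e01.
have e0 : 0 < e by lra.
have e1 : e <= 1 by lra.
have e011 : 0 < e <= 1 by rewrite e0.
have e010 : 0 < e < 1 by rewrite e0 /=; lra.
have [C1 C10 HC] := cell_singular e01; exists (9 * C * C1); first by rewrite !mulr_ge0.
move=> k H mk M x y l i j u v ij xy far yu xv.
have h0 := mesh_gt0 (R := R) M; have ml : measurable (@cell R M l) := measurable_cell l.
have G := @grid_dyadic M.*2.+1.
have xyj : same_cube j x y by exact: (dy_leq G ij).
have iu := row_integrable e010 C0 H mk yu (far_cells_mono far xyj).
have iv := row_integrable e010 C0 H mk xv (far_cells_mono far (dy_refl G j x)).
have [u1 u2] := (cellE _ _).1 yu; have [v1 v2] := (cellE _ _).1 xv.
have p0 n : 0 < 2 ^+ n :> R by rewrite exprn_gt0.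
have [/eqP xy1 /eqP xy2] := andP xy.
have d1 : `|u.1 - v.1| <= 2 ^+ i * mesh M.
  by rewrite -natrX; apply: (in_slot_near u1 v1); rewrite ?expn_gt0.
have d2 : `|u.2 - v.2| <= 2 ^+ i * mesh M.
  by rewrite -natrX; apply: (in_slot_near u2 v2); rewrite ?expn_gt0.
pose a z s t : R := `|s - z.1| `^ (- (2 * e)) + `|t - z.2| `^ (- (2 * e)).
set c := 9 * C * (2 ^+ i * mesh M) `^ e * (2 ^+ j * mesh M) `^ (e - 2).
have c0 : 0 <= c by rewrite !mulr_ge0 ?powR_ge0.
have [mu1 _] := measurable_dist_powR (2 * e) u.1; have [_ mu2] := measurable_dist_powR (2 * e) u.2.
have [mv1 _] := measurable_dist_powR (2 * e) v.1; have [_ mv2] := measurable_dist_powR (2 * e) v.2.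
have idiff := integrableB ml iu iv.
have pw0 (t : R) : 0 <= `|t| `^ (- (2 * e)) by exact: powR_ge0.
have main : (\int[mu]_(z in cell l) `|restr k (u, z) - restr k (v, z)|%:E <=
    \int[mu]_(z in cell l) (c * ((`|u.1 - z.1| `^ (- (2 * e)) + `|u.2 - z.2| `^ (- (2 * e))) +
       (`|v.1 - z.1| `^ (- (2 * e)) + `|v.2 - z.2| `^ (- (2 * e)))))%:E)%E.
  apply: ae_ge0_le_integral => //.
  - by apply/measurable_EFinP/measurableT_comp => //; apply: measurable_funTS; apply: measurable_funB; exact: measurable_row.
  - by move=> z _; rewrite lee_fin mulr_ge0 // !addr_ge0.
  - by apply/measurable_EFinP/measurable_funTS; apply: measurable_funM => //; apply: measurable_funD; exact: measurable_funD.
  apply: filterS2 (ae_off u) (ae_off v) => z ou ov lz; rewrite lee_fin.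
  rewrite /restr !indicE !mem_set // !mul1r /=.
  apply: (czx_difference e011 C0 _ H) => //; first by rewrite mulr_gt0.
  - exact: (rmax_far far xyj u1 u2 lz).
  - exact: (rmax_far far (dy_refl G j x) v1 v2 lz).
  - apply: (rmax_far (y := (x.1, y.2)) (z := (v.1, u.2)) far _ v1 u2 lz).
    by case/andP: xyj => _ h; rewrite /same_cube eqxx.
have [Iu1 _] := HC M l y.1 u.1 u1; have [_ Iu2] := HC M l y.2 u.2 u2.
have [Iv1 _] := HC M l x.1 v.1 v1; have [_ Iv2] := HC M l x.2 v.2 v2.
set S := (X in _ <= _ * X).
set q := mesh M ^+ 2 * mesh M `^ (- (2 * e)) in Iu1 Iu2 Iv1 Iv2.
have sum4 : (\int[mu]_(z in cell l) (c * ((`|u.1 - z.1| `^ (- (2 * e)) + `|u.2 - z.2| `^ (- (2 * e))) +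
       (`|v.1 - z.1| `^ (- (2 * e)) + `|v.2 - z.2| `^ (- (2 * e)))))%:E <= (c * (C1 * q * S))%:E)%E.
  have one (s t : plane R -> R) (b1 b2 : R) : measurable_fun [set: plane R] s -> measurable_fun [set: plane R] t ->
     (forall z, 0 <= s z) -> (forall z, 0 <= t z) ->
     (\int[mu]_(z in cell l) (s z)%:E <= b1%:E)%E -> (\int[mu]_(z in cell l) (t z)%:E <= b2%:E)%E ->
     (\int[mu]_(z in cell l) (s z + t z)%:E <= (b1 + b2)%:E)%E.
    move=> ms mt s0 t0 h1 h2; have := integral_le_sum2 ml (ler01 : 0 <= 1 :> R) ms mt s0 t0 h1 h2.
    by rewrite mul1r; under eq_integral do rewrite mul1r.
  have := integral_le_sum2 ml c0 (measurable_funD mu1 mu2) (measurable_funD mv1 mv2) _ _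
    (one _ _ _ _ mu1 mu2 (fun=> pw0 _) (fun=> pw0 _) Iu1 Iu2) (one _ _ _ _ mv1 mv2 (fun=> pw0 _) (fun=> pw0 _) Iv1 Iv2).
  move=> h; apply: le_trans (h _ _) _; [by move=> z; rewrite addr_ge0..|].
  by rewrite lee_fin le_eqVlt; apply/orP; left; apply/eqP; rewrite /S; ring.
rewrite /row -RintegralB //.
apply: le_trans (le_normr_Rintegral _ idiff) _ => //.
rewrite -lee_fin; apply: le_trans (_ : (\int[mu]_(z in cell l) `|restr k (u, z) - restr k (v, z)|%:E <= _)%E).
  rewrite -[leLHS]/((fine _)%:E) fineK //; apply: integrable_fin_num => //.
  by have := integrable_abse idiff; apply: eq_integrable.
apply: le_trans main _; apply: le_trans sum4 _; rewrite lee_fin.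
rewrite le_eqVlt; apply/orP; left; apply/eqP; rewrite /c /q !powRM ?(ltW (p0 _)) ?(ltW h0) //.
(* The powers of the mesh cancel, which makes the bound uniform in [M]. *)
have E : mesh M `^ e * mesh M `^ (e - 2) * (mesh M ^+ 2 * mesh M `^ (- (2 * e))) = 1.
  rewrite -powR_mulrn ?(ltW h0) // -!powRD ?(gt_eqF h0) ?implybT //.
  by rewrite (_ : _ + _ = 0) ?powRr0 //; ring.
transitivity (9 * C * C1 * (2 ^+ i) `^ e * (2 ^+ j) `^ (e - 2) * S *
   (mesh M `^ e * mesh M `^ (e - 2) * (mesh M ^+ 2 * mesh M `^ (- (2 * e))))); first by ring.
by rewrite E mulr1.
Qed.

Lemma off_swap x y : \1_off (x, y) = \1_off (y, x) :> R.
Proof.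
have h u v : off (u, v) -> off (v, u) by move=> [a b]; split; rewrite eq_sym.
rewrite !indicE; have [a|a] := pselect (off (x, y)).
  by rewrite !mem_set //; exact: h.
by rewrite !memNset // => /h.
Qed.

Lemma integrable_fubini_G d1 d2 (T1 : measurableType d1) (T2 : measurableType d2)
    (m1 : {sigma_finite_measure set T1 -> \bar R}) (m2 : {sigma_finite_measure set T2 -> \bar R})
    (f : T1 * T2 -> \bar R) :
  (m1 \x m2)%E.-integrable setT f -> m2.-integrable setT (fubini_G m1 f).
Proof.
move=> fi; have [mf _] := integrableP _ _ _ fi.
apply/integrableP; split; first exact: measurable_fubini_G fi.
apply: le_lt_trans ((integrable21ltyP m1 m2 mf).1 fi).
apply: ge0_le_integral => //.
- by apply: measurableT_comp => //; exact: measurable_fubini_G fi.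
- have mabs : measurable_fun setT (abse \o f) by apply: measurableT_comp.
  have H : measurable_fun setT (fubini_G m1 (abse \o f)).
    by apply: measurable_fun_fubini_tonelli_G => // z; exact: abse_ge0.
  exact: H.
- by move=> t _; apply: le_abse_integral => //; apply: (measurableT_comp mf); exact: pair2_measurable.
Qed.

Definition entry k M (x l : cells M) : R :=
  \int[(mu \x mu)%E]_(z in off) (k z.1 z.2 * \1_(cell l) z.2 * \1_(cell x) z.1).

(** Fubini's theorem in both orders: an entry integrates rows of [k] as well as rows of the
    transposed kernel, so that regularity is available for the matrix and for its transpose. *)
Lemma entry_rows (e C : R) k M (y l : cells M) : 0 < e < 1 -> 0 <= C ->
  czx_real e C k -> czx_real e C (fun x y => k y x) -> far_cells 0 y l ->
  [/\ mu.-integrable (cell y) (EFin \o row k l),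
      mu.-integrable (cell l) (EFin \o row (fun x y => k y x) y),
      entry k y l = \int[mu]_(z in cell y) row k l z &
      entry k y l = \int[mu]_(z in cell l) row (fun x y => k y x) y z].
Proof.
move=> e01 C0 H H' far; have /andP[e0 e1] := e01.
have e01' : 0 < e <= 1 by rewrite e0 ltW.
have mk := measurable_restr e01' C0 H H'.
have mk' : measurable_fun [set: plane R * plane R] (restr (fun x y => k y x)).
  exact: (measurable_restr e01' C0 H' H).
have my : measurable (@cell R M y) := measurable_cell y.
have ml : measurable (@cell R M l) := measurable_cell l.
have m1 : measurable_fun [set: plane R * plane R] (fst : _ -> plane R) := measurable_fst.
have m2 : measurable_fun [set: plane R * plane R] (snd : _ -> plane R) := measurable_snd.
pose F (z : plane R * plane R) : R := restr k z * (\1_(cell l) z.2 * \1_(cell y) z.1).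
have mF : measurable_fun [set: plane R * plane R] F.
  apply: measurable_funM => //; apply: measurable_funM.
    by apply: (measurableT_comp _ m2); exact: measurable_indic.
  by apply: (measurableT_comp _ m1); exact: measurable_indic.
have [B B0 HB] := row_integral_bound e01 C0 M.
have mFE : measurable_fun [set: plane R * plane R] (EFin \o F) by exact/measurable_EFinP.
have Fin x : (\int[mu]_z `|(F (x, z))%:E| = (\1_(cell y) x)%:E * \int[mu]_(z in cell l) `|restr k (x, z)|%:E)%E.
  rewrite -(integral_indicM mu (cell l)) -ge0_integralZl ?lee_fin //; last first.
    apply/measurable_EFinP; apply: measurable_funM; first exact: measurable_indic.
    by apply: measurableT_comp => //; exact: measurable_row.
  apply: eq_integral => z _; rewrite /F /= !normrM !(ger0_norm (_ : 0 <= \1__ _)) //.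
  by rewrite -EFinM; congr _%:E; ring.
have iF : (mu \x mu)%E.-integrable [set: plane R * plane R] (EFin \o F).
  apply/(integrable12ltyP mu mu mFE).
  apply: le_lt_trans (_ : \int[mu]_x ((\1_(cell y) x * B)%:E) < +oo)%E; last first.
    rewrite integral_indicM (_ : \int[mu]_(z in _) _ = \int[mu]_(z in cell y) cst B%:E z)%E //.
    by rewrite integral_cst_cell -EFinM ltry.
  apply: ge0_le_integral => //.
  - by move=> x _; apply: integral_ge0.
  - have mabs : measurable_fun [set: plane R * plane R] (abse \o (EFin \o F)) by apply: measurableT_comp.
    have HF : measurable_fun [set: plane R] (fubini_F mu (abse \o (EFin \o F))).
      by apply: measurable_fun_fubini_tonelli_F => // z; exact: abse_ge0.
    exact: HF.
  - by apply/measurable_EFinP; apply: measurable_funM => //; exact: measurable_indic.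
  move=> x _; rewrite [leLHS]Fin indicE.
  case: (boolP (x \in cell y)) => [/set_mem yx|_]; last by rewrite mul0e mul0r.
  by rewrite mul1e mul1r; exact: (HB k H mk y l x yx far).
have E1 : entry k y l = fine (\int[(mu \x mu)%E]_z (EFin \o F) z)%E.
  rewrite /entry /Rintegral -integral_indicM; congr fine; apply: eq_integral => z _.
  by rewrite /= /F /restr; congr _%:E; rewrite !mulrA.
have fF x : cell y x -> fubini_F mu (EFin \o F) x = (row k l x)%:E.
  move=> yx; have ir := row_integrable e01 C0 H mk yx far.
  rewrite /fubini_F /row fineK ?integrable_fin_num // -integral_indicM.
  by apply: eq_integral => z _; rewrite /F /= [X in _ * (_ * X)]indicE mem_set // mulr1 mulrC.
have fF' x : ~ cell y x -> fubini_F mu (EFin \o F) x = 0%E.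
  move=> yx; rewrite /fubini_F integral0_eq // => z _.
  by rewrite /F /= [X in _ * (_ * X)]indicE memNset // !mulr0.
have far' : far_cells 0 l y.
  have G := @grid_dyadic M.*2.+1; rewrite /far_cells; move: far; rewrite /far_cells.
  by rewrite (nb_sym G).
have fG x : cell l x -> fubini_G mu (EFin \o F) x = (row (fun x y => k y x) y x)%:E.
  move=> lx; have ir := row_integrable e01 C0 H' mk' lx far'.
  rewrite /fubini_G /row fineK ?integrable_fin_num // -integral_indicM.
  apply: eq_integral => z _; rewrite /F /= [X in _ * (X * _)]indicE mem_set // mul1r mulrC.
  by rewrite /restr off_swap.
have fG' x : ~ cell l x -> fubini_G mu (EFin \o F) x = 0%E.
  move=> lx; rewrite /fubini_G integral0_eq // => z _.
  by rewrite /F /= [X in _ * (X * _)]indicE memNset // mul0r mulr0.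
have iFF := integrable_fubini_F iF; have iGG := integrable_fubini_G iF.
have sub (D : set (plane R)) (f g : plane R -> \bar R) : measurable D -> mu.-integrable setT f ->
    (forall x, D x -> f x = g x) -> (forall x, ~ D x -> f x = 0%E) ->
    mu.-integrable D g /\ (\int[mu]_x f x = \int[mu]_(x in D) g x)%E.
  move=> mD fi fg f0; split.
    have := integrableS measurableT mD (@subsetT _ _) fi; apply: eq_integrable => // x.
    by rewrite inE; exact: fg.
  rewrite [RHS]integral_mkcond; apply: eq_integral => x _; rewrite patchE.
  by case: ifPn; [rewrite inE; exact: fg|move/negP; rewrite inE; exact: f0].
have [i1 e1'] := sub _ _ _ my iFF fF fF'; have [i2 e2'] := sub _ _ _ ml iGG fG fG'.
split => //.
  by rewrite E1 -integral12_prod_meas1 // e1'.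
by rewrite E1 -integral21_prod_meas1 // e2'.
Qed.

Lemma row_average (f : plane R -> R) M (y : cells M) (b Q : R) :
  mu.-integrable (cell y) (EFin \o f) -> (forall u, cell y u -> `|f u - b| <= Q) ->
  `|rav f y - b| <= Q.
Proof.
move=> fi fQ; have my : measurable (@cell R M y) := measurable_cell y.
have ib (c : R) : mu.-integrable (cell y) (EFin \o cst c) by exact: integrable_cst_cell.
have Ec (c : R) : rav (cst c) y = c by exact: rav_const.
rewrite ler_distl -{1}(Ec (b - Q)) -(Ec (b + Q)); apply/andP; split; apply: le_rav => // u yu;
  have := fQ u yu; rewrite ler_distl /cst; by case/andP.
Qed.

(** The common row of a cube is the row of [k] at the corner of one of its cells; averaging over a
    cell preserves the pointwise bound. *)
Lemma regular_entries (e s C : R) : 0 < e -> 1 < s -> 2 * e * (s / (s - 1)) < 1 -> 0 <= C ->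
  exists2 H : R, 0 <= H & forall k M (a : cells M -> cells M -> R),
  czx_real e C k -> measurable_fun [set: plane R * plane R] (restr k) ->
  (forall y l : cells M, far_cells 0 y l -> mu.-integrable (cell y) (EFin \o row k l) /\ a y l = rav (row k l) y) ->
  regular_mx M.*2.+1 same_cube near_cube s H a.
Proof.
move=> e0 s1 es C0.
have e01 : 0 < 2 * e < 1.
  rewrite mulr_gt0 //=; apply: le_lt_trans es.
  rewrite ler_peMr ?mulr_ge0 ?(ltW e0) // ler_pdivlMr ?subr_gt0 //; lra.
have [B B0 HB] := row_difference e01 C0.
have [H H0 HH] := regular_of_pointwise e0 s1 es B0.
exists H => // k M a Hk mk Ha; apply: HH => i x iN.
exists (fun l => row k l (corner x)), x; first by rewrite /same_cube !eqxx.
move=> y l j xy ij far.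
have xyj : same_cube j x y by exact: (dy_leq (@grid_dyadic M.*2.+1) ij).
have [ir ->] := Ha y l (far_cells_mono far xyj).
apply: row_average => // u yu.
by apply: (HB k Hk mk) => //; exact: corner_cell.
Qed.

End CellKernel.

(** * From matrices to operators *)

Section Limits.
Context {R : realType}.
Local Notation mu := (@lebesgue2 R).
Implicit Types (u v w : plane R -> R) (z : plane R).

(** Squeeze by the tangent inequalities at l and at u n; the slope of the second stays bounded. *)
Lemma cvg_powR (u : nat -> R) (l p : R) : 1 < p -> (forall n, 0 <= u n) -> 0 <= l ->
  (u n @[n --> \oo] --> l)%classic -> (u n `^ p @[n --> \oo] --> l `^ p)%classic.
Proof.
move=> p1 u0 l0 ul; have p0 : 0 <= p by lra.
have L0 : 0 <= l + 1 by lra.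
have c (a b : R) : (a + b * (u n - l) @[n --> \oo] --> a)%classic.
  rewrite -[X in (_ --> X)%classic](_ : a + b * (l - l) = a); last by rewrite subrr mulr0 addr0.
  by apply: cvgD; [exact: cvg_cst|apply: cvgMr; apply: cvgB => //; exact: cvg_cst].
have c' (a b : R) : (a + b * `|u n - l| @[n --> \oo] --> a)%classic.
  rewrite -[X in (_ --> X)%classic](_ : a + b * `|l - l| = a); last by rewrite subrr normr0 mulr0 addr0.
  by apply: cvgD; [exact: cvg_cst|apply: cvgMr; apply: cvg_norm; apply: cvgB => //; exact: cvg_cst].
apply: (squeeze_cvgr _ (c (l `^ p) (p * l `^ (p - 1))) (c' (l `^ p) (p * (l + 1) `^ (p - 1)))).
have /cvgrPdist_lt/(_ 1 ltr01) := ul; apply: filterS => n hn.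
rewrite powR_tangent //=.
have ub : u n <= l + 1 by have := ler_norm (u n - l); rewrite distrC; lra.
have := powR_tangent p1 l0 (u0 n) => h.
have h2 : u n `^ (p - 1) <= (l + 1) `^ (p - 1) by apply: ler_powR2 => //; lra.
have h3 : u n `^ (p - 1) * (u n - l) <= (l + 1) `^ (p - 1) * `|u n - l|.
  apply: le_trans (ler_wpM2l (powR_ge0 _ _) (ler_norm _)) _.
  by rewrite ler_wpM2r.
have h4 := ler_wpM2l p0 h3; rewrite !mulrA in h4 *.
by rewrite !mulrBr in h h4 *; lra.
Qed.

Lemma limn_einf_le (u : nat -> \bar R) (K : \bar R) : (forall n, (u n <= K)%E) -> (limn_einf u <= K)%E.
Proof.
move=> uK; rewrite limn_einf_lim; apply: lime_le; first exact: is_cvg_einfs.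
by apply: nearW => n; apply: le_trans (uK n); apply: ereal_inf_lbound; exists n => //=.
Qed.

Lemma limn_einf_ge0 (u : nat -> \bar R) : (forall n, (0 <= u n)%E) -> (0 <= limn_einf u)%E.
Proof.
move=> u0; rewrite limn_einf_lim; apply: lime_ge; first exact: is_cvg_einfs.
by apply: nearW => n; apply: le_ereal_inf_tmp => _ [m _ <-].
Qed.

(** The squared errors have an integrable sum, so they tend to 0 wherever that sum is finite. *)
Lemma sqi_cvg_ae u (v : nat -> plane R -> R) : measurable_fun [set: plane R] u ->
  (forall n, measurable_fun [set: plane R] (v n)) ->
  (forall n, (sqi (fun z => u z - v n z)%R <= (2 ^- n)%:E)%E) ->
  {ae mu, forall z, (v n z @[n --> \oo] --> u z)%classic}.
Proof.
move=> mf mv H; pose F n z := ((u z - v n z) ^+ 2)%:E.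
have F0 n z : (0 <= F n z)%E by rewrite lee_fin sqr_ge0.
have mF n : measurable_fun [set: plane R] (F n) by apply: measurable_sqr; exact: measurable_funB.
have iG : mu.-integrable setT (fun z => \sum_(0 <= n <oo) F n z)%E.
  apply/integrableP; split.
    by apply: ge0_emeasurable_sum => [n z _ _|n _]; [exact: F0|exact: mF].
  rewrite (eq_integral (fun z => \sum_(0 <= n <oo) F n z)%E); last first.
    by move=> z _; rewrite gee0_abs //; apply: nneseries_ge0 => n _ _; exact: F0.
  rewrite integral_nneseries //; apply: le_lt_trans (_ : 2%:E < +oo)%E; last exact: ltry.
  apply: lime_le; first by apply: is_cvg_nneseries => n _ _; exact: sqi_ge0.
  apply: nearW => N; apply: le_trans (_ : \sum_(0 <= n < N) (2 ^- n)%:E <= _)%E.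
    by apply: lee_sum => n _; exact: H.
  rewrite sumEFin lee_fin big_mkord.
  have : \sum_(i < N) 2 ^- i = 2 - 2 * 2 ^- N :> R.
    elim: N => [|N IH]; first by rewrite big_ord0 expr0 invr1; lra.
    rewrite big_ord_recr /= IH exprS invfM; field.
    by rewrite expf_neq0.
  by move=> ->; rewrite gerBl mulr_ge0 // invr_ge0 exprn_ge0.
have := integrable_ae measurableT iG; apply: filterS => z /(_ Logic.I) fin.
set G := (\sum_(0 <= n <oo) F n z)%E in fin.
have bound N : \sum_(0 <= n < N) (u z - v n z) ^+ 2 <= fine G.
  rewrite -lee_fin fineK // -sumEFin.
  by apply: (@nneseries_lim_ge _ (F ^~ z) xpredT 0%N N) => n _ _; exact: F0.
have cs : cvgn (series (fun n => (u z - v n z) ^+ 2)).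
  apply: nondecreasing_is_cvgn.
    apply/nondecreasing_seqP => n; rewrite /series /= big_nat_recr //= lerDl sqr_ge0 //.
  by exists (fine G) => _ [n _ <-]; exact: bound.
have c0 := cvg_series_cvg_0 cs.
apply/cvgrPdist_lt => eps eps0.
have e2 : 0 < eps ^+ 2 by rewrite exprn_gt0.
have /cvgrPdist_lt/(_ _ e2) := c0; apply: filterS => n.
rewrite sub0r normrN normrX => h.
by rewrite -(@ltr_pXn2r _ 2) ?nnegrE // ltW.
Qed.

(** A rapidly converging sequence in L^2 converges almost everywhere, and Fatou's lemma carries the
    weighted bound to the limit. *)
Lemma fatou_weight (p : R) w u (K : \bar R) : 1 < p -> measurable_fun [set: plane R] w -> (forall z, 0 < w z) ->
  measurable_fun [set: plane R] u ->
  (forall e : R, 0 < e -> exists v, [/\ measurable_fun [set: plane R] v, (sqi (fun z => u z - v z)%R <= e%:E)%E &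
     (\int[mu]_z (`|v z| `^ p * w z)%:E <= K)%E]) ->
  (\int[mu]_z (`|u z| `^ p * w z)%:E <= K)%E.
Proof.
move=> p1 mw w0 mf H.
have [v Hv] : exists v : nat -> plane R -> R, forall n, [/\ measurable_fun [set: plane R] (v n),
    (sqi (fun z => u z - v n z)%R <= (2 ^- n)%:E)%E & (\int[mu]_z (`|v n z| `^ p * w z)%:E <= K)%E].
  have p0 n : 0 < 2 ^- n :> R by rewrite invr_gt0 exprn_gt0.
  by exists (fun n => sval (cid (H _ (p0 n)))) => n; exact: svalP (cid (H _ (p0 n))).
have mg (s : plane R -> R) : measurable_fun [set: plane R] s ->
    measurable_fun [set: plane R] (fun z => (`|s z| `^ p * w z)%:E).
  move=> ms; apply/measurable_EFinP; apply: measurable_funM => //.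
  by apply: (measurableT_comp (measurable_powR p)); exact: measurableT_comp.
have pos (s : plane R -> R) z : (0 <= (`|s z| `^ p * w z)%:E)%E by rewrite lee_fin mulr_ge0 ?powR_ge0 // ltW.
have cv := sqi_cvg_ae mf (fun n => let: And3 h _ _ := Hv n in h) (fun n => let: And3 _ h _ := Hv n in h).
have mv n : measurable_fun [set: plane R] (v n) by case: (Hv n).
have := @fatou _ _ R mu setT measurableT (fun n z => (`|v n z| `^ p * w z)%:E) (fun n => mg _ (mv n)) (fun n z _ => pos (v n) z).
move=> /le_trans /(_ (limn_einf_le (fun n => let: And3 _ _ h := Hv n in h))).
apply: le_trans; apply: ae_ge0_le_integral => //.
- exact: mg.
- by move=> z _; apply: limn_einf_ge0.
- by apply: measurableT_comp => //; apply: measurable_fun_limn_esup => n; apply: measurableT_comp => //; exact: mg.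
apply: filterS cv => z cz _.
have c1 : ((`|v n z| `^ p * w z)%:E @[n --> \oo] --> (`|u z| `^ p * w z)%:E)%classic.
  apply: cvg_EFin; first by apply: nearW.
  by apply: cvgMl; apply: cvg_powR => //; exact: cvg_norm.
by rewrite (cvg_limn_einf_sup c1).1.
Qed.

End Limits.

(** * Compression of a real operator to the grid *)

Section RealOperator.
Context {R : realType}.
Local Notation mu := (@lebesgue2 R).
Implicit Types (u v w : plane R -> R) (z : plane R).
Variables (S : (plane R -> R) -> (plane R -> R)) (B : R).
Hypothesis B0 : 0 <= B.
Hypothesis SL2 : forall u, L2 u -> L2 (S u).
Hypothesis Slin : forall (a : R) u v, L2 u -> L2 v ->
  {ae mu, forall z, S (fun z => a * u z + v z) z = a * S u z + S v z}.
Hypothesis Sbnd : forall u, L2 u -> (sqi (S u) <= B%:E * sqi u)%E.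

Lemma ae_rav M (x : cells M) u v : measurable_fun [set: plane R] u -> measurable_fun [set: plane R] v ->
  {ae mu, forall z, u z = v z} -> rav u x = rav v x.
Proof.
move=> mu' mv uv; rewrite /rav /Rintegral; congr (_ * fine _); apply: ae_eq_integral.
- exact: measurable_cell.
- by apply/measurable_EFinP; exact: measurable_funTS.
- by apply/measurable_EFinP; exact: measurable_funTS.
- by apply: filterS uv => z h _; rewrite /= h.
Qed.

Lemma ae_sqi u v : measurable_fun [set: plane R] u -> measurable_fun [set: plane R] v ->
  {ae mu, forall z, u z = v z} -> sqi u = sqi v.
Proof.
move=> mu' mv uv; apply: ae_eq_integral => //; try exact: measurable_sqr.
by apply: filterS uv => z h _; rewrite /= h.
Qed.

(** The matrix of the compression EM S EM in the basis of cell indicators. All cells have the same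
    area, so the bound of [S] on L^2 is one for the matrix on l^2. *)
Definition matrix_of M (x l : cells M) : R := rav (S (\1_(cell l))) x.

Lemma L2_indic_cell M (l : cells M) : @L2 R (\1_(cell l)).
Proof.
apply: L2_indic; first exact: measurable_cell.
by have := lebesgue2_cell (R := R) l => ->; rewrite ltry.
Qed.

Lemma L2_0 : @L2 R (fun=> 0).
Proof.
have := L2Z 0 (step_L2 (fun _ : cells 0 => 0 : R)).
by under eq_fun do rewrite mul0r.
Qed.

Lemma rav_S_sum M (s : seq (cells M)) (c : cells M -> R) (x : cells M) :
  L2 (fun z => \sum_(l <- s) c l * \1_(cell l) z) /\
  rav (S (fun z => \sum_(l <- s) c l * \1_(cell l) z)) x = \sum_(l <- s) matrix_of x l * c l.
Proof.
elim: s => [|l s [IL IH]].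
  have -> : (fun z => \sum_(l <- [::]) c l * \1_(cell l) z) = (fun=> 0) :> (plane R -> R).
    by apply/funext => z; rewrite big_nil.
  split; first exact: L2_0.
  rewrite big_nil -[RHS](@rav_const R M 0 (fun=> 0) x (fun _ _ => erefl)).
  apply: ae_rav => //; first by case: (SL2 L2_0).
  have := Slin (-1) L2_0 L2_0; apply: filterS => z.
  by under [X in S X]eq_fun do rewrite mulr0 addr0; rewrite mulN1r addNr.
have E : (fun z => \sum_(l <- l :: s) c l * \1_(cell l) z) =
    (fun z => c l * \1_(cell l) z + \sum_(l <- s) c l * \1_(cell l) z).
  by apply/funext => z; rewrite big_cons.
have Ll := L2_indic_cell l.
rewrite E; have LL := L2D (L2Z (c l) Ll) IL; split => //.
rewrite big_cons -IH [matrix_of x l * _]mulrC /matrix_of -ravZ; last exact: SL2.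
rewrite -ravD; [|exact/L2Z/SL2|exact: SL2].
apply: ae_rav; [by case: (SL2 LL)| |exact: Slin].
by case: (L2D (L2Z (c l) (SL2 Ll)) (SL2 IL)).
Qed.

Lemma rav_S_step M (c : cells M -> R) (x : cells M) :
  rav (S (step c)) x = matrix_op (@matrix_of M) c x.
Proof. exact: (rav_S_sum _ _ _).2. Qed.

Lemma matrix_of_bounded M : bounded_mx 2 B (@matrix_of M).
Proof.
move=> c; have h20 : 0 < mesh M ^+ 2 :> R by rewrite exprn_gt0 ?mesh_gt0.
rewrite -(ler_pM2l h20) mulrCA.
have E (f : cells M -> R) : \sum_x `|f x| `^ 2 = \sum_x f x ^+ 2.
  by apply: eq_bigr => x _; rewrite powR_mulrn // real_normK ?num_real.
rewrite !E -lee_fin [leRHS]EFinM -!sqi_step.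
apply: le_trans (Sbnd (step_L2 c)); apply: le_trans (sqi_EM M (SL2 (step_L2 c))).
rewrite le_eqVlt; apply/orP; left; apply/eqP; congr sqi.
by apply/funext => z; rewrite /EM /step; apply: eq_bigr => x _; rewrite rav_S_step.
Qed.

(** The error is that of [EM] on S u, plus EM S applied to the error of [EM] on u; the second is
    small because both [EM] and [S] are bounded. *)
Lemma approximate_S u (e : R) : L2 u -> 0 < e -> exists M,
  (sqi (fun z => S u z - EM M (S (EM M u)) z)%R <= e%:E)%E.
Proof.
move=> Lu e0; have [_ A1] := approximable_L2 Lu; have [_ A2] := approximable_L2 (SL2 Lu).
have B1 : 0 < B + 1 by rewrite ltr_wpDl.
have d0 : 0 < e / (4 * (B + 1)) by rewrite divr_gt0 // mulr_gt0.
have d1 : 0 < e / 4 by rewrite divr_gt0.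
have [M1 h1] := A1 _ d0; have [M2 h2] := A2 _ d1.
pose M := maxn M1 M2; exists M.
have {}h1 := h1 M (leq_maxl _ _); have {}h2 := h2 M (leq_maxr _ _).
have LE : L2 (EM M u) by exact: EM_L2.
have Ld := L2B Lu LE; have LSd := L2B (SL2 Lu) (SL2 LE).
have E z : S u z - EM M (S (EM M u)) z = (S u z - EM M (S u) z) + EM M (fun z => S u z - S (EM M u) z) z.
  have := EMD M z (SL2 Lu) (L2Z (-1) (SL2 LE)).
  rewrite EMZ; last exact: SL2.
  have -> : (fun z => S u z + -1 * S (EM M u) z) = (fun z => S u z - S (EM M u) z).
    by apply/funext => y; rewrite mulN1r.
  by move=> ->; ring.
under [X in sqi X]eq_fun do rewrite E.
have [m1 _] := L2B (SL2 Lu) (EM_L2 M (S u)); have [m2 _] := EM_L2 M (fun z => S u z - S (EM M u) z).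
apply: le_trans (sqiD m1 m2) _.
have h3 : (sqi (EM M (fun z => S u z - S (EM M u) z)%R) <= (e / 4)%:E)%E.
  apply: le_trans (sqi_EM M LSd) _.
  have -> : sqi (fun z => S u z - S (EM M u) z) = sqi (S (fun z => u z - EM M u z)).
    apply: ae_sqi; [by case: LSd|by case: (SL2 Ld)|].
    have := Slin (-1) LE Lu; apply: filterS => z.
    under [X in S X]eq_fun do rewrite mulN1r addrC.
    by move=> ->; rewrite mulN1r addrC.
  apply: le_trans (Sbnd Ld) _; apply: le_trans (lee_wpmul2l _ h1) _; rewrite ?lee_fin //.
  have -> : B * (e / (4 * (B + 1))) = e / 4 * (B / (B + 1)) by field; rewrite gt_eqF.
  rewrite ler_piMr ?(ltW d1) // ler_pdivrMr // mul1r lerDl //.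
apply: le_trans (leeD (lee_wpmul2l _ h2) (lee_wpmul2l _ h3)) _; rewrite ?lee_fin //.
by lra.
Qed.

Variables (k : plane R -> plane R -> R) (t : R).
Hypothesis t0 : 0 < t.
Hypothesis Hk : forall e : R, 0 < e <= 1 -> e <= t -> exists2 C, 0 <= C &
  czx_real e C k /\ czx_real e C (fun x y => k y x).
Hypothesis Sker : forall M (x l : cells M), far_cells 0 x l ->
  \int[mu]_z (S (\1_(cell l)) z * \1_(cell x) z) = entry k x l.

Lemma matrix_of_entry M (x l : cells M) : far_cells 0 x l -> matrix_of x l = mesh M ^- 2 * entry k x l.
Proof.
move=> far; rewrite -Sker // /matrix_of /rav; congr (_ * _).
by rewrite /Rintegral -integral_indicM; congr fine; apply: eq_integral => z _; rewrite mulrC.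
Qed.

Theorem real_weighted_bound (p A : R) w : 1 < p -> 0 <= A -> measurable_fun [set: plane R] w ->
  (forall z, 0 < w z) -> Ap_bound p A w -> exists2 C, 0 <= C &
  forall u, L2 u -> mu.-integrable setT (EFin \o (fun z => `|u z| `^ p * w z)) ->
  (\int[mu]_z (`|S u z| `^ p * w z)%:E <= C%:E * \int[mu]_z (`|u z| `^ p * w z)%:E)%E.
Proof.
move=> p1 A0 mw w0 HA.
have [s [/andP[s1 s2] HD]] := discrete_weighted_bound (9 `^ p * A) p1.
have ss : 0 < s / (s - 1) by rewrite divr_gt0 //; lra.
(* Besides e <= t and e <= 1, regularity with exponent s asks for 2 e s' < 1, and regularity of the
   transpose with exponent 2 asks for 4 e < 1. *)
pose e := Num.min (Num.min t 1) (Num.min ((4 * (s / (s - 1)))^-1) 8^-1).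
have e0 : 0 < e by rewrite !lt_min t0 ltr01 !invr_gt0 mulr_gt0 // ltr0n.
have et : e <= t by rewrite /e !ge_min lexx.
have e1 : e <= 1 by rewrite /e !ge_min lexx !orbT.
have e8 : e <= 8^-1 by rewrite /e !ge_min lexx !orbT.
have es : 2 * e * (s / (s - 1)) < 1.
  apply: le_lt_trans (_ : 2 * (4 * (s / (s - 1)))^-1 * (s / (s - 1)) < 1).
    by rewrite ler_pM2r // ler_pM2l // /e !ge_min lexx !orbT.
  move: ss; move: (s / (s - 1)) => q q0; have -> : 2 / (4 * q) * q = 2^-1 by field; rewrite gt_eqF.
  lra.
have e2 : 2 * e * (2 / (2 - 1)) < 1.
  have -> : 2 / (2 - 1) = 2 :> R by field.
  lra.
have e01 : 0 < e <= 1 by rewrite e0.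
have e02 : 0 < e < 1 by rewrite e0 /=; lra.
have [C C0 [k1 k2]] := Hk e01 et.
have h2 : 1 < 2 :> R by rewrite ltr1n.
have [H1 H10 R1] := regular_entries e0 s1 es C0.
have [H2 H20 R2] := regular_entries e0 h2 e2 C0.
have mk := measurable_restr e01 C0 k1 k2.
have mk' : measurable_fun [set: plane R * plane R] (restr (fun x y => k y x)) by exact: (measurable_restr e01 C0 k2 k1).
pose H := Num.max H1 H2; have H0 : 0 <= H by rewrite le_max H10.
have regle (X : finType) N (dy nb : nat -> rel X) (r h h' : R) a : h <= h' -> regular_mx N dy nb r h a -> regular_mx N dy nb r h' a.
  move=> hh Hr i x iN; have [b Hb] := Hr i x iN; exists b => f m m0 Hf y xy.
  by apply: le_trans (Hb f m m0 Hf y xy) _; rewrite ler_wpM2r.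
have [C' C'0 HC'] := HD B H B0 H0.
have mfar M (y l : cells M) : far_cells 0 y l -> far_cells 0 l y.
  by rewrite /far_cells (nb_sym (@grid_dyadic M.*2.+1)).
have regular M : regular_mx M.*2.+1 same_cube near_cube s H (@matrix_of M).
  apply: (regle _ _ _ _ _ H1); first by rewrite le_max lexx.
  apply: (R1 k) => // y l far.
  have [i1 _ E1 _] := entry_rows e02 C0 k1 k2 far; split => //.
  by rewrite matrix_of_entry // E1.
have regular' M : regular_mx M.*2.+1 same_cube near_cube 2 H (fun x y => @matrix_of M y x).
  apply: (regle _ _ _ _ _ H2); first by rewrite le_max lexx orbT.
  apply: (R2 (fun x y => k y x)) => // y l far; have far' := mfar _ _ _ far.
  have [_ i2 _ E2] := entry_rows e02 C0 k1 k2 far'; split => //.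
  by rewrite matrix_of_entry // E2.
exists (C' * A); first by rewrite mulr_ge0.
move=> u Lu iu; have [mu' _] := Lu.
apply: (fatou_weight p1 mw w0); first by case: (SL2 Lu).
move=> eps eps0; have [M hM] := approximate_S Lu eps0.
exists (EM M (S (EM M u))); split => //; first exact: measurable_step.
have h20 : 0 < mesh M ^+ 2 :> R by rewrite exprn_gt0 ?mesh_gt0.
have p0 : 0 < p by lra.
have phi0 : `|0 : R| `^ p = 0 by rewrite normr0 powR0 // gt_eqF.
rewrite (integral_step _ (phi := fun r => `|r| `^ p) phi0 (fun r => powR_ge0 _ _) mw (fun z => ltW (w0 z))).
have WA := @Apair_rav R p A w M p1 A0 mw w0 HA.
have := HC' _ _ _ _ _ _ (@grid_dyadic M.*2.+1) (@matrix_of_bounded M) (@regular' M) (@regular M) WA (fun x => rav u x).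
move=> /(ler_wpM2l (ltW h20)) hd.
have fI : (\int[mu]_z (`|u z| `^ p * w z)%:E)%E \is a fin_num by exact: integrable_fin_num.
rewrite -(fineK fI) -EFinM (eq_bigr (fun x => (`|rav (S (EM M u)) x| `^ p * (mesh M ^+ 2 * rav w x))%:E)); last first.
  move=> x _; rewrite EFinM; congr (_ * _)%E.
  have [iw _] := Ap_bound_cell x HA.
  by rewrite -Rintegral_cell_rav /Rintegral fineK // integrable_fin_num //; exact: measurable_cell.
rewrite sumEFin lee_fin.
have := sum_rav_weight M p1 A0 mw w0 HA Lu iu => h3.
apply: le_trans (_ : mesh M ^+ 2 * (C' * \sum_x `|rav u x| `^ p * rav w x) <= _).
  apply: le_trans hd; rewrite mulr_sumr; apply: ler_sum => x _.
  by rewrite mulrCA /EM rav_S_step.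
by rewrite mulrCA -[leRHS]mulrA ler_wpM2l.
Qed.

End RealOperator.

(** * Reduction to real and imaginary parts *)

Section ComplexParts.
Context {R : realType}.
Local Notation mu := (@lebesgue2 R).
Local Notation Re := (@complex.Re R).
Local Notation Im := (@complex.Im R).
Implicit Types (f g : plane R -> R[i]) (u v w : plane R -> R) (x y : R[i]).

Lemma ReM x y : Re (x * y) = Re x * Re y - Im x * Im y.
Proof. by case: x => a b; case: y. Qed.

Lemma ImM x y : Im (x * y) = Re x * Im y + Im x * Re y.
Proof. by case: x => a b; case: y. Qed.

Lemma ReD x y : Re (x + y) = Re x + Re y.
Proof. by case: x => a b; case: y. Qed.

Lemma ImD x y : Im (x + y) = Im x + Im y.
Proof. by case: x => a b; case: y. Qed.

Lemma ReB x y : Re (x - y) = Re x - Re y.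
Proof. by case: x => a b; case: y. Qed.

Lemma ImB x y : Im (x - y) = Im x - Im y.
Proof. by case: x => a b; case: y. Qed.

Lemma cmod_ge0 x : 0 <= cmod x.
Proof. by case: x => a b; exact: sqrtr_ge0. Qed.

Lemma cmod_sqr x : cmod x ^+ 2 = Re x ^+ 2 + Im x ^+ 2.
Proof. by case: x => a b /=; rewrite sqr_sqrtr // addr_ge0 ?sqr_ge0. Qed.

Lemma Re_le_cmod x : `|Re x| <= cmod x.
Proof.
rewrite -(@ler_pXn2r _ 2) ?nnegrE ?cmod_ge0 // cmod_sqr real_normK ?num_real //.
by rewrite lerDl sqr_ge0.
Qed.

Lemma Im_le_cmod x : `|Im x| <= cmod x.
Proof.
rewrite -(@ler_pXn2r _ 2) ?nnegrE ?cmod_ge0 // cmod_sqr real_normK ?num_real //.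
by rewrite lerDr sqr_ge0.
Qed.

Lemma cmod_le x : cmod x <= `|Re x| + `|Im x|.
Proof.
rewrite -(@ler_pXn2r _ 2) ?nnegrE ?cmod_ge0 ?addr_ge0 // cmod_sqr sqrrD !real_normK ?num_real //.
by rewrite [leRHS]addrAC lerDl mulrn_wge0 // mulr_ge0.
Qed.

Definition embed u : plane R -> R[i] := fun z => Complex (u z) 0.

Lemma indicC (A : set (plane R)) z : \1_A z = Complex (\1_A z) 0 :> R[i].
Proof. by rewrite !indicE; case: (z \in A). Qed.

Lemma L2norm_sqr f : measurable_funC f ->
  (L2norm f `^ 2 = sqi (Re \o f) + sqi (Im \o f))%E.
Proof.
move=> [mr mi]; rewrite /L2norm powR_Lnorm // /sqi -ge0_integralD //; last 4 first.
- by move=> z _; rewrite lee_fin sqr_ge0.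
- exact: measurable_sqr.
- by move=> z _; rewrite lee_fin sqr_ge0.
- exact: measurable_sqr.
apply: eq_integral => z _; rewrite -EFinD /= -cmod_sqr ger0_norm ?cmod_ge0 //.
by rewrite powR_mulrn ?cmod_ge0.
Qed.

Lemma L2norm_ge0 f : (0 <= L2norm f)%E.
Proof. exact: Lnorm_ge0. Qed.

Lemma in_L2P f : in_L2 f <-> L2 (Re \o f) /\ L2 (Im \o f).
Proof.
split=> [[mf fin]|[[mr fr] [mi fi]]].
  have := poweR_lty 2 fin; rewrite L2norm_sqr // => h.
  have [mr mi] := mf; split; split => //; apply: le_lt_trans h; rewrite ?leeDl ?leeDr ?sqi_ge0 //.
split; first by split.
have n2 : 2 != 0 :> R by [].
apply: (lty_poweRy n2); rewrite L2norm_sqr; last by split.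
by rewrite lte_add_pinfty.
Qed.

Lemma L2norm_le (C : R) f g : 0 <= C -> measurable_funC f -> measurable_funC g ->
  (L2norm f <= C%:E * L2norm g <-> sqi (Re \o f) + sqi (Im \o f) <= (C ^+ 2)%:E * (sqi (Re \o g) + sqi (Im \o g)))%E.
Proof.
move=> C0 mf mg; rewrite -!L2norm_sqr //.
have C2 : ((C ^+ 2)%:E = C%:E `^ 2)%E by rewrite poweR_EFin powR_mulrn.
rewrite C2 -poweRM ?L2norm_ge0 ?lee_fin //.
have n0 : (0 <= C%:E * L2norm g)%E by rewrite mule_ge0 ?L2norm_ge0.
split => [h|h].
  apply: gt0_ler_poweR => //.
  - by rewrite in_itv /= ?L2norm_ge0 leey.
  - by rewrite in_itv /= ?n0 leey.
have p2 : (0 : R) < 2 by [].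
have K (a : \bar R) : (0 <= a)%E -> ((a `^ 2) `^ 2^-1 = a)%E.
  by move=> a0; rewrite -poweRrM mulfV // poweRe1.
rewrite -(K _ (L2norm_ge0 f)) -(K _ n0); apply: gt0_ler_poweR => //.
- by rewrite in_itv /= ?poweR_ge0 leey.
- by rewrite in_itv /= ?poweR_ge0 leey.
Qed.

Lemma measurable_embed u : measurable_fun [set: plane R] u -> measurable_funC (embed u).
Proof. by move=> mu'; split; rewrite /embed //=. Qed.

Lemma in_L2_embed u : L2 u -> in_L2 (embed u).
Proof. by move=> Lu; apply/in_L2P; split; [exact: Lu|exact: L2_0]. Qed.

Lemma sqi0 : sqi (fun _ : plane R => 0 : R) = 0%E.
Proof. by rewrite /sqi integral0_eq // => z _; rewrite expr0n. Qed.

Section ComplexOperator.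
Variables (T : (plane R -> R[i]) -> (plane R -> R[i])) (K : plane R -> plane R -> R[i]).
Hypothesis HT : bounded_operator_L2 T.
Hypothesis HK : has_kernel T K.

Lemma embed_comb (a : R) u v : embed (fun z => a * u z + v z) = (fun z => Complex a 0 * embed u z + embed v z).
Proof. by apply/funext => z; apply/eqP; rewrite eq_complex /= !mul0r !mulr0 subr0 !addr0 !eqxx. Qed.

(* [P] stands for the real or the imaginary part. *)
Lemma part_operator (P : R[i] -> R) : (P = Re \/ P = Im) ->
  [/\ forall u, L2 u -> L2 (P \o T (embed u)),
      forall (a : R) u v, L2 u -> L2 v ->
        {ae mu, forall z, (P \o T (embed (fun z => a * u z + v z))) z =
           a * (P \o T (embed u)) z + (P \o T (embed v)) z},
      exists2 B, 0 <= B & forall u, L2 u -> (sqi (P \o T (embed u)) <= B%:E * sqi u)%E &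
      forall M (x l : cells M), far_cells 0 x l ->
        \int[mu]_z ((P \o T (embed (\1_(cell l)))) z * \1_(cell x) z) = entry (fun x y : plane R => P (K x y)) x l].
Proof.
move=> HP; have [T1 T2 [C TC]] := HT; split.
- move=> u Lu; have := T1 _ (in_L2_embed Lu) => /in_L2P[? ?].
  by case: HP => ->.
- move=> a u v Lu Lv; have := T2 (Complex a 0) _ _ (in_L2_embed Lu) (in_L2_embed Lv).
  apply: filterS => z; rewrite embed_comb /= => ->.
  by case: HP => ->; rewrite ?ReD ?ImD ?ReM ?ImM /= !mul0r ?subr0 ?addr0.
(* The given constant may be negative, hence the absolute value. *)
- exists (`|C| ^+ 2); first exact: sqr_ge0.
  move=> u Lu; have iu := in_L2_embed Lu; have iT := T1 _ iu.
  have h : (L2norm (T (embed u)) <= `|C|%:E * L2norm (embed u))%E.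
    apply: le_trans (TC _ iu) _; rewrite lee_wpmul2r ?L2norm_ge0 // lee_fin ler_norm.
    done.
  have := (L2norm_le (normr_ge0 C) iT.1 iu.1).1 h.
  rewrite [sqi (Im \o embed u)]sqi0 adde0; apply: le_trans.
  by case: HP => ->; rewrite ?leeDl ?leeDr ?sqi_ge0.
- move=> M x l far.
  have cs (y : cells M) : @cube_simple R (embed (\1_(cell y))).
    exists 1%N, (fun=> 1), (fun=> cell y); split.
      by move=> _; exists (corner y), (mesh M); split => //; exact: mesh_gt0.
    by move=> z; rewrite big_ord1 mul1r indicC.
  have supp (y : cells M) z : embed (\1_(cell y)) z != 0 :> R[i] -> cell y z.
    apply: contraNP => yz; by rewrite /embed indicE memNset.
  have disj : [set z | embed (\1_(cell l)) z != 0 :> R[i]] `&` [set z | embed (\1_(cell x)) z != 0 :> R[i]] = set0.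
    apply/seteqP; split => z //= [/supp lz /supp xz]; move: far; rewrite /far_cells.
    by rewrite (cell_inj lz xz) (dy_nb (@grid_dyadic M.*2.+1) (dy_refl (@grid_dyadic M.*2.+1) _ _)).
  have := HK (cs l) (cs x) disj; rewrite /integralC => -[Er Ei].
  have PE (a : R[i]) (b : R) : P (a * Complex b 0) = P a * b.
    by case: HP => ->; rewrite ?ReM ?ImM /= mulr0 ?subr0 ?addr0 ?add0r //.
  have E : \int[mu]_z P (T (embed (\1_(cell l))) z * embed (\1_(cell x)) z) =
     \int[(mu \x mu)%E]_(z in off) P (K z.1 z.2 * embed (\1_(cell l)) z.2 * embed (\1_(cell x)) z.1).
    by case: HP => ->.
  transitivity (\int[mu]_z P (T (embed (\1_(cell l))) z * embed (\1_(cell x)) z)).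
    by apply: eq_Rintegral => z _; rewrite PE.
  by rewrite E; apply: eq_Rintegral => z _; rewrite !PE.
Qed.

End ComplexOperator.

Lemma eccentricity_ge1 (x y : plane R) : off_diag x y -> 1 <= eccentricity x y.
Proof.
move=> od; apply: le_trans (eccentricity_ge od).
by rewrite ler_pdivlMr ?rmin_gt0 // mul1r rmin_le_rmax.
Qed.

(** The eccentricity is at least 1. So its power -1 is at most its power e - 1, and its logarithm is
    at most e^-1 times its power e. *)
Lemma kernel_weights (e : R) (x y : plane R) : 0 < e <= 1 -> off_diag x y ->
  (0 <= Dtheta 1 x y <= e^-1 * eccentricity x y `^ (e - 1)) /\
  (0 <= D1log x y <= e^-1 * eccentricity x y `^ (e - 1)).
Proof.
move=> /andP[e0 e1] od; have ec1 := eccentricity_ge1 od.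
have ec0 : 0 < eccentricity x y by exact: lt_le_trans ec1.
rewrite /Dtheta /D1log; split; apply/andP; split.
- exact: powR_ge0.
- apply: le_trans (_ : 1 * eccentricity x y `^ (e - 1) <= _).
    by rewrite mul1r ler_powR //; lra.
  by rewrite ler_wpM2r ?powR_ge0 // invf_ge1.
- by rewrite mulr_ge0 ?invr_ge0 ?(ltW ec0) // ln_ge0.
have -> : eccentricity x y `^ (e - 1) = (eccentricity x y)^-1 * eccentricity x y `^ e.
  by rewrite addrC powRD ?(gt_eqF ec0) ?implybT // powR_inv1 // ltW.
by rewrite mulrCA ler_wpM2l ?invr_ge0 ?(ltW ec0) // ln_le_powR.
Qed.

Lemma czx_parts (t : R) (K : plane R -> plane R -> R[i]) (P : R[i] -> R) : 0 < t -> P = Re \/ P = Im ->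
  CZX_kernel t 1 K \/ CZX_log_kernel t K ->
  forall e : R, 0 < e <= 1 -> e <= t -> exists2 C, 0 <= C &
  czx_real e C (fun x y : plane R => P (K x y)) /\ czx_real e C (fun x y : plane R => P (K y x)).
Proof.
move=> t0 HP HK e e01 et; have /andP[e0 _] := e01.
have [D [HD [C [Hs [H1 H2] [H3 H4]]]]] : exists D : plane R -> plane R -> R,
    (forall x y : plane R, off_diag x y -> 0 <= D x y <= e^-1 * eccentricity x y `^ (e - 1) /\ D x y = D y x) /\ CZX_estimates D t K.
  have DC (x y : plane R) : Dtheta 1 x y = Dtheta 1 y x by rewrite /Dtheta eccentricityC.
  have DC' (x y : plane R) : D1log x y = D1log y x by rewrite /D1log eccentricityC.
  case: HK => HK; [exists (Dtheta 1)|exists (@D1log R)]; split => // x y od; split => //.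
    by case: (kernel_weights e01 od).
  by case: (kernel_weights e01 od).
pose C' := Num.max C 0; have C'0 : 0 <= C' by rewrite le_max lexx orbT.
have CC' : C <= C' by rewrite le_max lexx.
have Pc x : `|P x| <= cmod x by case: HP => ->; [exact: Re_le_cmod|exact: Im_le_cmod].
have PB x y : P x - P y = P (x - y) by case: HP => ->; rewrite ?ReB ?ImB.
have HD' (x y : plane R) : off_diag x y -> 0 <= D x y <= e^-1 * eccentricity x y `^ (e - 1) by move=> /HD[].
have D0 (x y : plane R) : off_diag x y -> 0 <= D x y by move=> /HD'/andP[].
have sym (x y : plane R) : off_diag x y -> off_diag y x by move=> [a b]; split; rewrite eq_sym.
exists (C' * e^-1); first by rewrite mulr_ge0 // invr_ge0 ltW.
have up (a b c d : R) : 0 <= a -> 0 <= b -> 0 <= d -> C * a * b * d <= C' * a * b * d.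
  by move=> a0 b0 d0; rewrite !ler_wpM2r.
have i0 (r : R) : 0 <= `|r|^-1 by rewrite invr_ge0.
have q0 (r s a b : R) : 0 <= `|r| `^ a / `|s| `^ b by rewrite divr_ge0 ?powR_ge0.
split; apply: (czx_of_estimates e01 et HD' C'0).
- move=> x y od; apply: le_trans (Pc _) _; apply: le_trans (Hs x y od) _.
  by apply: up => //; exact: D0.
- move=> x y w1 od le; rewrite PB; apply: le_trans (Pc _) _; apply: le_trans (H1 x y w1 od le) _.
  by apply: up => //; exact: D0.
- move=> x y w1 od le; rewrite PB; apply: le_trans (Pc _) _; apply: le_trans (H2 x y w1 od le) _.
  by apply: up => //; exact: D0.
- move=> x y od; apply: le_trans (Pc _) _; apply: le_trans (Hs y x (sym _ _ od)) _.
  rewrite -(HD x y od).2 !(distrC y.1) !(distrC y.2).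
  by apply: up => //; exact: D0.
- move=> x y w1 od le; rewrite PB; apply: le_trans (Pc _) _; apply: le_trans (H3 x y w1 od le) _.
  by apply: up => //; exact: D0.
- move=> x y w1 od le; rewrite PB; apply: le_trans (Pc _) _; apply: le_trans (H4 x y w1 od le) _.
  by apply: up => //; exact: D0.
Qed.

End ComplexParts.

Section WeightedBound.
Context {R : realType}.
Local Notation mu := (@lebesgue2 R).
Local Notation Re := (@complex.Re R).
Local Notation Im := (@complex.Im R).

Lemma powR_sum4 (p a b c d : R) : 0 < p -> 0 <= a -> 0 <= b -> 0 <= c -> 0 <= d ->
  (a + b + (c + d)) `^ p <= 4 `^ p * (a `^ p + b `^ p + (c `^ p + d `^ p)).
Proof.
move=> p0 a0 b0 c0 d0; pose m := Num.max (Num.max a b) (Num.max c d).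
have am : a <= m by rewrite /m !le_max lexx.
have bm : b <= m by rewrite /m !le_max lexx orbT.
have cm : c <= m by rewrite /m !le_max lexx !orbT.
have dm : d <= m by rewrite /m !le_max lexx !orbT.
apply: le_trans (_ : (4 * m) `^ p <= _).
  by apply: ler_powR2; rewrite ?(ltW p0) ?addr_ge0 //; lra.
rewrite powRM ?(le_trans a0 am) // ler_wpM2l ?powR_ge0 //.
have := powR_ge0 a p; have := powR_ge0 b p; have := powR_ge0 c p; have := powR_ge0 d p.
have : m = a \/ m = b \/ m = c \/ m = d.
  rewrite /m; case: (leP a b) => _; case: (leP c d) => _;
  by [case: (leP b d) => _; auto|case: (leP b c) => _; auto|case: (leP a d) => _; auto|case: (leP a c) => _; auto].
by case=> [->|[->|[->|->]]]; lra.
Qed.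

(** T f = i T(Im f) + T(Re f) almost everywhere. The real theorem is applied to the real and
    imaginary parts of T on real functions, and the four pieces are recombined by [powR_sum4]. *)
Lemma weighted_extension (t : R) (T : (plane R -> R[i]) -> (plane R -> R[i]))
    (K : plane R -> plane R -> R[i]) :
  0 < t -> bounded_operator_L2 T -> has_kernel T K -> CZX_kernel t 1 K \/ CZX_log_kernel t K ->
  forall (p : R) (w : plane R -> R), 1 < p -> Ap_weight p w -> extends_boundedly_Lpw T p w.
Proof.
move=> t0 HT HK HE p w p1 Aw; have p0 : 0 < p by lra.
have [w' [A [mw' w'0 ww' A0 HA]]] := Ap_weight_bound p1 Aw.
have bound (P : R[i] -> R) : P = Re \/ P = Im -> exists2 C, 0 <= C & forall u, L2 u ->
    mu.-integrable setT (EFin \o (fun z => `|u z| `^ p * w' z)) ->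
    (\int[mu]_z (`|(P \o T (embed u)) z| `^ p * w' z)%:E <= C%:E * \int[mu]_z (`|u z| `^ p * w' z)%:E)%E.
  move=> HP; have [S1 S2 [B B0 S3] S4] := part_operator HT HK HP.
  exact: (real_weighted_bound B0 S1 S2 S3 t0 (czx_parts t0 HP HE) S4 p1 A0 mw' w'0 HA).
have [C1 C10 H1] := bound Re (or_introl erefl).
have [C2 C20 H2] := bound Im (or_intror erefl).
have [T1 T2 _] := HT.
pose I (g : plane R -> R) := (\int[mu]_z (`|g z| `^ p * w' z)%:E)%E.
have I0 g : (0 <= I g)%E by apply: integral_ge0 => z _; rewrite lee_fin mulr_ge0 ?powR_ge0 // ltW.
have mI (g : plane R -> R) : measurable_fun [set: plane R] g ->
    measurable_fun [set: plane R] (fun z => `|g z| `^ p * w' z).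
  move=> mg; apply: measurable_funM => //; apply: (measurableT_comp (measurable_powR p)).
  exact: measurableT_comp.
have mcmod f : measurable_funC f -> measurable_fun [set: plane R] (fun z => cmod (f z)).
  move=> [mr mi]; have -> : (fun z => cmod (f z)) = (fun z => Num.sqrt ((Re (f z)) ^+ 2 + (Im (f z)) ^+ 2)).
    by apply/funext => z; case: (f z).
  have msq : measurable_fun [set: plane R] (fun z => (Re (f z)) ^+ 2 + (Im (f z)) ^+ 2).
    by apply: measurable_funD; exact: measurable_funX.
  exact: (measurableT_comp (continuous_measurable_fun (@sqrt_continuous R)) msq).
have normE f : measurable_funC f -> (Lpw_norm p w f = (I (fun z => cmod (f z))) `^ p^-1)%E.
  move=> mf; rewrite /Lpw_norm /I; congr (_ `^ _)%E.
  have [[mw _ _] _] := Aw.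
  rewrite (eq_integral (fun z => (`|cmod (f z)| `^ p * w z)%:E)); last by move=> z _; rewrite ger0_norm ?cmod_ge0.
  apply: ae_eq_integral => //.
  - apply/measurable_EFinP; apply: measurable_funM => //; apply: (measurableT_comp (measurable_powR p)).
    by apply: measurableT_comp => //; exact: mcmod.
  - by apply/measurable_EFinP; apply: mI; exact: mcmod.
  - by apply: filterS ww' => z h _; rewrite /= h.
have Ile (g h : plane R -> R) : measurable_fun [set: plane R] g -> measurable_fun [set: plane R] h ->
    (forall z, `|g z| <= `|h z|) -> (I g <= I h)%E.
  move=> mg mh gh; apply: ge0_le_integral => //.
  - by move=> z _; rewrite lee_fin mulr_ge0 ?powR_ge0 // ltW.
  - by apply/measurable_EFinP; exact: mI.
  - by apply/measurable_EFinP; exact: mI.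
  - move=> z _; rewrite lee_fin ler_wpM2r ?(ltW (w'0 z)) //.
    by apply: ler_powR2 => //; exact: ltW.
pose D : R := 4 `^ p * (2 * (C1 + C2)).
have D0 : 0 <= D by rewrite mulr_ge0 ?powR_ge0 // mulr_ge0 // addr_ge0.
exists (D `^ p^-1) => f f2 fp.
have [Lr Li] := (in_L2P f).1 f2; have Tf2 := T1 f f2.
have [mr _] := Lr; have [mi _] := Li.
rewrite (normE f f2.1) (normE _ Tf2.1).
have fin : (I (fun z => cmod (f z)) < +oo)%E.
  have [_ +] := fp; rewrite (normE f f2.1); apply: lty_poweRy.
  by rewrite invr_eq0 gt_eqF.
have mcf := mcmod f f2.1.
have Ir : (I (Re \o f) <= I (fun z => cmod (f z)))%E.
  by apply: Ile => // z; rewrite [leRHS]ger0_norm ?cmod_ge0 // Re_le_cmod.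
have Ii : (I (Im \o f) <= I (fun z => cmod (f z)))%E.
  by apply: Ile => // z; rewrite [leRHS]ger0_norm ?cmod_ge0 // Im_le_cmod.
have integ (g : plane R -> R) : measurable_fun [set: plane R] g -> (I g < +oo)%E ->
    mu.-integrable setT (EFin \o (fun z => `|g z| `^ p * w' z)).
  move=> mg gfin; apply/integrableP; split; first by apply/measurable_EFinP; exact: mI.
  rewrite (_ : \int[mu]_(z in _) _ = I g)%E //; apply: eq_integral => z _.
  by rewrite gee0_abs // lee_fin mulr_ge0 ?powR_ge0 // ltW.
have ir := integ _ mr (le_lt_trans Ir fin); have ii := integ _ mi (le_lt_trans Ii fin).
have ae1 : {ae mu, forall z, T f z = 'i%C * T (embed (Im \o f)) z + T (embed (Re \o f)) z}.
  have := T2 'i%C _ _ (in_L2_embed Li) (in_L2_embed Lr); apply: filterS => z <-.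
  congr (T _ z); apply/funext => y; rewrite /embed /=; case: (f y) => a b.
  by apply/eqP; rewrite eq_complex /= !mul0r !mulr0 mul1r subrr add0r addr0 add0r !eqxx.
set U1 := T (embed (Re \o f)) in ae1; set U2 := T (embed (Im \o f)) in ae1.
have [mU1 _] := T1 _ (in_L2_embed Lr); rewrite -/U1 in mU1.
have [mU2 _] := T1 _ (in_L2_embed Li); rewrite -/U2 in mU2.
pose v1 : plane R -> R := Re \o U1; pose v2 : plane R -> R := Im \o U1.
pose v3 : plane R -> R := Re \o U2; pose v4 : plane R -> R := Im \o U2.
have m1 : measurable_fun [set: plane R] v1 := mU1.1; have m2 : measurable_fun [set: plane R] v2 := mU1.2.
have m3 : measurable_fun [set: plane R] v3 := mU2.1; have m4 : measurable_fun [set: plane R] v4 := mU2.2.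
have ae2 : {ae mu, forall z, cmod (T f z) <= `|v1 z| + `|v2 z| + (`|v3 z| + `|v4 z|)}.
  apply: filterS ae1 => z ->; apply: le_trans (cmod_le _) _; rewrite ReD ImD ReM ImM /= !mul0r !mul1r sub0r add0r.
  rewrite -/(v1 z) -/(v2 z) -/(v3 z) -/(v4 z).
  have := ler_normD (- v4 z) (v1 z); have := ler_normD (v3 z) (v2 z).
  by rewrite normrN; lra.
have r1 : (I v1 <= C1%:E * I (fun z => cmod (f z)))%E.
  by apply: le_trans (H1 _ Lr ir) _; apply: lee_wpmul2l Ir; rewrite lee_fin.
have r2 : (I v2 <= C2%:E * I (fun z => cmod (f z)))%E.
  by apply: le_trans (H2 _ Lr ir) _; apply: lee_wpmul2l Ir; rewrite lee_fin.
have r3 : (I v3 <= C1%:E * I (fun z => cmod (f z)))%E.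
  by apply: le_trans (H1 _ Li ii) _; apply: lee_wpmul2l Ii; rewrite lee_fin.
have r4 : (I v4 <= C2%:E * I (fun z => cmod (f z)))%E.
  by apply: le_trans (H2 _ Li ii) _; apply: lee_wpmul2l Ii; rewrite lee_fin.
clearbody v1 v2 v3 v4.
have step1 : (I (fun z => cmod (T f z)) <= (4 `^ p)%:E * ((I v1 + I v2) + (I v3 + I v4)))%E.
  have mE (g : plane R -> R) : measurable_fun [set: plane R] g ->
    measurable_fun [set: plane R] (fun z => (`|g z| `^ p * w' z)%:E).
    by move=> mg; apply/measurable_EFinP; exact: mI.
  have e0 (g : plane R -> R) z : (0 <= (`|g z| `^ p * w' z)%:E)%E by rewrite lee_fin mulr_ge0 ?powR_ge0 // ltW.
  have addI (g h : plane R -> \bar R) : measurable_fun [set: plane R] g -> measurable_fun [set: plane R] h ->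
      (forall z, 0 <= g z)%E -> (forall z, 0 <= h z)%E ->
      (\int[mu]_z g z + \int[mu]_z h z = \int[mu]_z (g z + h z))%E.
    by move=> mg mh g0 h0; rewrite ge0_integralD.
  have mD (g h : plane R -> R) : measurable_fun [set: plane R] g -> measurable_fun [set: plane R] h ->
      measurable_fun [set: plane R] (fun z => (`|g z| `^ p * w' z)%:E + (`|h z| `^ p * w' z)%:E)%E.
    by move=> mg mh; apply: emeasurable_funD; exact: mE.
  have D0' (g h : plane R -> R) z : (0 <= (`|g z| `^ p * w' z)%:E + (`|h z| `^ p * w' z)%:E)%E by rewrite adde_ge0 ?e0.
  rewrite /I (addI _ _ (mE _ m1) (mE _ m2) (e0 _) (e0 _)) (addI _ _ (mE _ m3) (mE _ m4) (e0 _) (e0 _)).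
  rewrite (addI _ _ (mD _ _ m1 m2) (mD _ _ m3 m4) (D0' _ _) (D0' _ _)).
  rewrite -ge0_integralZl ?lee_fin ?powR_ge0 //; last 2 first.
  - by apply: emeasurable_funD; apply: emeasurable_funD; exact: mE.
  - by move=> z _; apply: adde_ge0; exact: D0'.
  apply: ae_ge0_le_integral => //.
  - by move=> z _; rewrite lee_fin mulr_ge0 ?powR_ge0 // ltW.
  - by apply: mE; apply: mcmod; case: Tf2.
  - by move=> z _; apply: mule_ge0; [by rewrite lee_fin powR_ge0|apply: adde_ge0; exact: D0'].
  - by apply: measurable_funeM; apply: emeasurable_funD; apply: emeasurable_funD; exact: mE.
  apply: filterS ae2 => z h _.
  rewrite -!EFinD -EFinM lee_fin -!mulrDl mulrA ler_wpM2r ?(ltW (w'0 z)) //.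
  rewrite (ger0_norm (cmod_ge0 _)).
  apply: le_trans (powR_sum4 p0 (normr_ge0 _) (normr_ge0 _) (normr_ge0 _) (normr_ge0 _)).
  by apply: ler_powR2; [exact: ltW|exact: cmod_ge0|].
have hD : (I (fun z => cmod (T f z)) <= D%:E * I (fun z => cmod (f z)))%E.
  apply: le_trans step1 _; rewrite EFinM -muleA lee_wpmul2l ?lee_fin ?powR_ge0 //.
  have fI : I (fun z => cmod (f z)) \is a fin_num by rewrite ge0_fin_numE.
  apply: le_trans (leeD (leeD r1 r2) (leeD r3 r4)) _.
  rewrite -(fineK fI) -!EFinM -!EFinD lee_fin; set c := fine _.
  by rewrite -!mulrDl (_ : C1 + C2 + (C1 + C2) = 2 * (C1 + C2)) //; ring.
have pi0 : 0 <= p^-1 by rewrite invr_ge0 ltW.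
have -> : ((D `^ p^-1)%:E * I (fun z => cmod (f z)) `^ p^-1 = (D%:E * I (fun z => cmod (f z))) `^ p^-1)%E.
  by rewrite poweRM ?lee_fin // poweR_EFin.
apply: gt0_ler_poweR => //.
- by rewrite in_itv /= I0 leey.
- by rewrite in_itv /= mule_ge0 ?lee_fin // leey.
Qed.

End WeightedBound.

(** * The counterexample *)

Section RoughKernel.
Context {R : realType}.
Variable b : R.
Hypotheses (b0 : 0 < b) (b1 : b < 1).
Implicit Types (x y w : plane R) (s t r : R).

(* As [0 `^ (b - 1) = 0], the kernel vanishes on the diagonal [t = 0]. *)
Definition kappa t : R := Num.max 0 (`|t| `^ (b - 1) - 1).
Definition psi s : R := Num.max 0 (2^-1 - `| `|s| - 3 / 2 |).
Definition rough x y : R := kappa (x.1 - y.1) * psi (x.2 - y.2).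

Lemma kappa_ge0 t : 0 <= kappa t. Proof. by rewrite /kappa le_max lexx. Qed.
Lemma psi_ge0 s : 0 <= psi s. Proof. by rewrite /psi le_max lexx. Qed.
Lemma rough_ge0 x y : 0 <= rough x y. Proof. by rewrite mulr_ge0 ?kappa_ge0 ?psi_ge0. Qed.

Lemma kappa_le t : kappa t <= `|t| `^ (b - 1).
Proof. by rewrite /kappa ge_max powR_ge0 gerBl ler01. Qed.

Lemma kappa_out t : 1 <= `|t| -> kappa t = 0.
Proof.
move=> t1; apply/max_idPl; rewrite subr_le0 -[leRHS](powRr0 `|t|).
by apply: ler_powR => //; rewrite subr_le0 ltW.
Qed.

Lemma kappa0 : kappa 0 = 0.
Proof. by apply/max_idPl; rewrite normr0 powR0 ?sub0r ?lerN10 // subr_eq0 lt_eqF. Qed.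

Lemma psi_le s : psi s <= 2^-1.
Proof. by rewrite /psi ge_max invr_ge0 ler0n gerBl normr_ge0. Qed.

Lemma psi_out s : `|s| <= 1 \/ 2 <= `|s| -> psi s = 0.
Proof.
move=> h; apply/max_idPl; rewrite subr_le0.
by case: h => h; [rewrite distrC|]; apply: le_trans (ler_norm _); lra.
Qed.

Lemma psi_lip s s' : `|psi s - psi s'| <= `|s - s'|.
Proof.
have maxlip (p q : R) : `|Num.max 0 p - Num.max 0 q| <= `|p - q|.
  have := ler_norm (p - q); have := ler_norm (- (p - q)); have := normr_ge0 (p - q); rewrite normrN ler_norml.
  by case: (leP 0 p); case: (leP 0 q); lra.
apply: le_trans (maxlip _ _) _.
have -> : 2^-1 - `| `|s| - 3 / 2| - (2^-1 - `| `|s'| - 3 / 2|) = `| `|s'| - 3 / 2| - `| `|s| - 3 / 2| by ring.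
apply: le_trans (ler_dist_dist _ _) _.
have -> : `|s'| - 3 / 2 - (`|s| - 3 / 2) = `|s'| - `|s| by ring.
by apply: le_trans (ler_dist_dist _ _) _; rewrite distrC.
Qed.

(** For r <= s the difference is r^-a (1 - (r/s)^a), and (r/s)^a >= r/s because a <= 1. *)
Lemma powRN_lip (a m r s : R) : 0 < a <= 1 -> 0 < m -> m <= r -> m <= s ->
  `|r `^ (- a) - s `^ (- a)| <= m `^ (- a) / m * `|r - s|.
Proof.
move=> /andP[a0 a1] m0; wlog rs : r s / r <= s.
  move=> H mr ms; have [/H|/ltW/H] := leP r s; first exact.
  by rewrite distrC [`|r - s|]distrC; exact.
move=> mr ms; have r0 : 0 < r by lra. have s0 : 0 < s by lra.
have E : s `^ (- a) = r `^ (- a) * (r / s) `^ a.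
  rewrite powRM ?invr_ge0 ?(ltW r0) ?(ltW s0) // mulrA powRVn // mul1r.
  by rewrite -(powR_inv1 (ltW s0)) -powRrM mulN1r.
have rs1 : 0 < r / s <= 1 by rewrite divr_gt0 //= ler_pdivrMr // mul1r.
have h : r / s <= (r / s) `^ a by apply: ger1_powR.
have h1 : (r / s) `^ a <= 1.
  have := @ler_powR2 R (r / s) 1 a; rewrite powR1; case/andP: rs1 => rs0 rs1.
  by apply => //; exact: ltW.
rewrite E -{1}[r `^ (- a)]mulr1 -mulrBr normrM (ger0_norm (powR_ge0 _ _)) ger0_norm ?subr_ge0 //.
rewrite -mulrA; apply: ler_pM; rewrite ?powR_ge0 ?subr_ge0 //.
  by apply: powRN_anti => //; exact: ltW.
rewrite distrC ger0_norm ?subr_ge0 //.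
apply: le_trans (_ : (s - r) / s <= _).
  by rewrite mulrBl mulfV ?gt_eqF // lerD2l lerN2.
rewrite [leRHS]mulrC ler_wpM2l ?subr_ge0 // lef_pV2 //.
Qed.

(** [powRN_lip] with m = |t| / 2, which leaves the factor 2 times 2^(1-b), at most 4. *)
Lemma kappa_lip t t' : 0 < `|t| -> `|t| / 2 <= `|t'| ->
  `|kappa t - kappa t'| <= 4 * (`|t| `^ (b - 1) / `|t|) * `|t - t'|.
Proof.
move=> t0 tt'; have m0 : 0 < `|t| / 2 by rewrite divr_gt0.
have maxlip (p q : R) : `|Num.max 0 p - Num.max 0 q| <= `|p - q|.
  have := ler_norm (p - q); have := ler_norm (- (p - q)); have := normr_ge0 (p - q); rewrite normrN ler_norml.
  by case: (leP 0 p); case: (leP 0 q); lra.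
apply: le_trans (maxlip _ _) _.
have -> : `|t| `^ (b - 1) - 1 - (`|t'| `^ (b - 1) - 1) = `|t| `^ (- (1 - b)) - `|t'| `^ (- (1 - b)).
  by rewrite !opprB addrA subrK.
have a01 : 0 < 1 - b <= 1 by rewrite subr_gt0 b1 gerBl ltW.
apply: le_trans (powRN_lip a01 m0 _ tt') _; first by lra.
apply: ler_pM; [by rewrite mulr_ge0 ?powR_ge0 // invr_ge0 ltW|exact: normr_ge0| |].
  have -> : (`|t| / 2) `^ (- (1 - b)) = `|t| `^ (b - 1) * 2 `^ (1 - b).
    rewrite powRM ?invr_ge0 //; congr (_ * _); first by rewrite opprB.
    by rewrite -(powR_inv1 (ler0n R 2)) -powRrM mulN1r opprK.
  rewrite invf_div.
  have -> : `|t| `^ (b - 1) * 2 `^ (1 - b) * (2 / `|t|) = 2 `^ (1 - b) * 2 * (`|t| `^ (b - 1) / `|t|) by ring.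
  rewrite ler_wpM2r ?divr_ge0 ?powR_ge0 //.
  have : 2 `^ (1 - b) <= 2 `^ 1 :> R by apply: ler_powR; rewrite ?ler1n // gerBl ltW.
  rewrite powRr1 //; lra.
exact: ler_dist_dist.
Qed.

(** In this range the eccentricity is at most (18 + 4) / r1, so the size bound is at least a
    multiple of r1^(b-1); the constant is 4 times 22. The range exceeds the support of the kernel in
    order to cover points one Hoelder increment away from it. *)
Lemma Dtheta_lower : exists2 c : R, 0 <= c & forall x y, off_diag x y ->
  `|x.1 - y.1| <= 3 -> 2^-1 <= `|x.2 - y.2| <= 4 ->
  `|x.1 - y.1| `^ (b - 1) <= c * (`|x.1 - y.1|^-1 * `|x.2 - y.2|^-1 * Dtheta b x y).
Proof.
exists 88; first by rewrite ler0n.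
move=> x y od; have [h1 h2] := off_diag_gt0 od; rewrite /Dtheta /eccentricity.
move: (`|x.1 - y.1|) (`|x.2 - y.2|) h1 h2 => r1 r2 r10 r20 r13 /andP[r2l r2u].
have v2 : r2^-1 <= 2 by rewrite invf_ple ?posrE.
have v2' : 4^-1 <= r2^-1 by rewrite lef_pV2 ?posrE.
have ec : r1 / r2 + r2 / r1 <= 22 / r1.
  rewrite -(ler_pM2r r10) mulrDl !divfK ?gt_eqF //.
  have : r1 / r2 * r1 <= 3 * 2 * 3.
    by apply: ler_pM; rewrite ?(ltW r10) ?divr_ge0 ?(ltW r10) ?(ltW r20) // ler_pM ?invr_ge0 // ltW.
  lra.
have ec0 : 0 < r1 / r2 + r2 / r1 by rewrite addr_gt0 // divr_gt0.
have D : r1 `^ b / 22 <= (r1 / r2 + r2 / r1) `^ (- b).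
  apply: le_trans (powRN_anti (ltW b0) ec0 ec).
  rewrite powRM ?invr_ge0 ?(ltW r10) // -(powR_inv1 (ltW r10)) -powRrM mulN1r opprK mulrC ler_wpM2r ?powR_ge0 //.
  rewrite -(powR_inv1 (ler0n R 22)); apply: ler_powR; [by rewrite ler1n|by rewrite lerN2 ltW].
have -> : r1 `^ (b - 1) = r1 `^ b / r1.
  by rewrite powRD ?(gt_eqF r10) ?implybT // powR_inv1 // ltW.
apply: le_trans (_ : 88 * (r1^-1 * 4^-1 * (r1 `^ b / 22)) <= _).
  by rewrite le_eqVlt; apply/orP; left; apply/eqP; field; rewrite gt_eqF.
by rewrite ler_wpM2l // ler_pM ?mulr_ge0 ?divr_ge0 ?invr_ge0 ?powR_ge0 ?(ltW r10) // ler_wpM2l ?invr_ge0 // ltW.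
Qed.

Lemma powR_ratio (t d r : R) : 0 < t <= 1 -> 0 <= d -> 0 < r -> d <= r / 2 ->
  d / r <= d `^ t / r `^ t.
Proof.
move=> /andP[t0 t1] d0 r0 dr.
have -> : d `^ t / r `^ t = (d / r) `^ t.
  by rewrite powRM ?invr_ge0 ?(ltW r0) // -(powR_inv1 (ltW r0)) -powRrM mulN1r powRN.
have [->|dn] := eqVneq d 0; first by rewrite mul0r powR_ge0.
have dp : 0 < d by rewrite lt_neqAle eq_sym dn.
apply: ger1_powR => //; rewrite divr_gt0 //= ler_pdivrMr //; lra.
Qed.

Lemma roughC x y : rough x y = rough y x.
Proof. by rewrite /rough /kappa /psi !(distrC x.1) !(distrC x.2). Qed.

Lemma rough_diag x y : ~ off_diag x y -> rough x y = 0.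
Proof.
move=> od; have : x.1 = y.1 \/ x.2 = y.2.
  apply: contrapT => h; apply: od; split; apply/eqP => e; apply: h; [left|right]; exact: e.
case=> e; rewrite /rough e subrr ?kappa0 ?mul0r //.
by rewrite psi_out ?mulr0 // normr0; left.
Qed.

Section Bounds.
Variable c : R.
Hypothesis c0 : 0 <= c.
Hypothesis Dlow : forall x y, off_diag x y -> `|x.1 - y.1| <= 3 -> 2^-1 <= `|x.2 - y.2| <= 4 ->
  `|x.1 - y.1| `^ (b - 1) <= c * (`|x.1 - y.1|^-1 * `|x.2 - y.2|^-1 * Dtheta b x y).

Lemma rough_size x y : off_diag x y ->
  rough x y <= (4 * c) * `|x.1 - y.1|^-1 * `|x.2 - y.2|^-1 * Dtheta b x y.
Proof.
move=> od; have [h1 h2] := off_diag_gt0 od.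
have R0 : 0 <= `|x.1 - y.1|^-1 * `|x.2 - y.2|^-1 * Dtheta b x y by rewrite !mulr_ge0 ?invr_ge0 ?powR_ge0.
have -> : 4 * c * `|x.1 - y.1|^-1 * `|x.2 - y.2|^-1 * Dtheta b x y =
   4 * c * (`|x.1 - y.1|^-1 * `|x.2 - y.2|^-1 * Dtheta b x y) by ring.
have c40 : 0 <= 4 * c by rewrite mulr_ge0.
have [r1|r1] := leP 1 `|x.1 - y.1|; first by rewrite /rough kappa_out // mul0r mulr_ge0.
have [r2|r2] := leP `|x.2 - y.2| 1.
  by rewrite /rough (psi_out (or_introl r2)) mulr0 mulr_ge0.
have [r2'|r2'] := leP 2 `|x.2 - y.2|.
  by rewrite /rough (psi_out (or_intror r2')) mulr0 mulr_ge0.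
apply: le_trans (_ : `|x.1 - y.1| `^ (b - 1) * 1 <= _).
  apply: ler_pM; rewrite ?kappa_ge0 ?psi_ge0 ?kappa_le //.
  by apply: le_trans (psi_le _) _; lra.
rewrite mulr1; apply: le_trans (Dlow od _ _) _; first by lra.
  by apply/andP; split; lra.
by rewrite ler_wpM2r // ler_peMl // ler1n.
Qed.

(** The Lipschitz bound for [kappa], weakened to exponent t by [powR_ratio], is set against the
    lower bound [Dlow]. *)
Lemma rough_holder1 (t : R) x y (w1 : R) : 0 < t <= 1 -> off_diag x y -> `|x.1 - w1| <= `|x.1 - y.1| / 2 ->
  `|rough x y - rough (w1, x.2) y| <=
  (4 * c) * (`|x.1 - w1| `^ t / `|x.1 - y.1| `^ (1 + t)) * `|x.2 - y.2|^-1 * Dtheta b x y.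
Proof.
move=> t01 od dw; have [h1 h2] := off_diag_gt0 od.
have R0 : 0 <= `|x.1 - y.1|^-1 * `|x.2 - y.2|^-1 * Dtheta b x y by rewrite !mulr_ge0 ?invr_ge0 ?powR_ge0.
set d := `|x.1 - w1| in dw *.
have -> : (4 * c) * (d `^ t / `|x.1 - y.1| `^ (1 + t)) * `|x.2 - y.2|^-1 * Dtheta b x y =
   (4 * c) * (d `^ t / `|x.1 - y.1| `^ t) * (`|x.1 - y.1|^-1 * `|x.2 - y.2|^-1 * Dtheta b x y).
  by rewrite powR1D // invfM; ring.
have c40 : 0 <= 4 * c by rewrite mulr_ge0.
have P0 : 0 <= d `^ t / `|x.1 - y.1| `^ t by rewrite divr_ge0 ?powR_ge0.
rewrite /rough -mulrBl normrM (ger0_norm (psi_ge0 _)) /=.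
have [r2|r2] := leP `|x.2 - y.2| 1.
  by rewrite (psi_out (or_introl r2)) mulr0 mulr_ge0 // mulr_ge0.
have [r2'|r2'] := leP 2 `|x.2 - y.2|.
  by rewrite (psi_out (or_intror r2')) mulr0 mulr_ge0 // mulr_ge0.
have tw : `|x.1 - y.1| / 2 <= `|w1 - y.1|.
  by have := ler_distD w1 x.1 y.1; rewrite -/d; lra.
(* Beyond distance 2, both arguments of [kappa] have absolute value at least 1. *)
have [r1|r1] := leP 2 `|x.1 - y.1|.
  rewrite !kappa_out ?subrr ?normr0 ?mul0r; [by rewrite mulr_ge0 // mulr_ge0|lra|lra].
have := kappa_lip h1 tw.
have -> : x.1 - y.1 - (w1 - y.1) = x.1 - w1 by ring.
rewrite -/d => H.
have L1 : `|x.1 - y.1| <= 3 by lra.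
have L2 : 2^-1 <= `|x.2 - y.2| <= 4 by apply/andP; split; lra.
have L := Dlow od L1 L2.
apply: le_trans (_ : 4 * (`|x.1 - y.1| `^ (b - 1) / `|x.1 - y.1|) * d * 1 <= _).
  by apply: ler_pM; rewrite ?psi_ge0 //; apply: le_trans (psi_le _) _; lra.
have D0 : 0 <= d by exact: normr_ge0.
have -> : 4 * (`|x.1 - y.1| `^ (b - 1) / `|x.1 - y.1|) * d * 1 = 4 * ((d / `|x.1 - y.1|) * `|x.1 - y.1| `^ (b - 1)) by ring.
apply: le_trans (_ : 4 * ((d `^ t / `|x.1 - y.1| `^ t) * (c * (`|x.1 - y.1|^-1 * `|x.2 - y.2|^-1 * Dtheta b x y))) <= _).
  rewrite ler_wpM2l // ler_pM ?powR_ge0 ?divr_ge0 ?(ltW h1) //; exact: powR_ratio.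
move: P0 R0; move: (d `^ t / _) (_ * Dtheta _ _ _) => p q p0 q0.
by rewrite le_eqVlt; apply/orP; left; apply/eqP; ring.
Qed.

Lemma rough_holder2 (t : R) x y (w2 : R) : 0 < t <= 1 -> off_diag x y -> `|x.2 - w2| <= `|x.2 - y.2| / 2 ->
  `|rough x y - rough (x.1, w2) y| <=
  (4 * c) * `|x.1 - y.1|^-1 * (`|x.2 - w2| `^ t / `|x.2 - y.2| `^ (1 + t)) * Dtheta b x y.
Proof.
move=> t01 od dw; have [h1 h2] := off_diag_gt0 od.
have R0 : 0 <= `|x.1 - y.1|^-1 * `|x.2 - y.2|^-1 * Dtheta b x y by rewrite !mulr_ge0 ?invr_ge0 ?powR_ge0.
set d := `|x.2 - w2| in dw *.
have -> : (4 * c) * `|x.1 - y.1|^-1 * (d `^ t / `|x.2 - y.2| `^ (1 + t)) * Dtheta b x y =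
   (4 * c) * (d `^ t / `|x.2 - y.2| `^ t) * (`|x.1 - y.1|^-1 * `|x.2 - y.2|^-1 * Dtheta b x y).
  by rewrite powR1D // invfM; ring.
have c40 : 0 <= 4 * c by rewrite mulr_ge0.
have P0 : 0 <= d `^ t / `|x.2 - y.2| `^ t by rewrite divr_ge0 ?powR_ge0.
rewrite /rough -mulrBr normrM (ger0_norm (kappa_ge0 _)) /=.
have [r1|r1] := leP 1 `|x.1 - y.1|; first by rewrite kappa_out // mul0r mulr_ge0 // mulr_ge0.
have tw : `|x.2 - y.2| / 2 <= `|w2 - y.2|.
  by have := ler_distD w2 x.2 y.2; rewrite -/d; lra.
have tw' : `|w2 - y.2| <= 3 / 2 * `|x.2 - y.2|.
  by have := ler_distD x.2 w2 y.2; rewrite [`|w2 - x.2|]distrC -/d; lra.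
have D0 : 0 <= d by exact: normr_ge0.
(* An increment changes the second distance by at most half, so outside the range from 1/2 to 4 both
   values of [psi] vanish. *)
have [r2|r2] := leP `|x.2 - y.2| 2^-1.
  rewrite !psi_out ?subrr ?normr0 ?mulr0; [by rewrite mulr_ge0 // mulr_ge0|left; lra|left; lra].
have [r2'|r2'] := leP 4 `|x.2 - y.2|.
  rewrite !psi_out ?subrr ?normr0 ?mulr0; [by rewrite mulr_ge0 // mulr_ge0|right; lra|right; lra].
have L1 : `|x.1 - y.1| <= 3 by lra.
have L2 : 2^-1 <= `|x.2 - y.2| <= 4 by apply/andP; split; lra.
have L := Dlow od L1 L2.
have H := psi_lip (x.2 - y.2) (w2 - y.2).
have E : x.2 - y.2 - (w2 - y.2) = x.2 - w2 by ring.
rewrite E -/d in H.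
have H2 : d <= 4 * (d `^ t / `|x.2 - y.2| `^ t).
  apply: le_trans (_ : 4 * (d / `|x.2 - y.2|) <= _); last by rewrite ler_wpM2l //; exact: powR_ratio.
  by rewrite mulrA ler_pdivlMr // mulrC ler_wpM2r // ltW.
apply: le_trans (_ : (c * (`|x.1 - y.1|^-1 * `|x.2 - y.2|^-1 * Dtheta b x y)) * (4 * (d `^ t / `|x.2 - y.2| `^ t)) <= _).
  apply: ler_pM; rewrite ?kappa_ge0 //; first exact: le_trans (kappa_le _) L.
  exact: le_trans H H2.
move: P0 R0; move: (d `^ t / _) (_ * Dtheta _ _ _) => p q p0 q0.
by rewrite le_eqVlt; apply/orP; left; apply/eqP; ring.
Qed.

End Bounds.

Definition roughC_kernel x y : R[i] := Complex (rough x y) 0.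

Lemma cmod_real (a : R) : cmod (Complex a 0) = `|a|.
Proof. by rewrite /= expr0n addr0 sqrtr_sqr. Qed.

Lemma rough_CZX (t : R) : 0 < t <= 1 -> CZX_kernel t b roughC_kernel.
Proof.
move=> t01; have [c c0 Dlow] := Dtheta_lower; exists (4 * c).
have B (a a' : R) : Complex a 0 - Complex a' 0 = Complex (a - a') 0.
  by apply/eqP; rewrite eq_complex /= subrr !eqxx.
have hol : mixed_holder_estimate (Dtheta b) t (4 * c) roughC_kernel.
  split => x y w' od le; rewrite /roughC_kernel B cmod_real.
    exact: (rough_holder1 c0 Dlow).
  exact: (rough_holder2 c0 Dlow).
have E : (fun x y => roughC_kernel y x) = roughC_kernel.
  by apply/funext => x; apply/funext => y; rewrite /roughC_kernel roughC.
split => //; last by rewrite E.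
by move=> x y od; rewrite cmod_real ger0_norm ?rough_ge0 // (rough_size c0 Dlow).
Qed.

End RoughKernel.

(** * Schur's test for a symmetric nonnegative kernel *)

Section Schur.
Context {R : realType}.
Local Notation mu := (@lebesgue2 R).
Variables (q : plane R -> plane R -> R) (C : R).
Hypotheses (q0 : forall x y, 0 <= q x y) (qC : forall x y, q x y = q y x).
Hypothesis mq : measurable_fun [set: plane R * plane R] (fun z => q z.1 z.2).
Hypotheses (C0 : 0 < C) (Hq : forall x, (\int[mu]_y (q x y)%:E <= C%:E)%E).
Implicit Types (u v : plane R -> R) (x y : plane R).

Definition iop u x : R := \int[mu]_y (q x y * u y).

Let mqx x : measurable_fun [set: plane R] (q x).
Proof. exact: (measurableT_comp mq (pair1_measurable x)). Qed.

Let m1 : measurable_fun [set: plane R * plane R] (fst : _ -> plane R). Proof. exact: measurable_fst. Qed.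
Let m2 : measurable_fun [set: plane R * plane R] (snd : _ -> plane R). Proof. exact: measurable_snd. Qed.

Lemma measurable_iop u : measurable_fun [set: plane R] u -> measurable_fun [set: plane R] (iop u).
Proof.
move=> mf; pose f (z : plane R * plane R) : \bar R := (q z.1 z.2 * u z.2)%:E.
have mE : measurable_fun [set: plane R * plane R] f.
  by apply/measurable_EFinP; apply: measurable_funM => //; exact: (measurableT_comp mf m2).
have mp : measurable_fun [set: plane R] (fubini_F mu (f^\+)%E).
  by apply: measurable_fun_fubini_tonelli_F => //; exact: measurable_funepos.
have mn : measurable_fun [set: plane R] (fubini_F mu (f^\-)%E).
  by apply: measurable_fun_fubini_tonelli_F => //; exact: measurable_funeneg.
have E : iop u = fine \o (fun x => fubini_F mu (f^\+)%E x - fubini_F mu (f^\-)%E x)%E.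
  apply/funext => x; rewrite /iop /Rintegral integralE /=; congr (fine (_ - _)).
    by apply: eq_integral => y _; rewrite !funeposE.
  by apply: eq_integral => y _; rewrite !funenegE.
by rewrite E; apply: measurableT_comp => //; exact: emeasurable_funB.
Qed.

(** The intermediate quantity of Schur's test: C [sqop] bounds the square of [iop] by
    Cauchy-Schwarz, and by Tonelli's theorem and symmetry [sqop] integrates to at most C times the
    squared norm of u. *)
Definition sqop u x : \bar R := (\int[mu]_y (q x y * u y ^+ 2)%:E)%E.

Lemma sqop_ge0 u x : (0 <= sqop u x)%E.
Proof. by apply: integral_ge0 => y _; rewrite lee_fin mulr_ge0 ?sqr_ge0. Qed.

Let mqu u : measurable_fun [set: plane R] u ->
  measurable_fun [set: plane R * plane R] (fun z => (q z.1 z.2 * u z.2 ^+ 2)%:E).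
Proof.
move=> mf; apply/measurable_EFinP; apply: measurable_funM => //.
have h : measurable_fun [set: plane R] (fun z => u z ^+ 2) by exact: measurable_funX.
exact: (measurableT_comp h m2).
Qed.

Lemma measurable_sqop u : measurable_fun [set: plane R] u -> measurable_fun [set: plane R] (sqop u).
Proof.
move=> mf; have := @measurable_fun_fubini_tonelli_F _ _ _ _ _ mu _ (mqu mf).
by apply => z; rewrite lee_fin mulr_ge0 ?sqr_ge0.
Qed.

Lemma integral_sqop u : measurable_fun [set: plane R] u -> (\int[mu]_x sqop u x <= C%:E * sqi u)%E.
Proof.
move=> mf; have pos z : (0 <= (q z.1 z.2 * u z.2 ^+ 2)%:E)%E by rewrite lee_fin mulr_ge0 ?sqr_ge0.
have := @fubini_tonelli _ _ _ _ _ mu mu (fun z => (q z.1 z.2 * u z.2 ^+ 2)%:E) (mqu mf) pos.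
rewrite [X in X = _](_ : _ = \int[mu]_x sqop u x)%E // => ->.
rewrite /sqi -ge0_integralZl ?lee_fin ?(ltW C0) //; last 2 first.
- exact: measurable_sqr.
- by move=> z _; rewrite lee_fin sqr_ge0.
apply: ge0_le_integral => //.
- by move=> y _; apply: integral_ge0 => x _; exact: pos.
- have := @measurable_fun_fubini_tonelli_G _ _ _ _ _ mu _ (mqu mf) pos; exact.
- by apply: measurable_funeM; exact: measurable_sqr.
move=> y _; rewrite (eq_integral (fun x => (u y ^+ 2)%:E * (q y x)%:E)%E); last first.
  by move=> x _; rewrite /= qC mulrC EFinM.
rewrite ge0_integralZl ?lee_fin ?sqr_ge0 //.
- by rewrite muleC lee_wpmul2r // lee_fin sqr_ge0.
- by apply/measurable_EFinP; exact: mqx.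
- by move=> x _; rewrite lee_fin.
Qed.

Lemma integrable_q x : mu.-integrable setT (EFin \o q x).
Proof.
apply/integrableP; split; first by apply/measurable_EFinP; exact: mqx.
under eq_integral do rewrite gee0_abs ?lee_fin //=.
by apply: le_lt_trans (Hq x) _; rewrite ltry.
Qed.

Lemma sqop_integrable u x : measurable_fun [set: plane R] u -> (sqop u x < +oo)%E ->
  mu.-integrable setT (EFin \o (fun y => q x y * u y ^+ 2)) /\
  mu.-integrable setT (EFin \o (fun y => q x y * u y)).
Proof.
move=> mf fin.
have m2' : measurable_fun [set: plane R] (fun y => q x y * u y ^+ 2).
  by apply: measurable_funM; [exact: mqx|exact: measurable_funX].
have i2 : mu.-integrable setT (EFin \o (fun y => q x y * u y ^+ 2)).
  apply/integrableP; split; first by apply/measurable_EFinP.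
  rewrite (_ : (\int[mu]_y _)%E = sqop u x) //; apply: eq_integral => y _.
  by rewrite gee0_abs // lee_fin mulr_ge0 ?sqr_ge0.
split => //; have [i3 _] := integrable_comb 1 1 measurableT (integrable_q x) i2.
apply: (le_integrable measurableT _ _ i3).
  by apply/measurable_EFinP; apply: measurable_funM => //; exact: mqx.
move=> y _; have : `|q x y * u y| <= `|1 * q x y + 1 * (q x y * u y ^+ 2)|; last by [].
have P : 0 <= q x y + q x y * u y ^+ 2 by apply: addr_ge0 => //; apply: mulr_ge0 => //; exact: sqr_ge0.
rewrite normrM (ger0_norm (q0 _ _)) !mul1r (ger0_norm P).
have -> : q x y + q x y * u y ^+ 2 = q x y * (1 + u y ^+ 2) by ring.
rewrite ler_wpM2l //.
have := sqr_ge0 (`|u y| - 1); rewrite -[u y ^+ 2]real_normK ?num_real // !expr2.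
by have := normr_ge0 (u y); nra.
Qed.

(** Cauchy-Schwarz through 2 m u - m^2 <= u^2 with the optimal m = a / C. *)
Lemma iop_sqr u x : measurable_fun [set: plane R] u -> ((iop u x ^+ 2)%:E <= C%:E * sqop u x)%E.
Proof.
move=> mf; have := sqop_ge0 u x; case E : (sqop u x) => [F| |] // F0; last first.
  by rewrite mulry gtr0_sg // mul1e leey.
have fin : (sqop u x < +oo)%E by rewrite E ltry.
have [i2 i1] := sqop_integrable mf fin.
rewrite -EFinM lee_fin; set a := iop u x; pose m := a / C.
have EF : F = \int[mu]_y (q x y * u y ^+ 2) by rewrite /Rintegral -/(sqop u x) E.
have [i3 e3] := integrable_comb (2 * m) (- m ^+ 2) measurableT i1 (integrable_q x).
have : \int[mu]_y (2 * m * (q x y * u y) + - m ^+ 2 * q x y) <= F.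
  rewrite EF; apply: le_Rintegral => // y _.
  have : 0 <= q x y * (u y - m) ^+ 2 by rewrite mulr_ge0 ?sqr_ge0.
  by rewrite sqrrB !expr2; nra.
rewrite e3 -/a => h.
have h2 : \int[mu]_y q x y <= C.
  by rewrite -lee_fin /Rintegral fineK ?integrable_fin_num //; exact: integrable_q.
have : C * (2 * m * a - m ^+ 2 * C) <= C * F.
  rewrite ler_pM2l //; apply: le_trans h; rewrite lerD2l mulNr lerN2 ler_wpM2l ?sqr_ge0 //.
apply: le_trans; rewrite /m le_eqVlt; apply/orP; left; apply/eqP; field; exact: lt0r_neq0.
Qed.

Lemma sqi_iop u : L2 u -> L2 (iop u) /\ (sqi (iop u) <= (C ^+ 2)%:E * sqi u)%E.
Proof.
move=> [mf fin]; have mi := measurable_iop mf.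
have h : (sqi (iop u) <= (C ^+ 2)%:E * sqi u)%E.
  apply: le_trans (_ : \int[mu]_x (C%:E * sqop u x) <= _)%E.
    apply: ge0_le_integral => //.
    - by move=> x _; rewrite lee_fin sqr_ge0.
    - exact: measurable_sqr.
    - by apply: measurable_funeM; exact: measurable_sqop.
    - by move=> x _; exact: iop_sqr.
  rewrite ge0_integralZl ?lee_fin ?(ltW C0) //; last 2 first.
  - exact: measurable_sqop.
  - by move=> x _; exact: sqop_ge0.
  by rewrite expr2 EFinM -muleA lee_wpmul2l ?lee_fin ?(ltW C0) // integral_sqop.
split => //; split => //; apply: le_lt_trans h _.
by rewrite lte_mul_pinfty ?lee_fin ?sqr_ge0.
Qed.

(** Needed for linearity almost everywhere: where a row integral diverges, [iop] takes a default
    value. *)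
Lemma ae_integrable u : L2 u -> {ae mu, forall x, mu.-integrable setT (EFin \o (fun y => q x y * u y))}.
Proof.
move=> [mf fin].
have is' : mu.-integrable setT (sqop u).
  apply/integrableP; split; first exact: measurable_sqop.
  under eq_integral do rewrite gee0_abs ?sqop_ge0 //.
  by apply: le_lt_trans (integral_sqop mf) _; rewrite lte_mul_pinfty ?lee_fin ?(ltW C0).
have := integrable_ae measurableT is'; apply: filterS => x /(_ Logic.I) h.
by apply: (sqop_integrable mf _).2; rewrite -ge0_fin_numE ?sqop_ge0.
Qed.

Lemma iop_comb (a b : R) u v x : mu.-integrable setT (EFin \o (fun y => q x y * u y)) ->
  mu.-integrable setT (EFin \o (fun y => q x y * v y)) ->
  mu.-integrable setT (EFin \o (fun y => q x y * (a * u y + b * v y))) /\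
  iop (fun y => a * u y + b * v y) x = a * iop u x + b * iop v x.
Proof.
move=> iu iv; have [i e] := integrable_comb a b measurableT iu iv.
have E : (fun y => q x y * (a * u y + b * v y)) = (fun y => a * (q x y * u y) + b * (q x y * v y)).
  by apply/funext => y; ring.
by rewrite /iop E.
Qed.

(** Bounded integrable functions: all their row integrals converge, and Fubini's theorem applies to
    pairs of them. Combinations of indicators of cubes are of this kind. *)
Definition nice u : Prop := [/\ measurable_fun [set: plane R] u, exists c, forall z, `|u z| <= c &
  mu.-integrable setT (EFin \o u)].

Lemma nice_row u x : nice u -> mu.-integrable setT (EFin \o (fun y => q x y * u y)).
Proof.
move=> [mf [c uc] _]; have c0 : 0 <= c by apply: le_trans (uc (0, 0)).
apply: (le_integrable measurableT _ _ (integrableZl measurableT c (integrable_q x))).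
  by apply/measurable_EFinP; apply: measurable_funM => //; exact: mqx.
move=> y _; have : `|q x y * u y| <= `|c * q x y|; last by [].
by rewrite !normrM (ger0_norm (q0 _ _)) (ger0_norm c0) mulrC ler_wpM2r.
Qed.

Lemma iop_bilinear u v : nice u -> nice v ->
  [/\ mu.-integrable setT (EFin \o (fun x => iop u x * v x)),
      (mu \x mu)%E.-integrable setT (EFin \o (fun z => q z.1 z.2 * u z.2 * v z.1)) &
      \int[mu]_x (iop u x * v x) = \int[(mu \x mu)%E]_z (q z.1 z.2 * u z.2 * v z.1)].
Proof.
move=> nu [mv _ iv]; have [mf [c uc] iu] := nu.
have c0 : 0 <= c by apply: le_trans (uc (0, 0)).
pose F z := q z.1 z.2 * u z.2 * v z.1.
have mF : measurable_fun [set: plane R * plane R] (EFin \o F).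
  apply/measurable_EFinP; apply: measurable_funM; last exact: (measurableT_comp mv m1).
  by apply: measurable_funM => //; exact: (measurableT_comp mf m2).
have iqu x := nice_row x nu.
have bound x : (\int[mu]_y `|(EFin \o F) (x, y)| <= (c * C)%:E * `|v x|%:E)%E.
  rewrite (eq_integral (fun y => `|v x|%:E * `|q x y * u y|%:E)%E); last first.
    by move=> y _; rewrite /F /= -EFinM [in RHS]mulrC -normrM.
  rewrite ge0_integralZl ?lee_fin //; last first.
    by apply/measurable_EFinP/measurableT_comp => //; apply: measurable_funM => //; exact: mqx.
  rewrite muleC lee_wpmul2r ?lee_fin //.
  apply: le_trans (_ : \int[mu]_y (c%:E * (q x y)%:E) <= _)%E.
    apply: ge0_le_integral => //.
    - by apply/measurable_EFinP/measurableT_comp => //; apply: measurable_funM => //; exact: mqx.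
    - by apply: measurable_funeM; apply/measurable_EFinP; exact: mqx.
    - by move=> y _; rewrite -EFinM lee_fin normrM (ger0_norm (q0 _ _)) mulrC ler_wpM2r.
  rewrite ge0_integralZl ?lee_fin //; [|by apply/measurable_EFinP; exact: mqx|by move=> y _; rewrite lee_fin].
  by rewrite EFinM lee_wpmul2l ?lee_fin.
have iF : (mu \x mu)%E.-integrable setT (EFin \o F).
  apply/(integrable12ltyP mu mu mF).
  apply: le_lt_trans (_ : \int[mu]_x ((c * C)%:E * `|v x|%:E) < +oo)%E.
    apply: ge0_le_integral => //.
    - by move=> x _; apply: integral_ge0.
    - have mabs : measurable_fun [set: plane R * plane R] (abse \o (EFin \o F)) by apply: measurableT_comp.
      have HF : measurable_fun [set: plane R] (fubini_F mu (abse \o (EFin \o F))).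
        by apply: measurable_fun_fubini_tonelli_F => // z; exact: abse_ge0.
      exact: HF.
    - by apply: measurable_funeM; apply/measurable_EFinP; exact: measurableT_comp.
  rewrite ge0_integralZl ?lee_fin ?mulr_ge0 ?(ltW C0) //; last first.
    by apply/measurable_EFinP; exact: measurableT_comp.
  rewrite lte_mul_pinfty ?lee_fin ?mulr_ge0 ?(ltW C0) //.
  by have /integrableP[_] := iv.
have fF x : fubini_F mu (EFin \o F) x = (iop u x * v x)%:E.
  rewrite /fubini_F /F /= (eq_integral (fun y => (v x)%:E * (q x y * u y)%:E)%E); last first.
    by move=> y _; rewrite -EFinM mulrC.
  rewrite integralZl; [|exact: measurableT|exact: iqu].
  rewrite mulrC EFinM; congr (_ * _)%E.
  rewrite /iop /Rintegral fineK //; exact: (integrable_fin_num measurableT (iqu x)).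
have iFF := integrable_fubini_F iF.
have EF : fubini_F mu (EFin \o F) = EFin \o (fun x => iop u x * v x).
  by apply/funext => x; rewrite fF.
split => //; first by rewrite -EF.
rewrite [RHS](_ : _ = fine (\int[(mu \x mu)%E]_z (EFin \o F) z)%E) // -integral12_prod_meas1 //.
by rewrite EF.
Qed.

End Schur.

(** * The operator of the rough kernel *)

Section RoughOperator.
Context {R : realType}.
Local Notation mu := (@lebesgue2 R).
Local Notation Re := (@complex.Re R).
Local Notation Im := (@complex.Im R).
Variable b : R.
Hypotheses (b0 : 0 < b) (b1 : b < 1).
Implicit Types (f g : plane R -> R[i]) (u v : plane R -> R) (x y : plane R).

Lemma measurable_rough : measurable_fun [set: plane R * plane R] (fun z => rough b z.1 z.2).
Proof.
have mmax (h : plane R * plane R -> R) : measurable_fun setT h -> measurable_fun setT (fun z => Num.max 0 (h z)).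
  by move=> mh; have := @measurable_maxr _ (plane R * plane R)%type R setT (fun=> 0) h (measurable_cst _) mh; exact.
have m1 : measurable_fun [set: plane R * plane R] (fun z => z.1.1 - z.2.1).
  by apply: measurable_funB; apply: (measurableT_comp measurable_fst); [exact: measurable_fst|exact: measurable_snd].
have m2 : measurable_fun [set: plane R * plane R] (fun z => z.1.2 - z.2.2).
  by apply: measurable_funB; apply: (measurableT_comp measurable_snd); [exact: measurable_fst|exact: measurable_snd].
apply: measurable_funM.
  apply: mmax; apply: measurable_funB => //.
  by apply: (measurableT_comp (measurable_powR (b - 1))); exact: measurableT_comp.
apply: mmax; apply: measurable_funB => //; apply: measurableT_comp => //.
by apply: measurable_funB => //; exact: measurableT_comp.
Qed.

(** The kernel lives on |x1 - y1| <= 1 and |x2 - y2| <= 2. There the points with |x1 - y1| <= t fill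
    an area of at most 8 t, so the power b - 1 > -1 is integrable by the layer-cake bound. *)
Lemma integral_rough : exists2 C : R, 0 < C & forall x, (\int[mu]_y (rough b x y)%:E <= C%:E)%E.
Proof.
have ab : 0 < 1 - b < 1 by rewrite subr_gt0 b1 /= gtrBl.
have [C C0 HC] := integral_negative_power ab; exists (C * 8 + 1); first by rewrite ltr_wpDl ?mulr_ge0.
move=> x; pose D : set (plane R) := `[x.1 - 1, x.1 + 1] `*` `[x.2 - 2, x.2 + 2].
have mD : measurable D by apply: measurableX; exact: measurable_itv.
pose g y := `|x.1 - y.1|.
have mg : measurable_fun [set: plane R] g.
  by apply: measurableT_comp => //; apply: measurable_funB => //; exact: measurable_fst.
have mr : measurable_fun [set: plane R] (rough b x) by exact: (measurableT_comp measurable_rough (pair1_measurable x)).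
apply: le_trans (_ : \int[mu]_(y in D) (g y `^ (- (1 - b)))%:E <= _)%E.
  rewrite -(integral_indicM mu D); apply: ge0_le_integral => //.
  - by move=> y _; rewrite lee_fin rough_ge0.
  - by apply/measurable_EFinP.
  - apply/measurable_EFinP; apply: measurable_funM; first exact: measurable_indic.
    exact: (measurableT_comp (measurable_powR _) mg).
  move=> y _; rewrite lee_fin.
  have [Dy|nDy] := pselect (D y); last first.
    rewrite (_ : rough b x y = 0) ?mulr_ge0 ?powR_ge0 //.
    rewrite /rough; have [h|h] := leP 1 `|x.1 - y.1|; first by rewrite kappa_out ?mul0r.
    have [h2|h2] := leP 2 `|x.2 - y.2|; first by rewrite psi_out ?mulr0; [|right].
    exfalso; apply: nDy; move: h h2; rewrite !ltr_norml => /andP[? ?] /andP[? ?].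
    by rewrite /D /setX /= !in_itv /=; split; lra.
  rewrite indicE mem_set // mul1r opprB /rough -[leRHS]mulr1 /g.
  apply: ler_pM; rewrite ?kappa_ge0 ?psi_ge0 ?kappa_le //; apply: le_trans (psi_le _) _.
  by rewrite invf_le1 // ler1n.
apply: le_trans (HC _ _ mu D g 8 1 mD mg _ ltr01 _ _) _ => //.
- move=> y; rewrite /D /setX /= !in_itv /= => -[/andP[? ?] _]; rewrite /g normr_ge0 ler_norml; lra.
- move=> t t0.
  have sub : D `&` [set z | g z <= t] `<=` `[x.1 - t, x.1 + t] `*` `[x.2 - 2, x.2 + 2].
    move=> y [[_ y2] /=]; rewrite /g ler_norml => /andP[? ?]; split => //=; rewrite in_itv /=; lra.
  have mS : measurable (D `&` [set z | g z <= t]).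
    exact: (measurable_fun_le mD (measurable_funTS mg) (measurable_cst t)).
  apply: le_trans (le_measure mu _ _ sub) _; rewrite ?inE //.
    by apply: measurableX; exact: measurable_itv.
  have x1 : x.1 - t <= x.1 + t by lra. have x2 : x.2 - 2 <= x.2 + 2 by lra.
  rewrite [leLHS](lebesgue2_rect true false true false x1 x2) lee_fin powRr1 ?(ltW t0) //; lra.
by rewrite powR1 mulr1 lee_fin ltW // ltrDl.
Qed.

End RoughOperator.

Section RoughOperatorBounds.
Context {R : realType}.
Local Notation mu := (@lebesgue2 R).
Local Notation Re := (@complex.Re R).
Local Notation Im := (@complex.Im R).
Variable b : R.
Hypotheses (b0 : 0 < b) (b1 : b < 1).
Implicit Types (f g : plane R -> R[i]) (u v : plane R -> R) (x y : plane R).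

Definition rough_op f x : R[i] := Complex (iop (rough b) (Re \o f) x) (iop (rough b) (Im \o f) x).

Lemma bounded_rough_op : bounded_operator_L2 rough_op.
Proof.
have [C C0 HC] := integral_rough b0 b1.
have q0 := @rough_ge0 R b; have qC := @roughC R b; have mq := measurable_rough b.
have S u : L2 u -> L2 (iop (rough b) u) /\ (sqi (iop (rough b) u) <= (C ^+ 2)%:E * sqi u)%E.
  by move=> Lu; exact: (sqi_iop q0 qC mq C0 HC Lu).
split.
- move=> f /in_L2P[/S[L1 _] /S[L2 _]]; apply/in_L2P; split; [exact: L1|exact: L2].
- move=> a f g /in_L2P[fr fi] /in_L2P[gr gi].
  have A u : L2 u -> {ae mu, forall x, mu.-integrable setT (EFin \o (fun y => rough b x y * u y))}.
    by move=> Lu; exact: (ae_integrable q0 qC mq C0 HC Lu).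
  apply: filter_app (A _ gi); apply: filter_app (A _ gr); apply: filter_app (A _ fi).
  apply: filterS (A _ fr) => x ifr ifi igr igi.
  have [i1 e1] := iop_comb (Re a) (- Im a) ifr ifi.
  have [i2 e2] := iop_comb (Re a) (Im a) ifi ifr.
  have [_ e3] := iop_comb 1 1 i1 igr.
  have [_ e4] := iop_comb 1 1 i2 igi.
  apply/eqP; rewrite eq_complex /rough_op /=; apply/andP; split; apply/eqP.
    transitivity (iop (rough b) (fun y => 1 * (Re a * (Re \o f) y + - Im a * (Im \o f) y) + 1 * (Re \o g) y) x).
      by congr (iop _ _ x); apply/funext => y /=; rewrite ReD ReM !mul1r mulNr.
    by rewrite e3 e1 ReD ReM /= !mul1r mulNr.
  transitivity (iop (rough b) (fun y => 1 * (Re a * (Im \o f) y + Im a * (Re \o f) y) + 1 * (Im \o g) y) x).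
    by congr (iop _ _ x); apply/funext => y /=; rewrite ImD ImM !mul1r.
  by rewrite e4 e2 ImD ImM /= !mul1r.
exists C => f Lf; have [fr fi] := (in_L2P f).1 Lf.
have [[m1 _] h1] := S _ fr; have [[m2 _] h2] := S _ fi.
apply/(L2norm_le (ltW C0) _ Lf.1); first by split; [exact: m1|exact: m2].
rewrite ge0_muleDr ?sqi_ge0 //; apply: leeD; [exact: h1|exact: h2].
Qed.

Lemma niceD u v : nice u -> nice v -> nice (fun z => u z + v z).
Proof.
move=> [mu' [c uc] iu] [mv [d vd] iv]; split; first exact: measurable_funD.
  by exists (c + d) => z; apply: le_trans (ler_normD _ _) _; apply: lerD.
exact: (integrableD measurableT iu iv).
Qed.

Lemma niceZ (a : R) u : nice u -> nice (fun z => a * u z).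
Proof.
move=> [mu' [c uc] iu]; split; first exact: measurable_funM.
  by exists (`|a| * c) => z; rewrite normrM ler_wpM2l.
exact: (integrableZl measurableT a iu).
Qed.

Lemma nice_indic (A : set (plane R)) : measurable A -> (mu A < +oo)%E -> nice (\1_A).
Proof.
move=> mA Aoo; split; first exact: measurable_indic.
  by exists 1 => z; rewrite indicE; case: (_ \in _); rewrite ?normr0 ?normr1.
apply/integrableP; split; first by apply/measurable_EFinP; exact: measurable_indic.
rewrite (_ : (\int[mu]_z _)%E = (\int[mu]_z (\1_A z)%:E)%E); last first.
  by apply: eq_integral => z _; rewrite /= ger0_norm.
by rewrite integral_indic // setIT.
Qed.

Lemma nice_cube (J : set (plane R)) : is_cube J -> nice (\1_J).
Proof.
move=> [a [l [l0 ->]]]; apply: nice_indic; first exact: measurable_square.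
by rewrite [X in (X < _)%E](lebesgue2_square a (ltW l0)) ltry.
Qed.

Lemma nice_sum n (F : 'I_n -> plane R -> R) : (forall i, nice (F i)) -> nice (fun z => \sum_(i < n) F i z).
Proof.
elim: n F => [|n IH] F H.
  rewrite (_ : (fun _ => _) = fun=> 0); last by apply/funext => z; rewrite big_ord0.
  by split; [|exists 0 => z; rewrite normr0|exact: integrable0].
rewrite (_ : (fun _ => _) = fun z => \sum_(i < n) F (widen_ord (leqnSn n) i) z + F ord_max z).
  by apply: niceD => //; apply: IH => i; exact: H.
by apply/funext => z; rewrite big_ord_recr.
Qed.

Lemma nice_cube_simple f : cube_simple f -> nice (Re \o f) /\ nice (Im \o f).
Proof.
move=> [n [c [Q [HQ E]]]]; split.
  rewrite (_ : Re \o f = fun z => \sum_(i < n) Re (c i) * \1_(Q i) z).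
    by apply: nice_sum => i; apply: niceZ; exact: nice_cube.
  apply/funext => z /=; rewrite E (big_morph Re (id1 := 0) (op1 := +%R)) //; last exact: ReD.
  by apply: eq_bigr => i _; rewrite indicC ReM /= mulr0 subr0.
rewrite (_ : Im \o f = fun z => \sum_(i < n) Im (c i) * \1_(Q i) z).
  by apply: nice_sum => i; apply: niceZ; exact: nice_cube.
apply/funext => z /=; rewrite E (big_morph Im (id1 := 0) (op1 := +%R)) //; last exact: ImD.
by apply: eq_bigr => i _; rewrite indicC ImM /= mulr0 add0r.
Qed.

Lemma rough_op_has_kernel : has_kernel rough_op (roughC_kernel b).
Proof.
have [C C0 HC] := integral_rough b0 b1.
have q0 := @rough_ge0 R b; have mq := measurable_rough b.
move=> f g /nice_cube_simple[fr fi] /nice_cube_simple[gr gi] _.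
have BI := iop_bilinear q0 mq C0 HC.
(* The kernel vanishes outside [off], so the integral may be extended to the whole product before
   applying Fubini's theorem. *)
have off_int (h : plane R * plane R -> R) : (forall z, ~ off z -> h z = 0) ->
    \int[(mu \x mu)%E]_(z in off) h z = \int[(mu \x mu)%E]_z h z.
  move=> h0; rewrite /Rintegral integral_mkcond; congr fine; apply: eq_integral => z _.
  rewrite patchE; case: ifPn => // /negP zo; rewrite h0 // => zo'.
  by apply: zo; rewrite inE.
have part (a1 : R) (u1 v1 u2 v2 : plane R -> R) (h : plane R * plane R -> R) (h' : plane R -> R) :
    nice u1 -> nice v1 -> nice u2 -> nice v2 ->
    (forall z, h z = rough b z.1 z.2 * (u1 z.2 * v1 z.1 + a1 * (u2 z.2 * v2 z.1))) ->
    (forall x, h' x = iop (rough b) u1 x * v1 x + a1 * (iop (rough b) u2 x * v2 x)) ->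
    \int[mu]_x h' x = \int[(mu \x mu)%E]_(z in off) h z.
  move=> nu1 nv1 nu2 nv2 Hh Hh'.
  rewrite off_int; last by move=> z zo; rewrite Hh rough_diag ?mul0r.
  have [i1 j1 e1] := BI _ _ nu1 nv1; have [i2 j2 e2] := BI _ _ nu2 nv2.
  have [_ E1] := integrable_comb 1 a1 measurableT i1 i2.
  have [_ E2] := integrable_comb 1 a1 measurableT j1 j2.
  transitivity (\int[mu]_x (1 * (iop (rough b) u1 x * v1 x) + a1 * (iop (rough b) u2 x * v2 x))).
    by apply: eq_Rintegral => x _; rewrite Hh' mul1r.
  rewrite E1 e1 e2 -E2; apply: eq_Rintegral => z _; rewrite Hh; ring.
rewrite /integralC; congr Complex.
  apply: (part (-1) (Re \o f) (Re \o g) (Im \o f) (Im \o g)) => // [z|x].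
    by rewrite !ReM !ImM /=; ring.
  by rewrite ReM /=; ring.
apply: (part 1 (Re \o f) (Im \o g) (Im \o f) (Re \o g)) => // [z|x].
  by rewrite !ImM !ReM /=; ring.
by rewrite ImM /=; ring.
Qed.

End RoughOperatorBounds.

(** * The power weight *)

Section SingularWeight.
Context {R : realType}.
Local Notation mu := (@lebesgue2 R).
Implicit Types (x y : plane R) (a p r t l m : R).

(** The distance in the maximum norm to (0, 3/2), the point to which the target rectangles
    shrink. *)
Definition centre_dist x : R := Num.max `|x.1| `|x.2 - 3 / 2|.
(* The weight is [0], not infinite, at the point [(0, 3 / 2)]. *)
Definition singular_weight a x : R := centre_dist x `^ (- a).

Lemma centre_dist_ge0 x : 0 <= centre_dist x.
Proof. by rewrite /centre_dist le_max normr_ge0. Qed.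

Lemma centre_distP x r : centre_dist x <= r <-> (- r <= x.1 <= r) /\ (3 / 2 - r <= x.2 <= 3 / 2 + r).
Proof.
rewrite /centre_dist ge_max !ler_norml; split; first by move=> /andP[-> /andP[? ?]]; split => //; lra.
by move=> [-> /andP[? ?]] /=; lra.
Qed.

Lemma measurable_centre_dist : measurable_fun [set: plane R] centre_dist.
Proof.
have m1 : measurable_fun [set: plane R] (fun x => `|x.1|).
  by apply: measurableT_comp => //; exact: measurable_fst.
have m2 : measurable_fun [set: plane R] (fun x => `|x.2 - 3 / 2|).
  by apply: measurableT_comp => //; apply: measurable_funB => //; exact: measurable_snd.
by have := @measurable_maxr _ (plane R) R setT _ _ m1 m2; exact.
Qed.

Lemma measurable_singular_weight a : measurable_fun [set: plane R] (singular_weight a).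
Proof. exact: (measurableT_comp (measurable_powR (- a)) measurable_centre_dist). Qed.

Lemma ae_singular_weight_gt0 a : {ae mu, forall x, 0 < singular_weight a x}.
Proof.
apply: filterS (ae_off (0, 3 / 2)) => x [x1 _]; apply: powR_gt0.
by rewrite /centre_dist lt_max normr_gt0 eq_sym x1.
Qed.

Lemma integral_singular_weight a : 0 < a < 2 -> exists2 C : R, 0 <= C & forall (D : set (plane R)) r,
  measurable D -> 0 < r -> (forall x, D x -> centre_dist x <= r) ->
  (\int[mu]_(x in D) (singular_weight a x)%:E <= (C * r `^ (2 - a))%:E)%E.
Proof.
move=> a02; have [C C0 HC] := integral_negative_power a02; exists (C * 4); first by rewrite mulr_ge0.
move=> D r mD r0 Dr.
apply: (HC _ _ mu D centre_dist 4 r mD measurable_centre_dist) => //.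
  by move=> x Dx; rewrite centre_dist_ge0 Dr.
move=> t t0.
have sub : D `&` [set x | centre_dist x <= t] `<=` `[- t, t] `*` `[3 / 2 - t, 3 / 2 + t].
  by move=> x [_ /= /centre_distP[h1 h2]]; split => /=; rewrite in_itv.
apply: le_trans (le_measure mu _ _ sub) _; rewrite ?inE //.
- exact: (measurable_fun_le mD (measurable_funTS measurable_centre_dist) (measurable_cst t)).
- by apply: measurableX; exact: measurable_itv.
have t1 : - t <= t by lra. have t2 : 3 / 2 - t <= 3 / 2 + t by lra.
rewrite [leLHS](lebesgue2_rect true false true false t1 t2) lee_fin powR_mulrn ?(ltW t0) // expr2; lra.
Qed.

Lemma is_weight_singular a : 0 < a < 2 -> is_weight (singular_weight a).
Proof.
move=> a02; split; [exact: measurable_singular_weight|exact: ae_singular_weight_gt0|move=> A /compact_bounded].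
move=> [M0 [_ /(_ (`|M0| + 1))]] H; have {}H x : A x -> `|x| <= `|M0| + 1.
  by apply: H; apply: le_lt_trans (ler_norm M0) _; rewrite ltrDl.
have [C C0 HC] := integral_singular_weight a02; pose r := `|M0| + 1 + 3 / 2.
have r0 : 0 < r by have := normr_ge0 M0; rewrite /r; lra.
pose D : set (plane R) := `[- r, r] `*` `[3 / 2 - r, 3 / 2 + r].
have mD : measurable D by apply: measurableX; exact: measurable_itv.
have sub : A `<=` D.
  move=> x /H; rewrite prod_normE ge_max !ler_norml => /andP[/andP[? ?] /andP[? ?]].
  by rewrite /D /r; split => /=; rewrite in_itv /=; lra.
have Dr x : D x -> centre_dist x <= r.
  by move=> [/=]; rewrite !in_itv /= => h1 h2; apply/centre_distP.
apply: le_lt_trans (_ : _ <= (C * r `^ (2 - a))%:E)%E (ltry _).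
apply: le_trans (HC D r mD r0 Dr).
rewrite !ge0_integralE; [|by move=> x _; rewrite lee_fin powR_ge0|by []].
apply: ereal_sup_le => _ [h hle <-]; exists h => // x; apply: le_trans (hle x) _; rewrite !patchE.
case: ifPn => [|_]; first by rewrite inE => /sub Dx; rewrite mem_set // ger0_norm ?powR_ge0.
by case: ifPn => // _; rewrite lee_fin powR_ge0.
Qed.

(** Let m be the distance of the corner c to the centre plus l. On a far square the weight is at
    most 3^a m^-a; on a near one m <= 3 l, and the weight is integrable since a < 2. So its average
    is at most a multiple of m^-a, while the dual factor is at most m^a because the distance is at
    most m on the square. *)
Lemma Ap_singular a p : 0 < a < 2 -> 1 < p -> Ap_weight p (singular_weight a).
Proof.
move=> a02 p1; split; first exact: is_weight_singular.
have [C C0 HC] := integral_singular_weight a02; have /andP[a0 a2] := a02.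
have p10 : 0 < p - 1 by rewrite subr_gt0.
apply: le_lt_trans (_ : _ <= (3 `^ a + 9 * C)%:E)%E (ltry _).
apply: ge_ereal_sup => _ [_ [c [l [l0 ->]]] <-].
set J := square c l; have mJ : measurable J := measurable_square c l.
have l2 : 0 < l ^+ 2 by rewrite exprn_gt0.
have muJ : lebesgue2 J = (l ^+ 2)%:E by rewrite lebesgue2_square // ltW.
have avg (f : plane R -> R) (k : R) : measurable_fun [set: plane R] f -> (forall x, J x -> 0 <= f x <= k) ->
    (average J f <= k%:E)%E.
  move=> mf fk; rewrite /average muJ /=.
  apply: le_trans (_ : ((l ^+ 2)^-1)%:E * (k * l ^+ 2)%:E <= _)%E; last first.
    by rewrite -EFinM lee_fin mulrC mulfK // gt_eqF.
  rewrite lee_wpmul2l ?lee_fin ?invr_ge0 ?(ltW l2) //.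
  apply: le_trans (_ : \int[mu]_(x in J) (cst k%:E x) <= _)%E; last first.
    by rewrite integral_cst // [X in (_ * X)%E]muJ -EFinM.
  apply: ge0_le_integral => //.
  - by move=> x /fk/andP[h _]; rewrite lee_fin.
  - by apply/measurable_EFinP; exact: measurable_funTS.
  - by move=> x /fk/andP[_ h]; rewrite lee_fin.
pose m := centre_dist c + l.
have m0 : 0 < m by rewrite ltr_wpDl ?centre_dist_ge0.
have [c1 c2] := (centre_distP c _).1 (lexx _).
have JE x : J x -> (c.1 <= x.1 < c.1 + l) /\ (c.2 <= x.2 < c.2 + l).
  by move=> [/=]; rewrite !in_itv.
have Jm x : J x -> centre_dist x <= m.
  move=> /JE[/andP[? ?] /andP[? ?]]; apply/centre_distP; rewrite /m; split; lra.
have Jm' x : J x -> centre_dist c - l <= centre_dist x.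
  move=> /JE[/andP[? ?] /andP[? ?]]; rewrite lerBlDr; apply/centre_distP.
  have [/andP[? ?] /andP[? ?]] := (centre_distP x _).1 (lexx _); split; lra.
have S : (average J (fun x => singular_weight a x `^ (- (p - 1)^-1))%R `^ (p - 1) <= (m `^ a)%:E)%E.
  apply: le_trans (_ : (m `^ (a / (p - 1)))%:E `^ (p - 1) <= _)%E; last first.
    by rewrite poweR_EFin -powRrM divfK ?gt_eqF // lexx.
  have A0 : (0 <= average J (fun x => (singular_weight a x `^ (- (p - 1)^-1))%R))%E.
    rewrite /average mule_ge0 ?lee_fin ?invr_ge0 ?fine_ge0 //.
    by apply: integral_ge0 => x _; rewrite lee_fin powR_ge0.
  have A1 : (average J (fun x => (singular_weight a x `^ (- (p - 1)^-1))%R) <= (m `^ (a / (p - 1)))%:E)%E.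
    apply: avg; first exact: (measurableT_comp (measurable_powR _) (measurable_singular_weight a)).
    move=> x Jx; rewrite powR_ge0 /singular_weight -powRrM mulrNN.
    by apply: ler_powR2; [rewrite divr_ge0 ?ltW|exact: centre_dist_ge0|exact: Jm].
  apply: gt0_ler_poweR => //; first exact: ltW.
  - by rewrite in_itv /= A0 leey.
  - by rewrite in_itv /= lee_fin powR_ge0 leey.
have W : (average J (singular_weight a) <= ((3 `^ a + 9 * C) * m `^ (- a))%:E)%E.
  have [far|near] := leP (2 * l) (centre_dist c).
    apply: le_trans (_ : (3 `^ a * m `^ (- a))%:E <= _)%E; last first.
      by rewrite lee_fin ler_wpM2r ?powR_ge0 // lerDl mulr_ge0.
    apply: avg; first exact: measurable_singular_weight.
    move=> x /Jm' h; rewrite powR_ge0 /=.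
    have -> : 3 `^ a * m `^ (- a) = (m / 3) `^ (- a).
      rewrite powRM ?invr_ge0 ?(ltW m0) // mulrC; congr (_ * _).
      by rewrite -powR_inv1 // -powRrM mulrNN mul1r.
    apply: powRN_anti; [exact: ltW|by rewrite divr_gt0|].
    by rewrite ler_pdivrMr // /m; lra.
  rewrite /average muJ /=.
  apply: le_trans (_ : ((l ^+ 2)^-1)%:E * (C * m `^ (2 - a))%:E <= _)%E.
    by rewrite lee_wpmul2l ?lee_fin ?invr_ge0 ?(ltW l2) // HC.
  rewrite -EFinM lee_fin.
  have -> : m `^ (2 - a) = m ^+ 2 * m `^ (- a).
    by rewrite powRD ?(gt_eqF m0) ?implybT // powR_mulrn // ltW.
  rewrite mulrCA !mulrA ler_wpM2r ?powR_ge0 //.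
  apply: le_trans (_ : C * 9 <= _); last by rewrite mulrC lerDr powR_ge0.
  rewrite -!mulrA ler_wpM2l // ler_pdivrMl //.
  have m3 : m <= 3 * l by rewrite /m; lra.
  have := ler_pM (ltW m0) (ltW m0) m3 m3; rewrite !expr2; lra.
apply: le_trans (_ : ((3 `^ a + 9 * C) * m `^ (- a))%:E * (m `^ a)%:E <= _)%E.
  apply: lee_pmul => //; last exact: poweR_ge0.
  rewrite /average mule_ge0 ?lee_fin ?invr_ge0 ?fine_ge0 //.
  by apply: integral_ge0 => x _; rewrite lee_fin powR_ge0.
by rewrite -EFinM lee_fin -mulrA powRVn // mulr1.
Qed.

End SingularWeight.

Lemma Lpw_norm_le_pow (R : realType) (p C : R) (w : plane R -> R) (f g : plane R -> R[i]) :
  0 < p -> (forall x, 0 <= w x) -> (Lpw_norm p w g <= C%:E * Lpw_norm p w f)%E ->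
  (\int[@lebesgue2 R]_x (cmod (g x) `^ p * w x)%:E <=
   (`|C| `^ p)%:E * \int[@lebesgue2 R]_x (cmod (f x) `^ p * w x)%:E)%E.
Proof.
move=> p0 w0 H; have pn : p != 0 by rewrite gt_eqF.
have n0 (h : plane R -> R[i]) : (0 <= Lpw_norm p w h)%E by exact: poweR_ge0.
have nE (h : plane R -> R[i]) : (Lpw_norm p w h `^ p = \int[@lebesgue2 R]_x (cmod (h x) `^ p * w x)%:E)%E.
  rewrite /Lpw_norm -poweRrM mulVf // poweRe1 //.
  by apply: integral_ge0 => x _; rewrite lee_fin mulr_ge0 ?powR_ge0.
have Hn : (Lpw_norm p w g <= `|C|%:E * Lpw_norm p w f)%E.
  by apply: le_trans H _; rewrite lee_wpmul2r ?n0 // lee_fin ler_norm.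
have C0 : (0 <= `|C|%:E * Lpw_norm p w f)%E by rewrite mule_ge0 ?n0 // lee_fin.
rewrite -!nE -poweR_EFin -poweRM ?n0 ?lee_fin //; apply: gt0_ler_poweR => //; first exact: ltW.
- by rewrite in_itv /= n0 leey.
- by rewrite in_itv /= C0 leey.
Qed.

(** * The test functions *)

Section Failure.
Context {R : realType}.
Local Notation mu := (@lebesgue2 R).
Variables (b d : R).
Hypotheses (b0 : 0 < b) (b1 : b < 1) (d0 : 0 < d) (d8 : d <= 8^-1) (d4 : 2 <= (4 * d) `^ (b - 1)).
Implicit Types (x y : plane R) (p a : R).

(** [S] is the source and [Q] the target. For x in [Q] and y in [S], |x1 - y1| <= 4 d, and x2 - y2
    lies within 1/4 of the peak 3/2 of [psi]. *)
Let S : set (plane R) := `[2 * d, 3 * d] `*` `[- 8^-1, 8^-1].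
Let Q : set (plane R) := `[d / 2, d] `*` `[3 / 2, 3 / 2 + d].

Let mS : measurable S. Proof. by apply: measurableX; exact: measurable_itv. Qed.
Let mQ : measurable Q. Proof. by apply: measurableX; exact: measurable_itv. Qed.

Let muS : mu S = (d / 4)%:E.
Proof.
have h := d0; have S1 : 2 * d <= 3 * d by lra. have S2 : - 8^-1 <= 8^-1 :> R by lra.
by rewrite [LHS](lebesgue2_rect true false true false S1 S2); congr EFin; lra.
Qed.

Let muQ : mu Q = (d ^+ 2 / 2)%:E.
Proof.
have h := d0; have Q1 : d / 2 <= d by lra. have Q2 : 3 / 2 <= 3 / 2 + d by lra.
by rewrite [LHS](lebesgue2_rect true false true false Q1 Q2); congr EFin; rewrite expr2; lra.
Qed.

Let SE y : S y -> (2 * d <= y.1 <= 3 * d) /\ (- 8^-1 <= y.2 <= 8^-1).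
Proof. by move=> [/=]; rewrite !in_itv. Qed.

Let QE x : Q x -> (d / 2 <= x.1 <= d) /\ (3 / 2 <= x.2 <= 3 / 2 + d).
Proof. by move=> [/=]; rewrite !in_itv. Qed.

(** Since (4 d)^(b-1) >= 2, the subtracted 1 in [kappa] costs at most half. A factor 1/4 comes from
    comparing (4 d)^(b-1) with d^(b-1), another from [psi]. *)
Lemma rough_lower x y : Q x -> S y -> d `^ (b - 1) / 32 <= rough b x y.
Proof.
move=> /QE[/andP[x1 x1'] /andP[x2 x2']] /SE[/andP[y1 y1'] /andP[y2 y2']].
have h := d0; have h8 := d8; have h4 := d4; have hb := b1.
have b10 : 0 <= 1 - b by lra.
have k : (4 * d) `^ (b - 1) / 2 <= kappa b (x.1 - y.1).
  rewrite /kappa le_max; apply/orP; right.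
  have : (4 * d) `^ (b - 1) <= `|x.1 - y.1| `^ (b - 1); last by lra.
  rewrite -[b - 1]opprB; apply: powRN_anti => //.
    by rewrite normr_gt0 subr_eq0 lt_eqF //; lra.
  by rewrite ler_norml; lra.
have s : 4^-1 <= psi (x.2 - y.2).
  rewrite /psi le_max; apply/orP; right; rewrite (ger0_norm (_ : 0 <= x.2 - y.2)); last by lra.
  have : `|x.2 - y.2 - 3 / 2| <= 4^-1 by rewrite ler_norml; lra.
  lra.
have e : d `^ (b - 1) / 4 <= (4 * d) `^ (b - 1).
  rewrite powRM ?(ltW d0) // mulrC ler_wpM2r ?powR_ge0 //.
  by rewrite -[leLHS]powR_inv1 //; apply: ler_powR; [rewrite ler1n|have hb0 := b0; lra].
apply: le_trans (_ : ((4 * d) `^ (b - 1) / 2) * 4^-1 <= _); first by lra.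
by apply: ler_pM => //; rewrite ?invr_ge0 // divr_ge0 ?powR_ge0.
Qed.

Lemma rough_op_lower x : Q x -> d `^ b / 128 <= cmod (rough_op b (embed (\1_S)) x).
Proof.
move=> Qx; have [C C0 HC] := integral_rough b0 b1.
have ndS : nice (\1_S : plane R -> R) by apply: nice_indic => //; rewrite [X in (X < _)%E]muS ltry.
have i1 := nice_row (@rough_ge0 R b) (measurable_rough b) HC x ndS.
apply: le_trans (Re_le_cmod _); apply: le_trans (ler_norm _); rewrite /rough_op /=.
have -> : d `^ b / 128 = \int[mu]_y (d `^ (b - 1) / 32 * \1_S y).
  rewrite RintegralZl //; last by case: ndS.
  rewrite /Rintegral integral_indic // setIT [X in fine X]muS /=.
  rewrite (powRS (ltW d0)) ?gt_eqF //; lra.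
apply: le_Rintegral => //.
  by case: ndS => _ _ iS; exact: (integrableZl measurableT (d `^ (b - 1) / 32) iS).
move=> y _; have [Sy|nSy] := pselect (S y); last by rewrite /embed /= indicE memNset // !mulr0.
by rewrite /embed /= indicE mem_set // !mulr1; exact: rough_lower.
Qed.

(** On [S] the distance to the centre is at least 1, so the weight is at most 1. *)
Lemma norm_indicator_le p a : 0 < p -> 0 < a ->
  (\int[mu]_x (cmod (embed (\1_S) x) `^ p * singular_weight a x)%:E <= (d / 4)%:E)%E.
Proof.
move=> p0 a0; have h := d0.
rewrite -muS -[X in (_ <= X)%E](_ : \int[mu]_x (\1_S x)%:E = _)%E; last by rewrite integral_indic // setIT.
apply: ge0_le_integral => //.
- by move=> x _; rewrite lee_fin mulr_ge0 ?powR_ge0.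
- apply/measurable_EFinP; apply: measurable_funM; last exact: measurable_singular_weight.
  rewrite (_ : (fun _ => _) = (fun x => `|\1_S x| `^ p)); last first.
    by apply/funext => x; rewrite cmod_real.
  apply: (measurableT_comp (measurable_powR p)); apply: measurableT_comp => //; exact: measurable_indic.
- by apply/measurable_EFinP; exact: measurable_indic.
move=> x _; rewrite lee_fin cmod_real.
have [Sx|nSx] := pselect (S x); last by rewrite indicE memNset // normr0 powR0 ?mul0r // gt_eqF.
rewrite indicE mem_set // normr1 powR1 mul1r.
have [/andP[? ?] /andP[? ?]] := SE Sx.
rewrite -(powRr0 (centre_dist x)); apply: ler_powR; last by lra.
by rewrite /centre_dist le_max; apply/orP; right; rewrite ler_normr; apply/orP; right; lra.
Qed.

Lemma norm_image_ge p a : 1 < p -> 0 < a ->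
  (((d `^ b / 128) `^ p * d `^ (- a) * (d ^+ 2 / 2))%:E <=
   \int[mu]_x (cmod (rough_op b (embed (\1_S)) x) `^ p * singular_weight a x)%:E)%E.
Proof.
move=> p1 a0; have h := d0.
set c := (d `^ b / 128) `^ p * d `^ (- a).
have c0 : 0 <= c by rewrite mulr_ge0 ?powR_ge0.
have -> : (c * (d ^+ 2 / 2))%:E = (\int[mu]_x (c * \1_Q x)%:E)%E.
  rewrite (eq_integral (fun x => c%:E * (\1_Q x)%:E)%E) // ge0_integralZl ?lee_fin //.
    by rewrite integral_indic // setIT [X in (_ * X)%E]muQ.
  by apply/measurable_EFinP; exact: measurable_indic.
rewrite !ge0_integralTE; [|by move=> x; rewrite lee_fin mulr_ge0 ?powR_ge0|by move=> x; rewrite lee_fin mulr_ge0].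
apply: ereal_sup_le => _ [g hg <-]; exists g => // x; apply: le_trans (hg x) _; rewrite lee_fin.
have [Qx|nQx] := pselect (Q x); last by rewrite indicE memNset // mulr0 mulr_ge0 ?powR_ge0.
rewrite indicE mem_set // mulr1; apply: ler_pM; rewrite ?powR_ge0 //.
  by apply: ler_powR2; [lra|rewrite divr_ge0 ?powR_ge0|exact: rough_op_lower].
have [/andP[? ?] /andP[? ?]] := QE Qx.
apply: powRN_anti; first exact: ltW.
  by rewrite /centre_dist lt_max normr_gt0 gt_eqF //; lra.
by apply/centre_distP; split; lra.
Qed.

Lemma test_function_ratio p a (C : R) : 1 < p -> 0 < a ->
  (forall f, in_L2 f -> in_Lpw p (singular_weight a) f ->
    (Lpw_norm p (singular_weight a) (rough_op b f) <= C%:E * Lpw_norm p (singular_weight a) f)%E) ->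
  (d `^ b / 128) `^ p * d `^ (- a) * (d ^+ 2 / 2) <= `|C| `^ p * (d / 4).
Proof.
move=> p1 a0 HT; have h := d0; have p0 : 0 < p by lra.
have LS : L2 (\1_S : plane R -> R) by apply: L2_indic => //; rewrite [X in (X < _)%E]muS ltry.
set f := embed (\1_S); have If := norm_indicator_le p0 a0; have Ig := norm_image_ge p1 a0.
rewrite -/f in If Ig.
have inL : in_Lpw p (singular_weight a) f.
  split; first by case: LS => mS' _; exact: measurable_embed.
  rewrite /Lpw_norm; apply: poweR_lty; apply: le_lt_trans If _; exact: ltry.
have := HT f (in_L2_embed LS) inL.
move=> /(Lpw_norm_le_pow p0 (fun x => powR_ge0 (centre_dist x) (- a))) H.
rewrite -lee_fin; apply: le_trans Ig _; apply: le_trans H _.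
by rewrite [X in (_ <= X)%E]EFinM lee_wpmul2l // lee_fin powR_ge0.
Qed.

End Failure.

(** The ratio of the two sides of [test_function_ratio] is a multiple of d^-e with e = a - b p - 1 >
    0, so [d] is defined by d^-e = X with X large. *)
Lemma rough_op_unbounded (R : realType) (b p a : R) : 0 < b < 1 -> 1 < p -> 0 < a -> b * p + 1 < a ->
  ~ extends_boundedly_Lpw (rough_op b) p (singular_weight a).
Proof.
move=> /andP[b0 b1] p1 a0 gap [C HC].
pose e := a - (b * p + 1); have e0 : 0 < e by rewrite subr_gt0.
pose dm : R := Num.min 8^-1 (2 `^ (- (1 - b)^-1) / 4).
have dm0 : 0 < dm by rewrite lt_min invr_gt0 ltr0n divr_gt0 // powR_gt0.
pose k : R := 128^-1 `^ p * 2; have k0 : 0 < k by rewrite mulr_gt0 // powR_gt0.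
(* The first summand ensures d <= dm, the second defeats the constant |C|^p. *)
pose X := dm `^ (- e) + `|C| `^ p / k + 1.
have X1 : dm `^ (- e) <= X by rewrite /X -addrA lerDl addr_ge0 // divr_ge0 ?powR_ge0 // ltW.
have X2 : `|C| `^ p < X * k.
  by rewrite -ltr_pdivrMr // /X; have := powR_ge0 dm (- e); lra.
have X0 : 0 < X by apply: lt_le_trans X1; exact: powR_gt0.
pose d := X `^ (- e^-1).
have d0 : 0 < d by exact: powR_gt0.
have dX : d `^ (- e) = X by rewrite /d -powRrM mulrNN mulVf ?gt_eqF // powRr1 // ltW.
have ddm : d <= dm.
  have -> : dm = (dm `^ (- e)) `^ (- e^-1) by rewrite -powRrM mulrNN mulfV ?gt_eqF // powRr1 // ltW.
  by apply: powRN_anti => //; [rewrite invr_ge0 ltW|exact: powR_gt0].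
have d8 : d <= 8^-1 by apply: le_trans ddm _; rewrite /dm ge_min lexx.
have d4 : 2 <= (4 * d) `^ (b - 1).
  have b10 : 0 < 1 - b by rewrite subr_gt0.
  have h4 : 4 * d <= 2 `^ (- (1 - b)^-1).
    rewrite mulrC -ler_pdivlMr //; apply: le_trans ddm _.
    by rewrite /dm ge_min lexx orbT.
  have d40 : 0 < 4 * d by rewrite mulr_gt0.
  have := powRN_anti (ltW b10) d40 h4; rewrite -powRrM mulrNN mulVf ?gt_eqF // powRr1 //.
  by rewrite opprB.
have := test_function_ratio b0 b1 d0 d8 d4 p1 a0 HC; apply/negP; rewrite -ltNge.
have -> : (d `^ b / 128) `^ p * d `^ (- a) * (d ^+ 2 / 2) = X * k * (d / 4).
  rewrite powRM ?powR_ge0 ?invr_ge0 // -powRrM -dX /k.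
  have -> : d `^ (- e) = d `^ (b * p) * d `^ (- a) * d.
    rewrite -powRD ?(gt_eqF d0) ?implybT // -[X in _ * X]powRr1 ?(ltW d0) // -powRD ?(gt_eqF d0) ?implybT //.
    by congr (_ `^ _); rewrite /e; ring.
  by field.
by rewrite ltr_pM2r // divr_gt0.
Qed.

Theorem theorem1p2 (R : realType) :
  (forall theta1 theta2 : R, 0 < theta1 <= 1 -> 0 < theta2 < 1 ->
    exists (T : (plane R -> R[i]) -> (plane R -> R[i]))
           (K : plane R -> plane R -> R[i]) (p : R) (w : plane R -> R),
      bounded_operator_L2 T /\ has_kernel T K /\ CZX_kernel theta1 theta2 K /\
      1 < p /\ Ap_weight p w /\ ~ extends_boundedly_Lpw T p w) /\
  (forall (theta1 : R) (T : (plane R -> R[i]) -> (plane R -> R[i]))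
          (K : plane R -> plane R -> R[i]),
    0 < theta1 <= 1 -> bounded_operator_L2 T -> has_kernel T K ->
    CZX_kernel theta1 1 K \/ CZX_log_kernel theta1 K ->
    forall (p : R) (w : plane R -> R),
      1 < p -> Ap_weight p w -> extends_boundedly_Lpw T p w).
Proof.
split=> [t b t01 /andP[b0 b1]|t T K /andP[t0 _] HT HK Kt p w p1 wp]; last first.
  exact: (weighted_extension t0 HT HK Kt p1 wp).
(* The exponent p is the midpoint of 1 and 1/b, so b p + 1 = (b + 3) / 2 < 2. The power (7 + b) / 4
   of the weight is the midpoint of these two numbers. *)
have p1 : 1 < (1 + b^-1) / 2 by rewrite ltr_pdivlMr // mul1r ltrD2l invf_gt1.
exists (rough_op b), (roughC_kernel b), ((1 + b^-1) / 2), (singular_weight ((7 + b) / 4)).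
split; first exact: bounded_rough_op.
split; first exact: rough_op_has_kernel.
split; first exact: rough_CZX.
split => //; split; first by apply: Ap_singular => //; lra.
apply: rough_op_unbounded => //; [by rewrite b0|by lra|].
have -> : b * ((1 + b^-1) / 2) = (b + 1) / 2 by field; rewrite gt_eqF.
by lra.
Qed.
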